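(* Let $(Y,\psi)$ be an irreducible Smale space with totally disconnected stable sets. For any étale groupoid $G$ that is Morita equivalent to $R^u(Y,\psi)$, and every $p$, there is an isomorphism $H^s_p(Y,\psi)\simeq H_p(G,\mathbb{Z})$ between Putnam's stable homology of $(Y,\psi)$ and the groupoid homology of $G$ with integer coefficients.
   Context: Topological groupoids are assumed second countable, locally compact, Hausdorff, with a continuous Haar system. Étale means $s,r$ are local homeomorphisms; ample means étale with totally disconnected unit space. Smale spaces. A Smale space $(X,\varphi)$ is a compact metric space $(X,d)$ with a homeomorphism $\varphi\colon X\to X$ such that: (i) there are $\epsilon_X>0$ and a continuous map $\{(x,y): d(x,y)\le\epsilon_X\}\to X$, $(x,y)\mapsto[x,y]$, with $[x,x]=x$, $[x,[y,z]]=[x,z]$, $[[x,y],z]=[x,z]$, $\varphi([x,y])=[\varphi(x),\varphi(y)]$ whenever both sides are defined; (ii) there is $0<\lambda<1$ such that, whenever the brackets are defined, $[x,y]=y$ implies $d(\varphi(x),\varphi(y))\le\lambda d(x,y)$, and $[x,y]=x$ implies $d(\varphi^{-1}(x),\varphi^{-1}(y))\le\lambda d(x,y)$. Smale spaces are assumed non-wandering (for every nonempty open $U$ there is $N\geq 1$ with $U\cap\varphi^N(U)\ne\emptyset$). Irreducible: for all ordered pairs of nonempty open $U,V$ there is $N$ with $U\cap\varphi^N(V)\neq\emptyset$. Local sets for $0<\epsilon\le\epsilon_X$: $X^s(x,\epsilon)=\{y: d(x,y)<\epsilon,[y,x]=x\}$, $X^u(x,\epsilon)=\{y: d(x,y)<\epsilon,[x,y]=x\}$.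 Totally disconnected stable sets means every $X^s(x,\epsilon)$ ($0<\epsilon<\epsilon_X$) is totally disconnected. Write $x\sim_s y$ if $d(\varphi^n(x),\varphi^n(y))\to0$ and $x\sim_u y$ if $d(\varphi^{-n}(x),\varphi^{-n}(y))\to0$ as $n\to\infty$; $X^s(x)$, $X^u(x)$ denote the equivalence classes. For fixed small $\epsilon$, $X^s(x)=\bigcup_{n\ge0}\varphi^{-n}(X^s(\varphi^n(x),\epsilon))$ has the inductive limit topology. Groupoid. $R^u(X,\varphi)=\{(x,y): x\sim_u y\}$, with $s(x,y)=y$, $r(x,y)=x$, is a locally compact Hausdorff groupoid for the topology in which it is the increasing union of the open subsets $G_u^n=\{(x,y): y\in\varphi^n(X^u(\varphi^{-n}(x),\epsilon))\}$, each carrying the topology induced from $X\times X$. Morita equivalence. Groupoids $G$, $H$ are Morita equivalent if there is a locally compact Hausdorff space $Z$ with commuting free and proper actions of $G$ (left, anchor map $\rho\colon Z\to G^{(0)}$) and $H$ (right, anchor map $\tau\colon Z\to H^{(0)}$) such that $\rho$ induces a homeomorphism $Z/H\to G^{(0)}$ and $\tau$ induces a homeomorphism $G\backslash Z\to H^{(0)}$. Groupoid homology. An étale $G$ Morita equivalent to $R^u(Y,\psi)$ as in the claim is ample. For an ample groupoid $G$, $H_\bullet(G,\mathbb Z)$ is the homology of the complex $(C_c(G^{(n)},\mathbb Z))_{n\ge0}$, where $G^{(n)}$ is the space of composable $n$-tuples, with differential $\sum_{i=0}^n(-1)^i(d_i)_*$; $d_i\colon G^{(n)}\to G^{(n-1)}$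 are the face maps of the nerve (local homeomorphisms) and $(d_*f)(y)=\sum_{d(x)=y}f(x)$. Maps. A factor map $f\colon(X,\varphi)\to(Y,\psi)$ is a continuous surjection with $f\varphi=\psi f$; it is $s$-bijective if it restricts to a bijection $X^s(x)\to Y^s(f(x))$ for every $x\in X$. A shift of finite type is the Smale space $(\Sigma_{\mathcal G},\sigma)$ of bi-infinite edge paths $(e_k)_{k\in\mathbb Z}$, $t(e_k)=i(e_{k+1})$, in a finite directed graph $\mathcal G$ (initial and terminal vertex maps $i,t$), with $\sigma(e)_k=e_{k+1}$ and, when $e_0=f_0$, $[e,f]=(\dots,f_{-2},f_{-1},e_0,e_1,e_2,\dots)$ (or a system conjugate to such). Stable homology. For a shift of finite type $(\Sigma,\sigma)$, Krieger's dimension group $D^s(\Sigma,\sigma)$ is the abelian group generated by classes $[E]$ of nonempty compact open subsets $E$ of stable sets $\Sigma^s(x)$, $x\in\Sigma$, modulo the smallest equivalence relation such that $E\sim F$ if $[E,F]=E$ and $[F,E]=F$ (brackets of sets being defined), and $E\sim F$ iff $\sigma(E)\sim\sigma(F)$, with relations $[E\cup F]=[E]+[F]$ for disjoint $E,F$ with $E\cup F$ again of this type. For $(Y,\psi)$ irreducible with totally disconnected stable sets there is an $s$-bijective factor map $f\colon(\Sigma,\sigma)\to(Y,\psi)$ from an irreducible shift of finite type. Let $\Sigma_n$ be the fiber product of $n+1$ copies of $\Sigma$ over $Y$ and $\sigma_n$ the diagonal action of $\sigma$; each $(\Sigma_n,\sigma_n)$ is a shift of finite type. The maps $\delta_k\colon\Sigma_n\to\Sigma_{n-1}$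 ($0\le k\le n$) deleting the $k$-th entry induce homomorphisms $[E]\mapsto[\delta_k(E)]$, $D^s(\Sigma_n,\sigma_n)\to D^s(\Sigma_{n-1},\sigma_{n-1})$, and $H^s_\bullet(Y,\psi)$ is the homology of the chain complex $(D^s(\Sigma_n,\sigma_n))_{n\ge0}$ with differential $\sum_{k=0}^n(-1)^k(\delta_k)_*$. It does not depend on the choice of $f$.
   Formalization: In Krieger's dimension group, the relation E ∼ F from [E,F]=E and [F,E]=F is imposed only when E and F lie in local stable sets and are close to each other; without locality the group would vanish, e.g. for the full 2-shift. *)

(* Defs.v *)
From HB Require Import structures.
From mathcomp Require Import all_boot all_order all_algebra ring_quotient.
From mathcomp Require Import boolp classical_sets functions fsbigop.
From mathcomp Require Import reals topology normedtype.
From mathcomp.multinomials Require Import freeg.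

Set Implicit Arguments.
Unset Strict Implicit.
Unset Printing Implicit Defensive.

Import Order.TTheory GRing.Theory Num.Theory.
Import numFieldNormedType.Exports.

Local Open Scope classical_set_scope.
Local Open Scope ring_scope.

(* -------------------------------------------------------------------------- *)
(** * Abelian groups and homology *)

Definition span_pred (V : zmodType) (S : set V) : {pred V} := fun v =>
  `[< forall P : set V, P 0 -> (forall x y, P x -> P y -> P (x - y)) ->
      S `<=` P -> P v >].

Lemma span_zmod_closed (V : zmodType) (S : set V) : zmod_closed (span_pred S).
Proof.
split; first by apply/asboolP => P P0.
move=> x y /asboolP xS /asboolP yS; apply/asboolP => P P0 PB SP.
by apply: (PB); [exact: xS | exact: yS].
Qed.

HB.instance Definition _ (V : zmodType) (S : set V) :=
  GRing.isZmodClosed.Build V (span_pred S) (span_zmod_closed S).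

(* V / <S> *)
Definition zmod_presented (V : zmodType) (S : set V) : zmodType :=
  Quotient.quot (span_pred S : zmodClosed V).

Definition zmod_class (V : zmodType) (S : set V) (v : V) : zmod_presented S :=
  (\pi_(Quotient.quot (span_pred S : zmodClosed V)) v)%qT.

(* The additive map with property P.  Like [lim], this is a total function: it
   is the zero map if there is no additive map with property P. *)
Definition the_additive (U V : zmodType) (P : set {additive U -> V}) :
    {additive U -> V} :=
  if pselect (exists g, P g) is left exP then projT1 (cid exP)
  else (\0 : U -> V).

Lemma the_additiveP (U V : zmodType) (P : set {additive U -> V}) :
  (exists g, P g) -> P (the_additive P).
Proof.
by move=> exP; rewrite /the_additive; case: pselect => // e; case: (cid e).
Qed.

Record chain_complex := ChainComplex {
  chain : nat -> zmodType;
  bd : forall n, {additive chain n.+1 -> chain n} }.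

Section Homology.
Variable C : chain_complex.

(* The differential on chains of degree 0 is 0. *)
Definition cycle_pred p : {pred chain C p} :=
  match p return {pred chain C p} with
  | 0 => fun=> true
  | q.+1 => fun c => bd C q c == 0
  end.

Lemma cycle_zmod_closed p : zmod_closed (@cycle_pred p).
Proof.
case: p => [//|p]; split; first by rewrite unfold_in raddf0.
by move=> x y; rewrite !unfold_in raddfB => /eqP-> /eqP->; rewrite subrr.
Qed.

HB.instance Definition _ p :=
  GRing.isZmodClosed.Build (chain C p) (@cycle_pred p) (@cycle_zmod_closed p).

Definition cycle p : Type := {c : chain C p | c \in @cycle_pred p}.

HB.instance Definition _ p := Choice.on (cycle p).
HB.instance Definition _ p :=
  SubType.copy (cycle p) {c : chain C p | c \in @cycle_pred p}.
HB.instance Definition _ p := [SubChoice_isSubZmodule of cycle p by <:].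

Definition boundary_pred p : {pred cycle p} := fun z =>
  `[< exists c : chain C p.+1, bd C p c = \val z >].

Lemma boundary_zmod_closed p : zmod_closed (@boundary_pred p).
Proof.
split; first by apply/asboolP; exists 0; rewrite !raddf0.
move=> x y /asboolP[c cx] /asboolP[d dy]; apply/asboolP; exists (c - d).
by rewrite !raddfB cx dy.
Qed.

HB.instance Definition _ p :=
  GRing.isZmodClosed.Build (cycle p) (@boundary_pred p) (@boundary_zmod_closed p).

Definition homology p : zmodType :=
  Quotient.quot (@boundary_pred p : zmodClosed (cycle p)).

End Homology.

Definition isomorphic (U V : zmodType) :=
  exists g : {additive U -> V}, bijective g.

(* sum_{k <= m} (-1)^k d_k *)
Definition altsum (U V : zmodType) m (d : 'I_m.+1 -> {additive U -> V}) (x : U)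
  : V := \sum_(k < m.+1) d k x *~ (-1) ^+ k.

Lemma altsum_zmod_morphism (U V : zmodType) m (d : 'I_m.+1 -> {additive U -> V}) :
  zmod_morphism (altsum d).
Proof.
move=> x y; rewrite /altsum -sumrB; apply: eq_bigr => k _.
by rewrite raddfB mulrzBl.
Qed.

HB.instance Definition _ (U V : zmodType) m (d : 'I_m.+1 -> {additive U -> V}) :=
  GRing.isZmodMorphism.Build U V (altsum d) (altsum_zmod_morphism d).

(* -------------------------------------------------------------------------- *)
(** * Topology *)

Definition homeomorphism (T U : topologicalType) (f : T -> U) :=
  continuous f /\ exists g, [/\ continuous g, cancel f g & cancel g f].

Definition local_homeomorphism (T U : topologicalType) (f : T -> U) :=
  forall x, exists A g, [/\ open_nbhs x A, open (f @` A),
    {within A, continuous f}, {within f @` A, continuous g} &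
    forall y, A y -> g (f y) = y].

(* The subset A of T as the union of its pieces A `&` E n, with the inductive
   limit topology: U is open when each U `&` E n is relatively open. *)
Definition inductive_limit (T : topologicalType) (A : set T) (E : nat -> set T)
  : Type := set_type A.

Section InductiveLimit.
Variables (T : topologicalType) (A : set T) (E : nat -> set T).
Let L := inductive_limit A E.
Let inc : L -> T := set_val.

Definition indlim_open (U : set L) := forall n, exists2 V : set T, open V &
  U `&` (inc @^-1` E n) = (inc @^-1` V) `&` (inc @^-1` E n).

Lemma indlim_openT : indlim_open setT.
Proof. by move=> n; exists setT; [exact: openT | rewrite preimage_setT]. Qed.

Lemma indlim_openI : setI_closed indlim_open.
Proof.
move=> U V oU oV n; have [U' oU' UE] := oU n; have [V' oV' VE] := oV n.
exists (U' `&` V'); first exact: openI.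
by rewrite preimage_setI setIIl UE VE -setIIl.
Qed.

Lemma indlim_open_bigU (I : Type) (F : I -> set L) :
  (forall i, indlim_open (F i)) -> indlim_open (\bigcup_i F i).
Proof.
move=> oF n; have /choice[G GP] : forall i, exists V, open V /\
    F i `&` (inc @^-1` E n) = (inc @^-1` V) `&` (inc @^-1` E n).
  by move=> i; have [V] := oF i n; exists V.
exists (\bigcup_i G i); first by apply: bigcup_open => i _; case: (GP i).
rewrite preimage_bigcup !setI_bigcupl.
by apply: eq_bigcupr => i _; case: (GP i).
Qed.

HB.instance Definition _ := Choice.copy L (set_type A).
HB.instance Definition _ :=
  isOpenTopological.Build L indlim_openT indlim_openI indlim_open_bigU.
End InductiveLimit.

(* The set of orbits of a family of subsets [orb z] (z : T), with the quotient
   topology for z |-> orb z. *)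
Definition orbit_space (T : topologicalType) (orb : T -> set T) : Type :=
  set_type (range orb).

Section OrbitSpace.
Variables (T : topologicalType) (orb : T -> set T).
Let Q := orbit_space orb.

Definition to_orbit (z : T) : Q :=
  exist _ (orb z) (mem_set (ex_intro2 _ _ z I erefl)).

Lemma orbit_openT : open (to_orbit @^-1` setT).
Proof. by rewrite preimage_setT; exact: openT. Qed.

Lemma orbit_openI : setI_closed [set U : set Q | open (to_orbit @^-1` U)].
Proof. by move=> U V; exact: openI. Qed.

Lemma orbit_open_bigU (I : Type) (F : I -> set Q) :
  (forall i, open (to_orbit @^-1` F i)) ->
  open (to_orbit @^-1` \bigcup_i F i).
Proof. by move=> oF; rewrite preimage_bigcup; exact: bigcup_open. Qed.

HB.instance Definition _ := Choice.copy Q (set_type (range orb)).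
HB.instance Definition _ :=
  @isOpenTopological.Build Q _ orbit_openT orbit_openI orbit_open_bigU.
End OrbitSpace.

(* -------------------------------------------------------------------------- *)
(** * Compactly supported integer functions *)

Section CompactlySupported.
Variable T : topologicalType.

Definition cc_pred : {pred T -> int} := fun f =>
  `[< continuous (f : T -> discrete_topology int) /\
      compact (closure [set x | f x != 0]) >].

Lemma continuous_discreteE (f : T -> int) :
  continuous (f : T -> discrete_topology int) <->
  forall x, \forall y \near x, f y = f x.
Proof.
split=> [cf x | lf x]; first exact: (cf x _ (discrete_set1 (f x : discrete_topology int))).
move=> U /nbhs_singleton Ufx; have := lf x.
by apply: filterS => y /= ->.
Qed.

Lemma cc_zmod_closed : zmod_closed cc_pred.
Proof.
split.
  apply/asboolP; split; first by apply/continuous_discreteE => x; exact: nearW.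
  rewrite (_ : [set x | _] = set0) ?closure0; first exact: compact0.
  by apply/seteqP; split=> x //=; rewrite eqxx.
move=> f g /asboolP[/continuous_discreteE cf kf].
move=> /asboolP[/continuous_discreteE cg kg]; apply/asboolP; split.
  apply/continuous_discreteE => x; near=> y.
  rewrite !fctE (near (cf x) y) ?(near (cg x) y) //; near: y; exact: filterT.
apply: subclosed_compact (compactU kf kg) _; first exact: closed_closure.
rewrite -closureU; apply: closureS => x /=; rewrite !fctE => fgx.
have [fx|] := eqVneq (f x) 0; last by left.
by right; apply: contra_neq fgx => gx; rewrite fx gx subrr.
Unshelve. all: by end_near. Qed.

HB.instance Definition _ :=
  GRing.isZmodClosed.Build (T -> int) cc_pred cc_zmod_closed.

(* C_c(T, Z) *)
Definition Cc : Type := {f : T -> int | f \in cc_pred}.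

HB.instance Definition _ := Choice.on Cc.
HB.instance Definition _ := SubType.copy Cc {f : T -> int | f \in cc_pred}.
HB.instance Definition _ := [SubChoice_isSubZmodule of Cc by <:].
End CompactlySupported.

(* (d_* f)(y) = sum_{d x = y} f x; the sum has finite support when d is a local
   homeomorphism of Hausdorff spaces. *)
Definition pushforward (T U : topologicalType) (d : T -> U) :
    {additive Cc T -> Cc U} :=
  the_additive [set g | forall (f : Cc T) (y : U),
    \val (g f) y = \sum_(x \in d @^-1` [set y]) \val f x].

(* -------------------------------------------------------------------------- *)
(** * Groupoids *)

(* The composite g h is defined when src g = rng h; [comp g h] is irrelevant
   otherwise.  The unit space is a separate type [obj], embedded by [idt]. *)
Record groupoid := Groupoid {
  obj : topologicalType;
  arr : topologicalType;
  src : arr -> obj;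
  rng : arr -> obj;
  idt : obj -> arr;
  inv : arr -> arr;
  comp : arr -> arr -> arr;
  src_idt : forall x, src (idt x) = x;
  rng_idt : forall x, rng (idt x) = x;
  src_inv : forall g, src (inv g) = rng g;
  rng_inv : forall g, rng (inv g) = src g;
  src_comp : forall g h, src g = rng h -> src (comp g h) = src h;
  rng_comp : forall g h, src g = rng h -> rng (comp g h) = rng g;
  compA : forall g h k, src g = rng h -> src h = rng k ->
    comp (comp g h) k = comp g (comp h k);
  comp1g : forall g, comp (idt (rng g)) g = g;
  compg1 : forall g, comp g (idt (src g)) = g;
  compVg : forall g, comp (inv g) g = idt (src g);
  compgV : forall g, comp g (inv g) = idt (rng g) }.

Arguments src {g0} _ : rename.
Arguments rng {g0} _ : rename.
Arguments idt {g0} _ : rename.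
Arguments inv {g0} _ : rename.
Arguments comp {g0} _ _ : rename.

Record topological_groupoid (G : groupoid) : Prop := {
  tg_src : continuous (@src G);
  tg_rng : continuous (@rng G);
  tg_idt : continuous (@idt G);
  tg_inv : continuous (@inv G);
  tg_comp : {within [set p : arr G * arr G | src p.1 = rng p.2],
    continuous (fun p => comp p.1 p.2)};
  tg_hausdorff : hausdorff_space (arr G);
  tg_locally_compact : locally_compact [set: arr G];
  tg_second_countable : @second_countable (arr G) }.

(* The counting measures on the fibres of rng form a continuous Haar system of
   an etale groupoid, so that no Haar system is required here. *)
Definition etale (G : groupoid) :=
  local_homeomorphism (@src G) /\ local_homeomorphism (@rng G).

Section Opposite.
Variable G : groupoid.
Definition opposite : groupoid.
Proof.
refine (@Groupoid (obj G) (arr G) rng src idt inv (fun g h => comp h g)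
  (@rng_idt G) (@src_idt G) (@rng_inv G) (@src_inv G)
  _ _ _ (@compg1 G) (@comp1g G) (@compgV G) (@compVg G)).
- by move=> g h gh; exact: rng_comp.
- by move=> g h gh; exact: src_comp.
- by move=> g h k gh hk; rewrite compA.
Defined.
End Opposite.

Section Actions.
Variables (G : groupoid) (Z : topologicalType) (rho : Z -> obj G).
Variable act : arr G -> Z -> Z.

(* [act g z] is relevant when src g = rho z. *)
Record left_action : Prop := {
  la_anchor : continuous rho;
  la_rng : forall g z, src g = rho z -> rho (act g z) = rng g;
  la_comp : forall g h z, src g = rng h -> src h = rho z ->
    act (comp g h) z = act g (act h z);
  la_idt : forall z, act (idt (rho z)) z = z;
  la_continuous : {within [set p : arr G * Z | src p.1 = rho p.2],
    continuous (fun p => act p.1 p.2)} }.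

Definition free_action :=
  forall g z, src g = rho z -> act g z = z -> g = idt (rho z).

Definition proper_action := forall K : set (Z * Z), compact K ->
  compact [set p : arr G * Z | src p.1 = rho p.2 /\ K (act p.1 p.2, p.2)].

Definition orbit_of (z : Z) : set Z := [set act g z | g in [set g | src g = rho z]].

End Actions.

Arguments left_action {G Z} rho act.
Arguments free_action {G Z} rho act.
Arguments proper_action {G Z} rho act.
Arguments orbit_of {G Z} rho act.

(* [a : T -> U] descends to a homeomorphism from the orbit space to U. *)
Definition induces_homeomorphism (T U : topologicalType) (orb : T -> set T)
    (a : T -> U) :=
  exists2 h : orbit_space orb -> U, homeomorphism h &
    forall z, h (to_orbit orb z) = a z.

(* A right H-action, z h being defined when tau z = rng h, is a left action of
   the opposite groupoid. *)
Definition morita_equivalent (G H : groupoid) :=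
  exists (Z : topologicalType)
    (rho : Z -> obj G) (lact : arr G -> Z -> Z)
    (tau : Z -> obj H) (ract : arr H -> Z -> Z),
  let tau' : Z -> obj (opposite H) := tau in
  let ract' : arr (opposite H) -> Z -> Z := ract in
  [/\ hausdorff_space Z /\ locally_compact [set: Z],
      [/\ left_action rho lact, free_action rho lact & proper_action rho lact],
      [/\ left_action tau' ract', free_action tau' ract' &
          proper_action tau' ract'],
      [/\ forall g z, src g = rho z -> tau (lact g z) = tau z,
          forall h z, tau z = rng h -> rho (ract h z) = rho z &
          forall g h z, src g = rho z -> tau z = rng h ->
            ract h (lact g z) = lact g (ract h z)] &
      induces_homeomorphism (orbit_of tau' ract') rho /\
      induces_homeomorphism (orbit_of rho lact) tau].

(** ** Groupoid homology *)

(* Composable n.+1-tuples (t_0, ..., t_n): t_0 t_1 ... t_n is defined. *)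
Definition composable (G : groupoid) n : set {ptws 'I_n.+1 -> arr G} :=
  [set t | forall i j : 'I_n.+1, j = i.+1 :> nat -> src (t i) = rng (t j)].

Definition nerve (G : groupoid) (n : nat) : topologicalType :=
  if n is m.+1 then set_type (@composable G m) else obj G.

Section Faces.
Variables (G : groupoid) (n : nat).
Implicit Types (k : 'I_n.+3) (t : 'I_n.+2 -> arr G).

Definition face_tuple k t : 'I_n.+1 -> arr G := fun j =>
  let tj := t (widen_ord (leqnSn _) j) in
  let tj1 := t (fintype.lift ord0 j) in
  if (j.+1 < k)%N then tj
  else if j.+1 == k :> nat then comp tj tj1
  else tj1.

Lemma face_composable k t : composable t -> composable (face_tuple k t).
Proof.
move=> ct i j ji; rewrite /face_tuple ji.
have cij : forall (a b : 'I_n.+2), b = a.+1 :> nat -> src (t a) = rng (t b).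
  exact: ct.
have ci : src (t (widen_ord (leqnSn _) i)) = rng (t (fintype.lift ord0 i)).
  by apply: cij; rewrite /= /bump.
have cj : src (t (widen_ord (leqnSn _) j)) = rng (t (fintype.lift ord0 j)).
  by apply: cij; rewrite /= /bump.
have eij : fintype.lift ord0 i = widen_ord (leqnSn _) j.
  by apply: val_inj; rewrite /= /bump ji.
case: (ltngtP i.+2 k) => _.
- by rewrite -eij.
- by case: ifP => _; rewrite ?(src_comp ci) eij.
- by rewrite rng_comp // -eij.
Qed.
End Faces.

(* d_0 drops the first arrow, the last face drops the last arrow and the others
   compose two consecutive arrows; in degree 1, d_0 = src and d_1 = rng. *)
Definition face (G : groupoid) (n : nat) :
    'I_n.+2 -> nerve G n.+1 -> nerve G n :=
  match n return 'I_n.+2 -> nerve G n.+1 -> nerve G n with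
  | 0 => fun k t => let g := set_val t ord0 in
      if k == ord0 then src g else rng g
  | m.+1 => fun k t =>
      exist _ (face_tuple k (set_val t))
        (mem_set (face_composable k (set_mem (valP t))))
  end.

Definition groupoid_complex (G : groupoid) : chain_complex :=
  @ChainComplex (fun n => Cc (nerve G n))
    (fun n => altsum (fun k : 'I_n.+2 => pushforward (@face G n k))).

Definition groupoid_homology (G : groupoid) (p : nat) : zmodType :=
  homology (groupoid_complex G) p.

(* -------------------------------------------------------------------------- *)
(** * Smale spaces *)

(* A metric space with an invertible self-map [dyn] and a partially defined
   bracket: [br x y] is relevant when [brdom x y].  [radius] is the constant
   eps_X of a Smale space.  Fibre products of Smale spaces are of this form, for
   a bracket domain which is not given by a bound on the distance. *)
Record system (R : realType) := System {
  pt :> metricType R;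
  dyn : pt -> pt;
  dynV : pt -> pt;
  dynK : cancel dyn dynV;
  dynVK : cancel dynV dyn;
  radius : R;
  brdom : pt -> pt -> Prop;
  br : pt -> pt -> pt }.

Arguments dyn {R s} _ : rename.
Arguments dynV {R s} _ : rename.
Arguments brdom {R s} _ _ : rename.
Arguments br {R s} _ _ : rename.
Arguments radius {R} s : rename.

Section Systems.
Variables (R : realType) (X : system R).
Implicit Types (x y z : X) (e : R) (E F : set X).

Definition non_wandering := forall U : set X, open U -> U !=set0 ->
  exists2 N, (0 < N)%N & U `&` (iter N dyn @` U) !=set0.

Definition irreducible := forall U V : set X,
  open U -> U !=set0 -> open V -> V !=set0 ->
  exists N, U `&` (iter N dyn @` V) !=set0.

Record smale_space : Prop := {
  sm_compact : compact [set: X];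
  sm_dyn : continuous (@dyn R X);
  sm_dynV : continuous (@dynV R X);
  sm_radius : 0 < radius X;
  sm_brdom : forall x y, brdom x y <-> mdist x y <= radius X;
  sm_br_continuous : {within [set p : X * X | brdom p.1 p.2],
    continuous (fun p => br p.1 p.2)};
  sm_brxx : forall x, br x x = x;
  sm_brr : forall x y z, brdom y z -> brdom x (br y z) -> brdom x z ->
    br x (br y z) = br x z;
  sm_brl : forall x y z, brdom x y -> brdom (br x y) z -> brdom x z ->
    br (br x y) z = br x z;
  sm_dyn_br : forall x y, brdom x y -> brdom (dyn x) (dyn y) ->
    dyn (br x y) = br (dyn x) (dyn y);
  sm_contract : exists lam : R, [/\ 0 < lam, lam < 1,
    forall x y, brdom x y -> br x y = y ->
      mdist (dyn x) (dyn y) <= lam * mdist x y &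
    forall x y, brdom x y -> br x y = x ->
      mdist (dynV x) (dynV y) <= lam * mdist x y];
  sm_non_wandering : non_wandering }.

Definition local_stable e x : set X :=
  [set y | [/\ mdist x y < e, brdom y x & br y x = x]].

Definition local_unstable e x : set X :=
  [set y | [/\ mdist x y < e, brdom x y & br x y = x]].

Definition totally_disconnected_stable_sets := forall x e,
  0 < e -> e < radius X -> totally_disconnected (local_stable e x).

Definition stably_equivalent x y :=
  (fun n => mdist (iter n dyn x) (iter n dyn y)) @ \oo --> (0 : R).

Definition unstably_equivalent x y :=
  (fun n => mdist (iter n dynV x) (iter n dynV y)) @ \oo --> (0 : R).

Definition stable_set x : set X := [set y | stably_equivalent x y].

(* The fixed small eps; the topologies below are the same for every positive
   eps <= eps_X. *)
Definition small : R := radius X / 2.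

Definition stable_space x : topologicalType :=
  inductive_limit (stable_set x)
    (fun n => iter n dynV @` local_stable small (iter n dyn x)).

(** ** The groupoid of the unstable equivalence relation *)

Lemma unstably_equivalentxx x : unstably_equivalent x x.
Proof.
rewrite /unstably_equivalent (_ : (fun n => _) = cst 0); first exact: cvg_cst.
by apply/funext => n; rewrite mdistxx.
Qed.

Lemma unstably_equivalentC x y :
  unstably_equivalent x y -> unstably_equivalent y x.
Proof.
rewrite /unstably_equivalent => h; apply: cvg_trans h.
by apply: near_eq_cvg; apply: nearW => n; rewrite metric_sym.
Qed.

Lemma unstably_equivalent_trans y x z :
  unstably_equivalent x y -> unstably_equivalent y z ->
  unstably_equivalent x z.
Proof.
move=> xy yz; have := cvgD xy yz; rewrite addr0 => /(_ (@eventually_filter)) xyz.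
rewrite /unstably_equivalent.
apply: squeeze_cvgr (cvg_cst (0 : R)) xyz.
by apply: nearW => n; rewrite mdist_ge0 metric_triangle.
Qed.

Definition unstable_rel : set (X * X) :=
  [set p | unstably_equivalent p.1 p.2].

(* The groupoid R^u, with unit space X and topologized by the G_u^n. *)
Definition unstable_arr : topologicalType :=
  inductive_limit unstable_rel (fun n => [set p : X * X |
    (iter n dyn @` local_unstable small (iter n dynV p.1)) p.2]).

Let pair_of (g : unstable_arr) : X * X := set_val g.

Let mk_arr (p : X * X) (h : unstable_rel p) : unstable_arr :=
  exist _ p (mem_set h).

Let arr_eq (g h : unstable_arr) : pair_of g = pair_of h -> g = h.
Proof. by case: g h => [g ?] [h ?] /= gh; exact: eq_exist. Qed.

Let pair_ofP (g : unstable_arr) : unstable_rel (pair_of g).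
Proof. exact: set_mem (valP g). Qed.

Definition unstable_comp (g h : unstable_arr) : unstable_arr :=
  if pselect ((pair_of g).2 = (pair_of h).1) is left e then
    @mk_arr ((pair_of g).1, (pair_of h).2)
      (@unstably_equivalent_trans (pair_of g).2 _ _ (pair_ofP g)
         (eq_ind_r (fun v => unstably_equivalent v _) (pair_ofP h) e))
  else g.

Let pair_of_comp (g h : unstable_arr) : (pair_of g).2 = (pair_of h).1 ->
  pair_of (unstable_comp g h) = ((pair_of g).1, (pair_of h).2).
Proof. by rewrite /unstable_comp; case: pselect. Qed.

Definition unstable_groupoid : groupoid.
Proof.
refine (@Groupoid X unstable_arr (fun g => (pair_of g).2)
  (fun g => (pair_of g).1)
  (fun x => @mk_arr (x, x) (@unstably_equivalentxx x))
  (fun g => @mk_arr ((pair_of g).2, (pair_of g).1)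
     (unstably_equivalentC (pair_ofP g)))
  unstable_comp _ _ _ _ _ _ _ _ _ _ _) => //.
- by move=> g h gh; rewrite pair_of_comp.
- by move=> g h gh; rewrite pair_of_comp.
- by move=> g h k gh hk; apply: arr_eq; rewrite !pair_of_comp.
- by move=> g; apply: arr_eq; rewrite !pair_of_comp //=; case: (pair_of g).
- by move=> g; apply: arr_eq; rewrite !pair_of_comp //=; case: (pair_of g).
- by move=> g; apply: arr_eq; rewrite pair_of_comp.
- by move=> g; apply: arr_eq; rewrite pair_of_comp.
Defined.

(** ** Krieger's dimension group *)

Definition compact_open_stable : set (set X) := [set E | E !=set0 /\
  exists2 x, E `<=` stable_set x &
    let E' : set (stable_space x) := set_val @^-1` E in open E' /\ compact E'].

(* The brackets of the sets E and F are defined: E and F lie in local stable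
   sets, and are close enough for [a, b] and [b, a] to be defined.  Without the
   locality of E and F, sets containing points with distinct futures would be
   related, e.g. all the classes of the full 2-shift would vanish. *)
Definition bracketable E F :=
  [/\ exists x, E `<=` local_stable small x,
      exists y, F `<=` local_stable small y &
      forall a b, E a -> F b -> [/\ mdist a b <= small, brdom a b & brdom b a]].

Definition set_br E F : set X := [set br a b | a in E & b in F].

Inductive stable_sim : set X -> set X -> Prop :=
| Sim_refl E : stable_sim E E
| Sim_sym E F : stable_sim E F -> stable_sim F E
| Sim_trans E F G : stable_sim E F -> stable_sim F G -> stable_sim E G
| Sim_br E F : compact_open_stable E -> compact_open_stable F ->
    bracketable E F -> set_br E F = E -> set_br F E = F -> stable_sim E F
| Sim_dyn E F : stable_sim E F -> stable_sim (dyn @` E) (dyn @` F)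
| Sim_dynV E F : stable_sim (dyn @` E) (dyn @` F) -> stable_sim E F.

Definition co_set : choiceType := set_type compact_open_stable.

Definition dimension_relations : set {freeg co_set} :=
  [set v | exists E F : co_set,
     stable_sim (set_val E) (set_val F) /\ v = << E >> - << F >>] `|`
  [set v | exists E F G : co_set,
     [/\ set_val E `&` set_val F = set0,
         set_val G = set_val E `|` set_val F &
         v = << G >> - (<< E >> + << F >>)]].

Definition dimension_group : zmodType := zmod_presented dimension_relations.

Definition dim_class (E : co_set) : dimension_group :=
  zmod_class dimension_relations << E >>.

End Systems.

(* The homomorphism [E] |-> [f(E)]. *)
Definition dimension_map (R : realType) (X Y : system R) (f : X -> Y) :
    {additive dimension_group X -> dimension_group Y} :=
  the_additive [set g | forall E : co_set X, exists2 E' : co_set Y,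
    set_val E' = f @` set_val E & g (dim_class E) = dim_class E'].

(** ** Shifts of finite type *)

Definition edge_shift (V E : finType) (i t : E -> V) : topologicalType :=
  set_type [set e : {ptws int -> discrete_topology E} |
    forall k, t (e k) = i (e (k + 1))].

(* Conjugate to the bi-infinite edge paths of a finite directed graph.  The
   bracket of a Smale space being determined, for close enough points, by the
   dynamics, the conjugacy need not mention it. *)
Definition shift_of_finite_type (R : realType) (S : system R) :=
  exists (V E : finType) (i t : E -> V) (h : S -> edge_shift i t),
    homeomorphism h /\
    forall x k, set_val (h (dyn x)) k = set_val (h x) (k + 1).

(** ** Factor maps and Putnam's stable homology *)

Record factor_map (R : realType) (X Y : system R) := FactorMap {
  fmap :> X -> Y;
  fmap_continuous : continuous fmap;
  fmap_surj : forall y, exists x, fmap x = y;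
  fmap_dyn : forall x, fmap (dyn x) = dyn (fmap x) }.

Definition s_bijective (R : realType) (X Y : system R) (f : factor_map X Y) :=
  forall x, set_bij (stable_set x) (stable_set (f x)) f.

Section FiberProduct.
Variables (R : realType) (X Y : system R) (f : factor_map X Y).

Definition fiber_tuple n : set ('I_n.+1 -> X) :=
  [set t | forall i j, f (t i) = f (t j)].

Definition fiber n : Type := set_type (@fiber_tuple n).

HB.instance Definition _ n := Choice.copy (fiber n) (set_type (@fiber_tuple n)).

Let coord n (t : fiber n) : 'I_n.+1 -> X := set_val t.
Let coordP n (t : fiber n) : fiber_tuple (coord t).
Proof. exact: set_mem (valP t). Qed.
Let fiber_eq n (t u : fiber n) : coord t =1 coord u -> t = u.
Proof. by case: t u => [t ?] [u ?] /= tu; exact/eq_exist/funext. Qed.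
Let mk n (t : 'I_n.+1 -> X) (ht : fiber_tuple t) : fiber n :=
  exist _ t (mem_set ht).

Definition fiber_dist n (t u : fiber n) : R :=
  \big[Num.max/0]_(i < n.+1) mdist (coord t i) (coord u i).

Let fiber_dist_ge n (t u : fiber n) i :
  mdist (coord t i) (coord u i) <= fiber_dist t u.
Proof. exact: (le_bigmax _ (fun i => mdist (coord t i) (coord u i))). Qed.

Let fiber_distxx n (t : fiber n) : fiber_dist t t = 0.
Proof.
by rewrite /fiber_dist; elim/big_ind: _ => // [x y -> -> | i _];
  rewrite ?maxxx ?mdistxx.
Qed.

Let fiber_dist_pos n (t u : fiber n) : fiber_dist t u = 0 -> t = u.
Proof.
move=> tu0; apply: fiber_eq => i; apply: mdist_positivity.
by apply/le_anti; rewrite mdist_ge0 -tu0 fiber_dist_ge.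
Qed.

Let fiber_dist_sym n (t u : fiber n) : fiber_dist t u = fiber_dist u t.
Proof. by apply: eq_bigr => i _; rewrite metric_sym. Qed.

Let fiber_dist_triangle n (u t v : fiber n) :
  fiber_dist t v <= fiber_dist t u + fiber_dist u v.
Proof.
have ge0 (a b : fiber n) : 0 <= fiber_dist a b.
  exact: le_trans (mdist_ge0 _ _) (fiber_dist_ge a b ord0).
apply/bigmax_leP; split=> [|i _]; first exact: addr_ge0.
by apply: le_trans (metric_triangle _ (coord u i) _) _; apply: lerD.
Qed.

HB.instance Definition _ n := isMetric.Build R (fiber n)
  (@fiber_distxx n) (@fiber_dist_pos n) (@fiber_dist_sym n)
  (@fiber_dist_triangle n).

Lemma fmap_dynV x : f (dynV x) = dynV (f x).
Proof. by rewrite -[in RHS](dynVK x) fmap_dyn dynK. Qed.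

Let dyn_fiber n (t : fiber n) : fiber_tuple (dyn \o coord t).
Proof. by move=> i j /=; rewrite !fmap_dyn (coordP t i j). Qed.

Let dynV_fiber n (t : fiber n) : fiber_tuple (dynV \o coord t).
Proof. by move=> i j /=; rewrite !fmap_dynV (coordP t i j). Qed.

Definition fiber_br_tuple n (t u : fiber n) : 'I_n.+1 -> X :=
  fun i => br (coord t i) (coord u i).

(* X_n: the bracket is computed coordinatewise, and is defined when the bracket
   of each pair of coordinates is, and the resulting tuple is in X_n. *)
Definition fiber_product (n : nat) : system R.
Proof.
refine (@System R (fiber n) (fun t => mk (dyn_fiber t))
  (fun t => mk (dynV_fiber t)) _ _ (radius X)
  (fun t u => (forall i, brdom (coord t i) (coord u i)) /\
     fiber_tuple (fiber_br_tuple t u))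
  (fun t u => if pselect (fiber_tuple (fiber_br_tuple t u)) is left h
     then mk h else t)).
- by move=> t; apply: fiber_eq => i; exact: dynK.
- by move=> t; apply: fiber_eq => i; exact: dynVK.
Defined.

Let omit_fiber n (k : 'I_n.+2) (t : fiber n.+1) :
  fiber_tuple (coord t \o fintype.lift k).
Proof. by move=> i j; exact: coordP. Qed.

Definition omit n (k : 'I_n.+2) : fiber_product n.+1 -> fiber_product n :=
  fun t => mk (@omit_fiber n k t).

Definition stable_complex : chain_complex :=
  @ChainComplex (fun n => dimension_group (fiber_product n))
    (fun n => altsum (fun k : 'I_n.+2 => dimension_map (@omit n k))).

(* H^s_p(Y), computed from the s-bijective factor map f from a shift of finite
   type *)
Definition stable_homology (p : nat) : zmodType := homology stable_complex p.

End FiberProduct.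

(* Main.v *)
From HB Require Import structures.
From mathcomp Require Import all_boot all_order all_algebra ring_quotient.
From mathcomp Require Import boolp classical_sets functions fsbigop cardinality.
From mathcomp Require Import reals topology normedtype sequences.
From mathcomp Require Import ring zify.
From mathcomp.multinomials Require Import freeg.
Require Import Defs.

(** Both homologies are computed from one double complex, attached to a Morita
    bibundle Z between G and the unstable groupoid of Y, with anchor maps
    rho : Z -> obj G and tau : Z -> Y, and to the s-bijective map f : S -> Y.

    A local section over a set of p-simplices of the nerve of G consists of
    continuous maps z and a, where z t is a point of Z over the first vertex of
    t and a t is a point of S with f (a t) = tau (z t); its class maps t to the
    unstable class of a t.  Two sections whose classes agree at a point have the
    same class near this point ([near_flun]), and sections can be translated
    along the arrows of G ([push_section]).  In degree (p, q), the double
    complex [A] consists of the integral combinations, with compact support, of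
    (q + 1)-tuples of such classes.  One differential is the alternating sum of
    the sums over the fibres of the faces of the nerve, the other one is the
    differential of the simplices whose vertices are all classes over a vertex.
    By [double_complex_homology], it is enough that the p-th row resolves
    C_c(nerve G p, Z) and that the q-th column resolves the dimension group of
    the fibre product S_q of q + 1 copies of S over Y.

    Rows ([rows_resolve]).  The nerve is zero-dimensional, so that a problem on
    chains which can be solved locally can be solved ([compact_open_ind]); and
    the cone over a local section contracts the simplices of classes.

    Columns ([columns_resolve]).  Classes over the same vertex are represented
    by a point of S_q ([fiber_sections]), so that the chains can be lifted to
    chains [B] labelled by points of S_q.  By s-bijectivity, a point of S_q
    over tau z extends to a local section along its stable set, which identifies
    a compact open set of objects with a compact open subset of this stable set
    ([chart]); sections with the same class differ by a holonomy, and this gives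
    the map [eta] to the dimension group.  The lifted columns are contracted by
    a section zeta of tau over S_q, which attaches an object to each label, and
    allows simplices to be extended by a new first vertex ([homotopy]).  To use
    this on classes, the lift of a cycle has to be a cycle.  This is achieved by
    the retractions of S_q along unstable sets ([retractions]), which eventually
    identify the labels of the same class.  In degree 0, what remains is the
    number of points with a given retraction, which is an invariant of the
    class in the dimension group ([dclass_sum_count]). *)

Set Implicit Arguments.
Unset Strict Implicit.
Unset Printing Implicit Defensive.
Import Order.TTheory GRing.Theory Num.Theory.
Import numFieldNormedType.Exports.
Local Open Scope classical_set_scope.
Local Open Scope ring_scope.

(** * Algebra *)

Lemma spanP (V : zmodType) (S : set V) (P : set V) :
  P 0 -> (forall x y, P x -> P y -> P (x - y)) -> S `<=` P ->
  forall v, v \in span_pred S -> P v.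
Proof. by move=> P0 PB SP v /asboolP; apply. Qed.

Lemma span_sub (V : zmodType) (S : set V) v : S v -> v \in span_pred S.
Proof. by move=> Sv; apply/asboolP => P _ _; apply. Qed.

Lemma sub_closed_mulz (V : zmodType) (P : set V) x n :
  P 0 -> (forall x y, P x -> P y -> P (x - y)) -> P x -> P (x *~ n).
Proof.
move=> P0 PB Px; have PN y : P y -> P (- y) by move=> Py; rewrite -sub0r; exact: PB.
have PD y z : P y -> P z -> P (y + z).
  by move=> Py Pz; rewrite -[z]opprK; apply: PB => //; exact: PN.
have Pn m : P (x *+ m).
  by elim: m => [|m IH]; rewrite ?mulr0n // mulrS; exact: PD.
case: n => n; first exact: Pn.
by rewrite NegzE mulrNz; apply: PN; exact: Pn.
Qed.

(** The substitute of [raddf_sum] for maps which are only additive on a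
    subgroup, such as the sums over fibres, which are additive on the functions
    with finite fibres; the induction needs the membership of the partial sums.
    *)
Lemma sub_additive_sum (U V : zmodType) (P : set U) (phi : U -> V)
    (I : Type) (r : seq I) (x : I -> U) (n : I -> int) :
  P 0 -> (forall x y, P x -> P y -> P (x - y)) ->
  (forall x y, P x -> P y -> phi (x - y) = phi x - phi y) ->
  (forall i, P (x i)) ->
  P (\sum_(i <- r) x i *~ n i) /\
  phi (\sum_(i <- r) x i *~ n i) = \sum_(i <- r) phi (x i) *~ n i.
Proof.
move=> P0 PB phiB Px.
have phi0 : phi 0 = 0 by have := phiB _ _ P0 P0; rewrite !subrr.
have PN y : P y -> P (- y) by move=> Py; rewrite -sub0r; exact: PB.
have PD y z : P y -> P z -> P (y + z).
  by move=> Py Pz; rewrite -[z]opprK; apply: PB => //; exact: PN.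
have phiN y : P y -> phi (- y) = - phi y.
  by move=> Py; rewrite -sub0r phiB // phi0 sub0r.
have phiD y z : P y -> P z -> phi (y + z) = phi y + phi z.
  by move=> Py Pz; rewrite -[z in LHS]opprK phiB ?phiN ?opprK //; exact: PN.
have Pz y m : P y -> P (y *~ m) by move=> Py; exact: sub_closed_mulz.
have phiz y m : P y -> phi (y *~ m) = phi y *~ m.
  move=> Py; have phin j : phi (y *+ j) = phi y *+ j.
    elim: j => [|j IH]; first by rewrite !mulr0n.
    by rewrite !mulrS phiD ?IH // pmulrn; exact: Pz.
  case: m => j; first by rewrite -!pmulrn phin.
  by rewrite NegzE !mulrNz phiN ?pmulrn ?phin //; exact: Pz.
elim: r => [|i r [IH1 IH2]]; first by rewrite !big_nil.
have Pi : P (x i *~ n i) by apply: Pz; exact: Px.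
by rewrite !big_cons; split; [exact: PD | rewrite phiD // IH2 phiz].
Qed.

Section QuotientGroup.
Variables (V : zmodType) (I : zmodClosed V).

Definition qclass (v : V) : Quotient.quot I := (\pi_(Quotient.quot I) v)%qT.

Lemma qclassB : zmod_morphism qclass.
Proof. exact: pi_is_zmod_morphism. Qed.

HB.instance Definition _ :=
  GRing.isZmodMorphism.Build V (Quotient.quot I) qclass qclassB.

Lemma qclass_eq0 v : qclass v = 0 <-> v \in I.
Proof.
rewrite -[in X in X <-> _](raddf0 qclass) /qclass.
by split=> [/eqP|vI]; [|apply/eqP]; rewrite -Quotient.idealrBE subr0.
Qed.

Lemma qclass_surj (u : Quotient.quot I) : exists v, u = qclass v.
Proof. by exists (repr u); rewrite /qclass reprK. Qed.
End QuotientGroup.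

Section PresentedGroup.
Variables (V : zmodType) (S : set V).

Lemma zmod_classB : zmod_morphism (zmod_class S).
Proof. exact: qclassB. Qed.

HB.instance Definition _ := GRing.isZmodMorphism.Build V (zmod_presented S)
  (zmod_class S) zmod_classB.

Lemma zmod_class_eq0 v : zmod_class S v = 0 <-> v \in span_pred S.
Proof. exact: qclass_eq0. Qed.

Lemma zmod_class_surj (u : zmod_presented S) : exists v, u = zmod_class S v.
Proof. exact: qclass_surj. Qed.

Lemma zmod_presented_lift (U : zmodType) (phi : {additive V -> U}) :
  (forall s, S s -> phi s = 0) ->
  exists g : {additive zmod_presented S -> U},
    forall v, g (zmod_class S v) = phi v.
Proof.
move=> phiS.
pose g (u : zmod_presented S) := phi (repr u).
have gE v : g (zmod_class S v) = phi v.
  apply/eqP; rewrite -subr_eq0 -raddfB.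
  have : repr (zmod_class S v) - v \in span_pred S.
    by apply/zmod_class_eq0; rewrite raddfB /= {1}/zmod_class reprK subrr.
  move=> vS; apply/eqP; move: (_ - v) vS; apply: spanP => //.
    exact: raddf0.
  by move=> x y; rewrite raddfB => -> ->; rewrite subr0.
have gB : zmod_morphism g.
  move=> x y; have [v ->] := zmod_class_surj x; have [w ->] := zmod_class_surj y.
  by rewrite -raddfB !gE raddfB.
pose G := GRing.isZmodMorphism.Build _ _ g gB.
by exists (HB.pack_for {additive zmod_presented S -> U} g G).
Qed.
End PresentedGroup.

(** Zigzags in a double complex involve choices and do not define a map, but a
    relation which is total on both sides, compatible with differences and has
    trivial kernels is the graph of an isomorphism. *)
Lemma isomorphic_of_relation (U V : zmodType) (r : U -> V -> Prop) :
  (forall u, exists v, r u v) -> (forall v, exists u, r u v) ->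
  (forall u v u' v', r u v -> r u' v' -> r (u - u') (v - v')) ->
  (forall v, r 0 v -> v = 0) -> (forall u, r u 0 -> u = 0) ->
  isomorphic U V.
Proof.
move=> /boolp.choice[g gP] /choice[h hP] rB r0v ru0.
have uniq_v u v v' : r u v -> r u v' -> v = v'.
  move=> ruv ruv'; apply/eqP; rewrite -subr_eq0; apply/eqP/r0v.
  by rewrite -(subrr u); exact: rB.
have uniq_u u u' v : r u v -> r u' v -> u = u'.
  move=> ruv ruv'; apply/eqP; rewrite -subr_eq0; apply/eqP/ru0.
  by rewrite -(subrr v); exact: rB.
have gB : zmod_morphism g.
  by move=> x y; apply: (uniq_v (x - y)) => //; exact: rB.
pose G := GRing.isZmodMorphism.Build _ _ g gB.
exists (HB.pack_for {additive U -> V} g G); exists h => /= [u|v].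
  by apply: (uniq_u _ _ (g u)).
by apply: (uniq_v (h v)).
Qed.

(** The terms (j, k + 1) and (k, j), for j <= k, cancel: this is why the
    alternating sum of the faces of a presimplicial object is a differential. *)
Lemma altsum_cancel (V : zmodType) m (z : 'I_m.+1 -> 'I_m.+2 -> V) :
  (forall j k : 'I_m.+1, (j <= k)%N ->
     z j (fintype.lift ord0 k) = z k (widen_ord (leqnSn _) j)) ->
  \sum_(j < m.+1) (\sum_(k < m.+2) z j k *~ (-1) ^+ k) *~ (-1) ^+ j = 0.
Proof.
move=> zE.
pose g (j : 'I_m.+1) (k : 'I_m.+2) := z j k *~ ((-1) ^+ k * (-1) ^+ j).
transitivity (\sum_(j < m.+1) (\sum_(k < m.+2 | (k <= j)%N) g j k +
                               \sum_(k < m.+2 | ~~ (k <= j)%N) g j k)).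
  apply: eq_bigr => j _; rewrite mulrz_suml [LHS](bigID (fun k : 'I__ => k <= j)%N) /=.
  by congr (_ + _); apply: eq_bigr => k _; rewrite -mulrzA.
rewrite big_split /=.
rewrite (eq_bigr (fun j : 'I_m.+1 => \sum_(k < m.+1 | (k <= j)%N)
  g j (widen_ord (leqnSn _) k))); last first.
  move=> j _; rewrite big_mkcond big_ord_recr /= leqNgt ltn_ord addr0.
  by rewrite -big_mkcond.
rewrite [X in _ + X](eq_bigr (fun j : 'I_m.+1 => \sum_(k < m.+1 | (j <= k)%N)
  g j (fintype.lift ord0 k))); last first.
  move=> j _; rewrite big_mkcond big_ord_recl /= add0r.
  by rewrite -big_mkcond /=; apply: eq_bigl => k; rewrite /bump /= add1n ltnNge negbK.
rewrite [X in _ + X](exchange_big_dep xpredT) //= -big_split /=.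
apply: big1 => j _; rewrite -big_split /= big1 // => k kj.
rewrite /g zE // -mulrzDr /= /bump leq0n add1n exprS mulN1r mulNr.
by rewrite [X in X - _]mulrC subrr mulr0z.
Qed.

(** ** Free abelian groups *)

Section FreeLift.
Variables (K : choiceType) (V : zmodType) (h : K -> V).

Definition frlift (D : {freeg K}) : V := fglift (h : K -> zmodule V) D.

Lemma frlift_is_additive : zmod_morphism frlift.
Proof. by move=> x y; exact: (@lift_is_additive _ K (zmodule V) h x y). Qed.

HB.instance Definition _ :=
  GRing.isZmodMorphism.Build {freeg K} V frlift frlift_is_additive.

Lemma frliftU x : frlift << x >> = h x.
Proof. by rewrite /frlift liftU scale1r. Qed.
End FreeLift.

Lemma freeg_gen (K : choiceType) (P : set {freeg K}) :
  P 0 -> (forall x y, P x -> P y -> P (x - y)) -> (forall k, P << k >>) ->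
  forall D, P D.
Proof.
move=> P0 PB P1 D.
have PN x : P x -> P (- x) by move=> Px; rewrite -sub0r; exact: PB.
have PD x y : P x -> P y -> P (x + y).
  by move=> Px Py; rewrite -[y]opprK; apply: PB => //; exact: PN.
rewrite -(freeg_sumE D); elim/big_ind: _ => // k _.
rewrite -[coeff k D]intz -freegU_mulz; case: (coeff k D) => n.
  by rewrite -pmulrn; elim: n => // n IH; rewrite mulrS; exact: PD.
rewrite NegzE mulrNz; apply: PN; rewrite -pmulrn.
by elim: n.+1 => // m IH; rewrite mulrS; exact: PD.
Qed.

(** As the << c i >> are free generators, values w i which only depend on c i
    extend to a morphism, which maps the relation to 0. *)
Lemma freeg_relation (I : Type) (r : seq I) (K : choiceType) (V : zmodType)
    (c : I -> K) (w : I -> V) (n : I -> int) (P : pred I) :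
  (forall i j, P i -> P j -> c i = c j -> w i = w j) ->
  \sum_(i <- r | P i) (<< c i >> : {freeg K}) *~ n i = 0 ->
  \sum_(i <- r | P i) w i *~ n i = 0.
Proof.
move=> cw c0.
pose h (k : K) : V := if pselect (exists2 i, P i & c i = k) is left e
  then w (projT1 (cid2 e)) else 0.
have hE i : P i -> h (c i) = w i.
  move=> Pi; rewrite /h; case: pselect => [e|[]]; last by exists i.
  by case: (cid2 e) => j Pj cj /=; exact: cw.
have := congr1 (frlift h) c0; rewrite raddf0 raddf_sum => h0; rewrite -[RHS]h0.
apply: eq_bigr => i Pi.
by rewrite raddfMz /= frliftU hE.
Qed.

(** ** Double complexes *)

Section Zigzag.
Variables (W : nat -> nat -> zmodType) (A : forall p q, set (W p q)).
Variables (dv : forall p q, W p.+1 q -> W p q).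
Variables (dh : forall p q, W p q.+1 -> W p q).

(** The groups of the double complex are subsets of larger groups, on which the
    differentials are defined but need not be additive: chains are particular
    functions, with sums over finite fibres. *)
Record double_complex : Prop := {
  dc_0 : forall p q, @A p q 0;
  dc_B : forall p q x y, @A p q x -> @A p q y -> @A p q (x - y);
  dc_dv : forall p q x, @A p.+1 q x -> @A p q (dv x);
  dc_dh : forall p q x, @A p q.+1 x -> @A p q (dh x);
  dc_dvB : forall p q x y, @A p.+1 q x -> @A p.+1 q y ->
    dv (x - y) = dv x - dv y;
  dc_dhB : forall p q x y, @A p q.+1 x -> @A p q.+1 y ->
    dh (x - y) = dh x - dh y;
  dc_dvdv : forall p q x, @A p.+2 q x -> dv (dv x) = 0;
  dc_dhdh : forall p q x, @A p q.+2 x -> dh (dh x) = 0;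
  dc_dvdh : forall p q x, @A p.+1 q.+1 x -> dv (dh x) = dh (dv x) }.

(** The columns are treated by the same record, with the indices exchanged. *)
Record row_resolution (B : chain_complex) (e : forall p, W p 0 -> chain B p)
    : Prop := {
  rr_eB : forall p x y, @A p 0 x -> @A p 0 y -> e p (x - y) = e p x - e p y;
  rr_edv : forall p x, @A p.+1 0 x -> e p (dv x) = bd B p (e p.+1 x);
  rr_edh : forall p x, @A p 1 x -> e p (dh x) = 0;
  rr_surj : forall p b, exists2 x, @A p 0 x & e p x = b;
  rr_exact0 : forall p x, @A p 0 x -> e p x = 0 ->
    exists2 y, @A p 1 y & dh y = x;
  rr_exact : forall p q x, @A p q.+1 x -> dh x = 0 ->
    exists2 y, @A p q.+2 y & dh y = x }.

(** As the squares of the double complex commute, no sign is needed. *)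
Definition zigzag n (a : forall i j, W i j) :=
  (forall i j, (i + j = n)%N -> A (a i j)) /\
  forall i j, (i + j.+1 = n)%N -> dv (a i.+1 j) = dh (a i j.+1).
End Zigzag.

Section RowResolution.
Variables (W : nat -> nat -> zmodType) (A : forall p q, set (W p q)).
Variables (dv : forall p q, W p.+1 q -> W p q).
Variables (dh : forall p q, W p q.+1 -> W p q).
Hypothesis dcA : double_complex A dv dh.
Variables (B : chain_complex) (e : forall p, W p 0 -> chain B p).
Hypothesis resB : row_resolution A dv dh e.
Arguments e : clear implicits.

(** Zigzags are built by recursion on one index, simultaneously for all values
    of the other one, which avoids transporting chains along equalities of
    degrees. *)
Lemma chain_family (n : nat) (b : chain B n) :
  exists beta : forall i, chain B i, beta n = b.
Proof.
exists (fun i => if pselect (n = i) is left E then ecast i (chain B i) E b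
                 else 0).
by case: pselect => // E; rewrite (Prop_irrelevance E erefl).
Qed.

Let pick p q (P : set (W p q)) : W p q := xget 0 P.
Let pickP p q (P : set (W p q)) : (exists x, P x) -> P (pick P).
Proof. by case=> x Px; rewrite /pick; case: xgetP => [y -> //|/(_ x)]. Qed.

Let e0 p : e p 0 = 0.
Proof. by rewrite -(subrr 0) (rr_eB resB) ?subrr //; exact: dc_0 dcA _ _. Qed.

(** The entries are found one after the other from the end in degree (n, 0): by
    exactness of the rows, each image under dv is an image under dh. *)
Lemma lift_zigzag n (beta : forall i, chain B i) :
  (forall m, n = m.+1 -> bd B m (beta m.+1) = 0) ->
  exists2 a, zigzag A dv dh n a & e n (a n 0) = beta n.
Proof.
move=> beta0.
pose F := fix F j : forall i, W i j := match j with
  | 0 => fun i => pick [set x | A x /\ e i x = beta i]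
  | k.+1 => fun i => pick [set x | A x /\ dh x = dv (F k i.+1)] end.
have F0 i : A (F 0 i) /\ e i (F 0 i) = beta i.
  apply: (@pickP _ _ [set x | A x /\ e i x = beta i]).
  by have [x] := rr_surj resB (beta i); exists x.
have FS j i : (exists x, A x /\ dh x = dv (F j i.+1)) ->
    A (F j.+1 i) /\ dh (F j.+1 i) = dv (F j i.+1).
  exact: (@pickP _ _ [set x | A x /\ dh x = dv (F j i.+1)]).
have FP j : (forall i, (i + j = n)%N -> A (F j i)) /\ forall i,
    (i.+1 + j = n)%N -> exists x, A x /\ dh x = dv (F j i.+1).
  elim: j => [|j [AF dF]].
    split=> [i _|i ijn]; first by case: (F0 i).
    have [AFi eFi] := F0 i.+1.
    have [|y Ay yE] := rr_exact0 resB (dc_dv dcA AFi); last by exists y.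
    by rewrite (rr_edv resB AFi) eFi beta0 // -ijn addn0.
  split=> i ijn; first by case: (FS j i) => //; apply: dF; rewrite addSnnS.
  have [|AFi dFi] := FS j i.+1; first by apply: dF; rewrite addSnnS.
  have [|y Ay yE] := rr_exact resB (dc_dv dcA AFi); last by exists y.
  rewrite -(dc_dvdh dcA AFi) dFi (dc_dvdv dcA) //; apply: AF.
  by rewrite -ijn addSnnS.
exists (fun i j => F j i); last by case: (F0 n).
split=> i j ijn; first by case: (FP j) => AF _; exact: AF.
have [_ dF] := FP j.
by case: (FS j i) => [|_ ->] //; apply: dF; rewrite addSnnS.
Qed.

(** If one end of a zigzag maps to a boundary of B, climbing along the rows once
    more shows that the other end is dh y up to some dv x. *)
Lemma lift_zigzag0 n a (beta : forall i, chain B i) :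
  zigzag A dv dh n a -> e n (a n 0) = bd B n (beta n.+1) ->
  exists2 y, @A 0 n.+1 y & exists2 x, @A 1 n x & dh y = a 0 n - dv x.
Proof.
move=> [Aa da] ea.
pose F := fix F j : forall i, W i j := match j with
  | 0 => fun i => pick [set x | A x /\ e i x = beta i]
  | k.+1 => fun i => pick [set x | A x /\ dh x = a i k - dv (F k i.+1)] end.
have F0 i : A (F 0 i) /\ e i (F 0 i) = beta i.
  apply: (@pickP _ _ [set x | A x /\ e i x = beta i]).
  by have [x] := rr_surj resB (beta i); exists x.
have FS j i : (exists x, A x /\ dh x = a i j - dv (F j i.+1)) ->
    A (F j.+1 i) /\ dh (F j.+1 i) = a i j - dv (F j i.+1).
  exact: (@pickP _ _ [set x | A x /\ dh x = a i j - dv (F j i.+1)]).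
have FP j : (forall i, (i + j = n.+1)%N -> A (F j i)) /\ forall i,
    (i + j = n)%N -> exists x, A x /\ dh x = a i j - dv (F j i.+1).
  elim: j => [|j [AF dF]].
    split=> [i _|i ijn]; first by case: (F0 i).
    have [AFi eFi] := F0 i.+1; have Aai := Aa _ _ ijn.
    have [|y Ay yE] := rr_exact0 resB (dc_B dcA Aai (dc_dv dcA AFi)); last first.
      by exists y.
    rewrite (rr_eB resB) //; last exact: dc_dv dcA _ _ _ AFi.
    rewrite (rr_edv resB AFi) eFi; move: ijn; rewrite addn0 => ->.
    by rewrite ea subrr.
  split=> i ijn.
    by case: (FS j i) => //; apply: dF; move: ijn; rewrite addnS => -[].
  have ijn' : (i.+1 + j = n)%N by rewrite addSnnS.
  have [|AFi dFi] := FS j i.+1; first exact: dF.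
  have Aai := Aa _ _ ijn.
  have [|y Ay yE] := rr_exact resB (dc_B dcA Aai (dc_dv dcA AFi)); last first.
    by exists y.
  rewrite (dc_dhB dcA) //; last exact: dc_dv dcA _ _ _ AFi.
  rewrite -(dc_dvdh dcA AFi) dFi (dc_dvB dcA); last 2 first.
  - exact: Aa.
  - by apply: dc_dv dcA _ _ _ (AF _ _); rewrite -ijn' addSn.
  rewrite (dc_dvdv dcA) ?subr0; last by apply: AF; rewrite -ijn' addSn.
  by rewrite -da // subrr.
have [AF dF] := FP n.
have [|AFn dFn] := FS n 0; first exact: dF.
by exists (F n.+1 0) => //; exists (F n 1%N) => //; exact: AF.
Qed.
End RowResolution.

Section DoubleComplex.
Variables (W : nat -> nat -> zmodType) (A : forall p q, set (W p q)).
Variables (dv : forall p q, W p.+1 q -> W p q).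
Variables (dh : forall p q, W p q.+1 -> W p q).

Let W' p q := W q p.
Let A' p q : set (W' p q) := @A q p.
Let dv' p q : W' p.+1 q -> W' p q := @dh q p.
Let dh' p q : W' p q.+1 -> W' p q := @dv q p.

Lemma double_complex_tr : double_complex A dv dh -> double_complex A' dv' dh'.
Proof.
move=> [A0 AB Adv Adh dvB dhB dvdv dhdh dvdh].
split=> p q; [exact: A0 | exact: AB | exact: Adh | exact: Adv | exact: dhB |
  exact: dvB | exact: dhdh | exact: dvdv | ].
by move=> x Ax; rewrite /dh' /dv' dvdh.
Qed.

Lemma zigzag_tr n a :
  zigzag A dv dh n a -> zigzag A' dv' dh' n (fun i j => a j i).
Proof.
move=> [Aa da]; split=> i j ijn; first by apply: Aa; rewrite addnC.
by rewrite /dv' /dh' da // -ijn addnC addSnnS.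
Qed.

(** Two classes correspond when they are the images of the two ends of a zigzag:
    the rows lift the cycles of B to zigzags, and the columns lift those of C.
    *)
Theorem double_complex_homology (B C : chain_complex)
    (e : forall p, W p 0 -> chain B p) (f : forall q, W 0 q -> chain C q) n :
  double_complex A dv dh -> row_resolution A dv dh e ->
  row_resolution A' dv' dh' f ->
  isomorphic (homology C n) (homology B n).
Proof.
move=> dcA resB resC; have dcA' := double_complex_tr dcA.
pose r (u : homology C n) (v : homology B n) :=
  exists (c : cycle C n) (b : cycle B n) a,
    [/\ u = qclass _ c, v = qclass _ b, zigzag A dv dh n a,
        f n (a 0 n) = \val c & e n (a n 0) = \val b].
have zigB a a' : zigzag A dv dh n a -> zigzag A dv dh n a' ->
    zigzag A dv dh n (fun i j => a i j - a' i j).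
  move=> [Aa da] [Aa' da']; split=> i j ijn.
    by apply: (dc_B dcA); [exact: Aa | exact: Aa'].
  have ijn' : (i.+1 + j = n)%N by rewrite addSnnS.
  rewrite (dc_dvB dcA (Aa _ _ ijn') (Aa' _ _ ijn')) da // da' //.
  by rewrite (dc_dhB dcA (Aa _ _ ijn) (Aa' _ _ ijn)).
have Bcyc a (b : chain B n) : zigzag A dv dh n a -> e n (a n 0) = b ->
    b \in @cycle_pred B n.
  case: n a b => [|m] a b //= in r zigB *; move=> [Aa da] <-.
  rewrite unfold_in /=; apply/eqP; rewrite -(rr_edv resB) ?da ?addn1 //.
    by apply: (rr_edh resB); apply: Aa; rewrite addn1.
  by apply: Aa; rewrite addn0.
have Ccyc a (c : chain C n) : zigzag A dv dh n a -> f n (a 0 n) = c ->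
    c \in @cycle_pred C n.
  case: n a c => [|m] a c //= in r zigB Bcyc *; move=> [Aa da] <-.
  rewrite unfold_in /=; apply/eqP; rewrite -(rr_edv resC); last exact: Aa.
  by rewrite /dv' -da // (rr_edh resC) //; exact: Aa.
apply: (@isomorphic_of_relation _ _ r).
- move=> u; have [c uc] := qclass_surj u.
  have [beta betaE] := chain_family (\val c).
  have [|a za ea] := lift_zigzag dcA' resC (n := n) (beta := beta).
    move=> m nm; move: c betaE {uc}; rewrite nm => -[/= c cP] ->.
    by move: cP; rewrite unfold_in => /eqP.
  have za' : zigzag A dv dh n (fun i j => a j i).
    case: za => Aa da; split=> i j ijn; first by apply: Aa; rewrite addnC.
    by rewrite -[LHS]/(dh' _) -da // -ijn addnC addSnnS.
  have bP : e n (a 0 n) \in @cycle_pred B n by apply: (Bcyc _ _ za').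
  pose b : cycle B n := exist (fun b => b \in @cycle_pred B n) _ bP.
  exists (qclass _ b), c, b, (fun i j => a j i).
  by split=> //; rewrite ea betaE.
- move=> v; have [b vb] := qclass_surj v.
  have [beta betaE] := chain_family (\val b).
  have [|a za ea] := lift_zigzag dcA resB (n := n) (beta := beta).
    move=> m nm; move: b betaE {vb}; rewrite nm => -[/= b bP] ->.
    by move: bP; rewrite unfold_in => /eqP.
  have cP : f n (a 0 n) \in @cycle_pred C n by apply: (Ccyc _ _ za).
  pose c : cycle C n := exist (fun c => c \in @cycle_pred C n) _ cP.
  exists (qclass _ c), c, b, a.
  by split=> //; rewrite ea betaE.
- move=> u v u' v' [c [b [a [-> -> za fa ea]]]] [c' [b' [a' [-> -> za' fa' ea']]]].
  exists (c - c'), (b - b'), (fun i j => a i j - a' i j).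
  have [Aa _] := za; have [Aa' _] := za'.
  split; [by rewrite raddfB | by rewrite raddfB | exact: zigB | | ].
    by rewrite (rr_eB resC) ?fa ?fa' //; [exact: Aa | exact: Aa'].
  rewrite (rr_eB resB) ?ea ?ea' //; [apply: Aa | apply: Aa']; exact: addn0.
- move=> v [c [b [a [/esym/qclass_eq0 c0 -> za fa ea]]]].
  apply/qclass_eq0/asboolP; move/asboolP: c0 => [c' c'E].
  have [beta betaE] := chain_family c'.
  have [|y Ay [x Ax yE]] := lift_zigzag0 dcA' resC (beta := beta) (zigzag_tr za).
    by rewrite fa betaE c'E.
  exists (e n.+1 y); have [Aa _] := za.
  have {}yE : dv y = a n 0 - dh x := yE.
  rewrite -ea -(rr_edv resB) // yE (rr_eB resB) ?(rr_edh resB) ?subr0 //.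
    by apply: Aa; rewrite addn0.
  exact: dc_dh dcA _ _ _ Ax.
- move=> u [c [b [a [-> /esym/qclass_eq0 b0 za fa ea]]]].
  apply/qclass_eq0/asboolP; move/asboolP: b0 => [b' b'E].
  have [beta betaE] := chain_family b'.
  have [|y Ay [x Ax yE]] := lift_zigzag0 dcA resB (beta := beta) za.
    by rewrite ea betaE b'E.
  exists (f n.+1 y); have [Aa _] := za.
  have yE' : dv' y = a 0 n - dh' x := yE.
  rewrite -fa -(rr_edv resC) // [dv' _]yE' (rr_eB resC) ?(rr_edh resC) ?subr0 //.
    exact: Aa.
  exact: dc_dh dcA' _ _ _ Ax.
Qed.
End DoubleComplex.

(** * Compact open sets and local homeomorphisms *)

Definition cont_at (X Y : topologicalType) (g : X -> Y) x := g @ x --> g x.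

Definition cont_on (X Y : topologicalType) (U : set X) (g : X -> Y) :=
  forall x, U x -> cont_at g x.

Lemma cont_on_sub (X Y : topologicalType) (U V : set X) (g : X -> Y) :
  V `<=` U -> cont_on U g -> cont_on V g.
Proof. by move=> VU gU x /VU; exact: gU. Qed.

Lemma cont_at_comp (X Y W : topologicalType) (g : X -> Y) (h : Y -> W) x :
  cont_at g x -> cont_at h (g x) -> cont_at (h \o g) x.
Proof. exact: continuous_comp. Qed.

Lemma cont_at_pair (X Y W : topologicalType) (g : X -> Y) (h : X -> W) x :
  cont_at g x -> cont_at h x -> cont_at (fun t => (g t, h t)) x.
Proof. exact: cvg_pair. Qed.

Lemma cont_at_cst (X Y : topologicalType) (y : Y) (x : X) :
  cont_at (fun=> y) x.
Proof. by rewrite /cont_at; apply: cvg_cst. Qed.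

Lemma cont_at_near (X Y : topologicalType) (g h : X -> Y) x :
  (\forall t \near x, g t = h t) -> cont_at g x -> cont_at h x.
Proof.
move=> gh; rewrite /cont_at -(nbhs_singleton gh); apply: cvg_trans.
by apply: near_eq_cvg; apply: filterS gh => t ->.
Qed.

Lemma cont_at_within (X Y W : topologicalType) (D : set Y) (g : X -> Y)
    (h : Y -> W) x : {within D, continuous h} -> cont_at g x ->
  (\forall t \near x, D (g t)) -> cont_at (h \o g) x.
Proof.
move=> /subspace_continuousP hD gx Dg.
have Dgx := nbhs_singleton Dg; have {}hD := hD _ Dgx.
move=> O /hD hO; have := gx _ hO; apply: filterS2 Dg => t Dt.
by rewrite /= => /(_ Dt).
Qed.

Lemma cont_on_within (X Y : topologicalType) (U : set X) (g : X -> Y) :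
  cont_on U g -> {within U, continuous g}.
Proof.
move=> gU; apply/subspace_continuousP => x Ux.
by apply: cvg_trans (gU x Ux); apply: cvg_app; exact: cvg_within.
Qed.

Lemma cont_on_compact (X Y : topologicalType) (U : set X) (g : X -> Y) :
  cont_on U g -> compact U -> compact (g @` U).
Proof. by move=> /cont_on_within; exact: continuous_compact. Qed.

Lemma nearP_open (X : topologicalType) (P : set X) x :
  (\forall t \near x, P t) -> exists N, [/\ open N, N x & N `<=` P].
Proof.
by move=> Px; have : nbhs x P := Px; rewrite nbhsE => -[N [oN Nx] NP]; exists N.
Qed.

Lemma preimage_open (X Y : topologicalType) (g : X -> Y) (O : set Y) :
  continuous g -> open O -> open (g @^-1` O).
Proof. by move=> /continuousP; apply. Qed.

Definition compact_open (X : topologicalType) (U : set X) := compact U /\ open U.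

Definition co_basis (X : topologicalType) := forall (x : X) O, nbhs x O ->
  exists U, [/\ compact_open U, U x & U `<=` O].

Section CompactOpen.
Variable X : topologicalType.
Hypothesis hX : hausdorff_space X.
Implicit Types U V N : set X.

Lemma compact_open0 : compact_open (@set0 X).
Proof. by split; [exact: compact0 | exact: open0]. Qed.

Lemma compact_openU U V :
  compact_open U -> compact_open V -> compact_open (U `|` V).
Proof. by move=> [? ?] [? ?]; split; [exact: compactU | exact: openU]. Qed.

Lemma compact_openI U V :
  compact_open U -> compact_open V -> compact_open (U `&` V).
Proof.
move=> [kU oU] [kV oV]; split; last exact: openI.
by apply: compact_closedI => //; exact: compact_closed.
Qed.

Lemma compact_openD U V :
  compact_open U -> compact_open V -> compact_open (U `\` V).
Proof.
move=> [kU oU] [kV oV]; split; rewrite setDE.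
  by apply: compact_closedI => //; exact: open_closedC.
by apply: openI => //; apply: closed_openC; exact: compact_closed.
Qed.

(** A compact open set is a finite disjoint union of small ones, so that
    additive properties of these sets are local. This is the gluing principle of
    the whole proof. *)
Lemma compact_open_ind (bX : co_basis X) (P : set X -> Prop) U0 :
  compact_open U0 -> P set0 ->
  (forall U V, compact_open U -> compact_open V -> U `<=` U0 -> V `<=` U0 ->
     U `&` V = set0 -> P U -> P V -> P (U `|` V)) ->
  (forall x, U0 x -> exists2 N, nbhs x N &
     forall M, compact_open M -> M `<=` N -> M `<=` U0 -> P M) ->
  P U0.
Proof.
move=> cU0 P0 PU Ploc.
pose good D := compact_open D /\
  forall M, compact_open M -> M `<=` D -> M `<=` U0 -> P M.
have goodU D E : good D -> good E -> good (D `|` E).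
  move=> [cD DP] [cE EP]; split=> [|M cM MDE MU0]; first exact: compact_openU.
  rewrite -(setUIDK M D); apply: PU.
  - exact: compact_openI.
  - exact: compact_openD.
  - by move=> y [/MU0].
  - by move=> y [/MU0].
  - by apply/seteqP; split=> // y [[_ ?] [_]].
  - apply: DP; [exact: compact_openI | by move=> y [] | by move=> y [/MU0]].
  apply: EP; [exact: compact_openD | | by move=> y [/MU0]].
  by move=> y [/MDE[]].
have good0 : good set0.
  by split=> [|M _ M0 _]; [exact: compact_open0 | rewrite (_ : M = set0) // -subset0].
have FF : Filter (filter_from good (fun D => [set W | D `<=` W])).
  apply: filter_from_filter; first by exists set0.
  move=> D E gD gE; exists (D `|` E); first exact: goodU.
  by move=> W DEW; split=> y ?; apply: DEW; [left | right].
have [kU0 _] := cU0; move/compact_near_coveringP: kU0.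
move=> /(_ _ _ (fun W x => W x) FF) [x U0x|D [cD DP] /(_ D)].
  have [N Nx NP] := Ploc _ U0x; have [D [cD Dx DN]] := bX _ _ Nx.
  exists (D, [set W | D `<=` W]); last by move=> [y W] /= [Dy]; apply.
  split=> /=; first by apply: open_nbhs_nbhs; split=> //; case: cD.
  exists D => //; split=> // M cM MD; apply: NP => //; exact: subset_trans DN.
by move=> /(_ (@subset_refl _ _)) U0D; exact: DP.
Qed.

End CompactOpen.

(** ** Local homeomorphisms *)

(** Local homeomorphisms, without a choice of local inverses. *)
Record etale_map (X Y : topologicalType) (d : X -> Y) : Prop := {
  em_continuous : continuous d;
  em_open : forall O, open O -> open (d @` O);
  em_inj : forall x : X, exists N, [/\ open N, N x &
    forall s t, N s -> N t -> d s = d t -> s = t] }.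

Lemma etale_inj (X Y : topologicalType) (d : X -> Y) x : etale_map d ->
  exists N, [/\ open N, N x &
    forall s t, N s -> N t -> d s = d t -> s = t].
Proof. by move=> /em_inj. Qed.

Lemma etale_map_comp (X Y W : topologicalType) (d : X -> Y) (e : Y -> W) :
  etale_map d -> etale_map e -> etale_map (e \o d).
Proof.
move=> ed ee; split.
- by move=> x; apply: continuous_comp; [exact: em_continuous | exact: em_continuous].
- by move=> O oO; rewrite -image_comp; do 2! apply: em_open => //.
- move=> x; have [N [oN Nx dN]] := etale_inj x ed.
  have [M [oM Mx eM]] := etale_inj (d x) ee.
  exists (N `&` d @^-1` M); split=> [||s t [Ns Ms] [Nt Mt] /= /eM st] //.
    by apply: openI => //; apply: preimage_open => //; exact: em_continuous.
  by apply: dN => //; exact: st.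
Qed.

(** Locally, d is v followed by the inverse of w. *)
Lemma etale_map_cancel (X Y W : topologicalType) (d : X -> Y) (v : X -> W)
    (w : Y -> W) :
  continuous d -> etale_map v -> etale_map w -> (forall x, w (d x) = v x) ->
  etale_map d.
Proof.
move=> cd ev ew wd; split=> // [O oO|x]; last first.
  have [N [oN Nx vN]] := em_inj ev x; exists N; split=> // s t sN tN dst.
  by apply: vN => //; rewrite -!wd dst.
rewrite openE => _ [t Ot <-].
have [N [oN Ndt wN]] := etale_inj (d t) ew.
have : open (v @` (O `&` d @^-1` N)).
  apply: em_open => //; apply: openI => //.
  exact: preimage_open.
move=> oV; have : nbhs (w (d t)) (v @` (O `&` d @^-1` N)).
  by apply: open_nbhs_nbhs; split=> //; rewrite wd; exists t.
move=> Vwdt; have Vdt : nbhs (d t) (w @^-1` (v @` (O `&` d @^-1` N))).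
  exact: em_continuous ew _ _ Vwdt.
have Ndt' : nbhs (d t) N by exact: open_nbhs_nbhs.
apply: filterS2 Vdt Ndt' => s /= [t' [Ot' Nt'] vt'] Ns.
by exists t' => //; apply: wN => //; rewrite wd.
Qed.

Lemma etale_section (X Y : topologicalType) (d : X -> Y) (N : set X) t0 :
  etale_map d -> open N -> N t0 ->
  (forall s t, N s -> N t -> d s = d t -> s = t) ->
  exists s : Y -> X, (forall t, N t -> s (d t) = t) /\ cont_on (d @` N) s.
Proof.
move=> ed oN Nt0 dN.
exists (fun y => xget t0 [set t | N t /\ d t = y]).
have sd t : N t -> xget t0 [set t' | N t' /\ d t' = d t] = t.
  move=> Nt; case: xgetP => [t' _ [Nt' dt'] | /(_ t)]; first exact: dN.
  by case.
split=> // _ [t Nt <-] O; rewrite sd // => /nearP_open[M [oM Mt MO]].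
have oNM : open (d @` (N `&` M)) by apply: em_open => //; exact: openI.
have : nbhs (d t) (d @` (N `&` M)).
  by apply: open_nbhs_nbhs; split=> //; exists t.
by apply: filterS => _ [t' [Nt' /MO Ot'] <-]; rewrite /= sd.
Qed.

Lemma etale_image_compact_open (X Y : topologicalType) (d : X -> Y) U :
  etale_map d -> compact_open U -> compact_open (d @` U).
Proof.
move=> ed [kU oU]; split; last exact: em_open.
by apply: cont_on_compact kU => x _; exact: em_continuous.
Qed.

Lemma etale_preimage_compact_open (X Y : topologicalType) (d : X -> Y)
    (N : set X) U :
  etale_map d -> open N -> (forall s t, N s -> N t -> d s = d t -> s = t) ->
  compact_open U -> U `<=` d @` N -> compact_open (N `&` d @^-1` U).
Proof.
move=> ed oN dN [kU oU] UN.
have oNU : open (N `&` d @^-1` U).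
  by apply: openI => //; apply: preimage_open => //; exact: em_continuous.
split=> //; have [[y Uy]|U0] := pselect (exists y, U y); last first.
  rewrite (_ : _ `&` _ = set0); first exact: compact0.
  by apply/seteqP; split=> // t [_ Ut]; apply: U0; exists (d t).
have [t Nt _] : (d @` N) y by exact: UN.
have [s [sd cs]] := etale_section ed oN Nt dN.
rewrite (_ : _ `&` _ = s @` U).
  by apply: cont_on_compact kU; apply: cont_on_sub cs.
apply/seteqP; split=> [t' [Nt' Ut']|_ [x Ux <-]].
  by exists (d t') => //; rewrite sd.
by have [t' Nt' dt'] : (d @` N) x by [exact: UN]; rewrite -dt' sd //; split=> //=; rewrite dt'.
Qed.

Lemma etale_co_basis (X Y : topologicalType) (d : X -> Y) :
  etale_map d -> co_basis Y -> co_basis X.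
Proof.
move=> ed bY x O /nearP_open[M [oM Mx MO]].
have [N [oN Nx dN]] := etale_inj x ed.
have : nbhs (d x) (d @` (N `&` M)).
  apply: open_nbhs_nbhs; split; last by exists x.
  by apply: em_open => //; exact: openI.
move=> /bY[U [cU Ux UNM]].
exists ((N `&` M) `&` d @^-1` U); split=> [||t [[_ /MO]]] //.
apply: etale_preimage_compact_open => //; first exact: openI.
by move=> s t [Ns _] [Nt _]; exact: dN.
Qed.

Lemma etale_fiber_finite (X Y : topologicalType) (d : X -> Y) U y :
  hausdorff_space X -> co_basis X -> etale_map d -> compact_open U ->
  finite_set (U `&` d @^-1` [set y]).
Proof.
move=> hX bX ed cU.
pose P V := finite_set (V `&` d @^-1` [set y]).
apply: (compact_open_ind hX bX (P := P)) cU _ _ _ => //.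
- by rewrite /P set0I.
- by move=> V V' *; rewrite /P setIUl finite_setU.
move=> x _; have [N [oN Nx dN]] := etale_inj x ed.
exists N; first exact: open_nbhs_nbhs.
move=> M _ MN _; rewrite /P.
have [[t [Mt dt]]|M0] := pselect (exists t, M t /\ d t = y).
  apply: (@sub_finite_set _ _ [set t]); last exact: finite_set1.
  by move=> s [Ms /= ds]; apply: dN; [exact: MN | exact: MN | rewrite ds].
apply: (@sub_finite_set _ _ set0); last exact: finite_set0.
by move=> s [Ms /= ds]; apply: M0; exists s.
Qed.

(** ** Sums over fibres *)

Section FibreSum.
Variables (X Y : choiceType) (V : zmodType) (d : X -> Y).
Implicit Types (F G : X -> V).

Definition fibre_sum F (y : Y) : V := \sum_(x \in d @^-1` [set y]) F x.

Definition fibre_finite F := forall y, finite_set [set x | d x = y /\ F x != 0].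

Lemma fibre_sumE F y (r : seq X) : uniq r ->
  (forall x, d x = y -> F x != 0 -> x \in r) ->
  fibre_sum F y = \sum_(x <- r | d x == y) F x.
Proof.
move=> ur rF; rewrite /fibre_sum (fsbigE [seq x <- r | d x == y]).
- rewrite big_filter_cond; apply: eq_bigl => x.
  by case: eqP => //= dx; rewrite mem_set.
- exact: filter_uniq.
- by move=> x /=; rewrite mem_filter => /andP[/eqP].
move=> x /= dx; rewrite mem_filter dx eqxx /= => xr.
by apply/eqP; apply: contraNT xr; exact: rF.
Qed.

Lemma fibre_sum_supp F y : finite_set [set x | d x = y /\ F x != 0] ->
  exists2 r : seq X, uniq r & forall x, d x = y -> F x != 0 -> x \in r.
Proof.
move=> /finite_seqP[r rE]; exists (undup r) => [|x dx Fx]; first exact: undup_uniq.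
by rewrite mem_undup; have : [set x | d x = y /\ F x != 0] x by []; rewrite rE.
Qed.

Lemma fibre_sumB F G : fibre_finite F -> fibre_finite G ->
  fibre_sum (F - G) = fibre_sum F - fibre_sum G.
Proof.
move=> fF fG; apply/funext => y.
have [r ur rF] := fibre_sum_supp (fF y); have [s us sG] := fibre_sum_supp (fG y).
rewrite !fctE !(@fibre_sumE _ y (undup (r ++ s))) ?undup_uniq //.
- by rewrite -sumrB.
- by move=> x dx Gx; rewrite mem_undup mem_cat (sG x) ?orbT.
- by move=> x dx Fx; rewrite mem_undup mem_cat (rF x).
move=> x dx; rewrite mem_undup mem_cat; apply: contraNT.
rewrite negb_or => /andP[xr xs].
have /eqP -> : F x == 0 by apply: contraNT xr; exact: rF.
have /eqP -> : G x == 0 by apply: contraNT xs; exact: sG.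
by rewrite subrr.
Qed.

Lemma fibre_sum0 : fibre_sum 0 = 0.
Proof. by apply/funext => y; apply: fsbig1. Qed.

Lemma raddf_fibre_sum (U : zmodType) (h : {additive V -> U}) F y :
  fibre_finite F -> h (fibre_sum F y) = \sum_(x \in d @^-1` [set y]) h (F x).
Proof.
move=> fF; have [r ur rF] := fibre_sum_supp (fF y).
rewrite (fibre_sumE ur rF) raddf_sum (fsbigE [seq x <- r | d x == y]).
- rewrite [RHS]big_filter_cond; apply: eq_bigl => x.
  by case: eqP => //= dx; rewrite mem_set.
- exact: filter_uniq.
- by move=> x /=; rewrite mem_filter => /andP[/eqP].
move=> x /= dx; rewrite mem_filter dx eqxx /= => xr.
have /eqP -> : F x == 0 by apply: contraNT xr; exact: rF.
exact: raddf0.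
Qed.
End FibreSum.

Lemma fibre_sum_comp (X Y W : choiceType) (V : zmodType) (d : X -> Y)
    (e : Y -> W) (F : X -> V) w :
  finite_set [set x | e (d x) = w /\ F x != 0] ->
  fibre_sum e (fibre_sum d F) w = fibre_sum (e \o d) F w.
Proof.
move=> /fibre_sum_supp[r ur rF]; rewrite (@fibre_sumE _ _ _ (e \o d) F w r) //.
have dFE y : e y = w -> fibre_sum d F y = \sum_(x <- r | d x == y) F x.
  by move=> ey; apply: fibre_sumE => // x dx; apply: rF; rewrite dx.
rewrite (@fibre_sumE _ _ _ e _ w (undup [seq d x | x <- r])) ?undup_uniq //.
  rewrite (eq_bigr (fun y => \sum_(x <- r | d x == y) F x)); last first.
    by move=> y /eqP /dFE.
  rewrite (exchange_big_dep (fun x => e (d x) == w)) /=; last first.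
    by move=> y x ey /eqP ->.
  rewrite big_seq_cond [RHS]big_seq_cond; apply: eq_bigr => x /andP[xr ex].
  rewrite (big_rem (d x)) ?mem_undup ?map_f //= eqxx ex /= big_seq_cond big1.
    by rewrite addr0.
  move=> y /and3P[]; rewrite mem_rem_uniq ?undup_uniq // inE => /andP[+ _] _.
  by rewrite eq_sym => /negbTE ->.
move=> y ey; rewrite dFE //; apply: contraNT => yr; apply/eqP.
rewrite big_seq_cond big1 // => x /andP[xr /eqP dx]; move: yr.
by rewrite mem_undup -dx map_f.
Qed.

Lemma indlim_openE (T : topologicalType) (A : set T) (E : nat -> set T)
    (U : set (inductive_limit A E)) : open U = indlim_open U.
Proof. reflexivity. Qed.

Lemma orbit_openE (T : topologicalType) (orb : T -> set T)
    (U : set (orbit_space orb)) : open U = open (to_orbit orb @^-1` U).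
Proof. reflexivity. Qed.

(** * Smale spaces *)

(** The argument of the Lebesgue number. *)
Lemma compact_uniform (R : realType) (X : metricType R) (K : set X)
    (P : R -> X -> Prop) :
  compact K -> (forall e e' x, e' <= e -> P e x -> P e' x) ->
  (forall x, K x -> exists2 e, 0 < e & forall y, K y -> mdist x y < e -> P e y) ->
  exists2 e, 0 < e & forall x, K x -> P e x.
Proof.
move=> /compact_near_coveringP kK Pe Ploc.
have FF : ProperFilter (filter_from [set e : R | 0 < e] (fun e => [set e' | 0 < e' <= e])).
  apply: filter_from_proper; last by move=> e /= e0; exists e => /=; rewrite e0 lexx.
  apply: filter_from_filter; first by exists 1 => /=.
  move=> e e' /= e0 e'0; exists (Num.min e e'); first by rewrite /= lt_min e0.
  by move=> t /= /andP[t0]; rewrite le_min t0 => /andP[-> ->].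
have [x Kx|] := kK _ _ (fun e x => K x -> P e x) FF.
  have [e e0 eP] := Ploc _ Kx.
  exists ([set y | mdist x y < e], [set e' | 0 < e' <= e]); first split.
  - by rewrite -metricType_numDomainType.nbhs_nbhs_mdist; exists e.
  - by exists e.
  by move=> [y e'] /= [xy /andP[_ e'e]] Ky; apply: Pe e'e _; exact: eP.
move=> e e0 /(_ e) eP; exists e => // x Kx.
by apply: eP => //=; rewrite e0 lexx.
Qed.

Lemma nbhs_mdist (R : realType) (X : metricType R) (x : X) (O : set X) :
  nbhs x O -> exists2 e, 0 < e & forall y, mdist x y < e -> O y.
Proof. by rewrite -metricType_numDomainType.nbhs_nbhs_mdist => -[e /= e0 eO]; exists e. Qed.

Lemma mdist_nbhs (R : realType) (X : metricType R) (x : X) e (O : set X) :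
  0 < e -> (forall y, mdist x y < e -> O y) -> nbhs x O.
Proof. by move=> e0 eO; rewrite -metricType_numDomainType.nbhs_nbhs_mdist; exists e. Qed.

Lemma uniform_continuity (R : realType) (X Y : metricType R) (g : X -> Y) e :
  compact [set: X] -> continuous g -> 0 < e ->
  exists2 d, 0 < d & forall x y, mdist x y < d -> mdist (g x) (g y) < e.
Proof.
move=> kX cg e0.
have [|x _|d d0 dP] := @compact_uniform R X setT
    (fun d x => forall y, mdist x y < d -> mdist (g x) (g y) < e) kX.
- by move=> d d' x d'd dP y xy; apply: dP; exact: lt_le_trans d'd.
- have e20 : 0 < e / 2 by rewrite divr_gt0.
  have /cg /nbhs_mdist[d d0 dP] : nbhs (g x) [set y | mdist (g x) y < e / 2].
    exact: mdist_nbhs e20 _.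
  exists (d / 2) => [|y _ xy z yz]; first by rewrite divr_gt0.
  rewrite (splitr e); apply: le_lt_trans (metric_triangle _ (g x) _) _.
  rewrite ltrD //; first rewrite metric_sym; apply: dP.
    by apply: lt_trans xy _; rewrite ltr_pdivrMr // ltr_pMr // ltr1n.
  apply: le_lt_trans (metric_triangle _ y _) _.
  by rewrite (splitr d) ltrD.
by exists d => // x y; exact: dP.
Qed.

Section SmaleAxioms.
Variables (R : realType) (X : system R).

(** The local axioms, in a form which is stable under time reversal (see
    [reverse_axioms]): each statement on stable sets has an unstable
    counterpart. *)
Record smale_axioms : Prop := {
  sa_compact : compact [set: X];
  sa_dyn : continuous (@dyn R X);
  sa_dynV : continuous (@dynV R X);
  sa_radius : 0 < radius X;
  sa_brdom : forall x y : X, brdom x y <-> mdist x y <= radius X;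
  sa_br_continuous : {within [set p : X * X | brdom p.1 p.2],
    continuous (fun p => br p.1 p.2)};
  sa_brxx : forall x : X, br x x = x;
  sa_brr : forall x y z : X, brdom y z -> brdom x (br y z) -> brdom x z ->
    br x (br y z) = br x z;
  sa_brl : forall x y z : X, brdom x y -> brdom (br x y) z -> brdom x z ->
    br (br x y) z = br x z;
  sa_dyn_br : forall x y : X, brdom x y -> brdom (dyn x) (dyn y) ->
    dyn (br x y) = br (dyn x) (dyn y);
  sa_contract : exists lam : R, [/\ 0 < lam, lam < 1,
    forall x y : X, brdom x y -> br x y = y ->
      mdist (dyn x) (dyn y) <= lam * mdist x y &
    forall x y : X, brdom x y -> br x y = x ->
      mdist (dynV x) (dynV y) <= lam * mdist x y] }.

Lemma smale_space_axioms : smale_space X -> smale_axioms.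
Proof. by case. Qed.

(** Time reversal exchanges the stable and the unstable directions. *)
Definition reverse : system R :=
  @System R X dynV dyn (@dynVK R X) (@dynK R X) (radius X)
    (fun x y => brdom y x) (fun x y => br y x).

(** The local stable and the local unstable relations. *)
Definition lst (x y : X) := mdist x y <= radius X /\ br x y = y.
Definition lun (x y : X) := mdist x y <= radius X /\ br x y = x.
End SmaleAxioms.

Lemma reverse_axioms (R : realType) (X : system R) :
  smale_axioms X -> smale_axioms (reverse X).
Proof.
move=> [kX cd cdV r0 bd cb bxx brr brl db [lam [l0 l1 con conV]]].
split=> //=.
- by move=> x y; rewrite bd metric_sym.
- move: cb => /subspace_continuousP cb; apply/subspace_continuousP => -[x y] /= xy.
  have := cb (y, x) xy; rewrite /= => cyx O /cyx; rewrite /within /= => hO.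
  have sw : (fun p : X * X => (p.2, p.1)) @ (x, y) --> (y, x).
    by apply: cvg_pair; [exact: cvg_snd | exact: cvg_fst].
  exact: sw _ hO.
- by move=> x y z ? ? ?; rewrite brl.
- by move=> x y z ? ? ?; rewrite brr.
- by move=> x y xy dxy; apply: (can_inj (@dynK R X)); rewrite dynVK db ?dynVK.
exists lam; split=> // x y yx b; rewrite metric_sym [mdist x y]metric_sym.
  exact: conV.
exact: con.
Qed.

Section SmaleSpace.
Variables (R : realType) (X : system R).
Hypothesis sX : smale_axioms X.
Implicit Types x y z w : X.

Local Notation r := (radius X).

Lemma iter_dynK n : cancel (iter n (@dyn R X)) (iter n (@dynV R X)).
Proof. by elim: n => [|n IH] x //; rewrite iterSr iterS dynK IH. Qed.

Lemma iter_dynVK n : cancel (iter n (@dynV R X)) (iter n (@dyn R X)).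
Proof. by elim: n => [|n IH] x //; rewrite iterSr iterS dynVK IH. Qed.

Lemma iter_continuous (g : X -> X) n : continuous g -> continuous (iter n g).
Proof.
move=> cg; elim: n => [|n IH] x; first exact: cvg_id.
by apply: (@continuous_comp _ _ _ (iter n g) g); [exact: IH | exact: cg].
Qed.

Lemma lst_refl x : lst x x.
Proof. by split; [rewrite mdistxx ltW // (sa_radius sX) | exact: sa_brxx]. Qed.

Lemma lst_sym x y : lst x y -> lst y x.
Proof.
move=> [xy bxy]; split; first by rewrite metric_sym.
rewrite -[in LHS]bxy (sa_brl sX) ?bxy ?(sa_brxx sX) //; apply/(sa_brdom sX) => //.
- by rewrite metric_sym.
- by rewrite mdistxx ltW // (sa_radius sX).
Qed.

Lemma lst_trans y x z : lst x y -> lst y z -> mdist x z <= r -> lst x z.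
Proof.
move=> [xy bxy] [yz byz] xz; split=> //; rewrite -[RHS]byz -[in RHS]bxy.
by rewrite (sa_brl sX) ?bxy //; exact/(sa_brdom sX).
Qed.

Lemma lun_sym x y : lun x y -> lun y x.
Proof.
move=> [xy bxy]; split; first by rewrite metric_sym.
rewrite -[in LHS]bxy (sa_brr sX) ?bxy ?(sa_brxx sX) //; apply/(sa_brdom sX) => //.
- by rewrite metric_sym.
- by rewrite mdistxx ltW // (sa_radius sX).
Qed.

Lemma lun_trans y x z : lun x y -> lun y z -> mdist x z <= r -> lun x z.
Proof.
move=> [xy bxy] [yz byz] xz; split=> //; rewrite -[RHS]bxy -[in RHS]byz.
by rewrite (sa_brr sX) ?byz //; exact/(sa_brdom sX).
Qed.

Lemma lst_lun_eq x y : lst x y -> lun x y -> x = y.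
Proof. by move=> [_ e1] [_ e2]; rewrite -[LHS]e2 e1. Qed.

Lemma br_lun w x y : lun x y -> mdist w x <= r -> mdist w y <= r ->
  br w x = br w y.
Proof.
by move=> [xy bxy] wx wy; rewrite -[in LHS]bxy (sa_brr sX) ?bxy //; exact/(sa_brdom sX).
Qed.

Lemma lst_br x y : mdist x y <= r -> mdist x (br x y) <= r -> lst x (br x y).
Proof. by move=> xy xw; split=> //; rewrite (sa_brr sX) //; exact/(sa_brdom sX). Qed.

Lemma lun_br x y : mdist x y <= r -> mdist (br x y) y <= r -> lun (br x y) y.
Proof. by move=> xy xw; split=> //; rewrite (sa_brl sX) //; exact/(sa_brdom sX). Qed.

Lemma lst_dyn x y : lst x y -> lst (dyn x) (dyn y).
Proof.
move=> [xy bxy]; have [lam [l0 l1 con _]] := sa_contract sX.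
have dxy : mdist (dyn x) (dyn y) <= r.
  apply: le_trans (con _ _ ((sa_brdom sX _ _).2 xy) bxy) _.
  by apply: le_trans xy; rewrite ler_piMl ?mdist_ge0 // ltW.
by split=> //; rewrite -(sa_dyn_br sX) ?bxy //; exact/(sa_brdom sX).
Qed.

Lemma lun_dyn x y : lun x y -> mdist (dyn x) (dyn y) <= r ->
  lun (dyn x) (dyn y).
Proof.
move=> [xy bxy] dxy.
by split=> //; rewrite -(sa_dyn_br sX) ?bxy //; exact/(sa_brdom sX).
Qed.

Lemma lst_dynV x y : lst x y -> mdist (dynV x) (dynV y) <= r ->
  lst (dynV x) (dynV y).
Proof.
move=> [xy bxy] dxy; split=> //; apply: (can_inj (@dynK R X)).
by rewrite (sa_dyn_br sX) ?dynVK //; exact/(sa_brdom sX).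
Qed.

Lemma lst_iter n x y : lst x y -> lst (iter n dyn x) (iter n dyn y).
Proof. by move=> xy; elim: n => //= n; exact: lst_dyn. Qed.

Lemma lst_iter_dist : exists lam : R, [/\ 0 < lam, lam < 1 &
  forall n x y, lst x y ->
    mdist (iter n dyn x) (iter n dyn y) <= lam ^+ n * mdist x y].
Proof.
have [lam [l0 l1 con _]] := sa_contract sX; exists lam; split=> // n x y xy.
elim: n => [|n IH] /=; first by rewrite expr0 mul1r.
have [nxy bnxy] := lst_iter n xy.
apply: le_trans (con _ _ ((sa_brdom sX _ _).2 nxy) bnxy) _.
by rewrite exprS -mulrA ler_wpM2l // ltW.
Qed.

Lemma lst_iter_le n x y : lst x y ->
  mdist (iter n dyn x) (iter n dyn y) <= mdist x y.
Proof.
move=> xy; have [lam [l0 l1 H]] := lst_iter_dist; apply: le_trans (H n _ _ xy) _.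
by rewrite ler_piMl ?mdist_ge0 // exprn_ile1 // ltW.
Qed.

Lemma geometric_small (lam c e : R) : 0 < lam -> lam < 1 -> 0 < e ->
  exists N, forall n, (N <= n)%N -> lam ^+ n * c < e.
Proof.
move=> l0 l1 e0.
have : (fun n => lam ^+ n * c) @ \oo --> (0 * c : R).
  by apply: cvgMl; apply: cvg_expr; rewrite ger0_norm // ltW.
rewrite mul0r => /cvgrPdist_lt /(_ _ e0)[N _ NP]; exists N => n /NP /=.
by rewrite sub0r normrN; exact: le_lt_trans (ler_norm _).
Qed.

Lemma lst_stably x y : lst x y -> stably_equivalent x y.
Proof.
move=> xy; have [lam [l0 l1 H]] := lst_iter_dist.
apply/cvgrPdist_lt => e e0; have [N NP] := geometric_small (mdist x y) l0 l1 e0.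
exists N => // n /NP; rewrite sub0r normrN ger0_norm ?mdist_ge0 //.
exact: le_lt_trans (H n _ _ xy).
Qed.

Lemma br_cont x y : mdist x y < r -> cont_at (fun p : X * X => br p.1 p.2) (x, y).
Proof.
move=> xy; apply: (cont_at_within (g := id)) (sa_br_continuous sX) _ _.
  exact: cvg_id.
have e0 : 0 < (r - mdist x y) / 2 by rewrite divr_gt0 // subr_gt0.
exists ([set x' | mdist x x' < (r - mdist x y) / 2],
        [set y' | mdist y y' < (r - mdist x y) / 2]).
  by split; exact: mdist_nbhs e0 _.
move=> [x' y'] /= [xx' yy']; apply/(sa_brdom sX).
apply: le_trans (metric_triangle _ x _) _.
apply: le_trans (lerD (lexx _) (metric_triangle _ y _)) _.
rewrite metric_sym addrCA -lerBrDl.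
by rewrite (splitr (r - _)) ltW // ltrD.
Qed.

(** The bracket is continuous and [x, x] = x, so that the bracket of close
    points is close to them, uniformly by compactness. *)
Lemma br_uniform e : 0 < e -> exists2 d, 0 < d & forall x y, mdist x y < d ->
  [/\ mdist x y <= r, mdist x (br x y) < e & mdist y (br x y) < e].
Proof.
move=> e0.
have [|x _|d d0 dP] := @compact_uniform R X setT (fun d x => forall y,
    mdist x y < d -> [/\ mdist x y <= r, mdist x (br x y) < e &
    mdist y (br x y) < e]) (sa_compact sX).
- by move=> d d' x d'd dP y xy; apply: dP; exact: lt_le_trans d'd.
- have e20 : 0 < e / 2 by rewrite divr_gt0.
  have r0 := sa_radius sX.
  have := @br_cont x x; rewrite mdistxx => /(_ r0) cb.
  have /cb [[U V] /= [/nbhs_mdist[d1 d10 d1P] /nbhs_mdist[d2 d20 d2P]] UV] :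
    nbhs (br x x) [set y | mdist (br x x) y < e / 2] by exact: mdist_nbhs e20 _.
  pose d := Num.min (Num.min d1 (d2 / 2)) (Num.min r (e / 2 / 2)).
  have d0 : 0 < d by rewrite !lt_min d10 r0 !divr_gt0.
  have dle : [/\ d <= d1, d <= d2 / 2, d <= r & d <= e / 2 / 2].
    by rewrite /d !ge_min !lexx ?orbT.
  have [dd1 dd2 dr de] := dle.
  exists d => // y _ xy z yz.
  have xz : mdist x z < d2.
    apply: le_lt_trans (metric_triangle _ y _) _.
    by rewrite (splitr d2) ltrD //; apply: lt_le_trans dd2.
  have xz' : mdist x z < e / 2.
    apply: le_lt_trans (metric_triangle _ y _) _.
    by rewrite (splitr (e / 2)) ltrD //; apply: lt_le_trans de.
  have : mdist (br x x) (br y z) < e / 2.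
    apply: (UV (y, z)); split; [apply: d1P; exact: lt_le_trans dd1 | exact: d2P].
  rewrite (sa_brxx sX) => xw.
  split; first by rewrite ltW // (lt_le_trans yz).
    apply: le_lt_trans (metric_triangle _ x _) _; rewrite (splitr e) ltrD //.
    rewrite metric_sym (lt_trans (lt_le_trans xy de)) //.
    by rewrite ltr_pdivrMr // ltr_pMr // ltr1n.
  apply: le_lt_trans (metric_triangle _ x _) _; rewrite (splitr e) ltrD //.
  by rewrite metric_sym.
by exists d => // x y; exact: dP.
Qed.

(** Otherwise the unstable distance from y to the bracket of x and y, which is
    expanded by the dynamics, would become large. *)
Lemma shadow_lst : exists2 e, 0 < e & forall x y,
  (forall n, mdist (iter n dyn x) (iter n dyn y) < e) -> lst x y.
Proof.
have r0 := sa_radius sX; have r20 : 0 < r / 2 by rewrite divr_gt0.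
have [d d0 dP] := br_uniform r20.
have [lam [l0 l1 _ con]] := sa_contract sX.
exists (Num.min d (r / 2)); first by rewrite lt_min d0.
move=> x y xy; have := xy 0; rewrite /= lt_min => /andP[/dP[xyr xw yw] _].
set w := br x y in xw yw.
have r2r : r / 2 <= r by rewrite ler_pdivrMr // ler_pMr // ler1n.
have xw' : lst x w by apply: lst_br => //; rewrite ltW // (lt_le_trans xw).
have wy : lun w y by apply: lun_br => //; rewrite metric_sym ltW // (lt_le_trans yw).
have wyn n : mdist (iter n dyn w) (iter n dyn y) <= r.
  apply: le_trans (metric_triangle _ (iter n dyn x) _) _.
  rewrite (splitr r) lerD //.
    by rewrite metric_sym (le_trans (lst_iter_le n xw')) // ltW.
  by have := xy n; rewrite lt_min => /andP[_ /ltW].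
have lwyn n : lun (iter n dyn w) (iter n dyn y).
  by elim: n => //= n IH; apply: lun_dyn => //; exact: (wyn n.+1).
have wyl n : mdist w y <= lam ^+ n * mdist (iter n dyn w) (iter n dyn y).
  elim: n => [|n IH]; first by rewrite expr0 mul1r.
  apply: le_trans IH _; rewrite exprSr -mulrA ler_wpM2l ?exprn_ge0 ?(ltW l0) //.
  have [w1 b1] := lwyn n.+1.
  have := con _ _ ((sa_brdom sX _ _).2 w1) b1.
  by rewrite /= !dynK.
suff -> : y = w by [].
apply/esym/mdist_positivity/eqP; rewrite eq_le mdist_ge0 andbT.
apply/ler_addgt0Pl => e e0; rewrite addr0.
have [N /(_ N (leqnn _)) NP] := geometric_small r l0 l1 e0.
apply: le_trans (wyl N) _; apply: le_trans (ltW NP).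
by rewrite ler_wpM2l ?exprn_ge0 // ltW.
Qed.

Lemma stably_lst x y e : 0 < e -> stably_equivalent x y ->
  exists N, forall n, (N <= n)%N ->
    lst (iter n dyn x) (iter n dyn y) /\ mdist (iter n dyn x) (iter n dyn y) < e.
Proof.
move=> e0 xy; have [e' e'0 e'P] := shadow_lst.
have e''0 : 0 < Num.min e e' by rewrite lt_min e0.
move/cvgrPdist_lt: (xy) => /(_ _ e''0)[N _ NP]; exists N => n Nn.
have NP' m : (N <= m)%N -> mdist (iter m dyn x) (iter m dyn y) < Num.min e e'.
  by move=> /NP; rewrite sub0r normrN ger0_norm ?mdist_ge0.
split; last by have := NP' _ Nn; rewrite lt_min => /andP[].
apply: e'P => m; rewrite -!iterD.
have : (N <= m + n)%N by rewrite (leq_trans Nn) // leq_addl.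
by move=> /NP'; rewrite lt_min => /andP[].
Qed.
End SmaleSpace.

Section Reversal.
Variables (R : realType) (X : system R).
Hypothesis sX : smale_axioms X.
Implicit Types x y z w : X.
Local Notation r := (radius X).

Let sX' := reverse_axioms sX.

Lemma lst_reverse x y : @lst R (reverse X) x y <-> lun x y.
Proof.
split=> [xy|/(lun_sym sX)[xy bxy]]; last by split=> //=; rewrite metric_sym.
by case: xy => /= xy bxy; apply: (lun_sym sX); split=> //; rewrite metric_sym.
Qed.

Lemma lun_dynV x y : lun x y -> lun (dynV x) (dynV y).
Proof. by move=> /lst_reverse/(lst_dyn sX')/lst_reverse. Qed.

Lemma lun_iter n x y : lun x y -> lun (iter n dynV x) (iter n dynV y).
Proof. by move=> xy; elim: n => //= n; exact: lun_dynV. Qed.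

Lemma lun_iter_le n x y : lun x y ->
  mdist (iter n dynV x) (iter n dynV y) <= mdist x y.
Proof. by move=> /lst_reverse/(lst_iter_le sX' n). Qed.

Lemma lun_unstably x y : lun x y -> unstably_equivalent x y.
Proof. by move=> /lst_reverse/(lst_stably sX'). Qed.

Lemma shadow_lun : exists2 e, 0 < e & forall x y,
  (forall n, mdist (iter n dynV x) (iter n dynV y) < e) -> lun x y.
Proof.
by have [e e0 eP] := shadow_lst sX'; exists e => // x y /eP/lst_reverse.
Qed.

Lemma unstably_lun x y e : 0 < e -> unstably_equivalent x y ->
  exists N, forall n, (N <= n)%N -> lun (iter n dynV x) (iter n dynV y) /\
    mdist (iter n dynV x) (iter n dynV y) < e.
Proof.
move=> e0 xy; have [N NP] := @stably_lst _ _ sX' x y e e0 xy.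
by exists N => n /NP[/lst_reverse].
Qed.

Lemma stably_iter n x y :
  stably_equivalent (iter n dyn x) (iter n dyn y) <-> stably_equivalent x y.
Proof.
rewrite /stably_equivalent -(cvg_shiftn n (fun k => mdist (iter k dyn x) _)).
by rewrite (_ : (fun k => _) = (fun k => mdist (iter (k + n) dyn x)
  (iter (k + n) dyn y))) //; apply/funext => k; rewrite !iterD.
Qed.

Lemma lst_iterV n x y : lst x y ->
  (forall k, (k <= n)%N -> mdist (iter k dynV x) (iter k dynV y) <= r) ->
  lst (iter n dynV x) (iter n dynV y).
Proof.
move=> xy; elim: n => //= n IH h; apply: (lst_dynV sX); last exact: (h n.+1).
by apply: IH => k kn; apply: h; exact: leq_trans kn _.
Qed.

Lemma iterV_uniform n e : 0 < e -> exists2 d, 0 < d & forall x y,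
  mdist x y < d -> forall k, (k <= n)%N ->
  mdist (iter k dynV x) (iter k dynV y) < e.
Proof.
move=> e0; elim: n => [|n [d d0 dP]].
  by exists e => // x y xy [].
have [d' d'0 d'P] := uniform_continuity (sa_compact sX)
  (iter_continuous (n := n.+1) (sa_dynV sX)) e0.
exists (Num.min d d') => [|x y]; first by rewrite lt_min d0.
rewrite lt_min => /andP[/dP xy /d'P xy'] k; rewrite leq_eqVlt => /orP[/eqP->|] //.
exact: xy.
Qed.
End Reversal.

(** ** Factor maps *)

Section FactorMap.
Variables (R : realType) (S Y : system R) (f : factor_map S Y).
Hypotheses (sS : smale_axioms S) (sY : smale_axioms Y) (fb : s_bijective f).
Implicit Types a b : S.

Lemma fmap_iter n a : f (iter n dyn a) = iter n dyn (f a).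
Proof. by elim: n => //= n IH; rewrite fmap_dyn IH. Qed.

Lemma fmap_iterV n a : f (iter n dynV a) = iter n dynV (f a).
Proof. by elim: n => //= n IH; rewrite fmap_dynV IH. Qed.

Lemma s_bijective_inj a b : stably_equivalent a b -> f a = f b -> a = b.
Proof.
move=> ab fab; have [_ inj _] := fb a; apply: inj => //; apply/mem_set => //.
by apply: lst_stably => //; exact: lst_refl.
Qed.

Lemma lst_inj a b : lst a b -> f a = f b -> a = b.
Proof. by move=> /(lst_stably sS); exact: s_bijective_inj. Qed.

Lemma fmap_uniform e : 0 < e -> exists2 d, 0 < d & forall a b,
  mdist a b < d -> mdist (f a) (f b) < e.
Proof. exact: uniform_continuity (sa_compact sS) (fmap_continuous (f := f)). Qed.

(** The bracket of two close points is characterized by the orbits which it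
    shadows, and shadowing is preserved by f. *)
Lemma fmap_br : exists2 d, 0 < d & forall a b, mdist a b < d ->
  [/\ mdist a b <= radius S, mdist (f a) (f b) <= radius Y &
      f (br a b) = br (f a) (f b)].
Proof.
have [es es0 esP] := shadow_lst sY; have [eu eu0 euP] := shadow_lun sY.
have rS0 := sa_radius sS; have rY0 := sa_radius sY.
have e0 : 0 < Num.min (radius Y) (Num.min es eu) by rewrite !lt_min rY0 es0.
have [h h0 hP] := fmap_uniform e0.
have h'0 : 0 < Num.min h (radius S) by rewrite lt_min h0.
have [d d0 dP] := br_uniform sS h'0.
exists (Num.min h d) => [|a b]; first by rewrite lt_min h0.
rewrite lt_min => /andP[/hP]; rewrite lt_min => /andP[/ltW fab _] /dP[ab].
rewrite !lt_min => /andP[aw aw'] /andP[bw bw']; split=> //.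
set w := br a b in aw aw' bw bw' *.
have law : lst a w by apply: lst_br => //; exact: ltW.
have lwb : lun w b by apply: lun_br => //; rewrite metric_sym ltW.
have /esP lfaw n : mdist (iter n dyn (f a)) (iter n dyn (f w)) < es.
  rewrite -!fmap_iter; have : mdist (iter n dyn a) (iter n dyn w) < h.
    exact: le_lt_trans (lst_iter_le sS n law) _.
  by move=> /hP; rewrite !lt_min => /and3P[].
have /euP [fwb bfwb] n : mdist (iter n dynV (f w)) (iter n dynV (f b)) < eu.
  rewrite -!fmap_iterV; have : mdist (iter n dynV w) (iter n dynV b) < h.
    by apply: le_lt_trans (lun_iter_le sS n lwb) _; rewrite metric_sym.
  by move=> /hP; rewrite !lt_min => /and3P[].
case: lfaw => faw bfaw; rewrite -[LHS]bfaw -[in LHS]bfwb (sa_brr sY) ?bfwb //.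
- exact/(sa_brdom sY).
- exact/(sa_brdom sY).
exact/(sa_brdom sY).
Qed.

(** The bracket of a and b is stable with a and has the same image as a, hence
    it is a, as f is injective on stable sets. *)
Lemma lun_lift : exists2 d, 0 < d & forall a b, mdist a b < d ->
  lun (f a) (f b) -> lun a b.
Proof.
have [d d0 dP] := fmap_br; have [d' d'0 d'P] := br_uniform sS (sa_radius sS).
exists (Num.min d d') => [|a b]; first by rewrite lt_min d0.
rewrite lt_min => /andP[/dP[ab _ fab] /d'P[_ aw _]] [_ bfab].
split=> //; apply/esym/lst_inj; first by apply: lst_br => //; exact: ltW.
by rewrite fab bfab.
Qed.

(** As f is injective on stable sets, it separates, uniformly by compactness,
    the locally stable pairs at distance at least e. *)
Lemma lst_separated e : 0 < e -> exists2 d, 0 < d & forall a b,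
  lst a b -> mdist a b <= radius S / 2 -> mdist (f a) (f b) < d ->
  mdist a b < e.
Proof.
move=> e0; pose P d a b := lst a b -> mdist a b <= radius S / 2 ->
  mdist (f a) (f b) < d -> mdist a b < e.
have Pmon d d' a b : d' <= d -> P d a b -> P d' a b.
  by move=> d'd dP l h fab; apply: dP => //; exact: lt_le_trans d'd.
have rS0 := sa_radius sS.
have r2 : radius S / 2 < radius S by rewrite ltr_pdivrMr // ltr_pMr // ltr1n.
have near_dist a b c : mdist a b < c -> exists2 d, 0 < d & forall a' b',
    mdist a a' < d -> mdist b b' < d -> mdist a' b' < c.
  move=> abc; have d0 : 0 < (c - mdist a b) / 2 by rewrite divr_gt0 // subr_gt0.
  exists ((c - mdist a b) / 2) => // a' b' aa' bb'.
  apply: le_lt_trans (metric_triangle _ a _) _.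
  apply: le_lt_trans (lerD (lexx _) (metric_triangle _ b _)) _.
  rewrite metric_sym addrCA -ltrBrDl.
  by rewrite (splitr (c - _)) ltrD.
have near_dist' a b c : c < mdist a b -> exists2 d, 0 < d & forall a' b',
    mdist a a' < d -> mdist b b' < d -> c < mdist a' b'.
  move=> abc; have d0 : 0 < (mdist a b - c) / 2 by rewrite divr_gt0 // subr_gt0.
  exists ((mdist a b - c) / 2) => // a' b' aa' bb'.
  have : mdist a b <= mdist a a' + (mdist a' b' + mdist b b').
    apply: le_trans (metric_triangle _ a' _) _; rewrite lerD2l.
    by apply: le_trans (metric_triangle _ b' _) _; rewrite lerD2l metric_sym.
  move=> h; rewrite -(ltrD2r (mdist a b - c)) addrC subrK.
  apply: le_lt_trans h _; rewrite addrCA ltrD2l.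
  by rewrite (splitr (mdist a b - c)) ltrD.
have Ploc a b : exists2 d, 0 < d & forall a' b',
    mdist a a' < d -> mdist b b' < d -> P d a' b'.
  have [abe|abe] := ltP (mdist a b) e.
    have [d d0 dP] := near_dist _ _ _ abe; exists d => // a' b' aa' bb' _ _ _.
    exact: dP.
  have [abr|abr] := ltP (radius S / 2) (mdist a b).
    have [d d0 dP] := near_dist' _ _ _ abr; exists d => // a' b' aa' bb' _.
    by rewrite leNgt dP.
  have [lab|nlab] := pselect (br a b = b).
    have fab : 0 < mdist (f a) (f b).
      rewrite mdist_gt0; apply/eqP => fab.
      have ab : a = b by apply: lst_inj => //; split=> //; rewrite ltW // (le_lt_trans abr).
      by move: abe; rewrite ab mdistxx leNgt e0.
    have f30 : 0 < mdist (f a) (f b) / 3 by rewrite divr_gt0.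
    have [d d0 dP] := fmap_uniform f30.
    exists (Num.min d (mdist (f a) (f b) / 3)); first by rewrite lt_min d0.
    move=> a' b'; rewrite !lt_min => /andP[/dP faa' _] /andP[/dP fbb' _] _ _.
    rewrite lt_min => /andP[_ fab']; exfalso; have : mdist (f a) (f b) < mdist (f a) (f b).
      apply: le_lt_trans (metric_triangle _ (f a') _) _.
      apply: le_lt_trans (lerD (lexx _) (metric_triangle _ (f b') _)) _.
      rewrite [X in _ < X](_ : _ = mdist (f a) (f b) / 3 +
        (mdist (f a) (f b) / 3 + mdist (f a) (f b) / 3)); last by field.
      by rewrite ltrD // ltrD // metric_sym.
    by rewrite ltxx.
  have nab : 0 < mdist (br a b) b by rewrite mdist_gt0; apply/eqP.
  have n20 : 0 < mdist (br a b) b / 2 by rewrite divr_gt0.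
  have /(br_cont sS) cb : mdist a b < radius S by exact: le_lt_trans abr r2.
  have /cb [[U V] /= [/nbhs_mdist[d1 d10 d1P] /nbhs_mdist[d2 d20 d2P]] UV] :
      nbhs (br a b) [set y | mdist (br a b) y < mdist (br a b) b / 2].
    exact: mdist_nbhs n20 _.
  exists (Num.min d1 (Num.min d2 (mdist (br a b) b / 2))).
    by rewrite !lt_min d10 d20.
  move=> a' b'; rewrite !lt_min => /andP[aa' _] /and3P[_ bb' bb''] [_ bab'] _ _.
  have : mdist (br a b) (br a' b') < mdist (br a b) b / 2.
    by apply: (UV (a', b')); split; [exact: d1P | exact: d2P].
  rewrite bab' => h; exfalso.
  have : mdist (br a b) b < mdist (br a b) b.
    rewrite {2}(splitr (mdist (br a b) b)).
    apply: le_lt_trans (metric_triangle _ b' _) _.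
    by rewrite ltrD // metric_sym.
  by rewrite ltxx.
have kS := sa_compact sS.
have Ploc' a : exists2 d, 0 < d & forall a' b, mdist a a' < d -> P d a' b.
  have [|b _|d d0 dP] := @compact_uniform R S setT
      (fun d b => forall a', mdist a a' < d -> P d a' b) kS.
  - move=> d d' b d'd dP a' aa'; apply: (Pmon d) => //; apply: dP.
    exact: lt_le_trans d'd.
  - have [d d0 dP] := Ploc a b; exists d => // b' _ bb' a' aa'; exact: dP.
  by exists d => // a' b; exact: dP.
have [|a _|d d0 dP] := @compact_uniform R S setT (fun d a => forall b, P d a b) kS.
- by move=> d d' a d'd dP b; exact: (Pmon d).
- by have [d d0 dP] := Ploc' a; exists d => // a' _ aa' b; exact: dP.
by exists d => // a b; exact: dP.
Qed.

(** Far in the future a and b are close; going back in time, they cannot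
    separate at any moment, since their images are close at that moment. *)
Lemma lst_lift_close e : 0 < e -> exists2 d, 0 < d & forall a b,
  stably_equivalent a b -> lst (f a) (f b) -> mdist (f a) (f b) < d ->
  lst a b /\ mdist a b < e.
Proof.
move=> e0; have rS0 := sa_radius sS.
have r20 : 0 < radius S / 2 by rewrite divr_gt0.
have r2 : radius S / 2 <= radius S by rewrite ler_pdivrMr // ler_pMr // ler1n.
have [h h0 hP] := uniform_continuity (sa_compact sS) (sa_dynV sS) r20.
have e10 : 0 < Num.min e h by rewrite lt_min e0.
have [d d0 dP] := lst_separated e10; exists d => // a b ab fab fabd.
have [N /(_ N (leqnn _)) NP] := stably_lst sS e10 ab.
suff : forall n, (n <= N)%N -> lst (iter (N - n) dyn a) (iter (N - n) dyn b) /\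
    mdist (iter (N - n) dyn a) (iter (N - n) dyn b) < Num.min e h.
  move=> /(_ N (leqnn _)); rewrite subnn /= => -[l]; rewrite lt_min.
  by move=> /andP[].
elim=> [|n IH] nN; first by rewrite subn0.
have {IH} := IH (ltnW nN).
set m := (N - n.+1)%N; have -> : (N - n = m.+1)%N by rewrite /m -subSn.
move=> /= [l]; rewrite lt_min => /andP[_ /hP]; rewrite !dynK => mr.
have lm : lst (iter m dyn a) (iter m dyn b).
  rewrite -[iter m dyn a](dynK (s := S)) -[iter m dyn b](dynK (s := S)).
  apply: (lst_dynV sS) => //; rewrite !dynK; apply: le_trans r2; exact: ltW.
split=> //; apply: dP => //; first exact: ltW.
by rewrite !fmap_iter; exact: le_lt_trans (lst_iter_le sY m fab) _.
Qed.

Lemma lst_lift e : 0 < e -> exists2 d, 0 < d & forall a (y : Y),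
  lst (f a) y -> mdist (f a) y < d ->
  exists b, [/\ f b = y, lst a b & mdist a b < e].
Proof.
move=> e0; have [d d0 dP] := lst_lift_close e0; exists d => // a y fay fayd.
have [_ _ /(_ y)] := fb a; case=> [|b ab fby]; first exact: lst_stably fay.
by exists b; have [||lab labe] := dP a b ab; rewrite ?fby.
Qed.
End FactorMap.

(** ** Levels of the unstable relation *)

Section UnstableLevel.
Variables (R : realType) (Y : system R).
Hypothesis sY : smale_axioms Y.
Implicit Types x y : Y.

Lemma small_gt0 : 0 < small Y.
Proof. by rewrite divr_gt0 // (sa_radius sY). Qed.

Lemma small_le : small Y <= radius Y.
Proof. by rewrite ler_pdivrMr // ler_pMr ?(sa_radius sY) // ler1n. Qed.

(** The n-th set of the union which defines the topology of the unstable
    groupoid. *)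
Definition ulevel n x y := lun (iter n dynV x) (iter n dynV y) /\
  mdist (iter n dynV x) (iter n dynV y) < small Y.

Lemma ulevelE n x y :
  (iter n dyn @` local_unstable (small Y) (iter n dynV x)) y <-> ulevel n x y.
Proof.
split=> [[z [xz _ bxz] <-]|[[xy bxy] xys]].
  by rewrite /ulevel iter_dynK; split=> //; split=> //; rewrite (le_trans (ltW xz)) // small_le.
exists (iter n dynV y); last by rewrite iter_dynVK.
by split=> //; exact/(sa_brdom sY).
Qed.

Lemma ulevel_le m n x y : (m <= n)%N -> ulevel m x y -> ulevel n x y.
Proof.
move=> mn [l d]; rewrite /ulevel -(subnK mn) !iterD; split.
  exact: lun_iter.
exact: le_lt_trans (lun_iter_le sY _ l) d.
Qed.

Lemma unstably_iterV n x y : unstably_equivalent (iter n dynV x) (iter n dynV y) ->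
  unstably_equivalent x y.
Proof.
rewrite /unstably_equivalent => h.
rewrite -(cvg_shiftn n (fun k => mdist (iter k dynV x) (iter k dynV y))).
by rewrite (_ : (fun k => _) = (fun k => mdist (iter k dynV (iter n dynV x))
  (iter k dynV (iter n dynV y)))) //; apply/funext => k; rewrite !iterD.
Qed.

Lemma ulevel_unstably n x y : ulevel n x y -> unstably_equivalent x y.
Proof. by move=> [/(lun_unstably sY) h _]; exact: unstably_iterV h. Qed.

Lemma unstably_ulevel x y : unstably_equivalent x y -> exists n, ulevel n x y.
Proof.
move=> xy; have [N /(_ N (leqnn _)) h] := unstably_lun sY small_gt0 xy.
by exists N.
Qed.
End UnstableLevel.

Definition uclass (R : realType) (X : system R) (x : X) : set X :=
  [set y | unstably_equivalent x y].

Lemma uclass_eq (R : realType) (X : system R) (x y : X) :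
  uclass x = uclass y <-> unstably_equivalent x y.
Proof.
split=> [xy|xy].
  have : uclass y y by exact: unstably_equivalentxx.
  by rewrite -xy.
apply/seteqP; split=> z; rewrite /uclass /=; apply: unstably_equivalent_trans => //.
exact: unstably_equivalentC.
Qed.

(** * Fibre products *)

Section Fiber.
Variables (R : realType) (S Y : system R) (f : factor_map S Y).
Hypotheses (sS : smale_axioms S) (sY : smale_axioms Y) (fb : s_bijective f).
Variable q : nat.
Local Notation X := (fiber_product f q).
Implicit Types t u v : X.

Definition crd (t : X) (i : 'I_q.+1) : S := (set_val t : 'I_q.+1 -> S) i.
Definition base (t : X) : Y := f (crd t ord0).

Lemma f_crd t i : f (crd t i) = base t.
Proof. exact: (set_mem (valP t)). Qed.

Lemma crd_ext t u : (forall i, crd t i = crd u i) -> t = u.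
Proof. by case: t u => [t ?] [u ?] tu; exact/eq_exist/funext. Qed.

Lemma fiber_mk (s : 'I_q.+1 -> S) (y : Y) : (forall i, f (s i) = y) ->
  exists2 t : X, crd t = s & base t = y.
Proof.
move=> sy; have sP : fiber_tuple f s by move=> i j; rewrite !sy.
by exists (exist _ s (mem_set sP)) => //; exact: sy.
Qed.

Lemma mdist_fiberE t u :
  mdist t u = \big[Num.max/0]_(i < q.+1) mdist (crd t i) (crd u i).
Proof. by []. Qed.

Lemma mdist_crd t u i : mdist (crd t i) (crd u i) <= mdist t u.
Proof.
rewrite mdist_fiberE.
exact: (le_bigmax _ (fun i => mdist (crd t i) (crd u i))).
Qed.

Lemma mdist_fiber_lt t u e : 0 < e ->
  (forall i, mdist (crd t i) (crd u i) < e) -> mdist t u < e.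
Proof. by move=> e0 h; rewrite mdist_fiberE; apply/bigmax_ltP. Qed.

Lemma crd_dyn t i : crd (dyn t) i = dyn (crd t i). Proof. by []. Qed.
Lemma crd_dynV t i : crd (dynV t) i = dynV (crd t i). Proof. by []. Qed.

Lemma crd_iter n t i : crd (iter n dyn t) i = iter n dyn (crd t i).
Proof. by elim: n => //= n IH; rewrite crd_dyn IH. Qed.

Lemma crd_iterV n t i : crd (iter n dynV t) i = iter n dynV (crd t i).
Proof. by elim: n => //= n IH; rewrite crd_dynV IH. Qed.

Lemma base_iter n t : base (iter n dyn t) = iter n dyn (base t).
Proof. by rewrite /base crd_iter fmap_iter. Qed.

Lemma base_iterV n t : base (iter n dynV t) = iter n dynV (base t).
Proof. by rewrite /base crd_iterV fmap_iterV. Qed.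

Lemma fiber_brdomE t u : brdom t u <->
  (forall i, brdom (crd t i) (crd u i)) /\
  forall i j, f (br (crd t i) (crd u i)) = f (br (crd t j) (crd u j)).
Proof. by []. Qed.

Lemma crd_br t u i : brdom t u -> crd (br t u) i = br (crd t i) (crd u i).
Proof. by move=> [_ h]; rewrite /br /=; case: pselect. Qed.

Lemma crd_cont i : continuous (crd^~ i).
Proof.
move=> t O /nbhs_mdist[e e0 eO]; apply: (mdist_nbhs e0) => u tu.
by apply: eO; exact: le_lt_trans (mdist_crd _ _ _) tu.
Qed.

Lemma cont_at_fiber (W : topologicalType) (g : W -> X) w :
  (forall i, cont_at (fun w => crd (g w) i) w) -> cont_at g w.
Proof.
move=> cg O /nbhs_mdist[e e0 eO].
have : \forall w' \near w, forall i, mdist (crd (g w) i) (crd (g w') i) < e.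
  by apply: filter_forall => i; apply: (cg i [set s | mdist (crd (g w) i) s < e]); exact: mdist_nbhs e0 _.
by apply: filterS => w' h; apply: eO; exact: mdist_fiber_lt.
Qed.

Lemma base_cont : continuous base.
Proof.
move=> t; apply: (@continuous_comp _ _ _ (crd^~ ord0) f); first exact: crd_cont.
exact: fmap_continuous.
Qed.

Lemma fiber_dyn_cont : continuous (@dyn R X).
Proof.
move=> t; apply: cont_at_fiber => i.
apply: (@cont_at_comp _ _ _ (crd^~ i) dyn); first exact: crd_cont.
exact: (sa_dyn sS).
Qed.

Lemma fiber_dynV_cont : continuous (@dynV R X).
Proof.
move=> t; apply: cont_at_fiber => i.
apply: (@cont_at_comp _ _ _ (crd^~ i) dynV); first exact: crd_cont.
exact: (sa_dynV sS).
Qed.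

Lemma fiber_compact : compact [set: X].
Proof.
rewrite compact_ultra => F FU _.
have cvgF i : exists s : S, (crd^~ i) @ F --> s.
  have [s [_ Gs]] := @sa_compact _ _ sS ((crd^~ i) @ F) _ filterT.
  exists s => O Os; have [//|] := in_ultra_setVsetC ((crd^~ i) @^-1` O) FU.
  by move=> FO; have [s' []] := Gs (~` O) O FO Os.
have [s sP] := boolp.choice cvgF.
have sF i j : f (s i) = f (s j).
  have fs k : base @ F --> f (s k).
    rewrite (_ : base = f \o crd^~ k); last first.
      by apply/funext => t; rewrite /= f_crd.
    by apply: continuous_cvg; [exact: fmap_continuous | exact: sP].
  have hY : hausdorff_space Y by exact: metric_hausdorff.
  exact: (cvg_unique hY (fs i) (fs j)).
have [t ts _] := fiber_mk (fun i => sF i ord0); exists t; split=> //.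
move=> O /nbhs_mdist[e e0 eO].
have : \forall u \near F, forall i, mdist (crd t i) (crd u i) < e.
  apply: filter_forall => i; rewrite ts.
  by apply: (sP i [set s' | mdist (s i) s' < e]); exact: mdist_nbhs e0 _.
by apply: filterS => u h; apply: eO; exact: mdist_fiber_lt.
Qed.

Lemma fiber_hausdorff : hausdorff_space X. Proof. exact: metric_hausdorff. Qed.

(** Coordinatewise local relations; they agree with those of the bracket of the
    fibre product, see [local_stableE]. *)
Definition flst t u := forall i, lst (crd t i) (crd u i).
Definition flun t u := forall i, lun (crd t i) (crd u i).

Lemma local_stableE e t u : local_stable e t u <-> mdist t u < e /\ flst t u.
Proof.
split=> [[tu but bt]|[tu ftu]].
  split=> // i; apply: (lst_sym sS); have [h _] := but; split.
    by apply/(sa_brdom sS).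
  by rewrite -crd_br // bt.
have ftu' i : lst (crd u i) (crd t i) by apply: (lst_sym sS).
have bd : brdom u t.
  apply/fiber_brdomE; split=> [i|i j]; first by case: (ftu' i) => /(sa_brdom sS).
  by rewrite (ftu' i).2 (ftu' j).2 !f_crd.
by split=> //; apply: crd_ext => i; rewrite crd_br // (ftu' i).2.
Qed.

(** The coordinates of t have the same image in Y, so that the brackets of the
    coordinates of t and u have the same image too. *)
Lemma fiber_br : exists2 d, 0 < d & forall t u, mdist t u < d ->
  [/\ mdist t u <= radius S, brdom t u & brdom u t].
Proof.
have [d d0 dP] := fmap_br f sS sY; exists (Num.min d (radius S)).
  by rewrite lt_min d0 (sa_radius sS).
have bd t u : mdist t u < d -> brdom t u.
  move=> tu; have h i : mdist (crd t i) (crd u i) < d.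
    exact: le_lt_trans (mdist_crd _ _ _) tu.
  apply/fiber_brdomE; split=> [i|i j].
    by have [/(sa_brdom sS)] := dP _ _ (h i).
  have [_ _ hi] := dP _ _ (h i); have [_ _ hj] := dP _ _ (h j).
  by rewrite hi hj !f_crd.
move=> t u; rewrite lt_min => /andP[tu tu']; split; [exact: ltW | exact: bd |].
by apply: bd; rewrite metric_sym.
Qed.

(** Each coordinate follows the move of the base along its own stable set. *)
Lemma flst_lift e : 0 < e -> exists2 d, 0 < d & forall t (y : Y),
  lst (base t) y -> mdist (base t) y < d ->
  exists u, [/\ base u = y, flst t u & mdist t u < e].
Proof.
move=> e0; have [d d0 dP] := lst_lift sS sY fb e0.
exists d => // t y ty tyd.
have yP i : exists b, [/\ f b = y, lst (crd t i) b & mdist (crd t i) b < e].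
  by apply: dP; rewrite f_crd.
have [s sP] := boolp.choice yP.
have [i|u us uy] := @fiber_mk s y; first by case: (sP i).
exists u; split=> // [i|]; rewrite ?us; first by case: (sP i).
by apply: mdist_fiber_lt => // i; rewrite us; case: (sP i).
Qed.

Lemma flun_lift : exists2 d, 0 < d & forall t u, mdist t u < d ->
  lun (base t) (base u) -> flun t u.
Proof.
have [d d0 dP] := lun_lift sS sY fb; exists d => // t u tu btu i.
by apply: dP; rewrite ?f_crd //; exact: le_lt_trans (mdist_crd _ _ _) tu.
Qed.

Lemma flst_base_inj t u : flst t u -> base t = base u -> t = u.
Proof.
move=> tu btu; apply: crd_ext => i; apply: (lst_inj sS fb) => //.
by rewrite !f_crd.
Qed.

Lemma fiber_iterV_uniform n e : 0 < e -> exists2 d, 0 < d & forall t u,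
  mdist t u < d -> forall k, (k <= n)%N ->
  mdist (iter k dynV t) (iter k dynV u) < e.
Proof.
move=> e0; have [d d0 dP] := iterV_uniform sS n e0; exists d => // t u tu k kn.
apply: mdist_fiber_lt => // i; rewrite !crd_iterV; apply: dP => //.
exact: le_lt_trans (mdist_crd _ _ _) tu.
Qed.

Lemma fiber_iter_uniform n e : 0 < e -> exists2 d, 0 < d & forall t u,
  mdist t u < d -> mdist (iter n dyn t) (iter n dyn u) < e.
Proof.
apply: uniform_continuity; first exact: fiber_compact.
exact: iter_continuous fiber_dyn_cont.
Qed.

Lemma flst_iter_le n t u : flst t u ->
  mdist (iter n dyn t) (iter n dyn u) <= mdist t u.
Proof.
move=> tu; rewrite [leLHS]mdist_fiberE; apply/bigmax_leP; split=> [|i _].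
  exact: mdist_ge0.
rewrite !crd_iter; apply: le_trans (mdist_crd _ _ i).
exact: lst_iter_le.
Qed.

Lemma flun_iter_le n t u : flun t u ->
  mdist (iter n dynV t) (iter n dynV u) <= mdist t u.
Proof.
move=> tu; rewrite [leLHS]mdist_fiberE; apply/bigmax_leP; split=> [|i _].
  exact: mdist_ge0.
rewrite !crd_iterV; apply: le_trans (mdist_crd _ _ i).
exact: lun_iter_le.
Qed.
End Fiber.

(** ** Retractions along unstable sets *)

Section ZeroDimensional.
Variables (R : realType) (S Y : system R) (f : factor_map S Y).
Hypotheses (sS : smale_axioms S) (sY : smale_axioms Y) (fb : s_bijective f).
Hypothesis zS : zero_dimensional S.
Variable q : nat.
Local Notation X := (fiber_product f q).
Implicit Types t u v : X.

Let kX : compact [set: X]. Proof. exact: fiber_compact. Qed.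
Let hX : hausdorff_space X. Proof. exact: fiber_hausdorff. Qed.

Lemma fiber_zero_dimensional : zero_dimensional X.
Proof.
move=> t u tu; have [i ti] : exists i, crd t i != crd u i.
  apply/existsP; apply: contra_neqT tu => /existsPn h; apply: crd_ext => i.
  by apply/eqP; have := h i; rewrite negbK.
have [U [[oU cU] Ut nUu]] := zS ti.
exists ((fun v : X => crd v i) @^-1` U); split=> //; split.
  by apply: preimage_open => //; exact: crd_cont.
by move: cU; apply: (closed_comp (f := fun v : X => crd v i)) => v _; exact: crd_cont.
Qed.

Lemma fiber_co_basis : co_basis X.
Proof.
move=> t O tO.
have := zero_dimensional_cvg (x := t) hX fiber_zero_dimensional kX.
move=> /(_ _ tO)[D [Dt [oD cD]] DO]; exists D; split=> //; split=> //.
exact: subclosed_compact cD kX _.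
Qed.

Lemma fiber_compact_openT : compact_open [set: X].
Proof. by split; [exact: fiber_compact | exact: openT]. Qed.

(** Choose a point in each set of a finite partition into small clopen sets. *)
Lemma locally_constant_approx d : 0 < d -> exists k : X -> X,
  (forall t, mdist t (k t) < d) /\
  exists2 d', 0 < d' & forall t u, mdist t u < d' -> k t = k u.
Proof.
move=> d0; pose P (U : set X) := exists k : X -> X,
  (forall t, U t -> mdist t (k t) < d) /\
  forall t, U t -> \forall u \near t, k t = k u.
have [k [kd kc]] : P setT.
  apply: (compact_open_ind hX fiber_co_basis fiber_compact_openT).
  - by exists id; split=> t [].
  - move=> U V [_ oU] [_ oV] _ _ UV0 [k [kd kc]] [l [ld lc]].
    have VnU t : V t -> t \in U = false.
      move=> Vt; apply/negP => /set_mem Ut.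
      by have : (U `&` V) t by []; rewrite UV0.
    exists (fun t => if t \in U then k t else l t); split=> t [Ut|Vt].
    + by rewrite (mem_set Ut); exact: kd.
    + by rewrite VnU //; exact: ld.
    + have nU : nbhs t U by exact: open_nbhs_nbhs.
      apply: filterS2 nU (kc _ Ut) => u Uu.
      by rewrite (mem_set Ut) (mem_set Uu).
    have nV : nbhs t V by exact: open_nbhs_nbhs.
    by apply: filterS2 nV (lc _ Vt) => u Vu; rewrite !VnU.
  move=> t _; exists [set u | mdist t u < d]; first exact: mdist_nbhs d0 _.
  move=> M _ Mt _; exists (fun=> t); split=> [u /Mt|u _].
    by rewrite metric_sym.
  by apply: (@filterS _ (nbhs u) _ setT) => //; exact: filterT.
exists k; split=> [t|]; first exact: kd.
have [|t _|d' d'0 d'P] := @compact_uniform R X setT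
    (fun d t => forall u, mdist t u < d -> k t = k u) kX.
- by move=> e e' t e'e eP u tu; apply: eP; exact: lt_le_trans e'e.
- have /nbhs_mdist[e e0 eP] : nbhs t [set u | k t = k u] by exact: kc.
  have e20 : 0 < e / 2 by rewrite divr_gt0.
  have e2e : e / 2 < e by rewrite ltr_pdivrMr // ltr_pMr // ltr1n.
  exists (e / 2) => // u _ tu v uv; rewrite -eP ?(lt_trans tu) //.
  apply: eP; apply: le_lt_trans (metric_triangle _ u _) _.
  by rewrite (splitr e) ltrD.
by exists d' => // t u; exact: d'P.
Qed.

(** Retractions along unstable sets onto finite unions of local stable sets;
    they identify more and more points of each unstable class, but stay
    injective on small stable sets. *)
Record retractions (rn : nat -> X -> X) : Prop := {
  rn_cont : forall n, continuous (rn n);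
  rn_level : forall n t, ulevel n (base t) (base (rn n t));
  rn_unstable : forall n t i, unstably_equivalent (crd t i) (crd (rn n t) i);
  rn_eq : exists2 d, 0 < d & forall n t u,
    mdist (iter n dynV t) (iter n dynV u) < d ->
    flun (iter n dynV t) (iter n dynV u) ->
    forall m, (n <= m)%N -> rn m t = rn m u;
  rn_inj : forall n, exists2 d, 0 < d & forall t u, mdist t u < d ->
    flst t u -> rn n t = rn n u -> t = u;
  rn_dyn : forall n t, rn n.+1 (dyn t) = dyn (rn n t) }.

Lemma flst_iterV n t u : flst t u ->
  (forall k, (k <= n)%N -> mdist (iter k dynV t) (iter k dynV u) <= radius S) ->
  flst (iter n dynV t) (iter n dynV u).
Proof.
move=> tu h i; rewrite !crd_iterV; apply: (lst_iterV sS) => // k kn.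
by rewrite -!crd_iterV; apply: le_trans (mdist_crd _ _ _) (h _ kn).
Qed.

(** Let r t be the bracket of k t and t, for a locally constant k close to the
    identity: r identifies close points which are locally unstable. Its
    conjugates by the iterates of the dynamics do so for points which become
    close and locally unstable after n backward iterations, as any two points of
    an unstable class do for large n. *)
Lemma retractions_exist : exists rn, retractions rn.
Proof.
have rS0 := sa_radius sS.
have [h1 h10 h1P] := fmap_uniform f sS (small_gt0 sY).
have [h2 h20 h2P] := fmap_br f sS sY.
have h0 : 0 < Num.min (radius S) (Num.min h1 h2) by rewrite !lt_min rS0 h10.
have [d1 d10 d1P] := br_uniform sS h0.
have [d2 d20 d2P] := fiber_br f sS sY q.
have d0 : 0 < Num.min (radius S) (Num.min d1 d2) by rewrite !lt_min rS0 d10.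
have [k [kd [dk dk0 dkP]]] := locally_constant_approx d0.
pose r0 (t : X) : X := br (k t) t.
have kdS t i : mdist (crd (k t) i) (crd t i) < radius S.
  apply: le_lt_trans (mdist_crd _ _ _) _; rewrite metric_sym.
  by have := kd t; rewrite lt_min => /andP[].
have kb t : brdom (k t) t.
  have := kd t; rewrite !lt_min metric_sym => /and3P[_ _ /d2P[]] //.
have r0E t i : crd (r0 t) i = br (crd (k t) i) (crd t i) by rewrite crd_br.
have r0d t i : mdist (crd t i) (crd (r0 t) i) < Num.min (radius S) (Num.min h1 h2).
  rewrite r0E; suff /d1P[] : mdist (crd (k t) i) (crd t i) < d1 by [].
  apply: le_lt_trans (mdist_crd _ _ _) _; rewrite metric_sym.
  by have := kd t; rewrite !lt_min => /and3P[].
have r0u t i : lun (crd (r0 t) i) (crd t i).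
  rewrite r0E; apply: (lun_br sS); first by rewrite ltW.
  rewrite metric_sym -r0E; have := r0d t i; rewrite lt_min => /andP[+ _].
  exact: ltW.
have r0l t : ulevel 0 (base t) (base (r0 t)).
  have := r0d t ord0; rewrite !lt_min => /and3P[_ h1t h2t].
  split; last exact: h1P.
  apply: (lun_sym sY); rewrite metric_sym in h2t.
  have [_ bd bf] := h2P _ _ h2t; split=> //.
  by rewrite -bf; congr (f _); case: (r0u t ord0).
have r0eq t u : k t = k u -> flun t u -> r0 t = r0 u.
  move=> ktu tu; apply: crd_ext => i; rewrite !r0E ktu.
  by apply: (br_lun sS) => //; [rewrite -ktu|]; exact: ltW.
have cdyn n := iter_continuous (n := n) (@fiber_dyn_cont _ _ _ f sS q).
have cdynV n := iter_continuous (n := n) (@fiber_dynV_cont _ _ _ f sS q).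
have cr0 : continuous r0.
  move=> t; apply: cont_at_fiber => i.
  apply: (@cont_at_near _ _ (fun u => br (crd (k t) i) (crd u i))).
    by apply: (mdist_nbhs dk0) => u /dkP ktu; rewrite r0E ktu.
  apply: (@cont_at_comp _ _ _ (fun u => (crd (k t) i, crd u i))
    (fun p => br p.1 p.2)); last exact: br_cont.
  by apply: cont_at_pair; [exact: cont_at_cst | exact: crd_cont].
exists (fun n t => iter n dyn (r0 (iter n dynV t))); split.
- move=> n t; apply: (cont_at_comp (g := fun t => r0 (iter n dynV t))).
    by apply: (cont_at_comp (h := r0)); [exact: cdynV | exact: cr0].
  exact: cdyn.
- move=> n t; have := r0l (iter n dynV t).
  by rewrite /ulevel /= !base_iterV base_iter iter_dynK.
- move=> n t i; apply: (@unstably_iterV _ _ n).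
  rewrite crd_iter iter_dynK -crd_iterV.
  exact/unstably_equivalentC/(lun_unstably sS).
- exists dk => // n t u tud tu m nm.
  congr (iter m dyn _); rewrite -(subnK nm) !iterD.
  have tu' : flun (iter (m - n) dynV (iter n dynV t))
      (iter (m - n) dynV (iter n dynV u)).
    by move=> i; rewrite !crd_iterV; apply: (lun_iter sS); rewrite -!crd_iterV.
  apply: r0eq => //; apply: dkP; apply: le_lt_trans tud.
  exact: (flun_iter_le sS).
- move=> n.
  have e0 : 0 < Num.min dk (radius S) by rewrite lt_min dk0.
  have [d d'0 dP] := fiber_iterV_uniform f sS q n e0.
  exists d => // t u /dP tu ltu /(can_inj (iter_dynK n)) rtu.
  have tun : flst (iter n dynV t) (iter n dynV u).
    apply: flst_iterV => // j /tu; rewrite lt_min => /andP[_].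
    exact: ltW.
  have /andP[/dkP kn _] : (mdist (iter n dynV t) (iter n dynV u) < dk) &&
    (mdist (iter n dynV t) (iter n dynV u) < radius S).
    by rewrite -lt_min; exact: tu.
  apply: (can_inj (iter_dynVK n)).
  move: (iter n dynV t) (iter n dynV u) kn rtu tun => t' u' ktu rtu tu'.
  apply: crd_ext => i; have [tur btu] := tu' i.
  have ru := r0E u' i; have rt := r0E t' i; rewrite rtu in rt.
  have tri : mdist (crd t' i) (crd (r0 u') i) <= radius S.
    by rewrite -rtu; have := r0d t' i; rewrite lt_min => /andP[/ltW].
  have bdtt : brdom (crd t' i) (crd t' i).
    by apply/(sa_brdom sS); rewrite mdistxx ltW.
  have bdt : brdom (crd t' i) (crd (r0 u') i) by exact/(sa_brdom sS).
  have bkt : brdom (crd (k t') i) (crd t' i) by exact/(sa_brdom sS)/ltW.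
  have bku : brdom (crd (k u') i) (crd u' i) by exact/(sa_brdom sS)/ltW.
  have bdu : brdom (crd t' i) (crd u' i) by exact/(sa_brdom sS).
  have := sa_brr sS bkt; rewrite -rt => /(_ _ bdt bdtt).
  rewrite ru (sa_brr sS bku) -?ru // btu (sa_brxx sS) => ->.
  by [].
by move=> n t; rewrite [iter n.+1 dynV _]iterSr dynK iterS.
Qed.
End ZeroDimensional.

(** ** Compact open subsets of stable sets *)

Section StableSets.
Variables (R : realType) (S Y : system R) (f : factor_map S Y).
Hypotheses (sS : smale_axioms S) (sY : smale_axioms Y).
Variable q : nat.
Local Notation X := (fiber_product f q).
Implicit Types (t u v x : X) (E F : set X).

Let small0 : 0 < small X. Proof. exact: small_gt0 sS. Qed.
Let small_rad : small X <= radius S. Proof. exact: small_le sS. Qed.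

Lemma flst_refl t : flst t t. Proof. by move=> i; exact: lst_refl. Qed.

Lemma flst_sym t u : flst t u -> flst u t.
Proof. by move=> tu i; exact: lst_sym. Qed.

Lemma flst_trans u t v : flst t u -> flst u v -> mdist t v <= radius S ->
  flst t v.
Proof.
move=> tu uv tv i; apply: (lst_trans sS (tu i) (uv i)).
exact: le_trans (mdist_crd _ _ _) tv.
Qed.

Lemma flst_iter n t u : flst t u -> flst (iter n dyn t) (iter n dyn u).
Proof. by move=> tu i; rewrite !crd_iter; exact: lst_iter. Qed.

Lemma flst_back n : exists2 d, 0 < d & forall t u, mdist t u < d ->
  flst (iter n dyn t) (iter n dyn u) -> flst t u.
Proof.
elim: n => [|n [d d0 dP]]; first by exists 1.
have [d' d'0 d'P] := fiber_iter_uniform f sS q n (sa_radius sS).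
exists (Num.min d d') => [|t u]; first by rewrite lt_min d0.
rewrite lt_min => /andP[tu /d'P /ltW tu'] h; apply: dP => // i.
have := h i; rewrite !crd_iter !iterS => /(lst_dynV sS); rewrite !dynK; apply.
by rewrite -!crd_iter; exact: le_trans (mdist_crd _ _ _) tu'.
Qed.

(** The n-th set of the union which defines the topology of the stable set of t.
    *)
Definition slevel n t u := flst (iter n dyn t) (iter n dyn u) /\
  mdist (iter n dyn t) (iter n dyn u) < small X.

Lemma slevelE n t u :
  (iter n dynV @` local_stable (small X) (iter n dyn t)) u <-> slevel n t u.
Proof.
split=> [[v /(local_stableE sS)[tv ftv] <-]|[ftu tu]].
  by rewrite /slevel iter_dynVK.
exists (iter n dyn u); last by rewrite iter_dynK.
exact/(local_stableE sS).
Qed.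

Lemma slevel_le m n t u : (m <= n)%N -> slevel m t u -> slevel n t u.
Proof.
move=> mn [tu d]; rewrite /slevel -(subnK mn) !iterD; split.
  exact: flst_iter.
exact: le_lt_trans (flst_iter_le sS _ tu) d.
Qed.

Lemma slevel_flst n x t u : slevel n x t -> slevel n x u ->
  flst (iter n dyn t) (iter n dyn u).
Proof.
move=> [xt dt] [xu du]; apply: (flst_trans (flst_sym xt) xu).
apply: le_trans (metric_triangle _ (iter n dyn x) _) _.
by rewrite (splitr (radius S)) lerD // ltW // metric_sym.
Qed.

Lemma slevel_close n : exists2 e, 0 < e & forall x t u,
  slevel n x t -> slevel n x u -> mdist t u < e -> flst t u.
Proof.
have [d d0 dP] := flst_back n; exists d => // x t u xt xu tu.
by apply: dP => //; exact: slevel_flst xu.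
Qed.

Lemma slevel_near n x t : slevel n x t -> exists2 e, 0 < e & forall u,
  mdist t u < e -> flst t u -> slevel n x u.
Proof.
move=> [xt dt]; exists (small X - mdist (iter n dyn x) (iter n dyn t)).
  by rewrite subr_gt0.
move=> u tud tu; have tun := flst_iter n tu.
have xu : mdist (iter n dyn x) (iter n dyn u) < small X.
  apply: le_lt_trans (metric_triangle _ (iter n dyn t) _) _.
  rewrite -ltrBrDl; apply: le_lt_trans tud.
  exact: flst_iter_le.
split=> //; apply: flst_trans tun _ => //.
by apply: le_trans small_rad; exact: ltW.
Qed.

Lemma slevel_stably n t u : slevel n t u -> stably_equivalent t u.
Proof.
move=> [tu _]; apply/cvgrPdist_lt => e e0.
have h i : \forall N \near \oo,
    mdist (iter N dyn (crd t i)) (iter N dyn (crd u i)) < e.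
  have := tu i; rewrite !crd_iter => /(lst_stably sS) /stably_iter.
  move=> /cvgrPdist_lt /(_ _ e0); apply: filterS => N.
  by rewrite sub0r normrN ger0_norm ?mdist_ge0.
have hh : \forall N \near \oo, forall i,
    mdist (iter N dyn (crd t i)) (iter N dyn (crd u i)) < e by exact: filter_forall.
apply: filterS hh => N NP.
rewrite sub0r normrN ger0_norm ?mdist_ge0 //.
by apply: mdist_fiber_lt => // i; rewrite !crd_iter.
Qed.

Lemma stably_slevel t u : stably_equivalent t u -> exists n, slevel n t u.
Proof.
move=> tu.
have tui i : stably_equivalent (crd t i) (crd u i).
  apply: (squeeze_cvgr _ (cvg_cst 0) tu); apply: nearW => n.
  by rewrite mdist_ge0 -!crd_iter mdist_crd.
have h i : \forall N \near \oo, lst (iter N dyn (crd t i)) (iter N dyn (crd u i))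
    /\ mdist (iter N dyn (crd t i)) (iter N dyn (crd u i)) < small X.
  have [N NP] := stably_lst sS small0 (tui i); by exists N.
have hh : \forall N \near \oo, forall i,
    lst (iter N dyn (crd t i)) (iter N dyn (crd u i)) /\
    mdist (iter N dyn (crd t i)) (iter N dyn (crd u i)) < small X.
  exact: filter_forall.
have [N _ /(_ N (leqnn _)) NP] := hh; exists N; split=> [i|].
  by rewrite !crd_iter; case: (NP i).
by apply: mdist_fiber_lt => // i; rewrite !crd_iter; case: (NP i).
Qed.

(** Openness in the stable direction, independent of a base point. *)
Definition sopen E := forall t, E t -> exists2 e, 0 < e &
  forall u, mdist t u < e -> flst t u -> E u.

Section StableSpace.
Variable x : X.
Local Notation L := (stable_space x).

Let inc (t : L) : X := set_val t.

Lemma open_stable_spaceE (U : set L) : open U = @indlim_open X (stable_set x)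
  (fun n => iter n dynV @` local_stable (small X) (iter n dyn x)) U.
Proof. exact: indlim_openE. Qed.

Lemma inc_cont : continuous inc.
Proof.
by apply/continuousP => O oO; rewrite open_stable_spaceE => n; exists O.
Qed.

Lemma open_stable_space (U : set L) :
  (forall t : L, U t -> exists2 e, 0 < e & forall u : L,
     mdist (inc t) (inc u) < e -> flst (inc t) (inc u) -> U u) ->
  open U.
Proof.
move=> sU; rewrite open_stable_spaceE => n.
pose A := [set v : X | forall u : L, inc u = v -> slevel n x v -> U u].
exists (A°); first exact: open_interior.
apply/seteqP; split=> t [Ut Et]; split=> //; last first.
  by apply: (interior_subset Ut) => //; exact/slevelE.
have [e e0 eP] := sU _ Ut; have [d d0 dP] := slevel_close n.
have ed0 : 0 < Num.min e d by rewrite lt_min e0.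
apply: (mdist_nbhs ed0) => v; rewrite lt_min => /andP[tve tvd] u uv xv.
apply: eP; rewrite uv //; apply: (dP x) => //; exact/slevelE.
Qed.

Lemma stable_space_open (U : set L) (t : L) n : open U -> U t -> slevel n x (inc t) ->
  exists2 e, 0 < e & forall u : L, mdist (inc t) (inc u) < e -> slevel n x (inc u) ->
    U u.
Proof.
rewrite open_stable_spaceE => /(_ n)[V oV VE] Ut xt.
have Vt : V (inc t).
  have : (U `&` inc @^-1` (iter n dynV @` local_stable (small X) (iter n dyn x))) t.
    by split=> //; exact/slevelE.
  by rewrite VE => -[].
have /nbhs_mdist[e e0 eP] : nbhs (inc t) V by exact: open_nbhs_nbhs.
exists e => // u tu xu.
have : (inc @^-1` V `&` inc @^-1` (iter n dynV @` local_stable (small X) (iter n dyn x))) u.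
  by split; [exact: eP | exact/slevelE].
by rewrite -VE => -[].
Qed.
End StableSpace.

(** The compact open subsets of stable sets, without the inductive limit
    topology. *)
Lemma compact_open_stableP E : compact_open_stable E <->
  [/\ E !=set0, sopen E, compact E & exists x n, E `<=` slevel n x].
Proof.
split=> [[E0 [x Ex /= [oE kE]]]|[E0 sE kE [x [n En]]]].
- set E' : set (stable_space x) := set_val @^-1` E in oE kE.
  have EE' : E = set_val @` E'.
    apply/seteqP; split=> [t Et|_ [t Et <-]//].
    have xt : t \in stable_set x by apply: mem_set; exact: Ex.
    by exists (exist _ t xt).
  have levelE' (t : stable_space x) : exists n, slevel n x (set_val t).
    by apply: stably_slevel; exact: (set_mem (valP t)).
  split=> //.
  + move=> t Et; have xt : t \in stable_set x by apply: mem_set; exact: Ex.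
    have [n nt] := levelE' (exist _ t xt).
    have [e e0 eP] := @stable_space_open x _ (exist _ t xt) n oE Et nt.
    have [d d0 dP] := slevel_near nt.
    exists (Num.min e d) => [|u]; first by rewrite lt_min e0.
    rewrite lt_min => /andP[tue tud] tu.
    have xu := dP _ tud tu.
    have xu' : u \in stable_set x by apply: mem_set; exact: slevel_stably xu.
    exact: (eP (exist _ u xu')).
  + rewrite EE'; apply: (@cont_on_compact (stable_space x) X E' set_val) kE => t _.
    exact: inc_cont.
  exists x.
  move/compact_near_coveringP: kE.
  move=> /(_ nat \oo (fun n (t : stable_space x) => slevel n x (set_val t)) _) [].
    move=> t _; have [n nt] := levelE' t.
    have on : open [set u : stable_space x | slevel n x (set_val u)].
      apply: open_stable_space => u /slevel_near[e e0 eP]; exists e => // v.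
      exact: eP.
    exists ([set u | slevel n x (set_val u)], [set m | (n <= m)%N]); first split.
    * exact: open_nbhs_nbhs.
    * by exists n.
    by move=> [u m] /= [nu nm]; exact: slevel_le nu.
  move=> n _ /(_ n (leqnn _)) En; exists n => t.
  by rewrite EE' => -[u /En h <-].
have Ex : E `<=` stable_set x by move=> t /En /slevel_stably.
split=> //; exists x => //=; set E' : set (stable_space x) := set_val @^-1` E.
split.
  apply: open_stable_space => t /sE[e e0 eP]; exists e => // u.
  exact: eP.
move=> G PG GE'.
have [t [Et Gt]] : E `&` cluster (set_val @ G) !=set0 by apply: kE.
have xt : t \in stable_set x by apply: mem_set; exact: Ex.
exists (exist _ t xt); split=> // A O GA.
rewrite nbhsE => -[O' [oO' O't] O'O].
have [e e0 eP] := @stable_space_open x _ _ n oO' O't (En _ Et).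
pose B : set X := [set v | exists u : stable_space x, (A u /\ E' u) /\ set_val u = v].
have GB : G (fun u : stable_space x => B (set_val u)).
  by apply: filterS (filterI GA GE') => u AEu; exists u.
have te : nbhs t [set v | mdist t v < e] by exact: mdist_nbhs e0 _.
have [_ [[u [[Au E'u] <-]] tu]] := Gt B _ GB te.
exists u; split=> //; apply: O'O; apply: eP => //; exact: En.
Qed.

Lemma compact_open_stable_sub E F : compact_open_stable E -> F `<=` E ->
  F !=set0 -> sopen F -> compact F -> compact_open_stable F.
Proof.
move=> /compact_open_stableP[_ _ _ [x [n En]]] FE F0 sF kF.
apply/compact_open_stableP; split=> //; exists x, n; exact: subset_trans En.
Qed.

Lemma compact_open_stable_dynV n E : compact_open_stable E ->
  compact_open_stable (iter n dynV @` E).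
Proof.
move=> /compact_open_stableP[[t Et] sE kE [x [m Em]]].
apply/compact_open_stableP; split.
- by exists (iter n dynV t); exists t.
- move=> _ [u Eu <-]; have [e e0 eP] := sE _ Eu.
  have [d d0 dP] := fiber_iter_uniform f sS q n e0.
  exists d => // v uv luv; exists (iter n dyn v); last by rewrite iter_dynK.
  apply: eP; first by have := dP _ _ uv; rewrite iter_dynVK.
  by have := flst_iter n luv; rewrite iter_dynVK.
- apply: cont_on_compact kE => u _.
  exact: (iter_continuous (@fiber_dynV_cont _ _ _ f sS q)).
exists (iter n dynV x), (m + n)%N => _ [u /Em xu <-].
by rewrite /slevel !iterD !iter_dynVK.
Qed.

(** ** The relation of Krieger's dimension group *)

(** After n backward iterations, E and F lie in local stable sets and are in the
    domain of the bracket, which slides each of them onto the other along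
    unstable sets; and the relation is invariant under the dynamics. It is
    important that d does not depend on n. *)
Lemma holonomy_sim : exists2 d, 0 < d & forall n E F (t0 u0 : X),
  compact_open_stable E -> compact_open_stable F ->
  (forall t, E t -> flst (iter n dynV t0) (iter n dynV t) /\
     mdist (iter n dynV t0) (iter n dynV t) < d) ->
  (forall u, F u -> flst (iter n dynV u0) (iter n dynV u) /\
     mdist (iter n dynV u0) (iter n dynV u) < d) ->
  mdist (iter n dynV t0) (iter n dynV u0) < d ->
  (forall t, E t -> exists2 u, F u & flun (iter n dynV t) (iter n dynV u)) ->
  (forall u, F u -> exists2 t, E t & flun (iter n dynV t) (iter n dynV u)) ->
  stable_sim E F.
Proof.
have [d' d'0 d'P] := fiber_br f sS sY q.
have e0 : 0 < Num.min d' (small X) by rewrite lt_min d'0.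
set e := Num.min d' (small X) in e0; exists (e / 3); first by rewrite divr_gt0.
have e3e : e / 3 < e by rewrite ltr_pdivrMr // ltr_pMr // ltr1n.
have es : e <= small X by rewrite /e ge_min lexx orbT.
have ed : e <= d' by rewrite /e ge_min lexx.
move=> n E F t0 u0 cE cF Et0 Fu0 tu0 EF FE.
suff main : stable_sim (iter n dynV @` E) (iter n dynV @` F).
  have dynE (A : set X) : A = iter n dyn @` (iter n dynV @` A).
    rewrite image_comp (_ : _ \o _ = id) ?image_id //.
    by apply/funext => t; exact: iter_dynVK.
  rewrite (dynE E) (dynE F).
  elim: n (iter n dynV @` E) (iter n dynV @` F) main {cE cF Et0 Fu0 tu0 EF FE dynE}.
    by move=> A B; rewrite !image_id.
  move=> m IH A B /IH /Sim_dyn; rewrite !image_comp.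
  by rewrite (_ : dyn \o iter m dyn = iter m.+1 dyn).
have imE (A : set X) t : A t -> (iter n dynV @` A) (iter n dynV t) by exists t.
have close a b : (iter n dynV @` E) a -> (iter n dynV @` F) b ->
    [/\ mdist a b < e, brdom a b & brdom b a].
  move=> [t Et <-] [u Fu <-].
  have [_ tt0] := Et0 _ Et; have [_ uu0] := Fu0 _ Fu.
  have ab : mdist (iter n dynV t) (iter n dynV u) < e.
    apply: le_lt_trans (metric_triangle _ (iter n dynV t0) _) _.
    apply: le_lt_trans (lerD (lexx _) (metric_triangle _ (iter n dynV u0) _)) _.
    rewrite [X in _ < X](_ : e = e / 3 + (e / 3 + e / 3)); last by field.
    by rewrite ltrD // ?ltrD // metric_sym.
  by have [] := d'P _ _ (lt_le_trans ab ed).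
have ler1 (a b : X) : mdist a b < e -> mdist a b <= radius S.
  by move=> h; apply: ltW; apply: lt_le_trans h (le_trans es small_rad).
have Eflst t t' : E t -> E t' -> flst (iter n dynV t) (iter n dynV t').
  move=> /Et0[h1 d1] /Et0[h2 d2]; apply: (flst_trans (flst_sym h1) h2).
  apply: ler1; apply: le_lt_trans (metric_triangle _ (iter n dynV t0) _) _.
  rewrite [X in _ < X](_ : e = e / 3 + (e / 3 + e / 3)); last by field.
  rewrite ltrD ?(metric_sym _ (iter n dynV t0)) //.
  by apply: lt_trans d2 _; rewrite ltrDl divr_gt0.
have Fflst u u' : F u -> F u' -> flst (iter n dynV u) (iter n dynV u').
  move=> /Fu0[h1 d1] /Fu0[h2 d2]; apply: (flst_trans (flst_sym h1) h2).
  apply: ler1; apply: le_lt_trans (metric_triangle _ (iter n dynV u0) _) _.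
  rewrite [X in _ < X](_ : e = e / 3 + (e / 3 + e / 3)); last by field.
  rewrite ltrD ?(metric_sym _ (iter n dynV u0)) //.
  by apply: lt_trans d2 _; rewrite ltrDl divr_gt0.
have brE (a b c : X) : brdom a b -> flst a c -> flun c b ->
    mdist a b <= radius S -> br a b = c.
  move=> bab ac cb ab; apply: crd_ext => i; rewrite crd_br //.
  rewrite -(br_lun sS (cb i)) ?(ac i).2 //; first by case: (ac i).
  exact: le_trans (mdist_crd _ _ _) ab.
have flun_sym (a b : X) : flun a b -> flun b a.
  by move=> ab i; exact: lun_sym.
apply: Sim_br.
- exact: compact_open_stable_dynV.
- exact: compact_open_stable_dynV.
- split.
  + exists (iter n dynV t0) => _ [t /Et0[h d] <-]; apply/(local_stableE sS).
    by split=> //; apply: lt_le_trans es; exact: lt_trans e3e.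
  + exists (iter n dynV u0) => _ [u /Fu0[h d] <-]; apply/(local_stableE sS).
    by split=> //; apply: lt_le_trans es; exact: lt_trans e3e.
  move=> a b Ea Fb; have [ab ? ?] := close _ _ Ea Fb; split=> //.
  by apply: ltW; exact: lt_le_trans es.
- apply/seteqP; split=> [_ [_ [t Et <-] [_ [u Fu <-] <-]]|_ [t Et <-]].
    have [t' Et' t'u] := FE _ Fu.
    have [ab bab _] := close (iter n dynV t) (iter n dynV u)
      (imE _ _ Et) (imE _ _ Fu).
    have -> := brE _ _ _ bab (Eflst _ _ Et Et') t'u (ler1 _ _ ab).
    by exists t'.
  have [u Fu tu] := EF _ Et.
  exists (iter n dynV t); first by exists t.
  exists (iter n dynV u); first by exists u.
  have [ab bab _] := close (iter n dynV t) (iter n dynV u)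
    (imE _ _ Et) (imE _ _ Fu).
  exact: brE bab (flst_refl _) tu (ler1 _ _ ab).
apply/seteqP; split=> [_ [_ [u Fu <-] [_ [t Et <-] <-]]|_ [u Fu <-]].
  have [u' Fu' tu'] := EF _ Et.
  have [ab _ bab] := close (iter n dynV t) (iter n dynV u)
    (imE _ _ Et) (imE _ _ Fu).
  rewrite metric_sym in ab.
  have -> := brE _ _ _ bab (Fflst _ _ Fu Fu') (flun_sym _ _ tu') (ler1 _ _ ab).
  by exists u'.
have [t Et tu] := FE _ Fu.
exists (iter n dynV u); first by exists u.
exists (iter n dynV t); first by exists t.
have [ab _ bab] := close (iter n dynV t) (iter n dynV u)
  (imE _ _ Et) (imE _ _ Fu).
rewrite metric_sym in ab.
exact: brE bab (flst_refl _) (flun_sym _ _ tu) (ler1 _ _ ab).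
Qed.
End StableSets.

(** ** The dimension group *)

Section DimensionGroup.
Variables (R : realType) (X : system R).
Implicit Types E F : set X.

(** Extended by 0, which is the natural class of the empty set. *)
Definition dclass E : dimension_group X :=
  if pselect (compact_open_stable E) is left h
  then dim_class (exist _ E (mem_set h)) else 0.

Lemma dclassE E (h : E \in @compact_open_stable R X) :
  dclass E = dim_class (exist _ E h).
Proof.
rewrite /dclass; case: pselect => [h'|[]]; last exact: set_mem.
by congr dim_class; apply: eq_exist.
Qed.

Lemma dclass0 : dclass set0 = 0.
Proof. by rewrite /dclass; case: pselect => // -[[]]. Qed.

Lemma dclass_sim E F : compact_open_stable E -> compact_open_stable F ->
  stable_sim E F -> dclass E = dclass F.
Proof.
move=> hE hF EF; rewrite (dclassE (mem_set hE)) (dclassE (mem_set hF)).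
apply/eqP; rewrite -subr_eq0 -raddfB; apply/eqP/zmod_class_eq0.
by apply: span_sub; left; exists (exist _ E (mem_set hE)), (exist _ F (mem_set hF)).
Qed.

Lemma dclassU E F : compact_open_stable (E `|` F) ->
  E = set0 \/ compact_open_stable E -> F = set0 \/ compact_open_stable F ->
  E `&` F = set0 -> dclass (E `|` F) = dclass E + dclass F.
Proof.
move=> hEF [->|hE]; first by rewrite set0U dclass0 add0r.
move=> [->|hF]; first by rewrite setU0 dclass0 addr0.
move=> EF0; rewrite (dclassE (mem_set hE)) (dclassE (mem_set hF)).
rewrite (dclassE (mem_set hEF)); apply/eqP; rewrite -subr_eq0 -raddfD -raddfB.
apply/eqP/zmod_class_eq0; apply: span_sub; right.
by exists (exist _ E (mem_set hE)), (exist _ F (mem_set hF)),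
  (exist _ (E `|` F) (mem_set hEF)).
Qed.

Lemma dimension_group_gen (P : set (dimension_group X)) :
  P 0 -> (forall x y, P x -> P y -> P (x - y)) ->
  (forall E, compact_open_stable E -> P (dclass E)) -> forall u, P u.
Proof.
move=> P0 PB Pd u; have [v ->] := zmod_class_surj u.
move: v; apply: (@freeg_gen _ (fun v => P (zmod_class _ v))).
- by rewrite raddf0.
- by move=> x y Px Py; rewrite raddfB; exact: PB.
move=> [E hE]; have := Pd E (set_mem hE).
by rewrite (dclassE hE).
Qed.
End DimensionGroup.

Section Count.
Variables (R : realType) (S Y : system R) (f : factor_map S Y).
Hypotheses (sS : smale_axioms S) (sY : smale_axioms Y) (fb : s_bijective f).
Hypothesis zS : zero_dimensional S.
Variable q : nat.
Local Notation X := (fiber_product f q).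
Variable rn : nat -> X -> X.
Hypothesis rnP : retractions rn.
Implicit Types (t u v x : X) (E F : set X).

Let kX : compact [set: X]. Proof. exact: fiber_compact. Qed.
Let hX : hausdorff_space X. Proof. exact: fiber_hausdorff. Qed.

(** E is a finite union of small stable pieces, on which rn n is injective. *)
Lemma retraction_fiber_finite E n b : compact_open_stable E ->
  finite_set (E `&` rn n @^-1` [set b]).
Proof.
move=> /(compact_open_stableP sS)[_ _ kE [x [m Em]]].
have cE : closed E by exact: compact_closed.
pose P U := finite_set (U `&` (E `&` rn n @^-1` [set b])).
have : P setT; last by rewrite /P setTI.
apply: (compact_open_ind hX (fiber_co_basis sS zS (q := q))).
- exact: fiber_compact_openT.
- by rewrite /P set0I.
- by move=> V V' *; rewrite /P setIUl finite_setU.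
have [d d0 dP] := rn_inj rnP n; have [e e0 eP] := slevel_close f sS q m.
move=> t _.
have de0 : 0 < Num.min d e / 2 by rewrite divr_gt0 // lt_min d0.
exists [set u | mdist t u < Num.min d e / 2]; first exact: mdist_nbhs de0 _.
move=> M _ Mt _; rewrite /P.
have [[u [Mu [Eu ru]]]|M0] := pselect (exists u, M u /\ E u /\ rn n u = b).
  apply: (@sub_finite_set _ _ [set u]); last exact: finite_set1.
  move=> v [Mv [Ev /= rv]]; have : mdist v u < Num.min d e.
    apply: le_lt_trans (metric_triangle _ t _) _.
    by rewrite [X in _ < X]splitr ltrD // ?(metric_sym v); exact: Mt.
  rewrite lt_min => /andP[vud vue]; apply: dP => //; last by rewrite rv.
  exact: eP (Em _ Ev) (Em _ Eu) vue.
apply: (@sub_finite_set _ _ set0); last exact: finite_set0.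
by move=> u [Mu [Eu ru]]; apply: M0; exists u.
Qed.

(** For large n, this number only depends on the class of E. It is the invariant
    through which the vanishing of a combination of classes is used. *)
Definition count n E b : int := \sum_(t \in E `&` rn n @^-1` [set b]) (1 : int).

Lemma count_dyn n E b : count n.+1 (dyn @` E) b = count n E (dynV b).
Proof.
rewrite /count (_ : _ `&` _ = dyn @` (E `&` rn n @^-1` [set dynV b])).
  by rewrite fsbig_image // => t u _ _; exact: (can_inj (@dynK _ _)).
apply/seteqP; split=> [_ [[t Et <-] rt]|_ [t [Et rt] <-]].
  exists t => //; split=> //.
  have {}rt : rn n.+1 (dyn t) = b := rt.
  by rewrite -rt (rn_dyn rnP) dynK.
have {}rt : rn n t = dynV b := rt.
split; first by exists t.
by have -> : b = rn n.+1 (dyn t) by rewrite (rn_dyn rnP) rt dynVK.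
Qed.

(** The bracket matches the points of two bracketable sets along local unstable
    sets; by contraction, matched points are uniformly close after enough
    backward iterations, and are then identified by the retractions. *)
Lemma count_sim E F : stable_sim E F ->
  exists N, forall n, (N <= n)%N -> forall b, count n E b = count n F b.
Proof.
elim=> {E F} [E|E F _ [N NP]|E F G _ [N NP] _ [M MP]|E F cE cF EF EFE FEF|
  E F _ [N NP]|E F _ [N NP]].
- by exists 0.
- by exists N => n Nn b; rewrite NP.
- exists (maxn N M) => n; rewrite geq_max => /andP[Nn Mn] b.
  by rewrite NP // MP.
- have [d d0 dP] := rn_eq rnP.
  have [lam [l0 l1 con]] := lst_iter_dist (reverse_axioms sS).
  have [N NP] := geometric_small (small X) l0 l1 d0.
  exists N => n Nn b; have [[xE Ex] [xF Fx] EFd] := EF.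
  have [[t0 Et0] _] := cE; have [[u0 Fu0] _] := cF.
  have srE (A : set X) x : A `<=` local_stable (small X) x ->
      forall t u, A t -> A u -> flst t u.
    move=> Ax t u /Ax/(local_stableE sS)[tx ltx] /Ax/(local_stableE sS)[ux lux].
    apply: (flst_trans sS (flst_sym sS ltx) lux).
    apply: le_trans (metric_triangle _ x _) _.
    by rewrite (splitr (radius S)) lerD // ltW // metric_sym.
  have lE := srE _ _ Ex; have lF := srE _ _ Fx.
  have brF t u : E t -> F u -> F (br u t) /\ flun (br u t) t.
    move=> Et Fu; have Fut : F (br u t) by rewrite -FEF; exists u => //; exists t.
    split=> // i; have [ut _ but] := EFd _ _ Et Fu.
    rewrite crd_br //; apply: (lun_br sS); first by apply/(sa_brdom sS); exact: (but.1 i).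
    have [d' b1 b2] := EFd _ _ Et Fut; rewrite -crd_br //.
    by apply/(sa_brdom sS); exact: (b2.1 i).
  have brE t u : E t -> F u -> E (br t u) /\ flun (br t u) u.
    move=> Et Fu; have Etu : E (br t u) by rewrite -EFE; exists t => //; exists u.
    split=> // i; have [ut but _] := EFd _ _ Et Fu.
    rewrite crd_br //; apply: (lun_br sS); first by apply/(sa_brdom sS); exact: (but.1 i).
    have [d' b1 b2] := EFd _ _ Etu Fu; rewrite -crd_br //.
    by apply/(sa_brdom sS); exact: (b1.1 i).
  have rEF t u : E t -> F u -> flun t u -> rn n t = rn n u.
    move=> Et Fu tu; have [tud _ _] := EFd _ _ Et Fu.
    apply: (dP n) => // [|i]; last by rewrite !crd_iterV; exact: lun_iter.
    apply: le_lt_trans (NP _ Nn); rewrite [leLHS]mdist_fiberE.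
    apply/bigmax_leP; split=> [|i _].
      by rewrite mulr_ge0 ?exprn_ge0 ?(ltW l0) // ltW // (small_gt0 sS).
    rewrite !crd_iterV; have /(lst_reverse sS) tui := tu i.
    apply: le_trans (con n _ _ tui) _; rewrite ler_wpM2l ?exprn_ge0 ?(ltW l0) //.
    exact: le_trans (mdist_crd _ _ _) tud.
  have luns t u : flun t u -> flun u t by move=> tu i; exact: lun_sym.
  have uniqF t u u' : E t -> F u -> F u' -> flun t u -> flun t u' -> u = u'.
    move=> Et Fu Fu' tu tu'; apply: crd_ext => i.
    apply: (lst_lun_eq (lF _ _ Fu Fu' i)).
    apply: (lun_trans sS (lun_sym sS (tu i)) (tu' i)).
    by case: (lF _ _ Fu Fu' i).
  have uniqE t t' u : E t -> E t' -> F u -> flun t u -> flun t' u -> t = t'.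
    move=> Et Et' Fu tu tu'; apply: crd_ext => i.
    apply: (lst_lun_eq (lE _ _ Et Et' i)).
    apply: (lun_trans sS (tu i) (lun_sym sS (tu' i))).
    by case: (lE _ _ Et Et' i).
  rewrite /count [RHS](reindex_fsbig (fun t => br u0 t)
    (E `&` rn n @^-1` [set b])) //; split.
  + move=> t [Et /= rt]; have [Fut ut] := brF _ _ Et Fu0; split=> //=.
    by rewrite -rt; apply/esym/rEF => //; exact: luns.
  + move=> t t' /set_mem[Et _] /set_mem[Et' _] tt'.
    have [Fut ut] := brF _ _ Et Fu0; have [Fut' ut'] := brF _ _ Et' Fu0.
    apply: (uniqE _ _ (br u0 t)) => //; first exact: luns.
    by rewrite tt'; exact: luns.
  move=> u [Fu /= ru]; have [Etu tu] := brE _ _ Et0 Fu.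
  have [Fut ut] := brF _ _ Etu Fu0.
  exists (br t0 u); last by apply: (uniqF (br t0 u)) => //; exact: luns.
  by split=> //=; rewrite -ru; exact: rEF.
- exists N.+1 => -[//|n] Nn b; rewrite !count_dyn; exact: NP.
exists N => n Nn b; have := NP n.+1 (leqW Nn) (dyn b).
by rewrite !count_dyn dynK.
Qed.

Lemma dclass_sum_count (I : Type) (r : seq I) (E : I -> set X) (m : I -> int) :
  (forall i, E i = set0 \/ compact_open_stable (E i)) ->
  \sum_(i <- r) dclass (E i) *~ m i = 0 ->
  exists N, forall n, (N <= n)%N -> forall b,
    \sum_(i <- r) count n (E i) b *~ m i = 0.
Proof.
move=> cE sE0.
pose e i : {freeg co_set X} :=
  if pselect (compact_open_stable (E i)) is left h
  then << exist _ (E i) (mem_set h) >> else 0.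
pose cnt n b : {additive {freeg co_set X} -> int} :=
  frlift (fun A : co_set X => count n (set_val A) b).
have eE i : zmod_class (@dimension_relations R X) (e i) = dclass (E i).
  rewrite /e; case: pselect => [h|nh]; first by rewrite (dclassE (mem_set h)).
  by case: (cE i) => // ->; rewrite raddf0 dclass0.
have cntE n b i : cnt n b (e i) = count n (E i) b.
  rewrite /e; case: pselect => [h|nh]; first by rewrite /= frliftU.
  by case: (cE i) => // ->; rewrite raddf0 /count set0I fsbig_set0.
pose v : {freeg co_set X} := \sum_(i <- r) e i *~ m i.
have : v \in span_pred (@dimension_relations R X).
  apply/zmod_class_eq0; rewrite -[RHS]sE0 raddf_sum; apply: eq_bigr => i _.
  by rewrite raddfMz /= eE.
pose P := [set v | exists N, forall n, (N <= n)%N -> forall b, cnt n b v = 0].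
suff vP : v \in span_pred (@dimension_relations R X) -> P v.
  move=> /vP[N NP]; exists N => n Nn b; rewrite -[RHS](NP n Nn b) raddf_sum.
  by apply: eq_bigr => i _; rewrite raddfMz cntE.
apply: spanP => {v} [|v w [N NP] [M MP]|v].
- by exists 0 => n _ b; rewrite raddf0.
- exists (maxn N M) => n; rewrite geq_max => /andP[Nn Mn] b.
  by rewrite raddfB /= NP // MP // subrr.
case=> [[A [B [AB ->]]]|[A [B [C [AB0 CAB ->]]]]].
  have [N NP] := count_sim AB; exists N => n Nn b.
  by rewrite raddfB /= !frliftU NP // subrr.
exists 0 => n _ b; rewrite raddfB raddfD /= !frliftU CAB /count setIUl.
rewrite fsbigU0 ?subrr //.
- by apply: retraction_fiber_finite; exact: set_mem (valP A).
- by apply: retraction_fiber_finite; exact: set_mem (valP B).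
by move=> t [[At _] [Bt _]]; have : (set_val A `&` set_val B) t by []; rewrite AB0.
Qed.
End Count.

(** ** Functoriality of the dimension group *)

Section Omit.
Variables (R : realType) (S Y : system R) (f : factor_map S Y).
Hypotheses (sS : smale_axioms S) (sY : smale_axioms Y) (fb : s_bijective f).
Variables (q : nat) (k : 'I_q.+2).
Local Notation X := (fiber_product f q.+1).
Local Notation X' := (fiber_product f q).
Implicit Types (t u v x : X) (E F : set X).
Local Notation del := (@omit R S Y f q k).

Lemma crd_omit t i : crd (del t) i = crd t (fintype.lift k i).
Proof. by []. Qed.

Lemma base_omit t : base (del t) = base t.
Proof. by rewrite /base crd_omit f_crd. Qed.

Lemma omit_cont : continuous del.
Proof.
move=> t; apply: cont_at_fiber => i.
exact: (@crd_cont _ _ _ f q.+1 (fintype.lift k i)).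
Qed.

Lemma omit_iter n t : del (iter n dyn t) = iter n dyn (del t).
Proof. by apply: crd_ext => i; rewrite crd_omit !crd_iter. Qed.

Lemma flst_omit t u : flst t u -> flst (del t) (del u).
Proof. by move=> tu i; exact: tu. Qed.

Lemma mdist_omit t u : mdist (del t) (del u) <= mdist t u.
Proof.
rewrite [leLHS]mdist_fiberE; apply/bigmax_leP; split=> [|i _].
  exact: mdist_ge0.
exact: (mdist_crd t u (fintype.lift k i)).
Qed.

Lemma slevel_omit n t u : slevel n t u -> slevel n (del t) (del u).
Proof.
move=> [tu d]; rewrite /slevel -!omit_iter; split; first exact: flst_omit.
exact: le_lt_trans (mdist_omit _ _) d.
Qed.

Lemma fmap_lst e : 0 < e -> exists2 d, 0 < d & forall a b : S,
  lst a b -> mdist a b < d -> lst (f a) (f b) /\ mdist (f a) (f b) < e.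
Proof.
move=> e0; have [d d0 dP] := fmap_br f sS sY.
have [d' d'0 d'P] := fmap_uniform f sS e0.
exists (Num.min d d') => [|a b [ab bab]]; first by rewrite lt_min d0.
rewrite lt_min => /andP[/dP[_ fab fbr] /d'P fabe]; split=> //.
by split=> //; rewrite -fbr bab.
Qed.

Lemma slevel_omit_inj n x t u : slevel n x t -> slevel n x u ->
  del t = del u -> t = u.
Proof.
move=> xt xu dtu; apply: (can_inj (iter_dynK n)).
apply: (flst_base_inj sS fb (slevel_flst sS xt xu)).
by rewrite !base_iter -!(base_omit t) -(base_omit u) dtu.
Qed.

(** Openness of the image holds since a stable move of the remaining coordinates
    moves the base, hence lifts to the omitted one. *)
Lemma compact_open_stable_omit E : compact_open_stable E ->
  compact_open_stable (del @` E).
Proof.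
move=> /(compact_open_stableP sS)[[t Et] sE kE [x [n En]]].
apply/(compact_open_stableP sS); split.
- by exists (del t); exists t.
- move=> _ [u Eu <-]; have [e e0 eP] := sE _ Eu.
  have [d d0 dP] := flst_lift sS sY fb q.+1 e0.
  have d10 : 0 < Num.min d (radius Y) by rewrite lt_min d0 (sa_radius sY).
  have [d' d'0 d'P] := fmap_lst d0.
  have er0 : 0 < Num.min e (radius S / 2).
    by rewrite lt_min e0 divr_gt0 // (sa_radius sS).
  have [d2 d20 d2P] := flst_lift sS sY fb q.+1 er0.
  have [d3 d30 d3P] := fmap_lst d20.
  exists (Num.min d3 (radius S / 2)) => [|v].
    by rewrite lt_min d30 divr_gt0 // (sa_radius sS).
  rewrite lt_min => /andP[uv uv'] luv.
  have [lb db] := d3P _ _ (luv ord0) (le_lt_trans (mdist_crd _ _ _) uv).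
  rewrite -/(base (del u)) -/(base v) base_omit in lb db.
  have [w [bw luw]] := d2P _ _ lb db; rewrite lt_min => /andP[uw uw'].
  exists w; first exact: eP.
  apply: (flst_base_inj sS fb); last by rewrite base_omit.
  apply: (flst_trans sS (flst_sym sS (flst_omit luw)) luv).
  apply: le_trans (metric_triangle _ (del u) _) _.
  rewrite (splitr (radius S)) lerD // ltW // metric_sym.
  exact: le_lt_trans (mdist_omit _ _) uw'.
- by apply: cont_on_compact kE => u _; exact: omit_cont.
by exists (del x), n => _ [u /En xu <-]; exact: slevel_omit.
Qed.

Lemma stable_sim_omit E F : stable_sim E F -> stable_sim (del @` E) (del @` F).
Proof.
have dynE (A : set X) : del @` (dyn @` A) = dyn @` (del @` A).
  by rewrite !image_comp; congr image; apply/funext => t; exact: (omit_iter 1).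
have brE A B : (forall a b, A a -> B b -> brdom a b) ->
    set_br (del @` A) (del @` B) = del @` set_br A B.
  move=> AB.
  have delbr a b : A a -> B b -> br (del a) (del b) = del (br a b).
    move=> Aa Bb; have ab := AB _ _ Aa Bb; apply: crd_ext => i.
    have bd : brdom (del a) (del b).
      by case: ab => h1 h2; split=> [j|i' j']; [exact: h1 | exact: h2].
    by rewrite crd_omit !crd_br.
  apply/seteqP; split=> [_ [_ [a Aa <-] [_ [b Bb <-] <-]]|_ [_ [a Aa [b Bb <-]] <-]].
    by rewrite delbr //; exists (br a b) => //; exists a => //; exists b.
  by rewrite -delbr //; exists (del a); [exists a | exists (del b); [exists b |]].
elim=> {E F} [E|E F _ h|E F G _ h _ h'|E F cE cF EF EFE FEF|E F _ h|E F _ h].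
- exact: Sim_refl.
- exact: Sim_sym.
- exact: Sim_trans h h'.
- have [[xE Ex] [xF Fx] EFd] := EF.
  have loc (A : set X) x : A `<=` local_stable (small X) x ->
      del @` A `<=` local_stable (small X') (del x).
    move=> Ax _ [t /Ax/(local_stableE sS)[xt lxt] <-].
    apply/(local_stableE sS); split; last exact: flst_omit.
    exact: le_lt_trans (mdist_omit _ _) xt.
  apply: Sim_br.
  + exact: compact_open_stable_omit.
  + exact: compact_open_stable_omit.
  + split; [by exists (del xE); exact: loc | by exists (del xF); exact: loc |].
    move=> _ _ [t Et <-] [u Fu <-]; have [tu [h1 h2] [h3 h4]] := EFd _ _ Et Fu.
    split; first exact: le_trans (mdist_omit _ _) tu.
      by split=> [j|i' j']; [exact: h1 | exact: h2].
    by split=> [j|i' j']; [exact: h3 | exact: h4].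
  + by rewrite brE ?EFE // => a b Ea Fb; case: (EFd _ _ Ea Fb).
  by rewrite brE ?FEF // => a b Fa Eb; case: (EFd _ _ Eb Fa).
- by rewrite !dynE; exact: Sim_dyn.
by apply: Sim_dynV; rewrite -!dynE.
Qed.

Lemma dimension_map_omit E : compact_open_stable E ->
  dimension_map del (dclass E) = dclass (del @` E).
Proof.
have [g gP] : exists g : {additive dimension_group X -> dimension_group X'},
    forall w, g (zmod_class _ w) =
      frlift (fun A : co_set X => dclass (del @` set_val A)) w.
  apply: zmod_presented_lift => s.
  have cval (A : co_set X) : compact_open_stable (set_val A).
    exact: set_mem (valP A).
  case=> [[A [B [AB ->]]]|[A [B [C [AB0 CAB ->]]]]].
    rewrite raddfB /= !frliftU (dclass_sim _ _ (stable_sim_omit AB)) ?subrr //.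
      exact: compact_open_stable_omit.
    exact: compact_open_stable_omit.
  rewrite raddfB raddfD /= !frliftU CAB image_setU dclassU ?subrr //.
  - by rewrite -image_setU -CAB; exact: compact_open_stable_omit.
  - by right; exact: compact_open_stable_omit.
  - by right; exact: compact_open_stable_omit.
  apply/seteqP; split=> // _ [[t At <-] [u Bu dut]].
  have [_ _ _ [x [n Cn]]] := (compact_open_stableP sS _).1 (cval C).
  have : t = u.
    apply: (@slevel_omit_inj n x) => //; apply: Cn; rewrite CAB.
      by left.
    by right.
  move=> tu; have : (set_val A `&` set_val B) u by split=> //; rewrite -tu.
  by rewrite AB0.
have : [set g : {additive dimension_group X -> dimension_group X'} |
    forall A : co_set X, exists2 A' : co_set X',
    set_val A' = del @` set_val A & g (dim_class A) = dim_class A']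
    (dimension_map del).
  apply: the_additiveP; exists g => -[A hA].
  have hA' := mem_set (compact_open_stable_omit (set_mem hA)).
  exists (exist _ (del @` A) hA') => //.
  by rewrite /dim_class gP frliftU (dclassE hA').
move=> h cE; rewrite (dclassE (mem_set cE)).
have [[A' hA'] /= A'E ->] := h (exist _ E (mem_set cE)).
have {}A'E : A' = del @` E := A'E.
by move: hA'; rewrite A'E => hA'; rewrite (dclassE hA').
Qed.
End Omit.

(** * Principal bibundles *)

Lemma locally_compact_nbhs (X : topologicalType) (x : X) :
  locally_compact [set: X] -> exists2 K, nbhs x K & compact K.
Proof.
move=> /(_ x I)[K xK [kK _]]; exists K => //.
by move: xK; rewrite /within /=; apply: filterS => y; apply.
Qed.

Lemma hausdorff_eq (X : topologicalType) (x y : X) : hausdorff_space X ->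
  (forall A B, nbhs x A -> nbhs y B -> A `&` B !=set0) -> x = y.
Proof. by move=> hX xy; apply: hX => A B; exact: xy. Qed.

Lemma local_homeomorphism_etale (X Y : topologicalType) (d : X -> Y) :
  local_homeomorphism d -> etale_map d.
Proof.
move=> ld; split=> [x|O oO|x].
- have [A [g [[oA Ax] odA cdA _ _]]] := ld x.
  have /subspace_continuousP := cdA => /(_ x Ax) h W /h hW.
  have nA : nbhs x A by exact: open_nbhs_nbhs.
  apply: filterS2 nA hW => y Ay; rewrite /= /within /=.
  by apply.
- rewrite openE => _ [x Ox <-].
  have [A [g [[oA Ax] odA _ cgA gd]]] := ld x.
  have dAx : (d @` A) (d x) by exists x.
  have /subspace_continuousP := cgA => /(_ (d x) dAx) h.
  have nO : nbhs (g (d x)) (A `&` O).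
    by rewrite gd //; apply: open_nbhs_nbhs; split=> //; exact: openI.
  have {}h := h _ nO; have nA : nbhs (d x) (d @` A) by exact: open_nbhs_nbhs.
  apply: filterS2 nA h => _ [y Ay <-] /(_ (ex_intro2 _ _ y Ay erefl)).
  by move=> [_ Ogy]; exists y => //; rewrite -(gd y).
have [A [g [[oA Ax] _ _ _ gd]]] := ld x; exists A; split=> // s t As At dst.
by rewrite -(gd s) // dst gd.
Qed.

Section OrbitSpace.
Variables (T U : topologicalType) (orb : T -> set T) (a : T -> U).
Hypothesis ha : induces_homeomorphism orb a.

Lemma induces_quotient D : open (a @^-1` D) -> open D.
Proof.
have [h [ch [k [ck hk kh]]] hE] := ha => oD.
have : open (h @^-1` D).
  by rewrite orbit_openE -comp_preimage (_ : h \o _ = a) //; apply/funext.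
move=> /(preimage_open ck); rewrite -comp_preimage.
by rewrite (_ : h \o k = id) //; apply/funext.
Qed.

Lemma induces_surj y : exists z, a z = y.
Proof.
have [h [ch [k [ck hk kh]]] hE] := ha.
have [z _ zE] : range orb (set_val (k y)) by exact: (set_mem (valP (k y))).
exists z; rewrite -hE -[RHS]kh; congr h.
by case: (k y) zE => A hA /= zA; exact: eq_exist.
Qed.

Lemma induces_orbit z z' : a z = a z' -> orb z = orb z'.
Proof.
have [h [ch [k [ck hk kh]]] hE] := ha.
by rewrite -!hE => /(can_inj hk)/(congr1 set_val).
Qed.
End OrbitSpace.

Section ProperAction.
Variables (K : groupoid) (Z : topologicalType) (rho : Z -> obj K).
Variable act : arr K -> Z -> Z.
Hypotheses (actP : left_action rho act) (freeP : free_action rho act).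
Hypotheses (properP : proper_action rho act) (hZ : hausdorff_space Z).
Hypothesis lcZ : locally_compact [set: Z].

Lemma free_action_eq g h z : src g = rho z -> src h = rho z ->
  act g z = act h z -> g = h.
Proof.
move=> gz hz ghz.
have rgh : rng g = rng h by rewrite -(la_rng actP gz) -(la_rng actP hz) ghz.
have ivz : src (inv h) = rng g by rewrite src_inv rgh.
have kz : src (comp (inv h) g) = rho z by rewrite src_comp.
have := freeP kz; rewrite (la_comp actP) // ghz -(la_comp actP) ?src_inv //.
rewrite compVg hz (la_idt actP) => /(_ erefl) kE.
by rewrite -[LHS]comp1g rgh -compgV compA ?kE ?src_inv ?rng_inv // -hz compg1.
Qed.

(** Otherwise the arrows g t outside of O would have a cluster point, by
    properness; it maps z x to z' x, hence is g x by freeness. *)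
Lemma division_near (X : topologicalType) (z z' : X -> Z) (g : X -> arr K)
    (D : set X) x O :
  cont_at z x -> cont_at z' x -> D x ->
  (forall t, D t -> src (g t) = rho (z t) /\ act (g t) (z t) = z' t) ->
  nbhs (g x) O -> \forall t \near x, D t -> O (g t).
Proof.
move=> cz cz' Dx gE; have [gx gzx] := gE _ Dx.
have [K1 nK1 kK1] := locally_compact_nbhs (z x) lcZ.
have [K2 nK2 kK2] := locally_compact_nbhs (z' x) lcZ.
have kC := properP (compact_setX kK2 kK1).
rewrite nbhsE => -[O' [oO' O'g] O'O].
apply: contrapT => nO.
(* the arrows g t outside of O', for t near x *)
pose F := filter_from (nbhs x) (fun W => [set p | exists t, [/\ W t, ~ O' (g t),
  src (g t) = rho (z t), act (g t) (z t) = z' t & p = (g t, z t)]]).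
have PF : ProperFilter F.
  apply: filter_from_proper.
    apply: filter_from_filter; first by exists setT; exact: filterT.
    move=> A B xA xB; exists (A `&` B); first exact: filterI.
    by move=> p [t [[At Bt] nt s1 s2 ->]]; split; exists t.
  move=> W xW; apply: contrapT => W0; apply: nO.
  apply: filterS xW => t Wt /gE[s1 s2]; apply: O'O; apply: contrapT => nt.
  by apply: W0; exists (g t, z t), t.
have FC : F [set p | src p.1 = rho p.2 /\ (K2 `*` K1) (act p.1 p.2, p.2)].
  exists ((z @^-1` K1) `&` (z' @^-1` K2)).
    by apply: filterI; [exact: cz | exact: cz'].
  by move=> _ [t [[z1 z2] _ s1 s2 ->]]; split=> //; split=> //=; rewrite s2.
have [[g1 z1] [[/= gz1 _] clF]] := kC _ PF FC.
have Fz W : nbhs (z x) W -> F [set p | W p.2].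
  by move=> nW; exists (z @^-1` W) => [|_ [t [Wt _ _ _ ->]]] //; exact: cz.
have Fz' W : nbhs (z' x) W -> F [set p | src p.1 = rho p.2 /\ W (act p.1 p.2)].
  move=> nW; exists (z' @^-1` W) => [|_ [t [Wt _ s1 s2 ->]]]; first exact: cz'.
  by split=> //=; rewrite s2.
have z1E : z1 = z x.
  apply: hausdorff_eq => // A B z1A zxB.
  have nA : nbhs (g1, z1) [set p : arr K * Z | A p.2].
    by exists (setT, A) => [|[? ?] []] //; split => //; exact: filterT.
  by have [[g' z''] [/= Bz Az]] := clF _ _ (Fz _ zxB) nA; exists z''.
have g1E : act g1 z1 = z' x.
  apply: hausdorff_eq => // A B gA zxB.
  have /subspace_continuousP := la_continuous actP => /(_ (g1, z1) gz1 _ gA).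
  rewrite /within /= => nA.
  have [[g' z''] [/= [s1 Bz] Az]] := clF _ _ (Fz' _ zxB) nA.
  by exists (act g' z''); split=> //; exact: Az.
have g1g : g1 = g x.
  by apply: (@free_action_eq _ _ z1) => //; rewrite ?g1E z1E.
have nO' : nbhs (g1, z1) [set p : arr K * Z | O' p.1].
  exists (O', setT) => [|[? ?] []] //; split => /=; last exact: filterT.
  by rewrite g1g; exact: open_nbhs_nbhs.
have Fn : F [set p | ~ O' p.1].
  by exists setT => [|_ [t [_ nt _ _ ->]]] //; exact: filterT.
by have [[g' z''] [/= h1 h2]] := clF _ _ Fn nO'.
Qed.

Lemma division_cont (X : topologicalType) (z z' : X -> Z) (g : X -> arr K) x :
  cont_at z x -> cont_at z' x ->
  (\forall t \near x, src (g t) = rho (z t) /\ act (g t) (z t) = z' t) ->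
  cont_at g x.
Proof.
move=> cz cz' gE O gO.
have h := division_near cz cz' (nbhs_singleton gE) (fun t => id) gO.
suff : \forall t \near x, O (g t) by [].
by apply: filterS2 gE h => t Dt; apply.
Qed.

Lemma act_cont (X : topologicalType) (z : X -> Z) (g : X -> arr K) x :
  cont_at z x -> cont_at g x -> (\forall t \near x, src (g t) = rho (z t)) ->
  cont_at (fun t => act (g t) (z t)) x.
Proof.
move=> cz cg gE.
apply: (@cont_at_within _ _ _ _ (fun t => (g t, z t)) (fun p => act p.1 p.2)).
- exact: (la_continuous actP).
- exact: cont_at_pair.
exact: gE.
Qed.

Lemma act_invK g z : src g = rho z -> act (inv g) (act g z) = z.
Proof.
move=> gz; rewrite -(la_comp actP) ?src_inv ?(la_rng actP) // compVg gz.
exact: (la_idt actP).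
Qed.
End ProperAction.

(** ** Continuity in the unstable groupoid *)

Section UnstableArrows.
Variables (R : realType) (Y : system R).
Hypothesis sY : smale_axioms Y.
Implicit Types x y : Y.

Lemma near_mdist_lt (M : metricType R) (x y : M) c : mdist x y < c ->
  \forall p \near (x, y), mdist p.1 p.2 < c.
Proof.
move=> xyc; have e0 : 0 < (c - mdist x y) / 2 by rewrite divr_gt0 // subr_gt0.
exists ([set x' | mdist x x' < (c - mdist x y) / 2],
        [set y' | mdist y y' < (c - mdist x y) / 2]).
  by split; exact: mdist_nbhs e0 _.
move=> [x' y'] /= [xx' yy']; apply: le_lt_trans (metric_triangle _ x _) _.
apply: le_lt_trans (lerD (lexx _) (metric_triangle _ y _)) _.
rewrite metric_sym addrCA -ltrBrDl.
by rewrite (splitr (c - _)) ltrD.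
Qed.

Lemma near_iterV_lt n x y c : mdist (iter n dynV x) (iter n dynV y) < c ->
  \forall p \near (x, y), mdist (iter n dynV p.1) (iter n dynV p.2) < c.
Proof.
move=> /near_mdist_lt h.
have cn := iter_continuous (n := n) (sa_dynV sY).
have : cont_at (fun p : Y * Y => (iter n dynV p.1, iter n dynV p.2)) (x, y).
  apply: cont_at_pair.
    apply: (@cont_at_comp _ _ _ fst (iter n dynV)); last exact: cn.
    exact: cvg_fst.
  apply: (@cont_at_comp _ _ _ snd (iter n dynV)); last exact: cn.
  exact: cvg_snd.
by move=> /(_ _ h).
Qed.

Lemma unstable_arr_openE (U : set (unstable_arr Y)) :
  open U = @indlim_open (Y * Y)%type (@unstable_rel R Y) (fun n =>
   [set p : Y * Y | (iter n dyn @` local_unstable (small Y) (iter n dynV p.1)) p.2]) U.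
Proof. exact: indlim_openE. Qed.

Definition apair (g : unstable_arr Y) : Y * Y := set_val g.

Lemma apairP g : unstably_equivalent (apair g).1 (apair g).2.
Proof. exact: (set_mem (valP g)). Qed.

Lemma apair_inj g h : apair g = apair h -> g = h.
Proof. by case: g h => [g ?] [h ?] /= gh; exact: eq_exist. Qed.

Definition uarr x y (xy : unstably_equivalent x y) : unstable_arr Y :=
  exist _ (x, y) (mem_set (xy : unstable_rel (x, y))).

Lemma apair_uarr x y (xy : unstably_equivalent x y) : apair (uarr xy) = (x, y).
Proof. by []. Qed.

(** On the n-th set of the filtration, being at a smaller level amounts to
    finitely many strict inequalities between distances. *)
Lemma open_ulevel n :
  open [set g : unstable_arr Y | ulevel n (apair g).1 (apair g).2].
Proof.
rewrite unstable_arr_openE => m.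
pose A := [set p : Y * Y | ulevel m p.1 p.2 -> ulevel n p.1 p.2].
exists (A°); first exact: open_interior.
apply/seteqP; split=> g [Ag Em]; split=> //; last first.
  by apply: (interior_subset Ag); exact/(ulevelE sY).
have {Ag} gn : ulevel n (apair g).1 (apair g).2 := Ag.
have [mn|nm] := leqP m n.
  apply: (@filterS _ (nbhs (apair g)) _ setT) => [p _|]; last exact: filterT.
  exact: ulevel_le.
have near_k (k : 'I_m.+1) : \forall p \near apair g, (n <= k)%N ->
    mdist (iter k dynV p.1) (iter k dynV p.2) < small Y.
  have [nk|kn] := leqP n k; last first.
    apply: (@filterS _ (nbhs (apair g)) _ setT) => [p _|]; last exact: filterT.
    by [].
  have [_ /near_iterV_lt] := ulevel_le sY nk gn.
  by rewrite -surjective_pairing => h; apply: filterS h => p.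
pose Q (k : 'I_m.+1) (p : Y * Y) := (n <= k)%N ->
  mdist (iter k dynV p.1) (iter k dynV p.2) < small Y.
have near_all : \forall p \near apair g, forall k, Q k p.
  exact: (@filter_forall _ _ Q (nbhs (apair g)) _ near_k).
apply: filterS near_all => p pk pm.
have pk' k : (n <= k <= m)%N ->
    mdist (iter k dynV p.1) (iter k dynV p.2) < small Y.
  by move=> /andP[nk km]; exact: (pk (Ordinal (km : (k < m.+1)%N))).
split; last by apply: pk'; rewrite leqnn ltnW.
suff h j : (j <= m - n)%N ->
    lun (iter (m - j) dynV p.1) (iter (m - j) dynV p.2).
  by have := h (m - n)%N (leqnn _); rewrite subKn // ltnW.
elim: j => [|j IH] jmn; first by rewrite subn0; case: pm.
have := IH (ltnW jmn).
have -> : (m - j = (m - j.+1).+1)%N.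
  by rewrite -subSn // (leq_trans jmn) // leq_subr.
move=> /(lun_dyn sY); rewrite !iterS !dynVK; apply.
apply: le_trans (small_le sY); apply: ltW; apply: pk'.
rewrite leq_subr andbT leq_subRL; last by rewrite (leq_trans jmn) // leq_subr.
by rewrite addnC -leq_subRL // ltnW.
Qed.

(** At bounded level, the topology of the unstable groupoid is that of the
    pairs. *)
Lemma unstable_arr_cont (X : topologicalType) (k : X -> unstable_arr Y) (x : X) n :
  cont_at (fun t => (apair (k t)).1) x -> cont_at (fun t => (apair (k t)).2) x ->
  (\forall t \near x, ulevel n (apair (k t)).1 (apair (k t)).2) -> cont_at k x.
Proof.
move=> c1 c2 kn O; rewrite nbhsE => -[O' [oO' O'k] O'O].
have [V oV VE] : exists2 V : set (Y * Y), open V & forall g : unstable_arr Y,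
    ulevel n (apair g).1 (apair g).2 -> O' g <-> V (apair g).
  move: oO'; rewrite unstable_arr_openE => /(_ n)[V oV VE]; exists V => // g gn.
  have gE : (set_val @^-1` [set p : Y * Y | (iter n dyn @`
      local_unstable (small Y) (iter n dynV p.1)) p.2]) g by exact/(ulevelE sY).
  split=> [Og|Vg].
    have : (O' `&` set_val @^-1` [set p : Y * Y | (iter n dyn @`
      local_unstable (small Y) (iter n dynV p.1)) p.2]) g by split.
    by rewrite VE => -[].
  have : (set_val @^-1` V `&` set_val @^-1` [set p : Y * Y | (iter n dyn @`
    local_unstable (small Y) (iter n dynV p.1)) p.2]) g by split.
  by rewrite -VE => -[].
have nV : nbhs (apair (k x)) V.
  apply: open_nbhs_nbhs; split=> //; apply/VE => //; exact: nbhs_singleton kn.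
have cp : cont_at (fun t => apair (k t)) x.
  rewrite (_ : (fun t => apair (k t)) =
    (fun t => ((apair (k t)).1, (apair (k t)).2))); first exact: cont_at_pair.
  by apply/funext => t; rewrite -surjective_pairing.
have cpV : \forall t \near x, V (apair (k t)) := cp _ nV.
suff : \forall t \near x, O (k t) by [].
by apply: filterS2 cpV kn => t Vt tn; apply: O'O; apply/VE.
Qed.
End UnstableArrows.

Section Bibundle.
Variables (R : realType) (S Y : system R) (f : factor_map S Y).
Hypotheses (sS : smale_axioms S) (sY : smale_axioms Y) (fb : s_bijective f).
Hypothesis zS : zero_dimensional S.
Variable G : groupoid.
Hypotheses (topG : topological_groupoid G) (etaleG : etale G).
Local Notation H := (unstable_groupoid Y).
Local Notation T := (obj G).
Variables (Z : topologicalType) (rho : Z -> obj G) (lact : arr G -> Z -> Z).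
Variables (tau : Z -> Y) (ract : unstable_arr Y -> Z -> Z).
Let tau' : Z -> obj (opposite H) := tau.
Let ract' : arr (opposite H) -> Z -> Z := ract.

Record bibundle : Prop := {
  bb_hausdorff : hausdorff_space Z;
  bb_locally_compact : locally_compact [set: Z];
  bb_left : left_action rho lact;
  bb_left_free : free_action rho lact;
  bb_left_proper : proper_action rho lact;
  bb_right : left_action tau' ract';
  bb_right_free : free_action tau' ract';
  bb_right_proper : proper_action tau' ract';
  bb_tau : forall g z, src g = rho z -> tau (lact g z) = tau z;
  bb_rho : forall (h : unstable_arr Y) z, tau z = (apair h).1 ->
    rho (ract h z) = rho z;
  bb_comm : forall g (h : unstable_arr Y) z, src g = rho z ->
    tau z = (apair h).1 -> ract h (lact g z) = lact g (ract h z);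
  bb_rho_quotient : induces_homeomorphism (orbit_of tau' ract') rho;
  bb_tau_quotient : induces_homeomorphism (orbit_of rho lact) tau }.

Hypothesis bb : bibundle.
Implicit Types (z : Z) (y : Y).

Lemma rho_cont : continuous rho. Proof. exact: la_anchor (bb_left bb). Qed.
Lemma tau_cont : continuous tau. Proof. exact: la_anchor (bb_right bb). Qed.

Lemma rho_surj x : exists z, rho z = x.
Proof. exact: induces_surj (bb_rho_quotient bb) x. Qed.

Lemma tau_surj y : exists z, tau z = y.
Proof. exact: induces_surj (bb_tau_quotient bb) y. Qed.

Lemma tau_eq z z' : tau z = tau z' -> exists2 g, src g = rho z & lact g z = z'.
Proof.
move=> /(induces_orbit (bb_tau_quotient bb)) zz'.
have : orbit_of rho lact z' z'.
  by exists (idt (rho z')); [exact: src_idt | exact: la_idt (bb_left bb) _].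
by rewrite -zz' => -[g gz gE]; exists g.
Qed.

(** The right action in terms of points: z is moved to the point y of the
    unstable class of tau z. *)
Definition transport z y : Z :=
  if pselect (unstably_equivalent (tau z) y) is left h then ract (uarr h) z
  else z.

Lemma transport_rho z y : rho (transport z y) = rho z.
Proof. by rewrite /transport; case: pselect => // h; rewrite (bb_rho bb). Qed.

Lemma transport_tau z y : unstably_equivalent (tau z) y ->
  tau (transport z y) = y.
Proof.
rewrite /transport; case: pselect => // h _.
exact: (@la_rng _ _ _ _ (bb_right bb) (uarr h) z erefl).
Qed.

Lemma rho_eq z z' : rho z = rho z' ->
  unstably_equivalent (tau z) (tau z') /\ transport z (tau z') = z'.
Proof.
move=> /(induces_orbit (bb_rho_quotient bb)) zz'.
have : orbit_of tau' ract' z' z'.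
  exists (@idt (opposite H) (tau z')); first exact: src_idt.
  exact: la_idt (bb_right bb) _.
rewrite -zz' => -[g gz gE].
have {}gz : (apair g).1 = tau z := gz.
have gz' : (apair g).2 = tau z'.
  by rewrite -gE; exact: esym (la_rng (bb_right bb) gz).
have zu : unstably_equivalent (tau z) (tau z').
  by rewrite -gz -gz'; exact: apairP.
split=> //; rewrite /transport; case: pselect => // h.
suff -> : uarr h = g by [].
apply: apair_inj.
by rewrite apair_uarr -gz -gz' -surjective_pairing.
Qed.

Lemma transport_cont (X : topologicalType) (z : X -> Z) (y : X -> Y) x n :
  cont_at z x -> cont_at y x ->
  (\forall t \near x, ulevel n (tau (z t)) (y t)) ->
  cont_at (fun t => transport (z t) (y t)) x.
Proof.
move=> cz cy zy.
have ctz : cont_at (fun t => tau (z t)) x.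
  by apply: (cont_at_comp (h := tau)) => //; exact: tau_cont.
pose g t : arr (opposite H) :=
  if pselect (unstably_equivalent (tau (z t)) (y t)) is left h then uarr h
  else uarr (unstably_equivalentxx (tau (z t))).
have gP t : ulevel n (tau (z t)) (y t) -> apair (g t) = (tau (z t), y t).
  by move=> /(ulevel_unstably sY) h; rewrite /g; case: pselect.
apply: (@cont_at_near _ _ (fun t => ract' (g t) (z t))).
  apply: filterS zy => t /(ulevel_unstably sY) h.
  by rewrite /transport /g; case: pselect.
apply: (act_cont (bb_right bb)) => //; last first.
  apply: filterS zy => t /gP gt.
  by rewrite [LHS]/((apair (g t)).1) gt.
apply: (@unstable_arr_cont _ _ sY _ _ _ n).
- apply: cont_at_near ctz; apply: filterS zy => t /gP gt.
  by rewrite gt.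
- by apply: cont_at_near cy; apply: filterS zy => t /gP gt; rewrite gt.
by apply: filterS zy => t zyt; rewrite (gP t) //.
Qed.

(** The arrow of the unstable groupoid which maps z t to z' t depends
    continuously on t. *)
Lemma near_ulevel (X : topologicalType) (z z' : X -> Z) (D : set X) x n :
  cont_at z x -> cont_at z' x -> D x ->
  (forall t, D t -> rho (z t) = rho (z' t)) ->
  ulevel n (tau (z x)) (tau (z' x)) ->
  \forall t \near x, D t -> ulevel n (tau (z t)) (tau (z' t)).
Proof.
move=> cz cz' Dx zz' nx.
pose g t : arr (opposite H) :=
  if pselect (unstably_equivalent (tau (z t)) (tau (z' t))) is left h then uarr h
  else uarr (unstably_equivalentxx (tau (z t))).
have gP t : D t -> apair (g t) = (tau (z t), tau (z' t)).
  by move=> /zz' /rho_eq[h _]; rewrite /g; case: pselect.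
have gE t : D t -> src (g t) = tau' (z t) /\ ract' (g t) (z t) = z' t.
  move=> Dt; split; first by rewrite [LHS]/((apair (g t)).1) gP.
  have [h tr] := rho_eq (zz' _ Dt).
  by rewrite -[RHS]tr /transport /g /ract'; case: pselect.
have := @division_near _ _ _ _ (bb_right bb) (bb_right_free bb)
  (bb_right_proper bb) (bb_hausdorff bb) (bb_locally_compact bb) _ _ _ g D x
  [set k | ulevel n (apair k).1 (apair k).2] cz cz' Dx gE.
have nO : nbhs (g x) [set k | ulevel n (apair k).1 (apair k).2].
  apply: open_nbhs_nbhs; split; first exact: open_ulevel.
  by rewrite /= gP.
by move=> /(_ nO); apply: filterS => t tD Dt; have := tD Dt; rewrite /= gP.
Qed.

Lemma left_division (X : topologicalType) (z z' : X -> Z) (U : set X) :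
  open U -> cont_on U z -> cont_on U z' ->
  (forall t, U t -> tau (z t) = tau (z' t)) ->
  exists g : X -> arr G, cont_on U g /\ forall t, U t ->
    [/\ src (g t) = rho (z t), rng (g t) = rho (z' t) & lact (g t) (z t) = z' t].
Proof.
move=> oU cz cz' zz'.
have gex t : exists g, U t -> src g = rho (z t) /\ lact g (z t) = z' t.
  have [Ut|nUt] := pselect (U t); last by exists (idt (rho (z t))) => /nUt.
  by have [g g1 g2] := tau_eq (zz' _ Ut); exists g.
have [g gP] := boolp.choice gex; exists g; split=> [x Ux|t Ut].
  apply: (@division_cont _ _ _ _ (bb_left bb) (bb_left_free bb)
    (bb_left_proper bb) (bb_hausdorff bb) (bb_locally_compact bb) _ z z').
  - exact: cz.
  - exact: cz'.
  by apply: filterS (open_nbhs_nbhs (conj oU Ux)) => t /gP.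
have [g1 g2] := gP _ Ut; split=> //.
by rewrite -(la_rng (bb_left bb) g1) g2.
Qed.

(** G is principal because the unstable groupoid is: a point of Z over a given
    object is determined by its image in Y, and G acts freely on Z. *)
Lemma arr_eq (g g' : arr G) : src g = src g' -> rng g = rng g' -> g = g'.
Proof.
move=> sgg rgg; have [z zE] := rho_surj (src g).
have gz : src g = rho z by []. have g'z : src g' = rho z by rewrite -sgg.
have [_ tr] : unstably_equivalent (tau (lact g z)) (tau (lact g' z)) /\
    transport (lact g z) (tau (lact g' z)) = lact g' z.
  by apply: rho_eq; rewrite !(la_rng (bb_left bb)).
apply: (free_action_eq (bb_left bb) (bb_left_free bb) gz) => //.
rewrite -tr (bb_tau bb g'z) -(bb_tau bb gz).
have [_] := rho_eq (erefl (rho (lact g z))).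
by move=> ->.
Qed.

Lemma arr_exists z z' : unstably_equivalent (tau z) (tau z') ->
  exists g, src g = rho z /\ rng g = rho z'.
Proof.
move=> zz'; have : tau (transport z (tau z')) = tau z' by exact: transport_tau.
move=> /tau_eq[g]; rewrite transport_rho => g1 g2; exists g; split=> //.
rewrite -g2 (la_rng (bb_left bb)) //.
by rewrite transport_rho.
Qed.

Lemma etale_src : etale_map (@src G).
Proof. by apply: local_homeomorphism_etale; case: etaleG. Qed.

Lemma etale_rng : etale_map (@rng G).
Proof. by apply: local_homeomorphism_etale; case: etaleG. Qed.

Lemma obj_hausdorff : hausdorff_space T.
Proof.
move=> x y xy; rewrite -[x](src_idt (g0 := G)) -[y](src_idt (g0 := G)).
congr src; apply: hausdorff_eq; first exact: tg_hausdorff.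
move=> A B xA yB.
have [t [At Bt]] := xy _ _ (tg_idt topG xA) (tg_idt topG yB).
by exists (idt t).
Qed.

(** tau is the quotient map of a free and proper action of an etale groupoid: it
    is open, and points in the same small open set are related by arrows which
    are close to units, hence are units. *)
Lemma etale_tau : etale_map tau.
Proof.
split; first exact: tau_cont.
- move=> O oO; apply: (induces_quotient (bb_tau_quotient bb)).
  rewrite openE => z1 [z0 Oz0 /tau_eq[g g0 gE]].
  have [N [oN Ng srcN]] := etale_inj (inv g) etale_src.
  have [s [sE cs]] := etale_section etale_src oN Ng srcN.
  have rz1 : src (inv g) = rho z1.
    by rewrite src_inv -gE (la_rng (bb_left bb)).
  have sg : s (rho z1) = inv g by rewrite -rz1 sE.
  have srcNz : nbhs (rho z1) (@src G @` N).
    apply: open_nbhs_nbhs; split; first exact: em_open etale_src _ oN.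
    by exists (inv g).
  have srcs x : (@src G @` N) x -> src (s x) = x.
    by move=> [k Nk <-]; rewrite sE.
  have nz : \forall z \near z1, (@src G @` N) (rho z).
    exact: rho_cont srcNz.
  have c : cont_at (fun z => lact (s (rho z)) z) z1.
    apply: (act_cont (bb_left bb)); first exact: cvg_id.
      apply: (cont_at_comp (h := s)); first exact: rho_cont.
      by apply: cs; exact: nbhs_singleton nz.
    by apply: filterS nz => z /srcs.
  have nO : nbhs (lact (s (rho z1)) z1) O.
    rewrite sg -gE (act_invK (bb_left bb)) //.
    exact: open_nbhs_nbhs.
  have h : \forall z \near z1, O (lact (s (rho z)) z) := c _ nO.
  apply: filterS2 nz h => z /srcs sz Oz.
  by exists (lact (s (rho z)) z) => //; rewrite (bb_tau bb).
move=> z0; have [N [oN Ni srcN]] := etale_inj (idt (rho z0)) etale_src.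
have ci : continuous (fun g : arr G => idt (src g)).
  move=> g; apply: (cont_at_comp (g := src) (h := idt)).
    exact: (tg_src topG).
  exact: (tg_idt topG).
have oN' : open (N `&` (fun g : arr G => idt (src g)) @^-1` N).
  by apply: openI => //; exact: preimage_open.
pose g (p : Z * Z) : arr G :=
  if pselect (exists2 g, src g = rho p.1 & lact g p.1 = p.2) is left e
  then projT1 (cid2 e) else idt (rho p.1).
pose D := [set p : Z * Z | tau p.1 = tau p.2].
have gP p : D p -> src (g p) = rho p.1 /\ lact (g p) p.1 = p.2.
  by move=> /tau_eq h; rewrite /g; case: pselect => // e; case: cid2 => k /=.
have g00 : g (z0, z0) = idt (rho z0).
  have [//|g1 g2] := gP (z0, z0).
  apply: (free_action_eq (bb_left bb) (bb_left_free bb) g1); rewrite ?src_idt //.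
  by rewrite g2 (la_idt (bb_left bb)).
have := @division_near _ _ _ _ (bb_left bb) (bb_left_free bb)
  (bb_left_proper bb) (bb_hausdorff bb) (bb_locally_compact bb) _ fst snd g D
  (z0, z0) (N `&` (fun g : arr G => idt (src g)) @^-1` N) _ _ erefl gP.
case=> [||| [A B] /= [nA nB] AB].
- exact: cvg_fst.
- exact: cvg_snd.
- apply: open_nbhs_nbhs; split=> //; rewrite g00; split=> //=.
  by rewrite src_idt.
have nAB : nbhs z0 (A `&` B) by exact: filterI.
have [M [oM Mz MAB]] := nearP_open nAB; exists M; split=> // s t /MAB[As _] /MAB[_ Bt] st.
have [g1 g2] := gP (s, t) st.
have [Ng Nig] := AB (s, t) (conj As Bt) st.
have gi : g (s, t) = idt (src (g (s, t))) by apply: srcN => //; rewrite src_idt.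
by have := la_idt (bb_left bb) s; rewrite -g1 -gi g2.
Qed.
End Bibundle.

Lemma cont_at_id (X : topologicalType) (x : X) : cont_at id x.
Proof. exact: cvg_id. Qed.

Lemma lun_refl (R : realType) (X : system R) (x : X) :
  smale_axioms X -> lun x x.
Proof.
by move=> sX; split; [rewrite mdistxx ltW // (sa_radius sX) | exact: sa_brxx].
Qed.

(** ** Sections of the bibundle *)

Section Charts.
Variables (R : realType) (S Y : system R) (f : factor_map S Y).
Hypotheses (sS : smale_axioms S) (sY : smale_axioms Y) (fb : s_bijective f).
Hypothesis zS : zero_dimensional S.
Variable G : groupoid.
Hypotheses (topG : topological_groupoid G) (etaleG : etale G).
Local Notation T := (obj G).
Variables (Z : topologicalType) (rho : Z -> obj G) (lact : arr G -> Z -> Z).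
Variables (tau : Z -> Y) (ract : unstable_arr Y -> Z -> Z).
Hypothesis bb : bibundle rho lact tau ract.

Let hT : hausdorff_space T. Proof. exact: (obj_hausdorff topG). Qed.

(** Points of Z over the same object have unstably equivalent images in Y, so
    that a section of tau over a stable set is transverse to the fibres of rho.
    *)
Lemma open_rho_section (s : Y -> Z) (N : set Z) (E : set Y) :
  open N -> (forall z, N z -> s (tau z) = z) -> cont_on (tau @` N) s ->
  E `<=` tau @` N ->
  (forall e, E e -> exists2 d, 0 < d & forall y, lst e y -> mdist e y < d -> E y) ->
  open ((rho \o s) @` E).
Proof.
move=> oN sN cs EN sE; apply: (induces_quotient (bb_rho_quotient bb)).
rewrite openE => z1 [e Ee /esym /(rho_eq bb)[un tr]].
have [n0 Nn0 tn0] := EN _ Ee; have tse : tau (s e) = e by rewrite -tn0 sN.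
rewrite tse in un tr.
have [n [xen dxe]] := unstably_ulevel sY un.
set en := iter n dynV e in xen dxe.
have [d d0 dP] := sE _ Ee.
pose x z := iter n dynV (tau z).
have cx : continuous x.
  move=> z; apply: (cont_at_comp (h := iter n dynV)); first exact: tau_cont bb _.
  exact: iter_continuous (sa_dynV sY) _.
have dlt z : mdist en (x z) < small Y -> mdist en (x z) < radius Y.
  by move=> h; apply: lt_le_trans h (small_le sY).
have dex : mdist en (x z1) < small Y by rewrite metric_sym.
pose w z := br en (x z).
have cw : cont_at w z1.
  apply: (cont_at_comp (g := fun z => (en, x z)) (h := fun p => br p.1 p.2)).
    by apply: cont_at_pair; [exact: cont_at_cst | exact: cx].
  by apply: br_cont => //; exact: dlt.
have w1 : w z1 = en by have [] := lun_sym sY xen.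
pose y z := iter n dyn (w z).
have cy : cont_at y z1.
  apply: (cont_at_comp (h := iter n dyn)) => //.
  exact: iter_continuous (sa_dyn sY) _.
have y1 : y z1 = e by rewrite /y w1 iter_dynVK.
have near1 : \forall z \near z1, mdist (x z) (w z) < small Y.
  have c : cont_at (fun z => (x z, w z)) z1 by apply: cont_at_pair => //; exact: cx.
  by apply: (c [set p | mdist p.1 p.2 < small Y]); apply: near_mdist_lt; rewrite w1.
have near2 : \forall z \near z1, mdist en (x z) < small Y.
  have c : cont_at (fun z => (en, x z)) z1.
    by apply: cont_at_pair; [exact: cont_at_cst | exact: cx].
  by apply: (c [set p | mdist p.1 p.2 < small Y]); exact: near_mdist_lt.
have near3 : \forall z \near z1, mdist en (w z) < radius Y.
  apply: (cw [set v | mdist en v < radius Y]).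
  by rewrite w1; exact: mdist_nbhs (sa_radius sY) _.
have near4 : \forall z \near z1, mdist e (y z) < d.
  apply: (cy [set v | mdist e v < d]).
  by rewrite y1; exact: mdist_nbhs d0 _.
have near5 : \forall z \near z1, ulevel n (tau z) (y z).
  apply: filterS2 near1 near2 => z h1 h2.
  rewrite /ulevel /y iter_dynK; split => //.
  apply: (lun_sym sY); apply: (lun_br sY); first by apply: ltW; exact: dlt.
  by rewrite metric_sym ltW // (lt_le_trans h1) // small_le.
have near6 : \forall z \near z1, E (y z).
  apply: filterS3 near2 near3 near4 => z h2 h3 h4; apply: dP => //.
  rewrite -[e](iter_dynVK n); apply: (lst_iter sY).
  by apply: (lst_br sY); [apply: ltW; exact: dlt | exact: ltW].
have near7 : \forall z \near z1, N (transport tau ract z (y z)).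
  have c : cont_at (fun z => transport tau ract z (y z)) z1.
    by apply: (transport_cont sY bb (z := id) (n := n)) => //; exact: cont_at_id.
  apply: (c N); rewrite y1 tr; apply: open_nbhs_nbhs; split=> //.
  by rewrite -tn0 sN.
apply: filterS3 near5 near6 near7 => z h5 h6 h7; exists (y z) => //=.
rewrite -[y z](transport_tau bb (ulevel_unstably sY h5)) sN //.
exact: (transport_rho bb).
Qed.

(** A section over U of the pullback of the fibre product of Z and the system
    over Y, by v. *)
Definition sect (X : topologicalType) (v : X -> T) q (U : set X) (z : X -> Z)
    (a : X -> fiber_product f q) :=
  [/\ cont_on U z, cont_on U a &
    forall t, U t -> rho (z t) = v t /\ tau (z t) = base (a t)].

Lemma sect_sub (X : topologicalType) (v : X -> T) q (U U' : set X) z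
    (a : X -> fiber_product f q) : U' `<=` U -> sect v U z a -> sect v U' z a.
Proof.
move=> U'U [cz ca za]; split; [exact: cont_on_sub cz | exact: cont_on_sub ca |].
by move=> t /U'U; exact: za.
Qed.

(** A nice section identifies U with a compact open subset of a stable set. *)
Definition nice q (U : set T) (z : T -> Z) (a : T -> fiber_product f q) :=
  [/\ compact_open U, sect id U z a,
      forall s t, U s -> U t -> a s = a t -> s = t,
      exists t, forall x, U x -> flst t (a x) /\
        mdist t (a x) < small (fiber_product f q) &
      sopen (a @` U)].

Lemma base_lst q e : 0 < e -> exists2 d, 0 < d & forall t u : fiber_product f q,
  flst t u -> mdist t u < d -> lst (base t) (base u) /\
    mdist (base t) (base u) < e.
Proof.
move=> e0; have [d d0 dP] := fmap_lst f sS sY e0; exists d => // t u tu tud.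
apply: dP; first exact: tu.
exact: le_lt_trans (mdist_crd _ _ _) tud.
Qed.

Lemma flst_near q (t c : fiber_product f q) : mdist t c < radius S ->
  ~ flst t c -> \forall u \near c, ~ flst t u.
Proof.
move=> tc /existsNP[i ntc].
have tci : mdist (crd t i) (crd c i) < radius S.
  exact: le_lt_trans (mdist_crd _ _ _) tc.
have bn : br (crd t i) (crd c i) <> crd c i.
  by move=> bE; apply: ntc; split=> //; exact: ltW.
have e0 : 0 < mdist (br (crd t i) (crd c i)) (crd c i) / 2.
  by rewrite divr_gt0 // mdist_gt0; apply/eqP.
have cb : cont_at (fun u : fiber_product f q => br (crd t i) (crd u i)) c.
  apply: (cont_at_comp (g := fun u => (crd t i, crd u i))
    (h := fun p => br p.1 p.2)); last exact: br_cont.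
  by apply: cont_at_pair; [exact: cont_at_cst | exact: crd_cont].
have cc : cont_at (fun u : fiber_product f q => crd u i) c by exact: crd_cont.
have /cb n1 := mdist_nbhs e0 (fun y => @id (mdist (br (crd t i) (crd c i)) y < _)).
have /cc n2 := mdist_nbhs e0 (fun y => @id (mdist (crd c i) y < _)).
have n1' : \forall u \near c, mdist (br (crd t i) (crd c i)) (br (crd t i) (crd u i)) <
  mdist (br (crd t i) (crd c i)) (crd c i) / 2 := n1.
have n2' : \forall u \near c, mdist (crd c i) (crd u i) <
  mdist (br (crd t i) (crd c i)) (crd c i) / 2 := n2.
apply: filterS2 n1' n2' => u h1 h2 /(_ i)[_ bu]; rewrite bu in h1.
have : mdist (br (crd t i) (crd c i)) (crd c i) <
    mdist (br (crd t i) (crd c i)) (crd c i).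
  apply: le_lt_trans (metric_triangle _ (crd u i) _) _.
  by rewrite [X in _ < X]splitr ltrD // metric_sym.
by rewrite ltxx.
Qed.

(** Move t0 along its stable set by Ct, push Ct to Y and lift it to Z by a local
    section of tau. The resulting map j from Ct to the objects is open by
    transversality, and injective since points of Y which are both locally
    stable and locally unstable are equal; a is its inverse. *)
Lemma chart q (z0 : Z) (t0 : fiber_product f q) (O : set T) e :
  base t0 = tau z0 -> nbhs (rho z0) O -> 0 < e ->
  exists U z a, [/\ nice U z a, U (rho z0), U `<=` O,
    a (rho z0) = t0 & forall x, U x -> flst t0 (a x) /\ mdist t0 (a x) < e].
Proof.
move=> t0z0 nO e0; set X := fiber_product f q in t0 t0z0 *.
have rS0 := sa_radius sS.
have [N [oN Nz0 tauN]] := etale_inj z0 (etale_tau topG etaleG bb).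
have [s [sE cs]] := etale_section (etale_tau topG etaleG bb) oN Nz0 tauN.
have oW : open (tau @` N) by exact: em_open (etale_tau topG etaleG bb) _ oN.
have tausK y : (tau @` N) y -> tau (s y) = y by move=> [z Nz <-]; rewrite sE.
have sNK y : (tau @` N) y -> N (s y) by move=> [z Nz <-]; rewrite sE.
have Wy0 : (tau @` N) (base t0) by rewrite t0z0; exists z0.
have sy0 : s (base t0) = z0 by rewrite t0z0 sE.
have nW : nbhs (base t0) (tau @` N) by exact: open_nbhs_nbhs.
have csy : cont_at s (base t0) by exact: cs.
(* points of the section in the same fibre of rho are locally unstable *)
have sep : exists2 h, 0 < h & forall y y', mdist (base t0) y < h ->
    mdist (base t0) y' < h -> rho (s y) = rho (s y') -> lun y y'.
  pose D := [set p : Y * Y | [/\ (tau @` N) p.1, (tau @` N) p.2 &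
    rho (s p.1) = rho (s p.2)]].
  have := @near_ulevel _ _ sY _ _ _ _ _ _ bb (Y * Y)%type (s \o fst) (s \o snd) D
    (base t0, base t0) 0.
  case.
  - by apply: (cont_at_comp (h := s)) => //; exact: cvg_fst.
  - by apply: (cont_at_comp (h := s)) => //; exact: cvg_snd.
  - by [].
  - by move=> p [].
  - split=> /=; first by rewrite sy0; exact: lun_refl.
    by rewrite mdistxx small_gt0.
  move=> [A B] /= [/nbhs_mdist[h1 h10 h1P] /nbhs_mdist[h2 h20 h2P]] AB.
  have [h3 h30 h3P] := nbhs_mdist nW.
  exists (Num.min h3 (Num.min h1 h2)); first by rewrite !lt_min h30 h10.
  move=> y y'; rewrite !lt_min => /and3P[y3 y1 y2] /and3P[y'3 y'1 y'2] yy'.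
  have := AB (y, y') (conj (h1P _ y1) (h2P _ y'2)).
  by case=> [|/= + _]; [split=> //; exact: h3P | rewrite !tausK //; exact: h3P].
have [h h0 hP] := sep.
have [h1 h10 h1P] := nbhs_mdist nW.
have crs : cont_at (rho \o s) (base t0).
  by apply: (cont_at_comp (h := rho)) => //; rewrite sy0; exact: rho_cont bb _.
have [h2 h20 h2P] : exists2 h, 0 < h & forall y, mdist (base t0) y < h ->
    O (rho (s y)).
  by apply: nbhs_mdist; apply: (crs O); rewrite /= sy0.
have k0 : 0 < Num.min (Num.min h h1) (Num.min h2 (radius Y / 2)).
  by rewrite !lt_min h0 h10 h20 divr_gt0 // (sa_radius sY).
have [d d0 dP] := base_lst q k0.
have d'0 : 0 < Num.min (Num.min d e) (small X).
  by rewrite !lt_min d0 e0 (small_gt0 sS).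
have cb : continuous (@base _ _ _ f q) by exact: base_cont.
have [C [[kC oC] Ct0 CP]] : exists C, [/\ compact_open C, C t0 & forall c, C c ->
    mdist t0 c < Num.min (Num.min d e) (small X) /\
    mdist (base t0) (base c) < h1].
  have n1 : nbhs t0 [set c | mdist t0 c < Num.min (Num.min d e) (small X)].
    exact: mdist_nbhs d'0 _.
  have n2 : nbhs t0 [set c | mdist (base t0) (base c) < h1].
    by apply: (cb t0 [set y | mdist (base t0) y < h1]); exact: mdist_nbhs h10 _.
  have [C [cC Ct0 CS]] := fiber_co_basis sS zS (filterI n1 n2).
  by exists C; split=> // c /CS[].
pose Ct := [set c | C c /\ flst t0 c].
have CtP c : Ct c -> [/\ lst (base t0) (base c), mdist (base t0) (base c) < h,
    mdist (base t0) (base c) < radius Y / 2, (tau @` N) (base c) &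
    O (rho (s (base c)))].
  move=> [/CP[]]; rewrite !lt_min => /andP[/andP[cd ce] _] ch1 lc.
  have [lb] := dP _ _ lc cd; rewrite !lt_min.
  by move=> /andP[/andP[bh bh1] /andP[bh2 br]]; split=> //; [exact: h1P | exact: h2P].
have Ctt0 : Ct t0 by split=> //; exact: flst_refl.
have small_r : small X <= radius S by exact: small_le sS.
have Crad c : C c -> mdist t0 c < radius S.
  by move=> /CP[+ _]; rewrite lt_min => /andP[_ h']; exact: lt_le_trans h' small_r.
have cCt : closed Ct.
  rewrite -[Ct]setCK; apply: open_closedC; rewrite openE => c nCt.
  have [Cc|nC] := pselect (C c).
    have nf : ~ flst t0 c by move=> lc; apply: nCt.
    have := flst_near (Crad _ Cc) nf; apply: filterS => u nu [_ /nu].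
    exact.
  have : nbhs c (~` C).
    apply: open_nbhs_nbhs; split=> //; apply: closed_openC.
    by apply: compact_closed kC; exact: fiber_hausdorff.
  by apply: filterS => u nu [/nu].
have kCt : compact Ct by apply: subclosed_compact cCt kC _ => c [].
have Ct2 c c' : Ct c -> Ct c' -> flst c c'.
  move=> [Cc lc] [Cc' lc']; apply: (flst_trans sS (flst_sym sS lc) lc').
  apply: le_trans (metric_triangle _ t0 _) _; rewrite (splitr (radius S)) lerD //.
    by rewrite metric_sym; have [+ _] := CP _ Cc; rewrite lt_min => /andP[_ /ltW].
  by have [+ _] := CP _ Cc'; rewrite lt_min => /andP[_ /ltW].
have sCt : sopen Ct.
  move=> c [Cc lc]; have /nbhs_mdist[r r0 rP] : nbhs c C by exact: open_nbhs_nbhs.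
  exists r => // u cu lcu; have Cu := rP _ cu; split=> //.
  by apply: (flst_trans sS lc lcu); apply: ltW; exact: Crad.
pose j (c : X) := rho (s (base c)).
have cj : cont_on C j.
  move=> c Cc; have Wc : (tau @` N) (base c) by have [_ /h1P] := CP _ Cc.
  apply: (cont_at_comp (g := fun c => s (base c)) (h := rho)); last exact: rho_cont bb _.
  by apply: (cont_at_comp (g := @base _ _ _ f q)); [exact: cb | exact: cs].
have cjt : cont_on Ct j by apply: cont_on_sub cj => c [].
have jinj c c' : Ct c -> Ct c' -> j c = j c' -> c = c'.
  move=> cC cC' jcc'.
  have [l1 a1 b1 _ _] := CtP _ cC; have [l2 a2 b2 _ _] := CtP _ cC'.
  apply: (flst_base_inj sS fb (Ct2 _ _ cC cC')).
  apply: lst_lun_eq (hP _ _ a1 a2 jcc').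
  apply: (lst_trans sY (lst_sym sY l1) l2).
  apply: le_trans (metric_triangle _ (base t0) _) _.
  by rewrite (splitr (radius Y)) lerD // ltW // metric_sym.
have oU : open (j @` Ct).
  have -> : j @` Ct = (rho \o s) @` (@base _ _ _ f q @` Ct).
    by rewrite image_comp.
  apply: (open_rho_section oN sE cs); first by move=> _ [c /CtP[_ _ _ ? _] <-].
  move=> _ [c cC <-]; have [r r0 rP] := sCt _ cC.
  have [k k'0 kP] := flst_lift sS sY fb q r0; exists k => // y cy cyk.
  by have [u [<- cu cud]] := kP _ _ cy cyk; exists u => //; exact: rP.
have kU : compact (j @` Ct) by exact: cont_on_compact kCt.
pose a (x : T) : X := xget t0 [set c | Ct c /\ j c = x].
have aP x : (j @` Ct) x -> Ct (a x) /\ j (a x) = x.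
  move=> [c cC jc]; rewrite /a; case: xgetP => [c' _ //|/(_ c)].
  by case.
have aj c : Ct c -> a (j c) = c.
  by move=> cC; have [c1 c2] := aP (j c) (ex_intro2 _ _ c cC erefl); exact: jinj.
have ca : cont_on (j @` Ct) a.
  move=> x Ux O'; rewrite nbhsE => -[O'' [oO'' O''a] OO].
  have kD : compact (Ct `\` O'').
    by rewrite setDE; apply: compact_closedI => //; exact: open_closedC.
  have cD : closed (j @` (Ct `\` O'')).
    apply: compact_closed => //; apply: cont_on_compact kD.
    by apply: cont_on_sub cjt => c [].
  have nD : nbhs x (~` (j @` (Ct `\` O''))).
    apply: open_nbhs_nbhs; split; first exact: closed_openC.
    by move=> [c [cC nOc] jc]; apply: nOc; rewrite -(aj c) // jc.
  have nU : nbhs x (j @` Ct) by exact: open_nbhs_nbhs.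
  suff : \forall x' \near x, O' (a x') by [].
  apply: filterS2 nD nU => x' nDx' /aP[cx' jx']; apply: OO.
  by apply: contrapT => nO'; apply: nDx'; exists (a x').
have jt0 : j t0 = rho z0 by rewrite /j sy0.
have ajt0 : a (rho z0) = t0 by rewrite -jt0 aj.
exists (j @` Ct), (fun x => s (base (a x))), a; split=> //.
- split=> //.
  + split=> // [x Ux|x Ux].
      have [cx jx] := aP _ Ux; have [_ _ _ Wx _] := CtP _ cx.
      apply: (cont_at_comp (g := fun x => base (a x)) (h := s)); last exact: cs.
      by apply: (cont_at_comp (h := @base _ _ _ f q)); [exact: ca | exact: cb].
    have [cx jx] := aP _ Ux; have [_ _ _ Wx _] := CtP _ cx.
    by split; [exact: jx | rewrite tausK].
  + by move=> x x' /aP[_ jx] /aP[_ jx'] axx'; rewrite -jx axx'.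
  + exists t0 => x /aP[[/CP[+ _] lx] _]; rewrite lt_min => /andP[_ h'].
    by split.
  have -> : a @` (j @` Ct) = Ct; last exact: sCt.
  apply/seteqP; split=> [_ [x /aP[? _] <-] //|c cC].
  by exists (j c); [exists c | rewrite aj].
- by exists t0.
- by move=> x [c /CtP[_ _ _ _ ?] <-].
move=> x /aP[[/CP[+ _] lx] _]; rewrite !lt_min => /andP[/andP[_ h'] _].
by split.
Qed.

Lemma obj_co_basis : co_basis T.
Proof.
move=> x O nO; have [z0 zx] := rho_surj bb x.
have [a0 fa0] := fmap_surj f (tau z0).
have [t0 _ bt0] := @fiber_mk _ _ _ f 0 (fun=> a0) _ (fun=> fa0).
rewrite -zx in nO *.
have [U [z [a [[cU _ _ _ _] Ux UO _ _]]]] := chart bt0 nO ltr01.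
by exists U.
Qed.
End Charts.

Section Sections.
Variables (R : realType) (S Y : system R) (f : factor_map S Y).
Hypotheses (sS : smale_axioms S) (sY : smale_axioms Y) (fb : s_bijective f).
Hypothesis zS : zero_dimensional S.
Variable G : groupoid.
Local Notation T := (obj G).
Variables (Z : topologicalType) (rho : Z -> obj G) (lact : arr G -> Z -> Z).
Variables (tau : Z -> Y) (ract : unstable_arr Y -> Z -> Z).
Hypothesis bb : bibundle rho lact tau ract.

Definition funst q (t u : fiber_product f q) :=
  forall i, unstably_equivalent (crd t i) (crd u i).

Lemma funst_close q (t u : fiber_product f q) e : funst t u -> 0 < e ->
  exists N, forall n, (N <= n)%N ->
    flun (iter n dynV t) (iter n dynV u) /\
    mdist (iter n dynV t) (iter n dynV u) < e.
Proof.
move=> tu e0.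
pose Q i n := lun (iter n dynV (crd t i)) (iter n dynV (crd u i)) /\
  mdist (iter n dynV (crd t i)) (iter n dynV (crd u i)) < e.
have h i : \forall n \near \oo, Q i n.
  by have [N NP] := unstably_lun sS e0 (tu i); exists N.
have [N _ NP] := @filter_forall _ _ Q \oo _ h; exists N => n /NP nP; split=> [i|].
  by rewrite !crd_iterV; case: (nP i).
by apply: mdist_fiber_lt => // i; rewrite !crd_iterV; case: (nP i).
Qed.

(** Unstable equivalence of sections over the same vertex is an open condition,
    with a bounded level: it is so for their images in Y, and nearby points with
    locally unstable images are locally unstable. *)
Lemma near_flun (X : topologicalType) (v : X -> T) q (U : set X) (z z' : X -> Z)
    (a a' : X -> fiber_product f q) t0 e :
  open U -> U t0 -> sect rho tau v U z a -> sect rho tau v U z' a' ->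
  funst (a t0) (a' t0) -> 0 < e ->
  exists n0, \forall t \near t0, forall n, (n0 <= n)%N ->
    flun (iter n dynV (a t)) (iter n dynV (a' t)) /\
    mdist (iter n dynV (a t)) (iter n dynV (a' t)) < e.
Proof.
move=> oU Ut0 [cz ca za] [cz' ca' za'] aa' e0.
have nU : nbhs t0 U by exact: open_nbhs_nbhs.
have rzz' t : U t -> rho (z t) = rho (z' t).
  by move=> Ut; rewrite (za _ Ut).1 (za' _ Ut).1.
have [zz0 _] := rho_eq bb (rzz' _ Ut0).
have [m zm] := unstably_ulevel sY zz0.
have [d d0 dP] := flun_lift sS sY fb q.
have de0 : 0 < Num.min d e by rewrite lt_min d0.
have [N NP] := funst_close aa' de0.
pose n0 := maxn m N; exists n0.
have [_ dn0] := NP n0 (leq_maxr _ _).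
have near1 : \forall t \near t0, U t -> ulevel m (tau (z t)) (tau (z' t)).
  exact: (near_ulevel sY bb (cz _ Ut0) (cz' _ Ut0) Ut0 rzz' zm).
have cn := iter_continuous (n := n0) (@fiber_dynV_cont _ _ _ f sS q).
have near2 : \forall t \near t0,
    mdist (iter n0 dynV (a t)) (iter n0 dynV (a' t)) < Num.min d e.
  have c : cont_at (fun t => (iter n0 dynV (a t), iter n0 dynV (a' t))) t0.
    apply: cont_at_pair.
      by apply: (cont_at_comp (h := iter n0 dynV)); [exact: ca | exact: cn].
    by apply: (cont_at_comp (h := iter n0 dynV)); [exact: ca' | exact: cn].
  by apply: (c [set p | mdist p.1 p.2 < Num.min d e]); exact: near_mdist_lt.
apply: filterS3 nU near1 near2 => t Ut /(_ Ut) h1; rewrite lt_min => /andP[hd he].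
have {}h1 : ulevel n0 (base (a t)) (base (a' t)).
  by rewrite -(za _ Ut).2 -(za' _ Ut).2; apply: (ulevel_le sY (leq_maxl _ _)).
have lun0 : flun (iter n0 dynV (a t)) (iter n0 dynV (a' t)).
  by apply: dP => //; rewrite !base_iterV; case: h1.
move=> n n0n; rewrite -(subnK n0n) !iterD; split=> [i|].
  by rewrite !crd_iterV; apply: (lun_iter sS); rewrite -!crd_iterV.
exact: le_lt_trans (flun_iter_le sS _ lun0) he.
Qed.

Lemma flun_funst q n (t u : fiber_product f q) :
  flun (iter n dynV t) (iter n dynV u) -> funst t u.
Proof.
move=> tu i; apply: (@unstably_iterV _ _ n); apply: (lun_unstably sS).
by rewrite -!crd_iterV.
Qed.

Lemma near_funst (X : topologicalType) (v : X -> T) q (U : set X) (z z' : X -> Z)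
    (a a' : X -> fiber_product f q) t0 :
  open U -> U t0 -> sect rho tau v U z a -> sect rho tau v U z' a' ->
  funst (a t0) (a' t0) -> \forall t \near t0, funst (a t) (a' t).
Proof.
move=> oU Ut0 sa sa' aa'; have [n0] := near_flun oU Ut0 sa sa' aa' ltr01.
by apply: filterS => t /(_ n0 (leqnn _))[/flun_funst].
Qed.

Lemma near_retract (X : topologicalType) (v : X -> T) q (U : set X) (z z' : X -> Z)
    (a a' : X -> fiber_product f q) t0 (rn : nat -> fiber_product f q -> _) :
  retractions rn ->
  open U -> U t0 -> sect rho tau v U z a -> sect rho tau v U z' a' ->
  funst (a t0) (a' t0) ->
  exists n0, \forall t \near t0, forall n, (n0 <= n)%N -> rn n (a t) = rn n (a' t).
Proof.
move=> rnP oU Ut0 sa sa' aa'; have [d d0 dP] := rn_eq rnP.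
have [n0 h] := near_flun oU Ut0 sa sa' aa' d0; exists n0.
apply: filterS h => t h n n0n; have [l m] := h n n0n.
exact: (dP n).
Qed.

(** The retractions move the points along unstable sets at a bounded level, so
    that the section of the bibundle can be transported continuously. *)
Lemma sect_retract (X : topologicalType) (v : X -> T) q (U : set X) (z : X -> Z)
    (a : X -> fiber_product f q) (rn : nat -> fiber_product f q -> _) n :
  retractions rn -> open U -> sect rho tau v U z a ->
  exists z', sect rho tau v U z' (rn n \o a).
Proof.
move=> rnP oU [cz ca za].
exists (fun t => transport tau ract (z t) (base (rn n (a t)))).
have cra : cont_on U (rn n \o a).
  move=> t Ut; apply: (cont_at_comp (h := rn n)); first exact: ca.
  exact: rn_cont.
have lev t : U t -> ulevel n (tau (z t)) (base (rn n (a t))).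
  by move=> Ut; rewrite (za _ Ut).2; exact: rn_level.
split=> // [t Ut|t Ut].
  apply: (transport_cont sY bb (n := n)); first exact: cz.
    apply: (cont_at_comp (g := rn n \o a) (h := @base _ _ _ f q)); first exact: cra.
    exact: base_cont.
  by apply: filterS (open_nbhs_nbhs (conj oU Ut)) => t'; exact: lev.
rewrite (transport_rho bb) (za _ Ut).1; split=> //.
by rewrite (transport_tau bb) //; exact: ulevel_unstably (lev _ Ut).
Qed.

(** ** Sections of the fibre products *)

(** Compactness: a limit of tuples whose images come together is in the fibre
    product. *)
Lemma approx_fiber q e : 0 < e -> exists2 d, 0 < d & forall c : 'I_q.+1 -> S,
  (forall i j, mdist (f (c i)) (f (c j)) < d) ->
  exists t : fiber_product f q, forall i, mdist (c i) (crd t i) < e.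
Proof.
move=> e0; apply: contrapT => nd.
pose B (d : R) := [set c : 'I_q.+1 -> S |
  (forall i j, mdist (f (c i)) (f (c j)) < d) /\
  ~ exists t : fiber_product f q, forall i, mdist (c i) (crd t i) < e].
have PF : ProperFilter (filter_from [set d : R | 0 < d] B).
  apply: filter_from_proper.
    apply: filter_from_filter; first by exists 1 => /=.
    move=> d d' /= d0 d'0; exists (Num.min d d'); first by rewrite /= lt_min d0.
    by move=> c [cd nc]; split; split=> // i j; have := cd i j;
      rewrite lt_min => /andP[].
  move=> d d0; apply: contrapT => B0; apply: nd; exists d => // c cd.
  by apply: contrapT => nc; apply: B0; exists c.
have [F [FU BF]] := ultraFilterLemma PF.
have cvgF i : exists s : S, (fun c : 'I_q.+1 -> S => c i) @ F --> s.
  have [s [_ Gs]] := @sa_compact _ _ sS ((fun c : 'I_q.+1 -> S => c i) @ F) _ filterT.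
  exists s => O Os.
  have [//|] := in_ultra_setVsetC ((fun c : 'I_q.+1 -> S => c i) @^-1` O) FU.
  by move=> FO; have [s' []] := Gs (~` O) O FO Os.
have [s sP] := boolp.choice cvgF.
have sF i j : f (s i) = f (s j).
  apply: mdist_positivity; apply/eqP; rewrite eq_le mdist_ge0 andbT.
  apply/ler_addgt0Pl => d d0; rewrite addr0.
  have d30 : 0 < d / 3 by rewrite divr_gt0.
  have fnear k : \forall c \near F, mdist (f (s k)) (f (c k)) < d / 3.
    have [d' d'0 d'P] := fmap_uniform f sS d30.
    have nk : F [set c | mdist (s k) (c k) < d'].
      by apply: (sP k [set x | mdist (s k) x < d']); exact: mdist_nbhs d'0 _.
    by apply: (filterS _ nk) => c /d'P.
  have dnear : \forall c \near F, mdist (f (c i)) (f (c j)) < d / 3.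
    by apply: BF; exists (d / 3) => // c [cd _]; exact: cd.
  have [c [h1 [h2 h3]]] := @filter_ex _ F _ _
    (filterI (fnear i) (filterI (fnear j) dnear)).
  apply: le_trans (metric_triangle _ (f (c i)) _) _.
  apply: le_trans (lerD (lexx _) (metric_triangle _ (f (c j)) _)) _.
  rewrite [X in _ <= X](_ : d = d / 3 + (d / 3 + d / 3)); last by field.
  by rewrite !lerD // ltW // metric_sym.
have [t ts _] := fiber_mk (fun i => sF i ord0).
pose Q i := [set c : 'I_q.+1 -> S | mdist (c i) (crd t i) < e].
have Qnear i : \forall c \near F, Q i c.
  apply: (sP i [set x | mdist x (crd t i) < e]).
  by apply: (mdist_nbhs e0) => x; rewrite ts metric_sym.
have Qall : F [set c | forall i, Q i c] by exact: (@filter_forall _ _ Q F).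
have FB : F (B 1) by apply: BF; exists 1 => /=.
by have [c [h [_ nc]]] := @filter_ex _ F _ _ (filterI Qall FB); apply: nc; exists t.
Qed.

(** Backward iterates of the images in Y of these sections approach each other,
    so that backward iterates of the sections approach a point (t_i) of the
    fibre product; the iterates of the brackets of t_i with them are unstably
    equivalent to the sections and are in the fibre product. *)
Lemma fiber_sections (X : topologicalType) (v : X -> T) q (U : set X)
    (z : 'I_q.+1 -> X -> Z) (a : 'I_q.+1 -> X -> S) x :
  open U -> U x -> (forall i, cont_on U (z i)) -> (forall i, cont_on U (a i)) ->
  (forall i t, U t -> rho (z i t) = v t /\ tau (z i t) = f (a i t)) ->
  exists (N : set X) (w : X -> Z) (b : X -> fiber_product f q),
    [/\ open N, N x, N `<=` U, sect rho tau v N w b &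
      forall t i, N t -> unstably_equivalent (crd (b t) i) (a i t)].
Proof.
move=> oU Ux cz ca za; have nU : nbhs x U by exact: open_nbhs_nbhs.
have rzz i t : U t -> rho (z i t) = rho (z ord0 t).
  by move=> Ut; rewrite (za i _ Ut).1 (za ord0 _ Ut).1.
have [d1 d10 d1P] := fmap_br f sS sY.
have sm0 := small_gt0 sY.
have [d2 d20 d2P] := br_uniform sY sm0.
have [d3 d30 d3P] := fmap_uniform f sS d20.
have [d4 d40 d4P] := br_uniform sS (sa_radius sS).
have e0 : 0 < Num.min (Num.min d1 d3) (Num.min (radius S) d4).
  by rewrite !lt_min d10 d30 d40 (sa_radius sS).
set e := Num.min _ _ in e0.
have [h h0 hP] := approx_fiber q e0.
have h20 : 0 < h / 2 by rewrite divr_gt0.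
(* a level at which the images of all the sections are close at x *)
pose Q i n := ulevel n (f (a i x)) (f (a ord0 x)) /\
  mdist (iter n dynV (f (a i x))) (iter n dynV (f (a ord0 x))) < h / 2.
have Qnear i : \forall n \near \oo, Q i n.
  have [un _] := rho_eq bb (rzz i _ Ux).
  rewrite (za i _ Ux).2 (za ord0 _ Ux).2 in un.
  have hs0 : 0 < Num.min (small Y) (h / 2) by rewrite lt_min sm0.
  have [N NP] := unstably_lun sY hs0 un; exists N => // n /NP[l].
  by rewrite lt_min => /andP[? ?]; split.
have [n _ /(_ n (leqnn _)) Qn] := @filter_forall _ _ Q \oo _ Qnear.
have [|t0 t0P] := hP (fun i => iter n dynV (a i x)).
  move=> i j; rewrite !fmap_iterV.
  apply: le_lt_trans (metric_triangle _ (iter n dynV (f (a ord0 x))) _) _.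
  rewrite (splitr h) ltrD //; first by case: (Qn i).
  by rewrite metric_sym; case: (Qn j).
have cn := iter_continuous (n := n) (sa_dynV sS).
have cn' := iter_continuous (n := n) (sa_dyn sS).
have cna i : cont_at (fun t => iter n dynV (a i t)) x.
  by apply: (cont_at_comp (h := iter n dynV)); [exact: ca | exact: cn].
pose P1 i t := mdist (crd t0 i) (iter n dynV (a i t)) < e.
pose P2 i t := U t -> ulevel n (f (a i t)) (f (a ord0 t)).
have near1 i : \forall t \near x, P1 i t.
  apply: (cna i [set y | mdist (crd t0 i) y < e]).
  have : mdist (crd t0 i) (iter n dynV (a i x)) < e by rewrite metric_sym.
  move=> lt; have e'0 : 0 < e - mdist (crd t0 i) (iter n dynV (a i x)).
    by rewrite subr_gt0.
  apply: (mdist_nbhs e'0) => y; rewrite ltrBrDl.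
  by apply: le_lt_trans; exact: metric_triangle.
have near2 i : \forall t \near x, P2 i t.
  have zx : ulevel n (tau (z i x)) (tau (z ord0 x)).
    by rewrite (za i _ Ux).2 (za ord0 _ Ux).2; case: (Qn i).
  have := near_ulevel sY bb (cz i _ Ux) (cz ord0 _ Ux) Ux (rzz i) zx.
  by apply: filterS => t hh Ut; rewrite -(za i _ Ut).2 -(za ord0 _ Ut).2; exact: hh.
have nearall1 : \forall t \near x, forall i, P1 i t.
  exact: (@filter_forall _ _ P1 (nbhs x)).
have nearall2 : \forall t \near x, forall i, P2 i t.
  exact: (@filter_forall _ _ P2 (nbhs x)).
have [N [oN Nx NP]] := nearP_open (filterI nU (filterI nearall1 nearall2)).
pose c i t := iter n dyn (br (crd t0 i) (iter n dynV (a i t))).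
have dist1 i t : N t -> [/\ mdist (crd t0 i) (iter n dynV (a i t)) < d1,
    mdist (crd t0 i) (iter n dynV (a i t)) < d3,
    mdist (crd t0 i) (iter n dynV (a i t)) < radius S &
    mdist (crd t0 i) (iter n dynV (a i t)) < d4].
  move=> /NP[_ [/(_ i) + _]]; rewrite /P1 /e !lt_min.
  by move=> /andP[/andP[-> ->] /andP[-> ->]].
pose y t := iter n dyn (br (base t0) (iter n dynV (f (a ord0 t)))).
have fc i t : N t -> f (c i t) = y t.
  move=> Nt; have [h1 h3 _ _] := dist1 i _ Nt; have [h1' _ _ _] := dist1 ord0 _ Nt.
  rewrite /c fmap_iter /y; congr (iter n dyn _).
  have [_ r1 ->] := d1P _ _ h1; have [_ r1' _] := d1P _ _ h1'.
  rewrite !f_crd !fmap_iterV in r1 r1' *.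
  by apply: (br_lun sY) => //; have [Ut [_ /(_ i Ut)[]]] := NP _ Nt.
have bex t : exists b : fiber_product f q, N t -> forall i, crd b i = c i t.
  have [Nt|nNt] := pselect (N t); last by exists t0 => /nNt.
  by have [b bc _] := fiber_mk (fun i => fc i t Nt); exists b => _ i; rewrite bc.
have [b bP] := boolp.choice bex.
have bbase t : N t -> base (b t) = y t.
  by move=> Nt; rewrite /base (bP _ Nt) fc.
have lev t : N t -> ulevel n (tau (z ord0 t)) (base (b t)).
  move=> Nt; have [Ut _] := NP _ Nt; rewrite (za ord0 _ Ut).2 bbase //.
  have [_ /d3P h3 _ _] := dist1 ord0 _ Nt; rewrite f_crd fmap_iterV in h3.
  have [r2 _ s2] := d2P _ _ h3.
  rewrite /ulevel /y iter_dynK; split=> //.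
  apply: (lun_sym sY); apply: (lun_br sY) => //.
  by rewrite metric_sym ltW // (lt_le_trans s2) // small_le.
have cb : cont_on N b.
  move=> t Nt; have [Ut _] := NP _ Nt; apply: cont_at_fiber => i.
  apply: (@cont_at_near _ _ (c i)).
    by apply: filterS (open_nbhs_nbhs (conj oN Nt)) => t' Nt'; rewrite (bP _ Nt').
  apply: (cont_at_comp (h := iter n dyn)); last exact: cn'.
  apply: (cont_at_comp (g := fun t => (crd t0 i, iter n dynV (a i t)))
    (h := fun p => br p.1 p.2)).
    apply: cont_at_pair; first exact: cont_at_cst.
    by apply: (cont_at_comp (h := iter n dynV)); [exact: ca | exact: cn].
  by apply: br_cont => //; have [_ _ ? _] := dist1 i _ Nt.
exists N, (fun t => transport tau ract (z ord0 t) (base (b t))), b; split=> //.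
- by move=> t /NP[].
- split=> // [t Nt|t Nt].
    apply: (transport_cont sY bb (n := n)).
    + by apply: cz; case: (NP _ Nt).
    + apply: (cont_at_comp (g := b) (h := @base _ _ _ f q)); first exact: cb.
      exact: base_cont.
    by apply: filterS (open_nbhs_nbhs (conj oN Nt)) => t'; exact: lev.
  have [Ut _] := NP _ Nt; rewrite (transport_rho bb) (za ord0 _ Ut).1; split=> //.
  by rewrite (transport_tau bb) //; exact: ulevel_unstably (lev _ Nt).
move=> t i Nt; rewrite (bP _ Nt); apply: (@unstably_iterV _ _ n).
rewrite /c iter_dynK; apply: (lun_unstably sS).
have [_ _ hr /d4P[_ _ h4]] := dist1 i _ Nt.
by apply: (lun_br sS); [exact: ltW | rewrite metric_sym ltW].
Qed.
End Sections.

(** * The nerve of a principal etale groupoid *)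

Section Nerve.
Variable G : groupoid.
Hypothesis topG : topological_groupoid G.
Hypotheses (esrc : etale_map (@src G)) (erng : etale_map (@rng G)).
Hypothesis principal :
  forall g h : arr G, src g = src h -> rng g = rng h -> g = h.
Hypotheses (hT : hausdorff_space (obj G)) (bT : co_basis (obj G)).

Definition arrow p (t : nerve G p.+1) (i : 'I_p.+1) : arr G := set_val t i.

Lemma arrow_src p (t : nerve G p.+1) (i j : 'I_p.+1) : j = i.+1 :> nat ->
  src (arrow t i) = rng (arrow t j).
Proof. exact: (set_mem (valP t)). Qed.

Lemma arrow_inj p (s t : nerve G p.+1) : arrow s =1 arrow t -> s = t.
Proof. by case: s t => [s ?] [t ?] /= st; exact/eq_exist/funext. Qed.

Lemma arrow_mk p (a : 'I_p.+1 -> arr G) :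
  (forall i j : 'I_p.+1, j = i.+1 :> nat -> src (a i) = rng (a j)) ->
  exists t : nerve G p.+1, arrow t =1 a.
Proof. by move=> aP; exists (exist _ a (mem_set (aP : composable a))). Qed.

(** As G is principal, a simplex of its nerve is determined by its vertices, see
    [vtx_inj], and the faces omit one vertex, see [vtx_face]: this reduces the
    simplicial identities to identities between indices. *)
Definition vtx p : nerve G p -> 'I_p.+1 -> obj G :=
  match p return nerve G p -> 'I_p.+1 -> obj G with
  | 0 => fun x _ => x
  | q.+1 => fun t i =>
      if unlift ord0 i is Some j then src (arrow t j) else rng (arrow t ord0)
  end.

Definition v0 p (t : nerve G p) : obj G := vtx t ord0.

Lemma vtx_src p (t : nerve G p.+1) j : vtx t (fintype.lift ord0 j) = src (arrow t j).
Proof. by rewrite /= liftK. Qed.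

Lemma v0E p (t : nerve G p.+1) : v0 t = rng (arrow t ord0).
Proof. by rewrite /v0 /= unlift_none. Qed.

Lemma vtx_rng p (t : nerve G p.+1) j :
  vtx t (widen_ord (leqnSn _) j) = rng (arrow t j).
Proof.
have [i ji|->] := unliftP ord0 j; last first.
  by rewrite (_ : widen_ord _ _ = ord0) ?[LHS]v0E //; exact: val_inj.
case: p t j i ji => [t j []//|p t j i ji].
rewrite (_ : widen_ord _ _ = fintype.lift ord0 (widen_ord (leqnSn _) i)); last first.
  by rewrite ji; apply: val_inj => /=; rewrite /bump.
by rewrite vtx_src; apply: arrow_src; rewrite ji.
Qed.

Lemma vtx_inj p (s t : nerve G p) : vtx s =1 vtx t -> s = t.
Proof.
case: p s t => [s t /(_ ord0)//|p s t st].
by apply: arrow_inj => j; apply: principal; rewrite -!(vtx_src, vtx_rng) st.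
Qed.

Lemma arrow_face p (k : 'I_p.+3) (t : nerve G p.+2) :
  arrow (face k t) = face_tuple k (arrow t).
Proof. by []. Qed.

Lemma vtx_face p (k : 'I_p.+2) (t : nerve G p.+1) i :
  vtx (face k t) i = vtx t (fintype.lift k i).
Proof.
case: p k t i => [k t i|p k t i].
  rewrite [i]ord1 /face -/(arrow t ord0); case: eqP => [->|k0].
    by rewrite (_ : fintype.lift _ _ = fintype.lift ord0 ord0) ?vtx_src.
  have k1 : k = 1%N :> nat by case: k k0 => -[|[|//]] //= ? /eqP; rewrite eqE.
  rewrite (_ : fintype.lift _ _ = widen_ord (leqnSn _) ord0) ?vtx_rng //.
  by apply: val_inj; rewrite /= /bump k1.
have cmp (j : 'I_p.+1) : src (arrow t (widen_ord (leqnSn _) j)) =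
    rng (arrow t (fintype.lift ord0 j)) by apply: arrow_src; rewrite /= /bump.
have [j ->|->] := unliftP ord0 i; last first.
  rewrite [LHS]v0E arrow_face /face_tuple.
  have [k1|k1|k1] := ltngtP 1%N k.
  - by rewrite -vtx_rng; congr (vtx t _); apply: val_inj; rewrite /= /bump leqNgt ltnW.
  - rewrite -vtx_rng; congr (vtx t _); apply: val_inj.
    by rewrite /= /bump; case: (k : nat) k1 => [|[]].
  rewrite rng_comp // -vtx_rng; congr (vtx t _); apply: val_inj.
  by rewrite /= /bump -k1.
rewrite vtx_src arrow_face /face_tuple.
have [k1|k1|k1] := ltngtP j.+1 k.
- by rewrite -vtx_src; congr (vtx t _); apply: val_inj;
    rewrite /= /bump /= add1n leqNgt k1.
- by rewrite -vtx_src; congr (vtx t _); apply: val_inj;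
    rewrite /= /bump /= !add1n ltnW.
rewrite src_comp // -vtx_src; congr (vtx t _); apply: val_inj.
by rewrite /= /bump /= !add1n -k1 leqnn.
Qed.

Lemma face_face p (t : nerve G p.+2) (j : 'I_p.+2) (k : 'I_p.+2) : (j <= k)%N ->
  face j (face (fintype.lift ord0 k) t) = face k (face (widen_ord (leqnSn _) j) t).
Proof.
move=> jk; apply: vtx_inj => i; rewrite !vtx_face; congr (vtx t _).
apply: val_inj; rewrite /= /bump /= /bump /= add1n.
by move: jk; case: (leqP j i); case: (leqP k i); case: leqP; case: leqP => /=; lia.
Qed.

Definition hd p (t : nerve G p.+1) : arr G := arrow t ord0.

Lemma src_hd p (t : nerve G p.+1) : src (hd t) = v0 (face ord0 t).
Proof.
rewrite /v0 vtx_face -vtx_src; congr (vtx t _); exact: val_inj.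
Qed.

Lemma rng_hd p (t : nerve G p.+1) : rng (hd t) = v0 t.
Proof. by rewrite v0E. Qed.

Lemma v0_face p (t : nerve G p.+1) k : k != ord0 -> v0 (face k t) = v0 t.
Proof.
move=> k0; rewrite /v0 vtx_face; congr (vtx t _); apply: val_inj.
have {}k0 : (k != 0 :> nat) by [].
by rewrite /= /bump leqn0 (negbTE k0).
Qed.

Lemma hd_face0_inj p (s t : nerve G p.+1) : hd s = hd t ->
  face ord0 s = face ord0 t -> s = t.
Proof.
move=> hst fst; apply: vtx_inj => i; have [j ->|->] := unliftP ord0 i; last first.
  by rewrite -!/(v0 _) -!rng_hd hst.
by rewrite -!vtx_face fst.
Qed.

(** The condition is inside of the existential quantifier so that [choice]
    applies. *)
Lemma cons_ex p (g : arr G) (s : nerve G p) : exists t : nerve G p.+1,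
  src g = v0 s -> hd t = g /\ face ord0 t = s.
Proof.
have [gs|] := pselect (src g = v0 s); last first.
  by have [t _] := @arrow_mk p (fun=> idt (src g)) (fun _ _ _ =>
    etrans (src_idt _) (esym (rng_idt _))); exists t.
case: p s gs => [s gs|p s gs].
  have [t tE] := @arrow_mk 0 (fun=> g) (fun i j ij => ltac:(by move: ij; rewrite [j]ord1)).
  exists t => _; split; first by rewrite /hd tE.
  by rewrite -[face _ _]/(src (arrow t ord0)) tE.
pose a i := if unlift ord0 i is Some j then arrow s j else g.
have [i j ij|t tE] := @arrow_mk p.+1 a.
  rewrite /a; have [j' jE|ji] := unliftP ord0 j; last by rewrite ji in ij.
  have [i' iE|iE] := unliftP ord0 i; last first.
    rewrite gs v0E; congr (rng (arrow s _)); apply: val_inj.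
    by move: ij; rewrite jE iE /= /bump /= add1n => -[].
  by apply: arrow_src; move: ij; rewrite jE iE /= /bump /= !add1n => -[].
exists t => _; split; first by rewrite /hd tE /a unlift_none.
apply: arrow_inj => j.
by rewrite -[LHS]/(arrow t (fintype.lift ord0 j)) tE /a liftK.
Qed.

(** ** Topology of the nerve *)

Lemma arrow_cont p (i : 'I_p.+1) : continuous (fun t : nerve G p.+1 => arrow t i).
Proof.
move=> t; apply: (cont_at_comp (g := fun t : nerve G p.+1 =>
  (set_val t : {ptws 'I_p.+1 -> arr G})) (h := fun a => a i)).
  exact: initial_continuous.
exact: (@proj_continuous _ (fun=> arr G) i).
Qed.

Lemma nerve_cont (X : topologicalType) p (g : X -> nerve G p.+1) x :
  (forall i, cont_at (fun y => arrow (g y) i) x) -> cont_at g x.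
Proof.
move=> ci O [_ [[O' oO' <-] O'g] O'O].
have : cont_at (fun y => (set_val (g y) : {ptws 'I_p.+1 -> arr G})) x.
  rewrite /cont_at; apply/cvg_sup => i U /= [_ [[W oW <-] Wg] WU].
  by apply: (filterS WU); apply: ci; exact: open_nbhs_nbhs.
move=> /(_ O' (open_nbhs_nbhs (conj oO' O'g))) h.
suff : \forall y \near x, O (g y) by [].
by apply: (@filterS _ (nbhs x) _ _ _ _ h) => y /O'O.
Qed.

Lemma etale_of_section (X W : topologicalType) (d : X -> W) :
  continuous d ->
  (forall x : X, exists N, [/\ open N, N x &
    forall s t, N s -> N t -> d s = d t -> s = t]) ->
  (forall x, exists s, [/\ cont_at s (d x), s (d x) = x &
    \forall y \near d x, d (s y) = y]) -> etale_map d.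
Proof.
move=> cd di ds; split=> // O oO; rewrite openE => _ [x Ox <-].
have [s [cs sx dsE]] := ds x.
have Os : \forall y \near d x, O (s y).
  by apply: cs; rewrite sx; exact: open_nbhs_nbhs.
by apply: filterS2 dsE Os => y sy Osy; exists (s y).
Qed.

Lemma etale_near_section (X W : topologicalType) (d : X -> W) x :
  etale_map d -> exists s, [/\ cont_at s (d x), s (d x) = x &
    \forall y \near d x, d (s y) = y].
Proof.
move=> ed; have [N [oN Nx dN]] := etale_inj x ed.
have [s [sE cs]] := etale_section ed oN Nx dN.
exists s; split; [by apply: cs; exists x | exact: sE |].
have : nbhs (d x) (d @` N).
  by apply: open_nbhs_nbhs; split; [exact: em_open ed _ oN | exists x].
by apply: filterS => _ [t Nt <-]; rewrite sE.
Qed.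

Lemma hd_cont p : continuous (@hd p).
Proof. exact: arrow_cont. Qed.

Lemma face0_cont p : continuous (@face G p ord0).
Proof.
case: p => [|p] t.
  apply: (cont_at_comp (g := fun t : nerve G 1 => arrow t ord0) (h := @src G)).
    exact: arrow_cont.
  exact: em_continuous esrc _.
apply: nerve_cont => i; exact: (@arrow_cont p.+1 (fintype.lift ord0 i)).
Qed.

Lemma v0_cont p : continuous (@v0 p).
Proof.
case: p => [|p] t; first exact: cvg_id.
rewrite (_ : @v0 p.+1 = fun t => rng (hd t)); last first.
  by apply/funext => u; rewrite rng_hd.
apply: (cont_at_comp (h := @rng G)); first exact: hd_cont.
exact: em_continuous erng _.
Qed.

Lemma cons_cont (X : topologicalType) p (g : X -> nerve G p.+1) x :
  cont_at (fun y => hd (g y)) x -> cont_at (fun y => face ord0 (g y)) x ->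
  cont_at g x.
Proof.
move=> ch ct; apply: nerve_cont => i.
have [j ->|->] := unliftP ord0 i; last exact: ch.
case: p g ch ct j {i} => [g _ _ []//|p g ch ct j].
apply: (cont_at_comp (g := fun y => face ord0 (g y))
  (h := fun t : nerve G p.+1 => arrow t j)) => //.
exact: arrow_cont.
Qed.

(** The missing arrow is recovered by a local section of the source map. *)
Lemma etale_face0 p : etale_map (@face G p ord0).
Proof.
apply: etale_of_section => [|t|t].
- exact: face0_cont.
- have [N [oN Nt srcN]] := etale_inj (hd t) esrc.
  exists (@hd p @^-1` N); split=> //.
    by apply: preimage_open => //; exact: hd_cont.
  move=> s u Ns Nu su; apply: hd_face0_inj => //; apply: srcN => //.
  by rewrite !src_hd su.
have [r [cr rx rE]] := etale_near_section (hd t) esrc.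
rewrite src_hd in cr rx rE.
have [w wP] := boolp.choice (fun s : nerve G p => cons_ex (r (v0 s)) s).
have {}rE : \forall s \near face ord0 t, src (r (v0 s)) = v0 s := v0_cont rE.
have wt : w (face ord0 t) = t.
  have [h1 h2] := wP _ (nbhs_singleton rE).
  by apply: hd_face0_inj => //; rewrite h1 rx.
exists w; split=> //; last by apply: filterS rE => s /wP[].
apply: cons_cont.
  apply: (@cont_at_near _ _ (fun s => r (v0 s))).
    by apply: filterS rE => s /wP[].
  by apply: (cont_at_comp (h := r)) => //; exact: v0_cont.
apply: (@cont_at_near _ _ id); last exact: cvg_id.
by apply: filterS rE => s /wP[].
Qed.

(** The first arrow is recovered by a local section of the range map, and the
    tail by induction. *)
Lemma etale_v0 p : etale_map (@v0 p).
Proof.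
elim: p => [|p IH].
  split=> [|O oO|x]; first exact: v0_cont.
    by rewrite (_ : _ @` _ = O) //; apply/seteqP; split=> [_ [x Ox <-]|x Ox] //; exists x.
  by exists setT; split=> //; exact: openT.
apply: etale_of_section => [|t|t].
- exact: v0_cont.
- have [N [oN Nt rngN]] := etale_inj (hd t) erng.
  have [M [oM Mt v0M]] := etale_inj (face ord0 t) IH.
  exists (@hd p @^-1` N `&` face ord0 @^-1` M); split=> //.
    apply: openI; apply: preimage_open => //; first exact: hd_cont.
    exact: face0_cont.
  move=> s u [Ns Ms] [Nu Mu] su; have hsu : hd s = hd u.
    by apply: rngN => //; rewrite !rng_hd.
  by apply: hd_face0_inj => //; apply: v0M => //; rewrite -!src_hd hsu.
have [r [cr rx rE]] := etale_near_section (hd t) erng.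
have [y [cy yx yE]] := etale_near_section (face ord0 t) IH.
rewrite rng_hd in cr rx rE; rewrite -src_hd in cy yx yE.
have crs : cont_at (fun x => src (r x)) (v0 t).
  by apply: (cont_at_comp (h := @src G)) => //; exact: em_continuous esrc _.
have crsy : cont_at (fun x => y (src (r x))) (v0 t).
  apply: (cont_at_comp (g := fun x => src (r x)) (h := y)) => //.
  by rewrite rx.
have [w wP] := boolp.choice (fun x => cons_ex (r x) (y (src (r x)))).
have {}yE : \forall x \near v0 t, src (r x) = v0 (y (src (r x))).
  rewrite -rx in yE; have h : \forall x \near v0 t, v0 (y (src (r x))) = src (r x).
    exact: crs yE.
  exact: filterS h.
have wt : w (v0 t) = t.
  have [h1 h2] := wP _ (nbhs_singleton yE).
  by apply: hd_face0_inj => //; rewrite ?h1 ?h2 rx.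
exists w; split=> //; last first.
  by apply: filterS2 rE yE => x rx' /wP[h1 h2]; rewrite -rng_hd h1.
apply: cons_cont.
  by apply: cont_at_near cr; apply: filterS yE => x /wP[].
by apply: cont_at_near crsy; apply: filterS yE => x /wP[].
Qed.

Lemma nerve_hausdorff p : hausdorff_space (nerve G p).
Proof.
case: p => [//|p] s t st; apply: arrow_inj => i.
apply: hausdorff_eq; first exact: tg_hausdorff.
move=> A B sA tB; have [u [Au Bu]] := st _ _ (@arrow_cont _ i _ _ sA) (@arrow_cont _ i _ _ tB).
by exists (arrow u i).
Qed.

Lemma nerve_co_basis p : co_basis (nerve G p).
Proof. exact: etale_co_basis (@etale_v0 p) bT. Qed.

Lemma face_cont p k : continuous (@face G p k).
Proof.
case: p k => [|p] k t.
  rewrite /face; case: (k == ord0).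
    apply: (cont_at_comp (g := fun t : nerve G 1 => arrow t ord0) (h := @src G)).
      exact: arrow_cont.
    exact: em_continuous esrc _.
  apply: (cont_at_comp (g := fun t : nerve G 1 => arrow t ord0) (h := @rng G)).
    exact: arrow_cont.
  exact: em_continuous erng _.
apply: nerve_cont => i; rewrite /cont_at.
suff : cont_at (fun u : nerve G p.+2 => face_tuple k (arrow u) i) t by [].
rewrite /face_tuple; case: ltngtP => _; try exact: arrow_cont.
apply: (@cont_at_within _ _ _ _
  (fun u : nerve G p.+2 => (arrow u (widen_ord (leqnSn _) i),
     arrow u (fintype.lift ord0 i))) (fun q => comp q.1 q.2)).
- exact: (tg_comp topG).
- by apply: cont_at_pair; exact: arrow_cont.
apply: (@filterS _ (nbhs t) _ setT) => [u _|]; last exact: filterT.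
by apply: arrow_src; rewrite /= /bump.
Qed.

Lemma etale_face p k : etale_map (@face G p k).
Proof.
have [->|k0] := eqVneq k ord0; first exact: etale_face0.
apply: (etale_map_cancel (v := @v0 p.+1) (w := @v0 p)).
- exact: face_cont.
- exact: etale_v0.
- exact: etale_v0.
by move=> t; exact: v0_face.
Qed.
End Nerve.

(** * Chains of local sections *)

Definition cut (X : Type) (V : zmodType) (U : set X) (v : X -> V) : X -> V :=
  fun t => if `[< U t >] then v t else 0.

Section Cut.
Variables (X : Type) (V : zmodType).
Implicit Types (U : set X) (v : X -> V).

Lemma cut_in U v t : U t -> cut U v t = v t.
Proof. by rewrite /cut => /asboolT ->. Qed.

Lemma cut_out U v t : ~ U t -> cut U v t = 0.
Proof. by rewrite /cut => /asboolF ->. Qed.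

Lemma cut_ext U v w : (forall t, U t -> v t = w t) -> cut U v = cut U w.
Proof.
by move=> vw; apply/funext => t; rewrite /cut; case: asboolP => // /vw.
Qed.

Lemma cut0 v : cut set0 v = 0.
Proof. by apply/funext => t; exact: cut_out. Qed.

Lemma cutU U U' v : U `&` U' = set0 -> cut (U `|` U') v = cut U v + cut U' v.
Proof.
move=> UU'; apply/funext => t; rewrite fctE.
have [Ut|nUt] := pselect (U t).
  rewrite cut_in; last by left.
  by rewrite (cut_in _ Ut) cut_out ?addr0 // => U't; have : (U `&` U') t by []; rewrite UU'.
rewrite (cut_out _ nUt) add0r /cut; congr (if _ then _ else _).
by apply/asboolP/asboolP; [case | right].
Qed.

Lemma cut_cut U U' v : cut U (cut U' v) = cut (U `&` U') v.
Proof.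
apply/funext => t; have [Ut|nUt] := pselect (U t); last first.
  by rewrite !cut_out // => -[].
rewrite cut_in //; have [U't|nU't] := pselect (U' t).
  by rewrite !cut_in.
by rewrite !cut_out // => -[].
Qed.

Lemma cutB U v w : cut U (v - w) = cut U v - cut U w.
Proof.
by apply/funext => t; rewrite !fctE /cut; case: asboolP => _; rewrite ?subr0 ?fctE.
Qed.

Lemma raddf_cut (W : zmodType) (h : {additive V -> W}) U v t :
  h (cut U v t) = cut U (fun x => h (v x)) t.
Proof. by rewrite /cut; case: asboolP; rewrite ?raddf0. Qed.
End Cut.

Lemma fct_mulrz (X : Type) (V : zmodType) (F : X -> V) n t :
  (F *~ n) t = F t *~ n.
Proof.
have h m : (F *+ m) t = F t *+ m.
  by elim: m => [|m IH]; rewrite ?mulr0n // !mulrS fctE IH.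
by case: n => n; [rewrite -!pmulrn h | rewrite !NegzE !mulrNz fctE -!pmulrn h].
Qed.

Section Chains.
Variables (X : topologicalType) (K : choiceType) (sec : set X -> (X -> K) -> Prop).

(** The predicate sec describes the sections of a sheaf of labels; chains are
    the integral combinations of sections over compact open sets. *)
Record gen := Gen {
  gset : set X; glab : X -> K;
  gco : compact_open gset; gsec : sec gset glab }.

Definition gfun (g : gen) : X -> {freeg K} :=
  cut (gset g) (fun t => << glab g t >>).

Definition gsum (r : seq (gen * int)) : X -> {freeg K} :=
  \sum_(g <- r) gfun g.1 *~ g.2.

Lemma gsumE r t : gsum r t = \sum_(g <- r) gfun g.1 t *~ g.2.
Proof. by rewrite /gsum fct_sumE; apply: eq_bigr => g _; rewrite fct_mulrz. Qed.

Definition chains (F : X -> {freeg K}) := exists r, F = gsum r.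

Lemma chains0 : chains 0.
Proof. by exists [::]; rewrite /gsum big_nil. Qed.

Lemma chainsB F H : chains F -> chains H -> chains (F - H).
Proof.
move=> [r ->] [s ->]; exists (r ++ [seq (g.1, - g.2) | g <- s]).
rewrite /gsum big_cat big_map /= -sumrN; congr (_ + _).
by apply: eq_bigr => g _; rewrite mulrNz.
Qed.

Lemma chainsN F : chains F -> chains (- F).
Proof. by move=> cF; rewrite -sub0r; apply: chainsB => //; exact: chains0. Qed.

Lemma chainsD F H : chains F -> chains H -> chains (F + H).
Proof. by move=> cF cH; rewrite -[H]opprK; apply/chainsB => //; exact: chainsN. Qed.

Lemma chainsMz F n : chains F -> chains (F *~ n).
Proof.
by move=> cF; apply: sub_closed_mulz cF; [exact: chains0 | exact: chainsB].
Qed.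

Lemma chains_sum (I : Type) (r : seq I) (P : pred I) (F : I -> X -> {freeg K}) :
  (forall i, P i -> chains (F i)) -> chains (\sum_(i <- r | P i) F i).
Proof.
move=> cF; elim/big_rec: _ => [|i H Pi cH]; first exact: chains0.
by apply: chainsD => //; exact: cF.
Qed.

Lemma chains_gen U l : compact_open U -> sec U l ->
  chains (cut U (fun t => << l t >>)).
Proof.
move=> cU lU; exists [:: (Gen cU lU, 1)].
by rewrite /gsum big_seq1 mulr1z.
Qed.

Lemma chains_ind (P : set (X -> {freeg K})) :
  P 0 -> (forall F H, P F -> P H -> P (F - H)) -> (forall g, P (gfun g)) ->
  forall F, chains F -> P F.
Proof.
move=> P0 PB Pg _ [r ->].
by have [] := @sub_additive_sum _ _ P id _ r (fun g => gfun g.1) (fun g => g.2) P0 PB.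
Qed.

Hypotheses (hX : hausdorff_space X) (bX : co_basis X).

Lemma chains_supp F : chains F -> exists2 U, compact_open U & F = cut U F.
Proof.
move: F; apply: chains_ind => [|F H [U cU FE] [U' cU' HE]|g].
- by exists set0; [exact: compact_open0 | rewrite cut0].
- exists (U `|` U'); first exact: compact_openU.
  apply/funext => t; have [Ut|nt] := pselect ((U `|` U') t).
    by rewrite cut_in.
  rewrite cut_out // !fctE.
  rewrite FE cut_out => [|Ut]; last by apply: nt; left.
  by rewrite HE cut_out ?subr0 // => Ut; apply: nt; right.
exists (gset g); first exact: gco.
by rewrite /gfun cut_cut setIid.
Qed.

Lemma gen_near (g : gen) x :
  \forall t \near x, gset g t <-> gset g x.
Proof.
have [kg og] := gco g; have [gx|ngx] := pselect (gset g x).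
  by apply: filterS (open_nbhs_nbhs (conj og gx)) => t gt; split.
have : nbhs x (~` gset g).
  by apply: open_nbhs_nbhs; split=> //; apply: closed_openC; exact: compact_closed.
by apply: filterS => t ngt; split.
Qed.

Lemma gsum_near r x : \forall t \near x,
  gsum r t = \sum_(g <- r | `[< gset g.1 x >]) << glab g.1 t >> *~ g.2.
Proof.
elim: r => [|[g m] r IH].
  apply: (@filterS _ (nbhs x) _ setT) => [t _|]; last exact: filterT.
  by rewrite gsumE !big_nil.
apply: filterS2 (gen_near g x) IH => t gt; rewrite !gsumE !big_cons /= => ->.
rewrite /gfun /cut; case: asboolP => gx; case: asboolP => gt' //.
- by case: gt' ; apply/gt.
- by case: gx; apply/gt.
by rewrite mul0rz add0r.
Qed.

(** Two of the finitely many sections through x with the same class at x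
    eventually have the same value, so that the relation at x carries over by
    freeness. The filter Phi serves both for points near x at large times and
    for small compact open neighbourhoods of x. *)
Lemma chains_relation (K' : choiceType) (c : K -> K') (r : seq (gen * int)) x
    (V : zmodType) (Th : Type) (Phi : set_system Th) (w : gen -> Th -> V) :
  Filter Phi ->
  frlift (fun k => (<< c k >> : {freeg K'})) (gsum r x) = 0 ->
  (forall g g' : gen, gset g x -> gset g' x -> c (glab g x) = c (glab g' x) ->
     \forall th \near Phi, w g th = w g' th) ->
  \forall th \near Phi,
     \sum_(g <- r | `[< gset g.1 x >]) w g.1 th *~ g.2 = 0.
Proof.
move=> FPhi r0 wnear; pose tr := in_tuple r.
pose Q (ij : 'I_(size r) * 'I_(size r)) th :=
  let g := (tnth tr ij.1).1 in let g' := (tnth tr ij.2).1 in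
  gset g x -> gset g' x -> c (glab g x) = c (glab g' x) -> w g th = w g' th.
have Qnear ij : \forall th \near Phi, Q ij th.
  rewrite /Q; set g := (tnth _ _).1; set g' := (tnth _ _).1 => /=.
  have [gx|ngx] := pselect (gset g x); last first.
    by apply: (@filterS _ Phi _ setT) => //; exact: filterT.
  have [g'x|ng'x] := pselect (gset g' x); last first.
    by apply: (@filterS _ Phi _ setT) => //; exact: filterT.
  have [cgg|ncgg] := pselect (c (glab g x) = c (glab g' x)); last first.
    by apply: (@filterS _ Phi _ setT) => //; exact: filterT.
  by apply: filterS (wnear _ _ gx g'x cgg).
have : \forall th \near Phi, forall ij, Q ij th.
  exact: (@filter_forall _ _ Q Phi _ Qnear).
apply: filterS => th Qth.
rewrite big_tnth; apply: (freeg_relation (c := fun i =>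
  c (glab (tnth tr i).1 x))) => [i j /asboolP gi /asboolP gj cij|].
  exact: (Qth (i, j)).
rewrite -[RHS]r0 gsumE raddf_sum [RHS]big_tnth [LHS]big_mkcond /=.
apply: eq_bigr => i _; rewrite raddfMz /= /gfun /cut.
by case: (asbool _); rewrite ?frliftU // raddf0 mul0rz.
Qed.
End Chains.

(** ** Pushing chains forward *)

Lemma fibre_sumD (X Y : choiceType) (V : zmodType) (d : X -> Y) (F H : X -> V) :
  fibre_finite d F -> fibre_finite d H ->
  fibre_sum d (F + H) = fibre_sum d F + fibre_sum d H.
Proof.
move=> fF fH; have f0 : fibre_finite d (0 : X -> V).
  by move=> y; apply: sub_finite_set (finite_set0 X) => x [_]; rewrite eqxx.
have fN : fibre_finite d (- H).
  by move=> y; apply: sub_finite_set (fH y) => x [dx]; rewrite fctE oppr_eq0.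
rewrite -[in LHS](opprK H) fibre_sumB // -[- H]sub0r fibre_sumB //.
by rewrite fibre_sum0 sub0r opprK.
Qed.

Section ChainsMap.
Variables (X Y : topologicalType) (K : choiceType).
Variables (secX : set X -> (X -> K) -> Prop) (secY : set Y -> (Y -> K) -> Prop).
Hypotheses (hX : hausdorff_space X) (bX : co_basis X).
Variable d : X -> Y.
Hypothesis ed : etale_map d.

Lemma chains_fibre_finite F : chains secX F -> fibre_finite d F.
Proof.
move=> /chains_supp[U cU ->] y.
apply: sub_finite_set (etale_fiber_finite y hX bX ed cU) => t [dt].
by rewrite /cut; case: asboolP => //; rewrite eqxx.
Qed.

Lemma fibre_sum_cut (V : zmodType) (N M : set X) (v : X -> V) (s : Y -> X) :
  (forall t, N t -> s (d t) = t) -> M `<=` N ->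
  fibre_sum d (cut M v) = cut (d @` M) (v \o s).
Proof.
move=> sd MN; apply/funext => y; have [[t Mt dt]|nMy] := pselect ((d @` M) y).
  rewrite cut_in; last by exists t.
  rewrite (@fibre_sumE _ _ _ d _ y [:: t]) // => [|x dx].
    by rewrite big_mkcond big_seq1 dt eqxx cut_in //= -dt sd //; exact: MN.
  rewrite /cut; case: asboolP => [Mx _|]; last by rewrite eqxx.
  by rewrite inE -(sd x) ?dx -?dt ?sd //; exact: MN.
rewrite cut_out // (@fibre_sumE _ _ _ d _ y [::]) ?big_nil // => x dx.
rewrite /cut; case: asboolP => [Mx _|]; last by rewrite eqxx.
by case: nMy; exists x.
Qed.

Hypothesis sec_push : forall U l s, open U -> secX U l ->
  (forall t, U t -> s (d t) = t) -> cont_on (d @` U) s ->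
  secY (d @` U) (l \o s).
Hypothesis secX_sub : forall U V l, V `<=` U -> secX U l -> secX V l.

(** A section over a set on which d is injective is pushed forward to a section,
    and compact open sets are disjoint unions of such sets. *)
Lemma chains_fibre_sum F : chains secX F -> chains secY (fibre_sum d F).
Proof.
suff : chains secX F -> fibre_finite d F /\ chains secY (fibre_sum d F).
  by move=> h /h[].
move: F; apply: chains_ind => [|F H [fF cF] [fH cH]|g].
- split; last by rewrite fibre_sum0; exact: chains0.
  apply: chains_fibre_finite; exact: chains0.
- rewrite (fibre_sumB fF fH); split; last exact: chainsB.
  move=> y; have := conj (fF y) (fH y); rewrite -finite_setU.
  apply: sub_finite_set => x [dx]; rewrite !fctE; have [-> FH|Fx _] := eqVneq (F x) 0.
    by right; split=> //; apply: contra_neq FH => ->; rewrite subr0.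
  by left.
split.
  by apply: chains_fibre_finite; apply: chains_gen; [exact: gco | exact: gsec].
have fcut U : compact_open U -> fibre_finite d (cut U (fun t => << glab g t >> : {freeg K})).
  move=> cU y; apply: sub_finite_set (etale_fiber_finite y hX bX ed cU) => t [dt].
  by rewrite /cut; case: asboolP => //; rewrite eqxx.
apply: (compact_open_ind hX bX
  (P := fun U => chains secY (fibre_sum d (cut U (fun t => << glab g t >>))))
  (gco g)) => [|U V cU cV _ _ UV hU hV|x gx].
- by rewrite cut0 fibre_sum0; exact: chains0.
- by rewrite cutU // (fibre_sumD (fcut _ cU) (fcut _ cV)); exact: chainsD.
have [N [oN Nx dN]] := etale_inj x ed.
have [s [sd cs]] := etale_section ed oN Nx dN.
exists N => [|M cM MN Mg]; first exact: open_nbhs_nbhs.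
rewrite (fibre_sum_cut _ sd MN); apply: chains_gen.
  exact: etale_image_compact_open.
apply: sec_push; first by case: cM.
- exact: secX_sub Mg (gsec g).
- by move=> t /MN; exact: sd.
by apply: cont_on_sub cs; exact: image_subset.
Qed.
End ChainsMap.

(** ** The simplicial differential of a free group on tuples *)

Section Simplex.
Variable E : choiceType.
Local Notation tup q := ('I_q.+1 -> E).

Definition sd q : {freeg tup q.+1} -> {freeg tup q} :=
  frlift (fun c : tup q.+1 => \sum_(k < q.+2) << c \o fintype.lift k >> *~ (-1) ^+ k).

HB.instance Definition _ q := GRing.isZmodMorphism.Build _ _ (@sd q)
  (frlift_is_additive _).

Definition prepend q (x : E) (c : tup q) : tup q.+1 :=
  fun i => if unlift ord0 i is Some j then c j else x.

(** The cone with apex x contracts the simplices, see [sd_cone]. *)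
Definition cone q x : {freeg tup q} -> {freeg tup q.+1} :=
  frlift (fun c : tup q => << prepend x c >>).

HB.instance Definition _ q x := GRing.isZmodMorphism.Build _ _ (@cone q x)
  (frlift_is_additive _).

Definition deg : {freeg tup 0} -> int := frlift (fun _ : tup 0 => 1).

HB.instance Definition _ := GRing.isZmodMorphism.Build _ _ deg
  (frlift_is_additive _).

Lemma sdU q (c : tup q.+1) :
  sd << c >> = \sum_(k < q.+2) << c \o fintype.lift k >> *~ (-1) ^+ k.
Proof. exact: frliftU. Qed.

Lemma degU c : deg << c >> = 1.
Proof. exact: frliftU. Qed.

Lemma sd_sd q (u : {freeg tup q.+2}) : sd (sd u) = 0.
Proof.
move: u; apply: freeg_gen => [|x y xE yE|c]; first by rewrite !raddf0.
  by rewrite !raddfB /= xE yE subr0.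
rewrite sdU raddf_sum /=.
rewrite (eq_bigr (fun j : 'I_q.+3 => (\sum_(k < q.+2)
   << (c \o fintype.lift j) \o fintype.lift k >> *~ (-1) ^+ k) *~ (-1) ^+ j));
  last by move=> j _; rewrite raddfMz /= sdU.
under eq_bigr do rewrite mulrz_suml.
rewrite exchange_big /=.
rewrite -[RHS](@altsum_cancel _ _ (fun k j => << (c \o fintype.lift j) \o
  fintype.lift k >> : {freeg tup q})) => [|j k jk].
  apply: eq_bigr => k _; rewrite mulrz_suml; apply: eq_bigr => j _.
  by rewrite -!mulrzA mulrC.
congr (<< _ >>); apply/funext => i /=; congr (c _).
apply: val_inj; rewrite /= /bump /= /bump /= add1n.
by move: jk; case: (leqP j i); case: (leqP k i); case: leqP; case: leqP => /=; lia.
Qed.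

Lemma prepend_lift0 q x (c : tup q) : prepend x c \o fintype.lift ord0 = c.
Proof. by apply/funext => i; rewrite /= /prepend liftK. Qed.

Lemma prepend_lift q x (c : tup q.+1) k :
  prepend x c \o fintype.lift (fintype.lift ord0 k) =
  prepend x (c \o fintype.lift k).
Proof.
apply/funext => i /=; rewrite {2}/prepend; case: unliftP => [j ->|->]; last first.
  rewrite (_ : fintype.lift _ _ = ord0) /prepend ?unlift_none //.
  exact: val_inj.
rewrite (_ : fintype.lift _ _ = fintype.lift ord0 (fintype.lift k j)).
  by rewrite /prepend liftK.
by apply: val_inj; rewrite /= /bump /= !add1n ltnS addnS.
Qed.

Lemma sd_cone q x (u : {freeg tup q.+1}) : sd (cone x u) = u - cone x (sd u).
Proof.
move: u; apply: freeg_gen => [|u v uE vE|c]; first by rewrite !raddf0 ?subr0 ?addr0.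
  by rewrite !raddfB /= uE vE !opprD addrACA.
rewrite /cone frliftU sdU big_ord_recl expr0 mulr1z prepend_lift0; congr (_ + _).
rewrite sdU raddf_sum -sumrN; apply: eq_bigr => k _.
rewrite prepend_lift raddfMz /= frliftU /bump /= add1n exprS mulN1r mulrNz.
by [].
Qed.

Lemma sd_cone0 x (u : {freeg tup 0}) :
  sd (cone x u) = u - << fun=> x >> *~ deg u.
Proof.
move: u; apply: freeg_gen => [|u v uE vE|c].
- by rewrite !raddf0 ?mulr0z ?subr0 ?addr0.
- by rewrite !raddfB /= uE vE ?mulrzBr !opprD addrACA.
rewrite /cone /deg !frliftU sdU big_ord_recl expr0 !mulr1z prepend_lift0.
rewrite big_ord1 /= mulrN1z; congr (_ - << _ >>).
apply/funext => i /=; rewrite [i]ord1 (_ : fintype.lift _ _ = ord0).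
  by rewrite /prepend unlift_none.
exact: val_inj.
Qed.

Lemma deg_sd (u : {freeg tup 1}) : deg (sd u) = 0.
Proof.
move: u; apply: freeg_gen => [|u v uE vE|c]; first by rewrite !raddf0.
  by rewrite !raddfB /= uE vE subr0.
by rewrite sdU raddf_sum big_ord_recl big_ord1 !raddfMz /= !degU.
Qed.
End Simplex.

(** * The double complex *)

Section DoubleComplex.
Variables (R : realType) (S Y : system R) (f : factor_map S Y).
Hypotheses (sS : smale_axioms S) (sY : smale_axioms Y) (fb : s_bijective f).
Hypothesis zS : zero_dimensional S.
Variable G : groupoid.
Hypotheses (topG : topological_groupoid G) (etaleG : etale G).
Variables (Z : topologicalType) (rho : Z -> obj G) (lact : arr G -> Z -> Z).
Variables (tau : Z -> Y) (ract : unstable_arr Y -> Z -> Z).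
Hypothesis bb : bibundle rho lact tau ract.
Local Notation X p := (nerve G p).
Local Notation L q := ('I_q.+1 -> set S).

Let principal (g h : arr G) := @arr_eq _ _ _ _ _ _ _ _ bb g h.
Let esrc := etale_src etaleG.
Let erng := etale_rng etaleG.
Let hX p : hausdorff_space (X p) := nerve_hausdorff topG (obj_hausdorff topG) (p:=p).
Let bT := obj_co_basis sS sY fb zS topG etaleG bb.
Let bX p : co_basis (X p) := nerve_co_basis esrc erng principal bT (p:=p).
Let eface p (k : 'I_p.+2) : etale_map (face k) := etale_face topG esrc erng principal k.

(** The first vertex is only changed by the face which omits it; the section is
    then translated along the first arrow. *)
Lemma push_section p (k : 'I_p.+2) (U : set (X p.+1)) (z : X p.+1 -> Z) s :
  open U -> cont_on U z -> (forall t, U t -> rho (z t) = v0 t) ->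
  (forall t, U t -> s (face k t) = t) -> cont_on (face k @` U) s ->
  exists z', cont_on (face k @` U) z' /\ forall t, U t ->
    rho (z' (face k t)) = v0 (face k t) /\ tau (z' (face k t)) = tau (z t).
Proof.
move=> oU cz zU sU cs; have oI : open (face k @` U) by exact: em_open (eface k) _ oU.
have czs : cont_on (face k @` U) (z \o s).
  move=> _ [t Ut <-]; apply: (cont_at_comp (h := z)); first by apply: cs; exists t.
  by rewrite sU //; exact: cz.
have [k0|k0] := eqVneq k ord0; last first.
  exists (z \o s); split=> // t Ut; rewrite /= sU // zU // v0_face //.
exists (fun y => lact (inv (hd (s y))) (z (s y))); split=> [y0 [t0 Ut0 t0y]|t Ut].
  apply: (act_cont (bb_left bb)).
  - by apply: czs; exists t0.
  - apply: (cont_at_comp (g := fun y => hd (s y)) (h := @inv G)).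
      apply: (cont_at_comp (h := @hd _ _)); last exact: hd_cont.
      by apply: cs; exists t0.
    exact: (tg_inv topG).
  have : nbhs y0 (face k @` U).
    by apply: open_nbhs_nbhs; split=> //; exists t0.
  by apply: filterS => _ [t Ut <-]; rewrite sU // src_inv rng_hd zU.
have hz : src (inv (hd t)) = rho (z t) by rewrite src_inv rng_hd zU.
rewrite sU // (la_rng (bb_left bb) hz) (bb_tau bb hz) rng_inv src_hd k0.
by [].
Qed.

(** ** Local sections of the unstable quotient *)

(** Continuous sections of the quotient of S by the unstable relation. This
    quotient has no useful topology: continuity is expressed by a representative
    a, lying over a section z of the bibundle. *)
Definition class_sec p (U : set (X p)) (c : X p -> set S) := exists z a,
  [/\ cont_on U z, cont_on U a,
    forall t, U t -> rho (z t) = v0 t /\ tau (z t) = f (a t) &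
    forall t, U t -> c t = uclass (a t)].

Definition classes_sec p q (U : set (X p)) (l : X p -> L q) :=
  forall i, class_sec U (fun t => l t i).

Definition fiber_sec p q (U : set (X p)) (a : X p -> fiber_product f q) :=
  exists z, sect rho tau (@v0 G p) U z a.

Lemma class_sec_sub p (U V : set (X p)) c : V `<=` U -> class_sec U c -> class_sec V c.
Proof.
move=> VU [z [a [cz ca za ac]]]; exists z, a.
by split; [exact: cont_on_sub cz | exact: cont_on_sub ca | move=> t /VU/za |
  move=> t /VU/ac].
Qed.

Lemma classes_sec_sub p q (U V : set (X p)) (l : X p -> L q) :
  V `<=` U -> classes_sec U l -> classes_sec V l.
Proof. by move=> VU lU i; exact: class_sec_sub (lU i). Qed.

Lemma fiber_sec_sub p q (U V : set (X p)) (a : X p -> fiber_product f q) :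
  V `<=` U -> fiber_sec U a -> fiber_sec V a.
Proof. by move=> VU [z sz]; exists z; exact: sect_sub sz. Qed.

Lemma cont_on_push (W W' V : topologicalType) (d : W -> W') (U : set W) s
    (a : W -> V) : (forall t, U t -> s (d t) = t) -> cont_on (d @` U) s ->
  cont_on U a -> cont_on (d @` U) (a \o s).
Proof.
move=> sd cs ca _ [t Ut <-]; apply: (cont_at_comp (h := a)).
  by apply: cs; exists t.
by rewrite sd //; exact: ca.
Qed.

Lemma classes_sec_push p q (k : 'I_p.+2) U (l : X p.+1 -> L q) s :
  open U -> classes_sec U l -> (forall t, U t -> s (face k t) = t) ->
  cont_on (face k @` U) s -> classes_sec (face k @` U) (l \o s).
Proof.
move=> oU lU sU cs i; have [z [a [cz ca za ac]]] := lU i.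
have [z' [cz' z'P]] := push_section oU cz (fun t Ut => (za t Ut).1) sU cs.
exists z', (a \o s); split=> //; first exact: cont_on_push cs ca.
  by move=> _ [t Ut <-]; have [-> ->] := z'P _ Ut; rewrite (za _ Ut).2 /= sU.
by move=> _ [t Ut <-]; rewrite /= sU // ac.
Qed.

Lemma fiber_sec_push p q (k : 'I_p.+2) U (a : X p.+1 -> fiber_product f q) s :
  open U -> fiber_sec U a -> (forall t, U t -> s (face k t) = t) ->
  cont_on (face k @` U) s -> fiber_sec (face k @` U) (a \o s).
Proof.
move=> oU [z [cz ca za]] sU cs.
have [z' [cz' z'P]] := push_section oU cz (fun t Ut => (za t Ut).1) sU cs.
exists z'; split=> //; first exact: cont_on_push cs ca.
by move=> _ [t Ut <-]; have [-> ->] := z'P _ Ut; rewrite (za _ Ut).2 /= sU.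
Qed.

Lemma class_sec_exists p (x : X p) : exists U c, [/\ open U, U x & class_sec U c].
Proof.
have [z0 z0x] := rho_surj bb (v0 x).
have [a0 fa0] := fmap_surj f (tau z0).
have [t0 _ bt0] := @fiber_mk _ _ _ f 0 (fun=> a0) _ (fun=> fa0).
have [U [z [a [[[kU oU] [cz ca za] _ _ _] Ux _ _ _]]]] :=
  chart sS sY fb zS topG etaleG bb bt0 (@filterT _ (nbhs (rho z0)) _) ltr01.
have cv : continuous (@v0 G p) by exact: v0_cont.
exists (@v0 G p @^-1` U), (fun t => uclass (crd (a (v0 t)) ord0)); split.
- exact: preimage_open.
- by rewrite /= -z0x.
exists (z \o @v0 G p), (fun t => crd (a (v0 t)) ord0); split=> //.
- by move=> t Ut; apply: (cont_at_comp (h := z)); [exact: cv | exact: cz].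
- move=> t Ut.
  apply: (cont_at_comp (g := fun t => a (v0 t)) (h := fun b => crd b ord0)).
    by apply: (cont_at_comp (h := a)); [exact: cv | exact: ca].
  exact: crd_cont.
by move=> t Ut; have [h1 h2] := za _ Ut; rewrite /= h1 h2 f_crd.
Qed.

(** ** Differentials *)

Definition dv (K : choiceType) p (F : X p.+1 -> {freeg K}) : X p -> {freeg K} :=
  \sum_(k < p.+2) fibre_sum (@face G p k) F *~ (-1) ^+ k.

Lemma dvE (K : choiceType) p (F : X p.+1 -> {freeg K}) t :
  dv F t = \sum_(k < p.+2) fibre_sum (@face G p k) F t *~ (-1) ^+ k.
Proof. by rewrite /dv fct_sumE; apply: eq_bigr => k _; rewrite fct_mulrz. Qed.

Section Sheaf.
Variables (K : choiceType) (sec : forall p, set (X p) -> (X p -> K) -> Prop).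
Hypothesis sec_sub : forall p (U V : set (X p)) l, V `<=` U -> sec U l -> sec V l.
Hypothesis sec_push : forall p (k : 'I_p.+2) U l s, open U -> sec U l ->
  (forall t, U t -> s (face k t) = t) -> cont_on (face k @` U) s ->
  sec (face k @` U) (l \o s).
Local Notation chn p := (@chains (X p) K (@sec p)).

Lemma chains_face p k F : chn p.+1 F -> chn p (fibre_sum (@face G p k) F).
Proof.
exact: (chains_fibre_sum (@hX _) (@bX _) (eface k) (@sec_push p k) (@sec_sub _)).
Qed.

Lemma chains_dv p F : chn p.+1 F -> chn p (dv F).
Proof.
by move=> cF; apply: chains_sum => k _; apply: chainsMz; exact: chains_face.
Qed.

Lemma chains_ff p k F : chn p.+1 F -> fibre_finite (@face G p k) F.
Proof. exact: (chains_fibre_finite (@hX _) (@bX _) (eface k)). Qed.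

Lemma dvB p F H : chn p.+1 F -> chn p.+1 H -> dv (F - H) = dv F - dv H.
Proof.
move=> cF cH; rewrite /dv -sumrB; apply: eq_bigr => k _.
by rewrite (fibre_sumB (chains_ff _ cF) (chains_ff _ cH)) mulrzBl.
Qed.

Lemma fibre_sum_lin p k m (H : 'I_m -> X p.+1 -> {freeg K}) n :
  (forall i, chn p.+1 (H i)) ->
  fibre_sum (@face G p k) (\sum_i H i *~ n i) =
  \sum_i fibre_sum (@face G p k) (H i) *~ n i.
Proof.
move=> cH; have [] // := @sub_additive_sum _ _ (chn p.+1)
  (fibre_sum (@face G p k)) _ (index_enum _) H n (@chains0 _ _ _) (@chainsB _ _ _).
by move=> F F' cF cF'; rewrite fibre_sumB //; exact: chains_ff.
Qed.

Lemma dv_dv p F : chn p.+2 F -> dv (dv F) = 0.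
Proof.
move=> cF; apply/funext => t.
have lin (j : 'I_p.+2) : fibre_sum (@face G p j) (dv F) t = \sum_(k < p.+3)
    fibre_sum (@face G p j) (fibre_sum (@face G p.+1 k) F) t *~ (-1) ^+ k.
  rewrite fibre_sum_lin => [|k]; last exact: chains_face.
  by rewrite fct_sumE; apply: eq_bigr => k _; rewrite fct_mulrz.
rewrite dvE; under eq_bigr do rewrite lin.
apply: altsum_cancel => j k jk.
have ff (d : X p.+2 -> X p) : etale_map d -> fibre_finite d F.
  by move=> ed; exact: (chains_fibre_finite (@hX _) (@bX _) ed cF).
have ec (a : 'I_p.+2) (b : 'I_p.+3) := etale_map_comp (eface b) (eface a).
rewrite !fibre_sum_comp; [|exact: (ff _ (ec _ _))..].
congr (fibre_sum _ _ _); apply/funext => s /=.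
exact: (face_face principal s jk).
Qed.

Lemma dv_hom (K' : choiceType) (h : {additive {freeg K} -> {freeg K'}}) p F :
  chn p.+1 F -> dv (h \o F) = h \o dv F.
Proof.
move=> cF; apply/funext => t; rewrite /= !dvE raddf_sum; apply: eq_bigr => k _.
by rewrite raddfMz /= (raddf_fibre_sum _ _ (chains_ff k cF)).
Qed.
End Sheaf.

(** ** Chains labelled by tuples of classes *)

Definition dh p q (F : X p -> {freeg L q.+1}) : X p -> {freeg L q} :=
  fun t => sd (F t).

(** The double complex: chains on the p-simplices of the nerve whose labels are
    tuples of q + 1 unstable classes over the first vertex. *)
Definition A p q : set (X p -> {freeg L q}) := chains (@classes_sec p q).
Arguments A : clear implicits.

Lemma A_dv p q F : A p.+1 q F -> A p q (dv F).
Proof.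
exact: (@chains_dv _ (fun p => @classes_sec p q) (fun p => @classes_sec_sub p q)
  (fun p => @classes_sec_push p q)).
Qed.

Lemma A_dh p q F : A p q.+1 F -> A p q (dh F).
Proof.
move: F; apply: chains_ind => [|F H AF AH|g].
- rewrite (_ : dh 0 = 0); first exact: chains0.
  by apply/funext => t; rewrite /dh raddf0.
- rewrite (_ : dh (F - H) = dh F - dh H); first exact: chainsB.
  by apply/funext => t; rewrite /dh !fctE raddfB.
rewrite (_ : dh _ = \sum_(k < q.+2) cut (gset g)
  (fun t => << glab g t \o fintype.lift k >>) *~ (-1) ^+ k).
  apply: chains_sum => k _; apply: chainsMz.
  apply: (@chains_gen _ _ (@classes_sec p q) (gset g)
    (fun t => glab g t \o fintype.lift k)); first exact: gco.
  by move=> i; exact: (gsec g).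
apply/funext => t; rewrite /dh /gfun fct_sumE raddf_cut.
rewrite {1}/cut; case: asboolP => gt.
  by rewrite /= sdU; apply: eq_bigr => k _; rewrite fct_mulrz cut_in.
by rewrite big1 // => k _; rewrite fct_mulrz cut_out // mul0rz.
Qed.

Lemma A_double_complex : double_complex A (fun p q => @dv (L q) p) (@dh).
Proof.
split.
- by move=> p q; exact: chains0.
- by move=> p q x y; exact: chainsB.
- by move=> p q x; exact: A_dv.
- by move=> p q x; exact: A_dh.
- by move=> p q x y; exact: (@dvB _ (fun p => @classes_sec p q)).
- by move=> p q x y _ _; apply/funext => t; rewrite /dh !fctE raddfB.
- move=> p q x; exact: (@dv_dv _ (fun p => @classes_sec p q) (fun p => @classes_sec_sub p q)
    (fun p => @classes_sec_push p q)).
- by move=> p q x _; apply/funext => t; exact: sd_sd.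
move=> p q x Ax.
exact: (dv_hom (sec := fun p => @classes_sec p q.+1) [the {additive _ -> _} of @sd _ q] Ax).
Qed.

(** ** Exactness of the rows *)

Lemma A_cone p q U c F : compact_open U -> class_sec U c -> A p q F ->
  A p q.+1 (cut U (fun t => cone (c t) (F t))).
Proof.
move=> cU uc; move: F; apply: chains_ind => [|F H AF AH|g].
- rewrite (_ : cut _ _ = 0); first exact: chains0.
  by apply/funext => t; rewrite /cut; case: asboolP; rewrite // raddf0.
- rewrite (_ : cut _ _ = cut U (fun t => cone (c t) (F t)) -
    cut U (fun t => cone (c t) (H t))); first exact: chainsB.
  by rewrite -cutB; apply: cut_ext => t _; rewrite !fctE raddfB.
rewrite (_ : cut _ _ = cut (U `&` gset g)
  (fun t => << prepend (c t) (glab g t) >>)).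
  apply: (@chains_gen _ _ (@classes_sec p q.+1) _ (fun t => prepend (c t) (glab g t))).
    exact: compact_openI (gco g).
  move=> i; rewrite /prepend; case: unliftP => [j _|_].
    by apply: class_sec_sub (gsec g j) => t [].
  by apply: class_sec_sub uc => t [].
rewrite -cut_cut; apply: cut_ext => t _.
rewrite /gfun /cut; case: asboolP => _; last exact: raddf0.
by rewrite /cone frliftU.
Qed.

(** The cone over a local section of classes is a local primitive. *)
Lemma rows_exact p q F : A p q F -> (forall x t, sd (cone x (F t)) = F t) ->
  exists2 H, A p q.+1 H & dh H = F.
Proof.
move=> AF FE; have [U0 cU0 ->] := chains_supp AF.
apply: (compact_open_ind (@hX p) (@bX p)
  (P := fun U => exists2 H, A p q.+1 H & dh H = cut U F)) cU0 _ _ _.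
- exists 0; first exact: chains0.
  by rewrite cut0; apply/funext => t; rewrite /dh raddf0.
- move=> U V _ _ _ _ UV [H AH HE] [H' AH' HE']; exists (H + H').
    exact: chainsD.
  by rewrite cutU // -HE -HE'; apply/funext => t; rewrite /dh !fctE raddfD.
move=> x _; have [N [c [oN Nx cN]]] := class_sec_exists x.
exists N => [|M cM MN _]; first exact: open_nbhs_nbhs.
exists (cut M (fun t => cone (c t) (F t))).
  by apply: A_cone => //; exact: class_sec_sub cN.
apply/funext => t; rewrite /dh /cut; case: asboolP => _; last exact: raddf0.
exact: FE.
Qed.

Definition augmentation p (F : X p -> {freeg L 0}) : Cc (X p) :=
  insubd 0 (fun t => deg (F t)).

Lemma indicator_cc p (U : set (X p)) :
  compact_open U -> cut U (fun=> 1 : int) \in cc_pred (T:=X p).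
Proof.
move=> [kU oU]; have clU : closed U by exact: compact_closed.
apply/asboolP; split.
  apply/continuous_discreteE => x; have [Ux|nUx] := pselect (U x).
    apply: filterS (open_nbhs_nbhs (conj oU Ux)) => y Uy.
    by rewrite !cut_in.
  have : nbhs x (~` U) by apply: open_nbhs_nbhs; split=> //; exact: closed_openC.
  by apply: filterS => y nUy; rewrite !cut_out.
have -> : [set x | cut U (fun=> 1 : int) x != 0] = U.
  apply/seteqP; split=> t /= => [|Ut]; last by rewrite cut_in.
  by rewrite /cut; case: asboolP.
by rewrite -(proj1 (closure_id U) clU).
Qed.

Lemma deg_cc p F : A p 0 F -> (fun t => deg (F t)) \in cc_pred (T:=X p).
Proof.
move: F; apply: chains_ind => [|F H AF AH|g].
- rewrite (_ : (fun t => _) = 0); first exact: rpred0.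
  by apply/funext => t; rewrite raddf0.
- rewrite (_ : (fun t => _) = (fun t => deg (F t)) - (fun t => deg (H t))).
    exact: rpredB.
  by apply/funext => t; rewrite !fctE raddfB.
rewrite (_ : (fun t => _) = cut (gset g) (fun=> 1)).
  by apply: indicator_cc; exact: gco.
apply/funext => t; rewrite /gfun /cut; case: asboolP => _; last exact: raddf0.
exact: degU.
Qed.

Lemma augmentationE p F t : A p 0 F -> val (augmentation F) t = deg (F t).
Proof. by move=> /deg_cc h; rewrite /augmentation insubdK. Qed.

Lemma augmentation_surj p (h : Cc (X p)) : exists2 F, A p 0 F & augmentation F = h.
Proof.
suff [F AF FE] : exists2 F, A p 0 F & forall t, deg (F t) = val h t.
  by exists F => //; apply: val_inj; apply/funext => t; rewrite augmentationE.
have /asboolP[/continuous_discreteE lh kh] := valP h.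
have oh : open [set t | val h t != 0].
  rewrite openE => t ht; apply: filterS (lh t) => s hs.
  by rewrite /= hs.
have ch : closed [set t | val h t != 0].
  rewrite -[W in closed W]setCK; apply: open_closedC; rewrite openE => t ht.
  by apply: filterS (lh t) => s hs; rewrite /= hs.
have cU : compact_open [set t | val h t != 0].
  by split=> //; rewrite [W in compact W](proj1 (closure_id _) ch).
suff [F AF FE] : exists2 F, A p 0 F &
    forall t, deg (F t) = cut [set t | val h t != 0] (val h) t.
  exists F => // t; rewrite FE /cut; case: asboolP => // /negP; rewrite negbK.
  by move=> /eqP.
apply: (compact_open_ind (@hX p) (@bX p)
  (P := fun U => exists2 F, A p 0 F & forall t, deg (F t) = cut U (val h) t)) cU _ _ _.
- by exists 0 => [|t]; [exact: chains0 | rewrite raddf0 cut0].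
- move=> U V _ _ _ _ UV [F AF FE] [H AH HE]; exists (F + H).
    exact: chainsD.
  by move=> t; rewrite cutU // !fctE raddfD /= FE HE.
move=> x _; have [N [c [oN Nx cN]]] := class_sec_exists x.
exists (N `&` [set y | val h y = val h x]).
  by apply: filterI; [exact: open_nbhs_nbhs | exact: lh].
move=> M cM MN _; exists (cut M (fun t => << fun=> c t >>) *~ (val h x)).
  apply: chainsMz; apply: (@chains_gen _ _ (@classes_sec p 0) _ (fun t _ => c t)) => // i.
  by apply: class_sec_sub cN => t /MN[].
move=> t; rewrite fct_mulrz raddfMz /= raddf_cut /= /cut.
case: asboolP => [/MN[_ ->]|_]; last by rewrite mul0rz.
by rewrite degU intz.
Qed.

(** By [augmentation_surj], functions with compact support are degrees of
    chains, whose sums over fibres are chains again; so there is an additive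
    pushforward, as the definition by [the_additive] requires. *)
Lemma pushforwardE p k (h : Cc (X p.+1)) :
  val (pushforward (@face G p k) h) = fibre_sum (face k) (val h).
Proof.
have fsE F : A p.+1 0 F -> fibre_sum (@face G p k) (val (augmentation F)) =
    (fun t => deg (fibre_sum (@face G p k) F t)).
  move=> AF; apply/funext => t.
  have ff : fibre_finite (@face G p k) F by exact: (chains_ff (sec := fun p => @classes_sec p 0)).
  rewrite (raddf_fibre_sum _ _ ff); apply: eq_fsbigr => x _.
  by rewrite augmentationE.
have cF F : A p.+1 0 F -> A p 0 (fibre_sum (@face G p k) F).
  exact: (@chains_face _ (fun p => @classes_sec p 0) (fun p => @classes_sec_sub p 0)
    (fun p => @classes_sec_push p 0)).
pose g (h : Cc (X p.+1)) : Cc (X p) := insubd 0 (fibre_sum (face k) (val h)).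
have gE h' : val (g h') = fibre_sum (face k) (val h').
  have [F AF <-] := augmentation_surj h'.
  by rewrite /g insubdK // fsE //; apply: deg_cc; exact: cF.
have gB : zmod_morphism g.
  move=> h1 h2; apply: val_inj; rewrite gE.
  have ff (h' : Cc (X p.+1)) : fibre_finite (@face G p k) (val h').
    have [F AF <-] := augmentation_surj h' => y.
    apply: sub_finite_set (chains_ff (sec := fun p => @classes_sec p 0) k AF y) => t [ft nz].
    by split=> //; apply: contra_neq nz; rewrite augmentationE // => ->; rewrite raddf0.
  by rewrite raddfB (fibre_sumB (ff h1) (ff h2)) -!gE.
pose gA := GRing.isZmodMorphism.Build _ _ g gB.
have := @the_additiveP _ _ [set g | forall (f : Cc (X p.+1)) (y : X p),
  val (g f) y = \sum_(x \in face k @^-1` [set y]) val f x].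
move=> h'; apply/funext => y; rewrite /pushforward h' //.
exists (HB.pack_for {additive Cc (X p.+1) -> Cc (X p)} g gA) => f' y' /=.
by rewrite gE.
Qed.

Lemma altsum_pushforwardE p (h : Cc (X p.+1)) t :
  val (altsum (fun k : 'I_p.+2 => pushforward (@face G p k)) h) t =
  \sum_(k < p.+2) fibre_sum (@face G p k) (val h) t *~ (-1) ^+ k.
Proof.
rewrite /altsum raddf_sum fct_sumE; apply: eq_bigr => k _.
by rewrite raddfMz fct_mulrz /= pushforwardE.
Qed.

Lemma rows_resolve : row_resolution A (fun p q => @dv (L q) p) (@dh)
  (B := groupoid_complex G) augmentation.
Proof.
have augB p x y : A p 0 x -> A p 0 y ->
    augmentation (x - y) = augmentation x - augmentation y.
  move=> Ax Ay; apply: val_inj; apply/funext => t.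
  rewrite augmentationE; last exact: chainsB.
  by rewrite !raddfB /= -!augmentationE.
split.
- exact: augB.
- move=> p x Ax; apply: val_inj; apply/funext => t.
  rewrite augmentationE; last exact: A_dv.
  rewrite [RHS]altsum_pushforwardE dvE raddf_sum; apply: eq_bigr => k _.
  rewrite raddfMz /=; congr (_ *~ _).
  have ff : fibre_finite (@face G p k) x by exact: (chains_ff (sec := fun p => @classes_sec p 0)).
  rewrite (raddf_fibre_sum _ _ ff); apply: eq_fsbigr => s _.
  exact/esym/augmentationE.
- move=> p x Ax; apply: val_inj; apply/funext => t.
  rewrite augmentationE; last exact: A_dh.
  exact: deg_sd.
- by move=> p b; exact: augmentation_surj.
- move=> p x Ax x0; apply: rows_exact => // s t.
  by rewrite sd_cone0 -augmentationE // x0 mulr0z subr0.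
move=> p q x Ax x0; apply: rows_exact => // s t.
by rewrite sd_cone -[sd (x t)]/(dh x t) x0 raddf0 subr0.
Qed.

(** ** Chains labelled by points of the fibre products *)

Definition cl q (b : fiber_product f q) : L q := fun i => uclass (crd b i).

Definition class_map q : {freeg fiber_product f q} -> {freeg L q} :=
  frlift (fun b : fiber_product f q => << cl b >>).

HB.instance Definition _ q := GRing.isZmodMorphism.Build _ _ (@class_map q)
  (frlift_is_additive _).

(** Chains whose labels are points of the fibre products rather than their
    classes: they cover the double complex and are easier to contract, since a
    point determines an object, by the section zeta below. *)
Definition B p q : set (X p -> {freeg fiber_product f q}) := chains (@fiber_sec p q).
Arguments B : clear implicits.

Lemma class_mapU q (b : fiber_product f q) : class_map << b >> = << cl b >>.
Proof. exact: frliftU. Qed.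

Lemma cl_funst q (t u : fiber_product f q) : cl t = cl u <-> funst t u.
Proof.
split=> [tu i|tu]; first by apply/uclass_eq; exact: (congr1 (@^~ i) tu).
by apply/funext => i; apply/uclass_eq; exact: tu.
Qed.

Lemma fiber_sec_classes p q U (a : X p -> fiber_product f q) :
  fiber_sec U a -> classes_sec U (fun t => cl (a t)).
Proof.
move=> [z [cz ca za]] i; exists z, (fun t => crd (a t) i); split=> //.
  move=> t Ut; apply: (cont_at_comp (g := a) (h := fun b => crd b i)).
    exact: ca.
  exact: crd_cont.
by move=> t Ut; have [-> ->] := za _ Ut; rewrite f_crd.
Qed.

Lemma cut_hom (W : Type) (V V' : zmodType) (h : {additive V -> V'}) U (v : W -> V) :
  h \o cut U v = cut U (h \o v).
Proof. by apply/funext => t; exact: raddf_cut. Qed.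

Lemma B_class_map p q H : B p q H -> A p q (@class_map q \o H).
Proof.
move: H; apply: chains_ind => [|F H AF AH|g].
- rewrite (_ : _ \o _ = 0); first exact: chains0.
  by apply/funext => t /=; rewrite raddf0.
- rewrite (_ : _ \o _ = (@class_map q \o F) - (@class_map q \o H)); first exact: chainsB.
  by apply/funext => t /=; rewrite !fctE raddfB.
rewrite cut_hom (_ : _ \o _ = fun t => << cl (glab g t) >>).
  by apply: chains_gen; [exact: gco | apply: fiber_sec_classes; exact: gsec].
by apply/funext => t /=; rewrite class_mapU.
Qed.

(** Local lifts are given by [fiber_sections]. *)
Lemma A_lift p q F : A p q F -> exists2 H, B p q H & @class_map q \o H = F.
Proof.
move: F; apply: chains_ind => [|F F' [H BH <-] [H' BH' <-]|g].
- by exists 0; [exact: chains0 | apply/funext => t /=; rewrite raddf0].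
- exists (H - H'); first exact: chainsB.
  by apply/funext => t /=; rewrite !fctE raddfB.
apply: (compact_open_ind (@hX p) (@bX p) (P := fun U => exists2 H, B p q H &
  @class_map q \o H = cut U (fun t => << glab g t >>))) (gco g) _ _ _.
- exists 0; first exact: chains0.
  by rewrite cut0; apply/funext => t /=; rewrite raddf0.
- move=> U V _ _ _ _ UV [H BH HE] [H' BH' HE']; exists (H + H').
    exact: chainsD.
  by rewrite cutU // -HE -HE'; apply/funext => t /=; rewrite !fctE raddfD.
move=> x gx; have [z zP] := boolp.choice (gsec g).
have {zP}[a zaP] := boolp.choice zP.
have [_ og] := gco g.
have [N [w [b [oN Nx Ng sb bP]]]] := fiber_sections sS sY bb (v := @v0 G p) og gx
  (fun i => let: And4 h _ _ _ := zaP i in h)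
  (fun i => let: And4 _ h _ _ := zaP i in h)
  (fun i => let: And4 _ _ h _ := zaP i in h).
exists N => [|M cM MN Mg]; first exact: open_nbhs_nbhs.
exists (cut M (fun t => << b t >>)).
  by apply: chains_gen => //; exists w; exact: sect_sub sb.
rewrite cut_hom; apply: cut_ext => t Mt /=; rewrite class_mapU; congr (<< _ >>).
apply/funext => i; have [_ _ _ ->] := zaP i; last exact: Mg.
by apply/uclass_eq; apply: bP; exact: MN.
Qed.

Section Retract.
Variables (q : nat) (rn : nat -> fiber_product f q -> fiber_product f q).
Hypothesis rnP : retractions rn.

Definition retract_map n : {freeg fiber_product f q} -> {freeg fiber_product f q} :=
  frlift (fun b : fiber_product f q => << rn n b >>).

HB.instance Definition _ n := GRing.isZmodMorphism.Build _ _ (@retract_map n)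
  (frlift_is_additive _).

Lemma retract_mapU n b : retract_map n << b >> = << rn n b >>.
Proof. exact: frliftU. Qed.

Lemma class_map_retract n u : class_map (retract_map n u) = class_map u.
Proof.
move: u; apply: freeg_gen => [|u v uE vE|b]; first by rewrite !raddf0.
  by rewrite !raddfB /= uE vE.
rewrite retract_mapU !class_mapU; congr (<< _ >>); apply/cl_funst => i.
by apply: unstably_equivalentC; exact: rn_unstable rnP n b i.
Qed.

Lemma B_retract p n H : B p q H -> B p q (retract_map n \o H).
Proof.
move: H; apply: chains_ind => [|F H AF AH|g].
- rewrite (_ : _ \o _ = 0); first exact: chains0.
  by apply/funext => t /=; rewrite raddf0.
- rewrite (_ : _ \o _ = (retract_map n \o F) - (retract_map n \o H)); first exact: chainsB.
  by apply/funext => t /=; rewrite !fctE raddfB.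
rewrite cut_hom (_ : _ \o _ = fun t => << (rn n \o glab g) t >>).
  apply: (@chains_gen _ _ (@fiber_sec p q) _ (rn n \o glab g)); first exact: gco.
  have [z sz] := gsec g; have [_ og] := gco g.
  have [z' sz'] := sect_retract sY bb n rnP og sz; by exists z'.
by apply/funext => t /=; rewrite retract_mapU.
Qed.

(** By compactness, from some stage on, the retractions identify all the labels
    which have the same class. *)
Lemma B_retract0 p H : B p q H -> @class_map q \o H = 0 ->
  exists n0, forall n, (n0 <= n)%N -> retract_map n \o H = 0.
Proof.
move=> BH H0; have [U cU HU] := chains_supp BH.
suff [n0 n0P] : exists n0, forall n, (n0 <= n)%N -> forall t, U t -> retract_map n (H t) = 0.
  exists n0 => n n0n; apply/funext => t /=; rewrite HU /cut.
  by case: asboolP => [/n0P|]; [exact | rewrite raddf0].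
apply: (compact_open_ind (@hX p) (@bX p) (P := fun U => exists n0, forall n,
  (n0 <= n)%N -> forall t, U t -> retract_map n (H t) = 0)) cU _ _ _.
- by exists 0%N.
- move=> V W _ _ _ _ _ [n1 n1P] [n2 n2P]; exists (maxn n1 n2) => n.
  by rewrite geq_max => /andP[/n1P h1 /n2P h2] t [/h1|/h2].
have [r HE] := BH; move=> x _.
pose w (g : gen (@fiber_sec p q)) (th : nat * X p) : {freeg fiber_product f q} :=
  << rn th.1 (glab g th.2) >>.
have := @chains_relation _ _ _ (L q) (@cl q) r x _ _ (filter_prod \oo (nbhs x)) w _.
have rx : frlift (fun k : fiber_product f q => << cl k >> : {freeg L q}) (gsum r x) = 0.
  by rewrite -HE; exact: (congr1 (fun F : X p -> {freeg L q} => F x) H0).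
move=> /(_ _ rx)[g g' gx g'x cgg|[P Q] /= [[n0 _ n0P] nQ] PQ].
  have [z sz] := gsec g; have [z' sz'] := gsec g'.
  have [_ og] := gco g; have [_ og'] := gco g'.
  have [n0 h] := near_retract sS sY fb bb (t0 := x) rnP (openI og og')
    (conj gx g'x) (sect_sub (@subIsetl _ _ _) sz) (sect_sub (@subIsetr _ _ _) sz')
    (proj1 (cl_funst _ _) cgg).
  exists ([set n | (n0 <= n)%N], [set t | forall n, (n0 <= n)%N ->
    rn n (glab g t) = rn n (glab g' t)]) => [|[n t] /= [n0n]].
    by split=> //; exists n0.
  by rewrite /w /= => ->.
have nH := gsum_near (@hX p) r x.
exists (Q `&` [set t | gsum r t =
  \sum_(g <- r | `[< gset g.1 x >]) << glab g.1 t >> *~ g.2]).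
  exact: filterI.
move=> M cM MN _; exists n0 => n n0n t /MN[Qt tE].
rewrite HE tE raddf_sum /= -[RHS](PQ (n, t)); last by split=> //; exact: n0P.
by apply: eq_bigr => g _; rewrite raddfMz /= retract_mapU.
Qed.
End Retract.

(** ** Exactness of the columns *)

(** tau is a surjective local homeomorphism, and the fibre product is compact
    and zero-dimensional. *)
Lemma zeta_exists q : exists zeta : fiber_product f q -> Z,
  continuous zeta /\ forall b, tau (zeta b) = base b.
Proof.
have hF : hausdorff_space (fiber_product f q) by exact: fiber_hausdorff.
have bF : co_basis (fiber_product f q) by exact: fiber_co_basis.
have [zeta0 tz0] := boolp.choice (fun b : fiber_product f q => tau_surj bb (base b)).
suff [zeta [cz tz]] : exists zeta : fiber_product f q -> Z,
    cont_on setT zeta /\ forall b, setT b -> tau (zeta b) = base b.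
  by exists zeta; split=> b; [exact: cz | exact: tz].
have cT : compact_open [set: fiber_product f q].
  by split; [exact: fiber_compact | exact: openT].
apply: (compact_open_ind hF bF (P := fun U => exists zeta : fiber_product f q -> Z,
  cont_on U zeta /\ forall b, U b -> tau (zeta b) = base b)) cT _ _ _.
- by exists zeta0; split.
- move=> U V [_ oU] [_ oV] _ _ UV [z [cz tz]] [z' [cz' tz']].
  exists (fun b => if `[< U b >] then z b else z' b); split=> [b|b].
    move=> [Ub|Vb].
      apply: (@cont_at_near _ _ z); last exact: cz.
      by apply: filterS (open_nbhs_nbhs (conj oU Ub)) => u /asboolT ->.
    apply: (@cont_at_near _ _ z'); last exact: cz'.
    apply: filterS (open_nbhs_nbhs (conj oV Vb)) => u Vu.
    by case: asboolP => // Uu; have : (U `&` V) u by []; rewrite UV.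
  by case: asboolP => [Ub _|nUb [//|/tz']]; first exact: tz.
move=> b _; have [s [cs sb sE]] := etale_near_section (zeta0 b) (etale_tau topG etaleG bb).
rewrite tz0 in cs sb sE.
have [N [oN Nb NP]] := nearP_open (base_cont (f := f) (q := q) sE).
have [W [oW Wb WP]] := etale_inj (zeta0 b) (etale_tau topG etaleG bb).
have [s' [s'E cs']] := etale_section (etale_tau topG etaleG bb) oW Wb WP.
have nW : nbhs b (base (f := f) (q := q) @^-1` (tau @` W)).
  apply: base_cont; apply: open_nbhs_nbhs; split.
    exact: em_open (etale_tau topG etaleG bb) _ oW.
  by exists (zeta0 b).
exists (base (f := f) (q := q) @^-1` (tau @` W)) => // M cM MW _.
exists (fun b => s' (base b)); split=> [u /MW Wu|u /MW [z Wz <-]].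
  by apply: (cont_at_comp (h := s')); [exact: base_cont | exact: cs'].
by rewrite s'E.
Qed.

Section Homotopy.
Variables (q : nat) (zeta : fiber_product f q -> Z).
Hypotheses (zeta_cont : continuous zeta).
Hypothesis tau_zeta : forall b, tau (zeta b) = base b.

(** Keeps the labels which zeta attaches to the object x. *)
Definition select (x : obj G) :
    {freeg fiber_product f q} -> {freeg fiber_product f q} :=
  frlift (fun b : fiber_product f q =>
    if `[< rho (zeta b) = x >] then << b >> else 0).

HB.instance Definition _ x := GRing.isZmodMorphism.Build _ _ (@select x)
  (frlift_is_additive _).

Lemma selectU x b :
  select x << b >> = if `[< rho (zeta b) = x >] then << b >> else 0.
Proof. exact: frliftU. Qed.

(** A simplex is extended by a new first vertex; among all extensions, a label
    is given to the one whose new vertex is the object attached to this label by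
    zeta. *)
Definition homotopy p (F : X p -> {freeg fiber_product f q}) : X p.+1 -> _ :=
  fun t => select (v0 t) (F (face ord0 t)).

Lemma homotopyB p F H : @homotopy p (F - H) = homotopy F - homotopy H.
Proof. by apply/funext => t; rewrite /homotopy !fctE raddfB. Qed.

Lemma homotopy0 p : @homotopy p 0 = 0.
Proof. by apply/funext => t; rewrite /homotopy raddf0. Qed.

(** The arrows from the first vertices to the objects attached to the labels
    form a continuous family, by division in the bibundle. Prepending them to
    the simplices embeds the section into the next degree, and is a right
    inverse of the first face. *)
Lemma homotopy_gen p (g : gen (@fiber_sec p q)) :
  B p.+1 q (homotopy (gfun g)) /\ fibre_sum (face ord0) (homotopy (gfun g)) = gfun g.
Proof.
have [z [cz ca za]] := gsec g; have [kg og] := gco g.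
have czeta : cont_on (gset g) (zeta \o glab g).
  move=> t gt; apply: (cont_at_comp (h := zeta)); first exact: ca.
  exact: zeta_cont.
have [|k [ck kP]] := left_division bb og cz czeta.
  by move=> t gt; rewrite (za _ gt).2 /= tau_zeta.
have [w wP] := boolp.choice (fun t : X p => cons_ex (k t) t).
have {wP}wP t : gset g t -> hd (w t) = k t /\ face ord0 (w t) = t.
  by move=> gt; apply: wP; have [-> _ _] := kP _ gt; rewrite (za _ gt).1.
have cw : cont_on (gset g) w.
  move=> t gt; have ng := open_nbhs_nbhs (conj og gt); apply: cons_cont.
    by apply: cont_at_near (ck _ gt); apply: filterS ng => s /wP[].
  by apply: cont_at_near (@cont_at_id _ t); apply: filterS ng => s /wP[].
have v0w t : gset g t -> v0 (w t) = rho (zeta (glab g t)).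
  by move=> gt; rewrite -rng_hd (wP _ gt).1; case: (kP _ gt).
set W := w @` gset g.
have wface t : W t -> w (face ord0 t) = t by move=> [s gs <-]; rewrite (wP _ gs).2.
(* w is inverse to the first face, which is injective near w t *)
have oW : open W.
  rewrite openE => _ [t gt <-].
  have [N [oN Nw dN]] := etale_inj (w t) (eface ord0).
  have cf : continuous (@face G p ord0) := em_continuous (eface ord0).
  have ng : nbhs (face ord0 (w t)) (gset g).
    by rewrite (wP _ gt).2; exact: open_nbhs_nbhs.
  have nN : nbhs (face ord0 (w t)) (w @^-1` N).
    by rewrite (wP _ gt).2; apply: (cw _ gt); exact: open_nbhs_nbhs.
  have h1 : \forall s \near w t, gset g (face ord0 s) := cf _ _ ng.
  have h2 : \forall s \near w t, N (w (face ord0 s)) := cf _ _ nN.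
  apply: filterS3 h1 h2 (open_nbhs_nbhs (conj oN Nw)) => s gs Nws Ns.
  exists (face ord0 s) => //; apply: dN => //; exact: (wP _ gs).2.
have cW : compact_open W by split=> //; exact: cont_on_compact cw kg.
have homotopyE : homotopy (gfun g) = cut W (fun t => << glab g (face ord0 t) >>).
  apply/funext => t; rewrite /homotopy /gfun {1}/cut.
  case: asboolP => gt; last first.
    by rewrite raddf0 cut_out // => -[s gs st]; apply: gt; rewrite -st (wP _ gs).2.
  rewrite selectU; case: asboolP => zt.
    rewrite cut_in //; exists (face ord0 t) => //; have [h1 h2] := wP _ gt.
    apply: (hd_face0_inj principal) => //; rewrite h1.
    have [s1 s2 _] := kP _ gt; apply: principal.
      by rewrite s1 (za _ gt).1 src_hd.
    by rewrite s2 /= zt rng_hd.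
  rewrite cut_out // => -[s gs st]; apply: zt.
  by rewrite -st (wP _ gs).2 v0w.
rewrite homotopyE; split.
  apply: (@chains_gen _ _ (@fiber_sec p.+1 q) W (fun t => glab g (face ord0 t))) => //.
  exists (fun t => zeta (glab g (face ord0 t))); split.
  - move=> _ [s gs <-]; apply: (cont_at_comp (g := face ord0) (h := zeta \o glab g)).
      exact: em_continuous (eface ord0) _.
    by rewrite (wP _ gs).2; exact: czeta.
  - move=> _ [s gs <-]; apply: (cont_at_comp (g := face ord0) (h := glab g)).
      exact: em_continuous (eface ord0) _.
    by rewrite (wP _ gs).2; exact: ca.
  by move=> _ [s gs <-]; rewrite (wP _ gs).2 v0w // tau_zeta.
rewrite (fibre_sum_cut _ wface (@subset_refl _ W)) /gfun.
have -> : face ord0 @` W = gset g.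
  apply/seteqP; split=> [_ [_ [s gs <-] <-]|s gs]; first by rewrite (wP _ gs).2.
  by exists (w s); [exists s | exact: (wP _ gs).2].
by apply: cut_ext => t gt /=; rewrite (wP _ gt).2.
Qed.

Lemma B_homotopy p F : B p q F ->
  B p.+1 q (homotopy F) /\ fibre_sum (face ord0) (homotopy F) = F.
Proof.
move: F; apply: chains_ind => [|F H [BF FE] [BH HE]|g]; last exact: homotopy_gen.
  by rewrite homotopy0 fibre_sum0; split=> //; exact: chains0.
rewrite homotopyB; split; first exact: chainsB.
rewrite fibre_sumB ?FE ?HE //; exact: (chains_ff (sec := fun p => @fiber_sec p q)).
Qed.

(** As G is principal, a simplex is determined by its first vertex and its tail,
    so that extending by a first vertex commutes with the other faces. *)
Lemma fibre_sum_face_homotopy p (k : 'I_p.+2) (F : X p.+1 -> {freeg fiber_product f q}) t :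
  B p.+1 q F ->
  fibre_sum (face (fintype.lift ord0 k)) (homotopy F) t =
  select (v0 t) (fibre_sum (face k) F (face ord0 t)).
Proof.
move=> BF; have ff := chains_ff (sec := fun p => @fiber_sec p q) k BF.
have lk0 (s : X p.+2) : v0 (face (fintype.lift ord0 k) s) = v0 s.
  by apply: v0_face.
have ff0 (s : X p.+2) :
    face ord0 (face (fintype.lift ord0 k) s) = face k (face ord0 s).
  rewrite (@face_face _ principal _ s ord0 k isT); congr (face k (face _ s)).
  exact: val_inj.
rewrite (raddf_fibre_sum _ _ ff) /fibre_sum.
rewrite (reindex_fsbig (face ord0) (face (fintype.lift ord0 k) @^-1` [set t])
  (face k @^-1` [set face ord0 t])).
  by apply: eq_fsbigr => s /set_mem st; rewrite /homotopy -lk0 (st : _ = t).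
split=> [s st|s s'|s st]; first by rewrite /preimage /= -ff0 (st : _ = t).
  move=> /set_mem st /set_mem s't ss'; apply: (hd_face0_inj principal) => //.
  by apply: principal; rewrite ?src_hd ?ss' // !rng_hd -!lk0 (st : _ = t) (s't : _ = t).
have [h [h1 h2]] : exists h, src h = v0 s /\ rng h = v0 t.
  have [k0|k0] := eqVneq k ord0; last first.
    exists (hd t); rewrite src_hd rng_hd; split=> //.
    by rewrite -(st : _ = _) v0_face.
  have e : src (hd t) = rng (inv (hd s)).
    by rewrite rng_inv !src_hd -(st : _ = _) k0.
  exists (comp (hd t) (inv (hd s))); rewrite src_comp // rng_comp //.
  by rewrite src_inv !rng_hd.
have [u uP] := cons_ex h s; have [hu fu] := uP h1.
exists u => //; apply: (hd_face0_inj principal); last by rewrite ff0 fu.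
apply: principal; first by rewrite !src_hd ff0 fu (st : _ = _).
by rewrite !rng_hd lk0 -rng_hd hu.
Qed.

Lemma dv_homotopy p (F : X p.+1 -> {freeg fiber_product f q}) :
  B p.+1 q F -> dv F = 0 -> dv (homotopy F) = F.
Proof.
move=> BF F0; apply/funext => t; rewrite dvE big_ord_recl expr0 mulr1z.
have [_ ->] := B_homotopy BF; rewrite -[RHS]addr0; congr (_ + _).
transitivity (- select (v0 t) (dv F (face ord0 t))); last first.
  by rewrite F0 raddf0 oppr0.
rewrite dvE raddf_sum -sumrN; apply: eq_bigr => k _.
rewrite fibre_sum_face_homotopy // raddfMz /= /bump /= add1n exprS mulN1r.
by rewrite mulrNz.
Qed.
End Homotopy.

Lemma B_dv p q F : B p.+1 q F -> B p q (dv F).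
Proof.
exact: (@chains_dv _ (fun p => @fiber_sec p q) (fun p => @fiber_sec_sub p q)
  (fun p => @fiber_sec_push p q)).
Qed.

Lemma dv_class_map p q H : B p.+1 q H -> dv (@class_map q \o H) = @class_map q \o dv H.
Proof.
exact: (dv_hom (sec := fun p => @fiber_sec p q) [the {additive _ -> _} of @class_map q]).
Qed.

(** Lift the cycle to point labels, retract it until the lift is a cycle too,
    contract, and take classes. *)
Lemma columns_exact p q F : A p.+1 q F -> dv F = 0 ->
  exists2 H, A p.+2 q H & dv H = F.
Proof.
move=> AF F0; have [rn rnP] := @retractions_exist _ _ _ f sS sY zS q.
have [zeta [zc tz]] := zeta_exists q.
have [H BH HE] := A_lift AF.
have [|n0 n0P] := B_retract0 rnP (B_dv BH).
  by rewrite -dv_class_map // HE.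
have BH' := B_retract rnP n0 BH.
have dH' : dv (retract_map rn n0 \o H) = 0.
  rewrite (dv_hom (sec := fun p => @fiber_sec p q) [the {additive _ -> _} of retract_map rn n0] BH).
  exact: n0P.
have [Bh _] := B_homotopy zc tz BH'.
exists (@class_map q \o homotopy zeta (retract_map rn n0 \o H)); first exact: B_class_map.
rewrite dv_class_map // (dv_homotopy zc tz BH' dH') -HE.
by apply/funext => t /=; rewrite class_map_retract.
Qed.

(** ** The dimension group as the cokernel of the columns *)

Definition nice_sec q (U : set (X 0)) (a : X 0 -> fiber_product f q) :=
  exists z, nice rho tau (U : set (obj G)) z a.

Lemma nice_sec_fiber q U (a : X 0 -> fiber_product f q) : nice_sec U a -> fiber_sec U a.
Proof. by move=> [z [_ sz _ _ _]]; exists z. Qed.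

Lemma nice_sec_costable q U (a : X 0 -> fiber_product f q) : nice_sec U a ->
  U !=set0 -> compact_open_stable (a @` U).
Proof.
move=> [z [[kU oU] [_ ca _] _ [t tU] sU]] [x Ux].
apply/(compact_open_stableP sS); split=> //.
- by exists (a x), x.
- exact: cont_on_compact ca kU.
by exists t, 0%N => _ [y Uy <-]; exact: tU.
Qed.

(** The inverse of a is continuous by compactness, so that open subsets of U
    have open images in the stable direction. *)
Lemma nice_sec_sub q U V (a : X 0 -> fiber_product f q) : compact_open V ->
  V `<=` U -> nice_sec U a -> nice_sec V a.
Proof.
move=> [kV oV] VU [z [[kU oU] [cz ca za] aU [t tU] sU]]; exists z; split=> //.
- by apply: sect_sub VU _.
- by move=> x y /VU Ux /VU Uy; exact: aU.
- by exists t => x /VU; exact: tU.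
move=> _ [x Vx <-]; have [e1 e10 e1P] := sU (a x) (ex_intro2 _ _ x (VU _ Vx) erefl).
have kC : compact (a @` (U `\` V)).
  apply: cont_on_compact; first by apply: cont_on_sub ca => y [].
  rewrite setDE; apply: compact_closedI => //; exact: open_closedC.
have oC : open (~` (a @` (U `\` V))).
  by apply: closed_openC; apply: compact_closed kC; exact: fiber_hausdorff.
have /nbhs_mdist[e2 e20 e2P] : nbhs (a x) (~` (a @` (U `\` V))).
  apply: open_nbhs_nbhs; split=> // -[y [Uy nVy] yx].
  by apply: nVy; rewrite (aU _ _ Uy (VU _ Vx) yx).
exists (Num.min e1 e2); first by rewrite lt_min e10.
move=> u; rewrite lt_min => /andP[/e1P h1 /e2P h2] /h1 [y Uy yu].
have [Vy|nVy] := pselect (V y); first by exists y.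
by case: h2; exists y.
Qed.

Lemma nice_sec_dclassU q U V (a : X 0 -> fiber_product f q) : compact_open U ->
  compact_open V -> nice_sec (U `|` V) a -> U `&` V = set0 ->
  dclass (a @` (U `|` V)) = dclass (a @` U) + dclass (a @` V).
Proof.
move=> cU cV sUV UV0.
have h W : compact_open W -> W `<=` U `|` V ->
    a @` W = set0 \/ compact_open_stable (a @` W).
  move=> cW WUV; have [[x Wx]|W0] := pselect (W !=set0).
    by right; apply: (nice_sec_costable (nice_sec_sub cW WUV sUV)); exists x.
  by left; apply/seteqP; split=> // t [x Wx _]; case: W0; exists x.
have [E0|E1] := h (U `|` V) (compact_openU cU cV) (@subset_refl _ _).
  have U0 : a @` U = set0.
    by apply/seteqP; split=> // t [x Ux xt]; rewrite -E0; exists x => //; left.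
  have V0 : a @` V = set0.
    by apply/seteqP; split=> // t [x Ux xt]; rewrite -E0; exists x => //; right.
  by rewrite E0 U0 V0 dclass0 addr0.
rewrite image_setU in E1 *; apply: dclassU => //.
- by apply: h => //; exact: subsetUl.
- by apply: h => //; exact: subsetUr.
apply/seteqP; split=> // _ [[x Ux <-] [y Vy yx]].
have [z [_ _ aUV _ _]] := sUV.
have yx' : y = x by apply: aUV => //; [right | left].
have : (U `&` V) x by split=> //; rewrite -yx'.
by rewrite UV0.
Qed.

(** Sections with the same class at x are related by a holonomy map near x. *)
Lemma nice_sec_holonomy q (g g' : gen (@nice_sec q)) x :
  gset g x -> gset g' x -> cl (glab g x) = cl (glab g' x) ->
  exists2 N, nbhs x N & forall M, compact_open M -> M `<=` N ->
    dclass (glab g @` M) = dclass (glab g' @` M).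
Proof.
move=> gx g'x /cl_funst cgg; have [d d0 dP] := holonomy_sim f sS sY q.
have [z ng] := gsec g; have [z' ng'] := gsec g'.
have [[_ og] sz _ [t tg] _] := ng; have [[_ og'] sz' _ [t' tg'] _] := ng'.
set U := gset g `&` gset g'.
have oU : open U by exact: openI.
have [n h] := near_flun sS sY fb bb (t0 := x) oU (conj gx g'x)
  (sect_sub (@subIsetl _ _ _) sz) (sect_sub (@subIsetr _ _ _) sz') cgg d0.
have e0 : 0 < Num.min d (radius S) by rewrite lt_min d0 (sa_radius sS).
have [e e0' eP] := fiber_iterV_uniform f sS q n e0.
have nearA (a : X 0 -> fiber_product f q) : cont_at a x ->
    \forall y \near x, forall k, (k <= n)%N ->
      mdist (iter k dynV (a x)) (iter k dynV (a y)) < Num.min d (radius S).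
  move=> ca; have : \forall y \near x, mdist (a x) (a y) < e.
    by apply: (ca [set u | mdist (a x) u < e]); exact: (mdist_nbhs e0').
  by apply: filterS => y /eP.
have nA := nearA (glab g); have [_ cg _] := sz; have {}nA := nA (cg _ gx).
have nA' := nearA (glab g'); have [_ cg' _] := sz'; have {}nA' := nA' (cg' _ g'x).
have nU : nbhs x U by apply: open_nbhs_nbhs.
exists (U `&` [set y | forall m, (n <= m)%N ->
    flun (iter m dynV (glab g y)) (iter m dynV (glab g' y)) /\
    mdist (iter m dynV (glab g y)) (iter m dynV (glab g' y)) < d] `&`
  ([set y | forall k, (k <= n)%N ->
      mdist (iter k dynV (glab g x)) (iter k dynV (glab g y)) < Num.min d (radius S)] `&`
   [set y | forall k, (k <= n)%N ->
      mdist (iter k dynV (glab g' x)) (iter k dynV (glab g' y)) < Num.min d (radius S)])).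
  by apply: filterI; apply: filterI.
move=> M cM MN; have [M0|M0] := pselect (M !=set0); last first.
  have -> : M = set0 by apply/seteqP; split=> // y My; case: M0; exists y.
  by rewrite !image_set0.
have MU : M `<=` gset g by move=> y /MN[[[]]].
have MU' : M `<=` gset g' by move=> y /MN[[[]]].
have back (a : X 0 -> fiber_product f q) W s :
    (forall y, W y -> flst s (a y) /\ mdist s (a y) < small (fiber_product f q)) ->
    W x -> forall y, W y -> (forall k, (k <= n)%N ->
      mdist (iter k dynV (a x)) (iter k dynV (a y)) < Num.min d (radius S)) ->
    flst (iter n dynV (a x)) (iter n dynV (a y)) /\
    mdist (iter n dynV (a x)) (iter n dynV (a y)) < d.
  move=> sW Wx y Wy ky; have h3 k kn := ky k kn; split; last first.
    by have := ky n (leqnn n); rewrite lt_min => /andP[].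
  apply: (flst_iterV sS) => [|k kn]; last first.
    by have := ky k kn; rewrite lt_min => /andP[_ /ltW].
  apply: (flst_trans sS (flst_sym sS (sW _ Wx).1) (sW _ Wy).1).
  by have := ky 0%N (leq0n n); rewrite lt_min => /andP[_ /ltW].
have nM := nice_sec_sub cM MU (ex_intro _ z ng).
have nM' := nice_sec_sub cM MU' (ex_intro _ z' ng').
have cE := nice_sec_costable nM M0; have cE' := nice_sec_costable nM' M0.
apply: dclass_sim => //; apply: (dP n _ _ (glab g x) (glab g' x)) => //.
- by move=> _ [y My <-]; apply: (back _ _ _ tg gx) => //; [exact: MU | case: (MN _ My) => _ []].
- by move=> _ [y My <-]; apply: (back _ _ _ tg' g'x) => //; [exact: MU' | case: (MN _ My) => _ []].
- exact: (nbhs_singleton h n (leqnn n)).2.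
- move=> _ [y My <-]; exists (glab g' y); first by exists y.
  by have [[_ /(_ n (leqnn n))[]]] := MN _ My.
- move=> _ [y My <-]; exists (glab g y); first by exists y.
  by have [[_ /(_ n (leqnn n))[]]] := MN _ My.
Qed.

Lemma sum_split (V : zmodType) (I : Type) (r : seq I) (F F1 F2 : I -> V) :
  (forall i, F i = F1 i + F2 i) ->
  \sum_(i <- r) F i = \sum_(i <- r) F1 i + \sum_(i <- r) F2 i.
Proof. by move=> h; rewrite -big_split; exact: eq_bigr. Qed.

(** The part over U of the class of a combination of nice sections; with U
    varying, it can be studied locally. *)
Definition nsum q (r : seq (gen (@nice_sec q) * int)) (U : set (X 0)) :
    dimension_group (fiber_product f q) :=
  \sum_(g <- r) dclass (glab g.1 @` (gset g.1 `&` U)) *~ g.2.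

Lemma nsum_setT q (r : seq (gen (@nice_sec q) * int)) :
  exists2 U, compact_open U & nsum r U = nsum r setT.
Proof.
suff [U cU UP] : exists2 U, compact_open U &
    forall V, U `<=` V -> nsum r V = nsum r setT.
  by exists U => //; exact: UP.
elim: r => [|[g m] r [U cU UP]].
  exists set0 => [|V _]; first exact: compact_open0.
  by rewrite /nsum !big_nil.
exists (gset g `|` U) => [|V UV]; first exact: compact_openU (gco g) cU.
rewrite /nsum !big_cons /= -!/(nsum r _) UP => [|y Uy]; last by apply: UV; right.
congr (dclass (_ @` _) *~ _ + _); rewrite setIT.
by apply/setIidPl => y gy; apply: UV; left.
Qed.

(** Locally, the class of a nice section is determined by its unstable class, by
    [nice_sec_holonomy]. *)
Lemma nsum_eq0 q (r : seq (gen (@nice_sec q) * int)) :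
  @class_map q \o gsum r = 0 -> nsum r setT = 0.
Proof.
move=> r0; have [U cU <-] := nsum_setT r.
apply: (compact_open_ind (@hX 0) (@bX 0) (P := fun U => nsum r U = 0)) cU _ _ _.
- by rewrite /nsum big1 // => g _; rewrite setI0 image_set0 dclass0 mul0rz.
- move=> V W cV cW _ _ VW hV hW.
  transitivity (nsum r V + nsum r W); last by rewrite hV hW addr0.
  apply: sum_split => g; rewrite -mulrzDl; congr (_ *~ _); rewrite setIUr.
  have cgV := compact_openI (@hX 0) (gco g.1) cV.
  have cgW := compact_openI (@hX 0) (gco g.1) cW.
  apply: nice_sec_dclassU => //.
    apply: nice_sec_sub (gsec g.1); first exact: compact_openU.
    by move=> y [[]|[]].
  by apply/seteqP; split=> // y [[_ Vy] [_ Wy]]; have : (V `&` W) y by []; rewrite VW.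
move=> x _.
pose Phi := filter_from (nbhs x) (fun N => [set M | compact_open M /\ M `<=` N]).
have FPhi : Filter Phi.
  apply: filter_from_filter; first by exists setT; exact: filterT.
  move=> N N' nN nN'; exists (N `&` N'); first exact: filterI.
  by move=> M [cM MN]; split; split=> // y /MN[].
have rx : frlift (fun k : fiber_product f q => << cl k >> : {freeg L q}) (gsum r x) = 0.
  exact: (congr1 (fun F : X 0 -> {freeg L q} => F x) r0).
have := @chains_relation _ _ _ (L q) (@cl q) r x _ _ Phi
  (fun g M => dclass (glab g @` M)) FPhi rx.
case=> [g g' gx g'x /(nice_sec_holonomy gx g'x)[N nN NP]|N nN NP].
  by exists N => // M [cM MN]; exact: NP.
have [N' nN' N'P] : Phi [set M | nsum r M =
    \sum_(g <- r | `[< gset g.1 x >]) dclass (glab g.1 @` M) *~ g.2].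
  elim: r {r0 rx NP} => [|[g m] r IH].
    by exists setT => [|M _]; [exact: filterT | rewrite /= /nsum !big_nil].
  have Pg : Phi [set M | M `<=` [set y | gset g y <-> gset g x]].
    by exists [set y | gset g y <-> gset g x] => [|M []//]; exact: gen_near (@hX 0) g x.
  apply: filterS2 Pg IH => M Mg; rewrite /= /nsum !big_cons /= => ->.
  case: asboolP => gx.
    have -> // : gset g `&` M = M by apply/setIidPr => y /Mg /= ->.
  rewrite (_ : gset g `&` M = set0) ?image_set0 ?dclass0 ?mul0rz ?add0r //.
  by apply/seteqP; split=> // y [gy /Mg /= h]; case: gx; apply/h.
exists (N `&` N') => [|M cM MN _]; first exact: filterI.
rewrite N'P; last by split=> // y /MN[].
by apply: NP; split=> // y /MN[].
Qed.

Lemma nice_near p q (t0 : X p) (z0 : Z) (b : fiber_product f q) :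
  rho z0 = v0 t0 -> tau z0 = base b -> exists (U : set (X 0)) a,
  [/\ nice_sec U a, compact_open U, U (v0 t0), a (v0 t0) = b &
    fiber_sec (@v0 G p @^-1` U) (a \o @v0 G p)].
Proof.
move=> z0t z0b; have [U [z [a [nU Ux _ ax _]]]] := chart sS sY fb zS topG etaleG bb
  (esym z0b) (@filterT _ (nbhs (rho z0)) _) ltr01.
have cv : continuous (@v0 G p) by exact: v0_cont.
rewrite z0t in Ux ax; have [cU [cz ca za] _ _ _] := nU.
exists U, a; split=> //; first by exists z.
exists (z \o @v0 G p); split=> [t Ut|t Ut|t Ut].
- by apply: (cont_at_comp (h := z)); [exact: cv | exact: cz].
- by apply: (cont_at_comp (h := a)); [exact: cv | exact: ca].
exact: za.
Qed.

(** There are charts through all the points of the fibre product. *)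
Lemma A_nice q F : A 0 q F -> exists r : seq (gen (@nice_sec q) * int),
  @class_map q \o gsum r = F.
Proof.
move=> /A_lift[H BH <-].
suff [H' [r ->] HE] : exists2 H', chains (@nice_sec q) H' & @class_map q \o H' = @class_map q \o H.
  by exists r.
move: H BH; apply: chains_ind => [|H1 H2 [H1' c1 E1] [H2' c2 E2]|g].
- by exists 0 => //; exact: chains0.
- exists (H1' - H2'); first exact: chainsB.
  apply/funext => t /=; rewrite !fctE !raddfB.
  have /= -> := congr1 (fun F : X 0 -> {freeg L q} => F t) E1.
  by have /= -> := congr1 (fun F : X 0 -> {freeg L q} => F t) E2.
apply: (compact_open_ind (@hX 0) (@bX 0) (P := fun U => exists2 H',
  chains (@nice_sec q) H' & @class_map q \o H' = @class_map q \o cut U (fun t => << glab g t >>)))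
  (gco g) _ _ _.
- exists 0; first exact: chains0.
  by rewrite cut0; apply/funext => t /=; rewrite raddf0.
- move=> U V _ _ _ _ UV [H1 c1 E1] [H2 c2 E2]; exists (H1 + H2).
    exact: chainsD.
  rewrite cutU //; apply/funext => t /=; rewrite !fctE !raddfD.
  have /= -> := congr1 (fun F : X 0 -> {freeg L q} => F t) E1.
  by have /= -> := congr1 (fun F : X 0 -> {freeg L q} => F t) E2.
move=> x gx; have [z sz] := gsec g; have [_ _ za] := sz.
have [U [a [nU [kU oU] Ux ax [z' sz']]]] := @nice_near 0 q x (z x) (glab g x)
  (za _ gx).1 (za _ gx).2.
have [_ og] := gco g.
have h : \forall t \near x, funst (a t) (glab g t).
  apply: (near_funst sS sY fb bb (openI og oU) (conj gx Ux)
    (sect_sub (@subIsetr _ _ _) sz') (sect_sub (@subIsetl _ _ _) sz)).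
  by rewrite /= ax => i; exact: unstably_equivalentxx.
exists (U `&` [set t | funst (a t) (glab g t)]).
  by apply: filterI h; exact: open_nbhs_nbhs.
move=> M cM MN Mg; exists (cut M (fun t => << a t >>)).
  by apply: chains_gen => //; apply: nice_sec_sub nU => // t /MN[].
rewrite !cut_hom; apply: cut_ext => t /MN[_ ft] /=; rewrite !class_mapU.
by congr (<< _ >>); apply/cl_funst.
Qed.

(** Defined by the choice of a combination of nice sections; by [nsum_eq0], all
    choices give the same value, see [etaE]. *)
Definition eta q (F : X 0 -> {freeg L q}) : dimension_group (fiber_product f q) :=
  if pselect (exists r : seq (gen (@nice_sec q) * int), @class_map q \o gsum r = F) is left e
  then nsum (projT1 (cid e)) setT else 0.

Lemma nsumB q (r s : seq (gen (@nice_sec q) * int)) : exists u,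
  gsum u = gsum r - gsum s /\ forall U, nsum u U = nsum r U - nsum s U.
Proof.
exists (r ++ [seq (g.1, - g.2) | g <- s]); split=> [|U].
  rewrite /gsum big_cat big_map /= -sumrN; congr (_ + _).
  by apply: eq_bigr => g _; rewrite mulrNz.
rewrite /nsum big_cat big_map /= -sumrN; congr (_ + _).
by apply: eq_bigr => g _; rewrite mulrNz.
Qed.

Lemma class_map_compB q (H H' : X 0 -> {freeg fiber_product f q}) :
  @class_map q \o (H - H') = (@class_map q \o H) - (@class_map q \o H').
Proof. by apply/funext => t /=; rewrite !fctE raddfB. Qed.

Lemma etaE q (r : seq (gen (@nice_sec q) * int)) : eta (@class_map q \o gsum r) = nsum r setT.
Proof.
rewrite /eta; case: pselect => [e|[]]; last by exists r.
case: (cid e) => s /= sr; have [u [uE uN]] := nsumB s r.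
apply/eqP; rewrite -subr_eq0 -uN; apply/eqP; apply: nsum_eq0.
by rewrite uE class_map_compB sr subrr.
Qed.

Lemma etaB q F H : A 0 q F -> A 0 q H -> eta (F - H) = eta F - eta H.
Proof.
move=> /A_nice[r <-] /A_nice[s <-]; have [u [uE uN]] := nsumB r s.
by rewrite -class_map_compB -uE !etaE uN.
Qed.

Lemma eta0 q : eta (0 : X 0 -> {freeg L q}) = 0.
Proof.
have A0 : A 0 q 0 by exact: chains0.
by have := etaB A0 A0; rewrite !subrr.
Qed.

Lemma etaD q F H : A 0 q F -> A 0 q H -> eta (F + H) = eta F + eta H.
Proof.
move=> AF AH; have AN : A 0 q (- H) by exact: chainsN.
rewrite -[H in LHS]opprK etaB //; congr (_ + _).
by rewrite -[- H]sub0r etaB ?eta0 ?sub0r ?opprK //; exact: chains0.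
Qed.

Lemma eta_cut q U (a : X 0 -> fiber_product f q) : compact_open U -> nice_sec U a ->
  eta (cut U (fun t => << cl (a t) >>)) = dclass (a @` U).
Proof.
move=> cU nU; pose r := [:: (Gen cU nU, 1 : int)].
rewrite (_ : cut _ _ = @class_map q \o gsum r).
  by rewrite etaE /nsum big_seq1 mulr1z /= setIT.
rewrite /gsum big_seq1 mulr1z cut_hom; apply: cut_ext => t _ /=.
by rewrite class_mapU.
Qed.

Lemma A_nice_sec q U (a : X 0 -> fiber_product f q) : compact_open U -> nice_sec U a ->
  A 0 q (cut U (fun t => << cl (a t) >>)).
Proof.
move=> cU /nice_sec_fiber/fiber_sec_classes sU.
by apply: (@chains_gen _ _ (@classes_sec 0 q) U (fun t => cl (a t))).
Qed.

(** The labels of a section are invariant under translation by arrows, so that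
    the two faces of a small set of arrows have the same class. *)
Lemma eta_dv q F : A 1 q F -> eta (dv F) = 0.
Proof.
suff : A 1 q F -> A 1 q F /\ eta (dv F) = 0 by move=> h /h[].
have dvAB F' H : A 1 q F' -> A 1 q H -> dv (F' - H) = dv F' - dv H.
  by move=> AF AH; exact: (@dvB _ (fun p => @classes_sec p q)).
have A0 : A 1 q 0 by exact: chains0.
have dv0 : dv (0 : X 1 -> {freeg L q}) = 0.
  by have := dvAB _ _ A0 A0; rewrite !subrr.
have dvAD F' H : A 1 q F' -> A 1 q H -> dv (F' + H) = dv F' + dv H.
  move=> AF AH; have AN : A 1 q (- H) by exact: chainsN.
  have dvN : dv (- H) = - dv H by rewrite -sub0r dvAB // dv0 sub0r.
  by rewrite -[H in LHS]opprK dvAB // dvN opprK.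
move: F; apply: chains_ind => [|F H [AF F0] [AH H0]|g].
- by split=> //; rewrite dv0; exact: eta0.
- split; first exact: chainsB.
  rewrite dvAB // etaB ?F0 ?H0 ?subrr //; exact: A_dv.
have Acut U : compact_open U -> U `<=` gset g -> A 1 q (cut U (fun t => << glab g t >>)).
  move=> cU Ug; apply: chains_gen => //; exact: classes_sec_sub Ug (gsec g).
split; first by apply: Acut => //; exact: gco.
apply: (compact_open_ind (@hX 1) (@bX 1) (P := fun U => eta (dv (cut U
  (fun t => << glab g t >>))) = 0)) (gco g) _ _ _.
- by rewrite cut0 dv0; exact: eta0.
- move=> U V cU cV Ug Vg UV hU hV; rewrite cutU //.
  have AU := Acut U cU Ug; have AV := Acut V cV Vg.
  rewrite dvAD // etaD ?hU ?hV ?addr0 //; exact: A_dv.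
move=> x gx; have [z zP] := boolp.choice (gsec g).
have {zP}[a zaP] := boolp.choice zP.
have [_ og] := gco g.
have [N [w [b [oN Nx Ng sb bP]]]] := fiber_sections sS sY bb (v := @v0 G 1) og gx
  (fun i => let: And4 h _ _ _ := zaP i in h)
  (fun i => let: And4 _ h _ _ := zaP i in h)
  (fun i => let: And4 _ _ h _ := zaP i in h).
have [_ _ wb] := sb.
have [U [c [nU [kU oU] Ux cx [z' sz']]]] := nice_near (wb _ Nx).1 (wb _ Nx).2.
have ov : open (@v0 G 1 @^-1` U) by apply: preimage_open => //; exact: v0_cont.
have h : \forall t \near x, funst (c (v0 t)) (b t).
  apply: (near_funst sS sY fb bb (openI ov oN) (conj Ux Nx)
    (sect_sub (@subIsetl _ _ _) sz') (sect_sub (@subIsetr _ _ _) sb)).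
  by rewrite /= cx => i; exact: unstably_equivalentxx.
have v1 t : face ord_max t = v0 t :> X 0 by rewrite v0E /face.
have [N0 [oN0 N0x dN0]] := etale_inj x (eface (ord0 : 'I_2)).
have [N1 [oN1 N1x dN1]] := etale_inj x (eface (ord_max : 'I_2)).
have [s0 [s0d cs0]] := etale_section (eface ord0) oN0 N0x dN0.
have [s1 [s1d cs1]] := etale_section (eface ord_max) oN1 N1x dN1.
exists ((N `&` @v0 G 1 @^-1` U) `&` [set t | funst (c (v0 t)) (b t)] `&` (N0 `&` N1)).
  apply: filterI; [apply: filterI h | by apply: filterI; exact: open_nbhs_nbhs].
  by apply: filterI; exact: open_nbhs_nbhs.
move=> M cM MN Mg; have [kM oM] := cM.
have MN0 : M `<=` N0 by move=> t /MN[_ []].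
have MN1 : M `<=` N1 by move=> t /MN[_ []].
have MU t : M t -> U (v0 t) by move=> /MN[[[]]].
have lE t : M t -> glab g t = cl (c (v0 t)).
  move=> Mt; have [[[Nt _] ft] _] := MN _ Mt.
  transitivity (cl (b t)); last by apply/cl_funst => i; exact/unstably_equivalentC.
  apply/funext => i; have [_ _ _ ->] := zaP i; last exact: Mg.
  by apply/uclass_eq; apply: unstably_equivalentC; exact: bP.
have c0 := etale_image_compact_open (eface ord0) cM.
have c1 := etale_image_compact_open (eface ord_max) cM.
have n1 : nice_sec (face ord_max @` M) c.
  by apply: nice_sec_sub nU => // _ [t Mt <-]; rewrite v1; exact: MU.
have MU' : M `<=` @v0 G 1 @^-1` U by exact: MU.
have [cz' cc za'] := sect_sub MU' sz'.
have cs0M : cont_on (face ord0 @` M) s0.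
  by apply: cont_on_sub cs0; exact: image_subset.
have s0M t : M t -> s0 (face ord0 t) = t by move=> /MN0; exact: s0d.
have imE : (fun y => c (v0 (s0 y))) @` (face ord0 @` M) = c @` (face ord_max @` M).
  apply/seteqP; split=> _ [_ [t Mt <-] <-].
    by exists (v0 t); [exists t => //; rewrite v1 | rewrite s0M].
  by exists (face ord0 t); [exists t | rewrite s0M // v1].
(* the same section, translated along the arrows of M *)
have n0 : nice_sec (face ord0 @` M) (fun y => c (v0 (s0 y))).
  have [z2 [cz2 z2P]] := push_section oM cz' (fun t Mt => (za' t Mt).1) s0M cs0M.
  have [zc [_ _ cinj [u uP] _]] := n1.
  exists z2; split=> //.
  - split=> //; first exact: cont_on_push cs0M cc.
    move=> _ [t Mt <-]; have [-> ->] := z2P _ Mt.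
    by rewrite s0M // (za' _ Mt).2.
  - move=> _ _ [t Mt <-] [t' Mt' <-]; rewrite !s0M // => ctt.
    suff -> : t = t' by []; apply: dN1; [exact: MN1 | exact: MN1 |]; rewrite !v1.
    by apply: cinj ctt; rewrite -v1; [exists t | exists t'].
  - exists u => _ [t Mt <-]; rewrite s0M //; apply: uP.
    by exists t => //; rewrite v1.
  by rewrite imE; have [_ [_ _ _ _ sU]] := n1.
rewrite /dv big_ord_recl big_ord1 expr0 mulr1z expr1 mulrN1z.
rewrite (fibre_sum_cut _ s0d MN0).
rewrite (_ : fintype.lift _ _ = ord_max); last exact: val_inj.
rewrite (fibre_sum_cut _ s1d MN1).
rewrite (_ : cut (face ord0 @` M) _ = cut (face ord0 @` M)
  (fun y => << cl (c (v0 (s0 y))) >>)); last first.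
  by apply: cut_ext => _ [t Mt <-] /=; rewrite s0M // lE.
rewrite (_ : cut (face ord_max @` M) _ = cut (face ord_max @` M)
  (fun y => << cl (c y) >>)); last first.
  apply: cut_ext => _ [t Mt <-]; rewrite -[LHS]/(<< glab g (s1 (face ord_max t)) >>).
  by rewrite (s1d _ (MN1 _ Mt)) lE // v1.
have Ac0 := A_nice_sec c0 n0; have Ac1 := A_nice_sec c1 n1.
by rewrite etaB // (eta_cut c0 n0) (eta_cut c1 n1) imE subrr.
Qed.

Lemma nice_sec_omit q (k : 'I_q.+2) U (a : X 0 -> fiber_product f q.+1) :
  nice_sec U a -> nice_sec U (omit k \o a).
Proof.
move=> nU; have [z [cU [cz ca za] aU [t tU] sU]] := nU.
have omitU x y : U x -> U y -> omit k (a x) = omit k (a y) -> x = y.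
  move=> Ux Uy oxy; apply: aU => //; apply: (flst_base_inj sS fb).
    apply: (flst_trans sS (flst_sym sS (tU _ Ux).1) (tU _ Uy).1).
    apply: le_trans (metric_triangle _ t _) _.
    rewrite (splitr (radius S)) lerD // ltW //; last exact: (tU _ Uy).2.
    by rewrite metric_sym; exact: (tU _ Ux).2.
  by rewrite -!(base_omit k) oxy.
exists z; split=> //.
- split=> // [x Ux|x Ux].
    by apply: (cont_at_comp (h := omit k)); [exact: ca | exact: omit_cont].
  by rewrite /= base_omit; exact: za.
- exists (omit k t) => x Ux; have [h1 h2] := tU _ Ux; split; first exact: flst_omit.
  exact: le_lt_trans (mdist_omit _ _ _) h2.
have [U0|U0] := pselect (U !=set0); last by move=> u [x Ux _]; case: U0; exists x.
have /(compact_open_stable_omit sS sY fb k) := nice_sec_costable nU U0.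
by move=> /(compact_open_stableP sS)[_ + _ _]; rewrite image_comp.
Qed.

(** Omitting a coordinate of a nice section gives a nice section. *)
Lemma eta_dh q F : A 0 q.+1 F ->
  eta (dh F) = altsum (fun k : 'I_q.+2 => dimension_map (@omit _ _ _ f q k)) (eta F).
Proof.
move=> AF; suff : A 0 q.+1 F /\ eta (dh F) =
  altsum (fun k : 'I_q.+2 => dimension_map (@omit _ _ _ f q k)) (eta F) by case.
have [r <-] := A_nice AF; have : chains (@nice_sec q.+1) (gsum r) by exists r.
have dhB F' H : @dh 0 q (F' - H) = dh F' - dh H.
  by apply/funext => t; rewrite /dh !fctE raddfB.
have dh0 : @dh 0 q 0 = 0 by have := dhB 0 0; rewrite !subrr.
set del := altsum _.
have delB x y : del (x - y) = del x - del y by exact: altsum_zmod_morphism.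
have del0 : del 0 = 0 by have := delB 0 0; rewrite !subrr.
move: (gsum r); apply: chains_ind => [|H H' [AH HE] [AH' HE']|g].
- have -> : @class_map q.+1 \o (0 : X 0 -> {freeg fiber_product f q.+1}) = 0.
    by have := @class_map_compB q.+1 0 0; rewrite !subrr.
  by rewrite dh0 !eta0 del0; split=> //; exact: chains0.
- rewrite class_map_compB; split; first exact: chainsB.
  rewrite dhB !etaB //; [|exact: A_dh | exact: A_dh].
  by rewrite delB HE HE'.
have gE : @class_map q.+1 \o gfun g = cut (gset g) (fun t => << cl (glab g t) >>).
  by rewrite cut_hom; apply: cut_ext => t _ /=; rewrite class_mapU.
have cg := gco g; have ng := gsec g.
rewrite gE; split; first exact: A_nice_sec.
have -> : @dh 0 q (cut (gset g) (fun t => << cl (glab g t) >>)) =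
    \sum_(k < q.+2) cut (gset g) (fun t => << cl ((omit k \o glab g) t) >>) *~ (-1) ^+ k.
  apply/funext => t; rewrite /dh fct_sumE raddf_cut /= {1}/cut.
  case: asboolP => gt.
    by rewrite sdU; apply: eq_bigr => k _; rewrite fct_mulrz cut_in.
  by rewrite big1 // => k _; rewrite fct_mulrz cut_out // mul0rz.
have [|_ ->] := @sub_additive_sum _ _ (A 0 q) (@eta q) _ (index_enum _)
  (fun k : 'I_q.+2 => cut (gset g) (fun t => << cl ((omit k \o glab g) t) >>))
  (fun k => (-1) ^+ k) (@chains0 _ _ _) (@chainsB _ _ _) (@etaB q).
  by move=> k; apply: A_nice_sec => //; exact: nice_sec_omit.
rewrite eta_cut // /del /altsum; apply: eq_bigr => k _; congr (_ *~ _).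
rewrite eta_cut //; last exact: nice_sec_omit.
have [U0|U0] := pselect (gset g !=set0).
  by rewrite dimension_map_omit //; [rewrite image_comp | exact: nice_sec_costable].
have -> : gset g = set0 by apply/seteqP; split=> // x gx; case: U0; exists x.
rewrite !image_set0 !dclass0.
exact/esym/(raddf0 (dimension_map (@omit _ _ _ f q k))).
Qed.

Lemma costable_cap q (E D : set (fiber_product f q)) : compact_open_stable E ->
  compact_open D -> E `&` D = set0 \/ compact_open_stable (E `&` D).
Proof.
move=> cE [kD oD]; have [_ sE kE _] := proj1 (compact_open_stableP sS E) cE.
have [ED0|ED0] := pselect (E `&` D !=set0); last first.
  by left; apply/seteqP; split=> // t ?; case: ED0; exists t.
right; apply: (compact_open_stable_sub sS cE) => //.
  move=> t [Et Dt]; have [e e0 eP] := sE _ Et.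
  have /nbhs_mdist[e' e'0 e'P] : nbhs t D by exact: open_nbhs_nbhs.
  exists (Num.min e e') => [|u]; first by rewrite lt_min e0.
  by rewrite lt_min => /andP[/eP h /e'P Du] /h.
by apply: compact_closedI => //; apply: compact_closed kD; exact: fiber_hausdorff.
Qed.

(** Small clopen sets of the fibre product cut a compact open subset of a stable
    set into images of nice sections. *)
Lemma eta_surj q (u : dimension_group (fiber_product f q)) :
  exists2 F, A 0 q F & eta F = u.
Proof.
move: u; apply: dimension_group_gen => [|x y [F AF <-] [H AH <-]|E cE].
- by exists 0; [exact: chains0 | exact: eta0].
- by exists (F - H); [exact: chainsB | rewrite etaB].
have [_ sE kE [x0 [n En]]] := proj1 (compact_open_stableP sS E) cE.
have hF : hausdorff_space (fiber_product f q) by exact: fiber_hausdorff.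
have bF : co_basis (fiber_product f q) by exact: fiber_co_basis.
have clE : closed E by exact: compact_closed.
have [e e0 eP] := slevel_close f sS q n.
rewrite -[E]setIT.
apply: (compact_open_ind hF bF (P := fun D => exists2 F, A 0 q F &
  eta F = dclass (E `&` D)) (U0 := setT)) => [||D D' cD cD' _ _ DD [F AF FE] [H AH HE]|t _].
- by split; [exact: fiber_compact | exact: openT].
- by exists 0; [exact: chains0 | rewrite setI0 dclass0; exact: eta0].
- exists (F + H); first exact: chainsD.
  rewrite etaD // FE HE setIUr.
  have h1 := costable_cap cE cD; have h2 := costable_cap cE cD'.
  have [E0|c] := costable_cap cE (compact_openU cD cD').
    have z1 : E `&` D = set0.
      by apply/seteqP; split=> // s [Es Ds]; rewrite -E0; split=> //; left.
    have z2 : E `&` D' = set0.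
      by apply/seteqP; split=> // s [Es Ds]; rewrite -E0; split=> //; right.
    by rewrite z1 z2 setU0 dclass0 addr0.
  rewrite -dclassU // -?setIUr //.
  by apply/seteqP; split=> // s [[_ Ds] [_ D's]]; rewrite -DD.
have [Et|nEt] := pselect (E t); last first.
  exists (~` E); first by apply: open_nbhs_nbhs; split=> //; exact: closed_openC.
  move=> M _ ME _; exists 0; first exact: chains0.
  rewrite (_ : E `&` M = set0) ?dclass0 ?eta0 //.
  by apply/seteqP; split=> // s [Es /ME].
have [z0 z0t] := tau_surj bb (base t).
have [U [a [nU cU Ux ax _]]] := @nice_near 0 q (rho z0) z0 t erefl z0t.
have [z [[kU oU] [_ ca _] aU [t1 tU] sU]] := nU.
have [e1 e10 e1P] := sU t (ex_intro2 _ _ (rho z0) Ux ax).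
have ee0 : 0 < Num.min e e1 by rewrite lt_min e0.
exists [set s | mdist t s < Num.min e e1]; first exact: mdist_nbhs ee0 _.
move=> M cM MN _; have [kM oM] := cM.
set W := U `&` a @^-1` (E `&` M).
have EM : E `&` M = a @` W.
  apply/seteqP; split=> [s [Es Ms]|_ [y [Uy EMy] <-]] //.
  have /= := MN _ Ms; rewrite lt_min => /andP[/eP h1 /e1P h2].
  have [y Uy ys] := h2 (h1 x0 (En _ Et) (En _ Es)).
  by exists y => //; split=> //; rewrite /preimage /= ys.
have clEM : closed (E `&` M) by apply: closedI => //; exact: compact_closed.
have flU y y' : U y -> U y' -> flst (a y) (a y').
  move=> Uy Uy'; apply: (flst_trans sS (flst_sym sS (tU _ Uy).1) (tU _ Uy').1).
  apply: le_trans (metric_triangle _ t1 _) _.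
  rewrite (splitr (radius S)) lerD // ltW //; last exact: (tU _ Uy').2.
  by rewrite metric_sym; exact: (tU _ Uy).2.
have oW : open W.
  rewrite openE => y [Uy [Ey My]]; have [e2 e20 e2P] := sE _ Ey.
  have n1 : \forall y' \near y, mdist (a y) (a y') < e2.
    by apply: (ca _ Uy [set u | mdist (a y) u < e2]); exact: (mdist_nbhs e20).
  have n2 : \forall y' \near y, M (a y').
    by apply: (ca _ Uy M); exact: open_nbhs_nbhs.
  apply: filterS3 (open_nbhs_nbhs (conj oU Uy)) n1 n2 => y' Uy' d My'.
  by split=> //; split=> //; apply: e2P => //; exact: flU.
have oUW : open (U `&` ~` (a @^-1` (E `&` M))).
  rewrite openE => y [Uy nEy].
  have n1 : \forall y' \near y, (~` (E `&` M)) (a y').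
    by apply: (ca _ Uy (~` (E `&` M))); apply: open_nbhs_nbhs; split=> //;
      exact: closed_openC.
  by apply: filterS2 (open_nbhs_nbhs (conj oU Uy)) n1 => y' Uy' ny'.
have cW : compact_open W.
  split=> //; rewrite (_ : W = U `&` ~` (U `&` ~` (a @^-1` (E `&` M)))).
    by apply: compact_closedI => //; exact: open_closedC.
  apply/seteqP; split=> [y [Uy EMy]|y [Uy]]; first by split=> // -[_]; apply.
  by move=> /not_andP[//|/contrapT].
have WU : W `<=` U by move=> y [].
have nW := nice_sec_sub cW WU nU.
exists (cut W (fun y => << cl (a y) >>)); first exact: A_nice_sec.
by rewrite (eta_cut cW nW) EM.
Qed.

(** In degree 0, the homotopy is a contraction up to the sum of all the labels
    attached to each object. The coefficients of this sum are the numbers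
    [count], which vanish for a late enough retraction when the class is 0. *)
Lemma dv_eta_exact q F : A 0 q F -> eta F = 0 -> exists2 H, A 1 q H & dv H = F.
Proof.
move=> AF; have [r <-] := A_nice AF; rewrite etaE => r0.
have [rn rnP] := @retractions_exist _ _ _ f sS sY zS q.
have [zeta [zc tz]] := zeta_exists q.
pose img (g : gen (@nice_sec q) * int) := glab g.1 @` gset g.1.
have imgP g : img g = set0 \/ compact_open_stable (img g).
  have [U0|U0] := pselect (gset g.1 !=set0).
    by right; exact: nice_sec_costable (gsec g.1) U0.
  by left; apply/seteqP; split=> // u [x gx _]; case: U0; exists x.
have [|n nP] := @dclass_sum_count _ _ _ f sS zS q rn rnP _ r img (fun g => g.2) imgP.
  by rewrite -[RHS]r0 /nsum; apply: eq_bigr => g _; rewrite setIT.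
have {}nP := nP n (leqnn n).
pose K := retract_map rn n \o gsum r.
have chB : B 0 q (gsum r).
  have : chains (@nice_sec q) (gsum r) by exists r.
  move: (gsum r); apply: chains_ind => [|F' H BF BH|g]; first exact: chains0.
    exact: chainsB.
  apply: (@chains_gen _ _ (@fiber_sec 0 q) (gset g) (glab g)); first exact: gco.
  exact: nice_sec_fiber (gsec g).
have BK : B 0 q K by exact: B_retract.
have [BhK hK] := B_homotopy zc tz BK.
exists (@class_map q \o homotopy zeta K); first exact: B_class_map.
rewrite dv_class_map //.
have -> : @class_map q \o gsum r = @class_map q \o K.
  by apply/funext => t /=; rewrite /K /= class_map_retract.
congr (_ \o _); apply/funext => t; rewrite dvE big_ord_recl big_ord1 expr0 mulr1z.
rewrite hK -[RHS]addr0; congr (_ + _); rewrite expr1 mulrN1z.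
apply/eqP; rewrite oppr_eq0; apply/freeg_eqP => b; rewrite coeff0.
rewrite (_ : fintype.lift _ _ = ord_max); last exact: val_inj.
have v1 (s : X 1) : face ord_max s = v0 s :> X 0 by rewrite v0E /face.
have ff := chains_ff (sec := fun p => @fiber_sec p q) ord_max BhK.
rewrite (raddf_fibre_sum [the {additive _ -> _} of coeff b] t ff).
have coeff_res x u : coeff b (select zeta x u) =
    if `[< rho (zeta b) = x >] then coeff b u else 0.
  move: u; apply: freeg_gen => [|u v uE vE|c].
  - by rewrite !raddf0; case: asbool.
  - by rewrite !raddfB /= uE vE; case: asbool; rewrite ?subr0.
  rewrite selectU; have [->|cb] := eqVneq c b; first by case: asboolP; rewrite // coeff0.
  have h0 : coeff b (<< c >> : {freeg fiber_product f q}) = 0.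
    by rewrite coeffU (negbTE cb) mulr0.
  by case: asboolP => _; case: asboolP => _; rewrite ?h0 ?coeff0.
under eq_fsbigr do rewrite /= /homotopy coeff_res.
have [zb|zb] := pselect (rho (zeta b) = t); last first.
  apply: fsbig1 => s st; case: asboolP => // zbs; case: zb.
  by rewrite zbs -v1.
have {ff coeff_res}-> : \sum_(s \in face ord_max @^-1` [set t])
    (if `[< rho (zeta b) = v0 s >] then coeff b (K (face ord0 s)) else 0) =
    \sum_(s \in face ord_max @^-1` [set t]) coeff b (K (face ord0 s)).
  apply: eq_fsbigr => s /set_mem st; case: asboolP => // -[].
  by rewrite zb -v1.
rewrite -(reindex_fsbig (face ord0) _ (face ord0 @` (face ord_max @^-1` [set t]))
  (fun y : X 0 => coeff b (K y))); last first.
  split=> [s st|s s' /set_mem st /set_mem s't ss'|//]; first by exists s.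
  apply: (hd_face0_inj principal) => //; apply: principal.
    by rewrite !src_hd ss'.
  by rewrite !rng_hd -!v1 (st : _ = t) (s't : _ = t).
(* labels attached to t only occur at objects of the orbit of t *)
rewrite (fsbig_widen _ setT) => [|//|y [_ ny]]; last first.
  have [r' KE] := BK; rewrite /= KE gsumE raddf_sum big1 // => g _.
  rewrite raddfMz /= /gfun /cut; case: asboolP => gy; last by rewrite coeff0 mul0rz.
  rewrite coeffU; case: eqP => gb; last by rewrite mulr0 mul0rz.
  case: ny; have [z [_ _ zP]] := gsec g.1; have [zy1 zy2] := zP _ gy.
  have [h [h1 h2]] : exists h, src h = rho (z y) /\ rng h = rho (zeta b).
    apply: (arr_exists bb); rewrite zy2 tz -gb.
    exact: unstably_equivalentxx.
  have [s sP] := cons_ex h y; have [hs fs] := sP (etrans h1 zy1).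
  by exists s => //=; rewrite -zb -h2 -hs rng_hd -v1.
pose phi (g : gen (@nice_sec q)) : X 0 -> int :=
  cut (gset g) (fun y => (rn n (glab g y) == b)%:R).
have KE : (fun y => coeff b (K y)) = \sum_(g <- r) phi g.1 *~ g.2.
  apply/funext => y; rewrite /K /= gsumE !raddf_sum fct_sumE.
  apply: eq_bigr => g _; rewrite !raddfMz fct_mulrz; congr (_ *~ _).
  rewrite /phi /gfun /cut; case: asboolP => _ /=; last by rewrite raddf0 coeff0.
  by rewrite retract_mapU coeffU mul1r.
have phiE g : fibre_finite (fun=> tt) (phi g) /\
    fibre_sum (fun=> tt) (phi g) tt = count rn n (glab g @` gset g) b.
  pose W := [set y | gset g y /\ rn n (glab g y) = b].
  have [_ [_ _ aU _ _]] := gsec g.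
  have imW : glab g @` W = (glab g @` gset g) `&` rn n @^-1` [set b].
    apply/seteqP; split=> [_ [y [gy yb] <-]|_ [[y gy <-] yb]]; last by exists y.
    by split=> //; exists y.
  have finW : finite_set (glab g @` W).
    have gI : glab g @` gset g = set0 \/ compact_open_stable (glab g @` gset g).
      exact: (imgP (g, 1 : int)).
    rewrite imW; have [->|c] := gI; first by rewrite set0I.
    exact: retraction_fiber_finite.
  have [[y0 _]|W0] := pselect (W !=set0); last first.
    have W0' : W = set0 by apply/seteqP; split=> // y Wy; case: W0; exists y.
    have p0 y : phi g y = 0.
      rewrite /phi /cut; case: asboolP => // gy; case: eqP => // yb.
      by case: W0; exists y.
    split=> [u|]; last first.
      rewrite /count -imW W0' image_set0 fsbig_set0.
      by apply: fsbig1 => y _.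
    by apply: sub_finite_set (finite_set0 (X 0)) => y [_]; rewrite p0 eqxx.
  have fW : finite_set W.
    pose inv u := xget y0 [set y | W y /\ glab g y = u].
    apply: sub_finite_set (finite_image inv finW) => y Wy.
    exists (glab g y); first by exists y.
    rewrite /inv; case: xgetP => [y' _ [[gy' _] yy']|/(_ y)]; last by case.
    by apply: aU => //; case: Wy.
  split=> [u|].
    apply: sub_finite_set fW => y [_]; rewrite /phi /cut; case: asboolP => // gy.
    by case: (rn n (glab g y) =P b) => [yb _|_]; [split | rewrite eqxx].
  rewrite /fibre_sum /count -imW.
  rewrite (reindex_fsbig (glab g) W (glab g @` W)); last first.
    split=> [y Wy|y y' /set_mem[gy _] /set_mem[gy' _]|//]; [by exists y | exact: aU].
  transitivity (\sum_(y \in W) phi g y); last first.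
    apply: eq_fsbigr => y /set_mem[gy yb]; rewrite /phi cut_in // yb eqxx.
    by [].
  apply/esym; apply: fsbig_widen => [y _ //|y [_ nWy]].
  rewrite /preimage /= /phi /cut; case: asboolP => // gy; case: eqP => // yb.
  by case: nWy.
have ffB (F1 H : X 0 -> int) : fibre_finite (fun=> tt) F1 -> fibre_finite (fun=> tt) H ->
    fibre_finite (fun=> tt) (F1 - H).
  move=> fF fH u; have := conj (fF u) (fH u); rewrite -finite_setU.
  apply: sub_finite_set => y [_]; rewrite !fctE => FHy.
  have [F10|] := eqVneq (F1 y) 0; last by left; split=> //; case: u.
  right; split; first by case: u.
  by apply: contra_neq FHy => ->; rewrite F10 subr0.
have ff0 : fibre_finite (fun=> tt) (0 : X 0 -> int).
  by move=> u; apply: sub_finite_set (finite_set0 (X 0)) => y [_]; rewrite eqxx.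
have [||_] := @sub_additive_sum _ _ _ (fun F1 : X 0 -> int => fibre_sum (fun=> tt) F1 tt) _ r
  (fun g => phi g.1) (fun g => g.2) ff0 ffB.
- by move=> F1 H fF fH; rewrite (fibre_sumB fF fH) !fctE.
- by move=> g; case: (phiE g.1).
rewrite -KE /fibre_sum => hsum.
transitivity (\sum_(g <- r) fibre_sum (fun=> tt) (phi g.1) tt *~ g.2).
  by rewrite -hsum; apply: eq_fsbigl; apply/seteqP; split.
by rewrite -[RHS](nP b); apply: eq_bigr => g _; rewrite (phiE g.1).2.
Qed.

Lemma columns_resolve :
  @row_resolution (fun p q => X q -> {freeg L p}) (fun p q => A q p)
    (fun p q => @dh q p) (fun p q => @dv (L p) q) (stable_complex f) eta.
Proof.
split.
- by move=> q x y; exact: etaB.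
- by move=> q x; exact: eta_dh.
- by move=> q x; exact: eta_dv.
- by move=> q u; exact: eta_surj.
- by move=> q x; exact: dv_eta_exact.
by move=> q p x; exact: columns_exact.
Qed.

Theorem bibundle_homology p :
  isomorphic (stable_homology f p) (groupoid_homology G p).
Proof.
exact: double_complex_homology A_double_complex rows_resolve columns_resolve.
Qed.
End DoubleComplex.

(** * Stable homology and groupoid homology *)

(** Distinct paths differ at some edge, and each edge is a locally constant
    function of the path. *)
Lemma sft_zero_dimensional (R : realType) (S : system R) :
  shift_of_finite_type S -> zero_dimensional S.
Proof.
move=> [V [E [i [t [h [[ch [k [_ hk _]]] _]]]]]] x y xy.
have [n xyn] : exists n, set_val (h x) n <> set_val (h y) n.
  apply: contrapT => nex; move/eqP: xy; apply; apply: (can_inj hk).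
  have : set_val (h x) = set_val (h y).
    by apply/funext => n; apply: contrapT => ne; apply: nex; exists n.
  by case: (h x) (h y) => [a ?] [b ?] /= ab; exact: eq_exist.
pose c (s : S) : discrete_topology E := set_val (h s) n.
have cc : continuous c.
  move=> s; apply: (cont_at_comp (g := h)
    (h := fun e : edge_shift i t => (set_val e : {ptws int -> discrete_topology E}) n)).
    exact: ch.
  apply: (cont_at_comp (g := fun e : edge_shift i t =>
    (set_val e : {ptws int -> discrete_topology E})) (h := fun a => a n)).
    exact: initial_continuous.
  exact: (@proj_continuous _ (fun=> discrete_topology E) n).
exists (c @^-1` [set c x]); split=> //; last by move=> /esym.
split; first by apply: preimage_open => //; exact: discrete_open.
rewrite -[W in closed W]setCK; apply: open_closedC.
rewrite -[~` _]/(c @^-1` ~` [set c x]).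
by apply: preimage_open => //; exact: discrete_open.
Qed.

Theorem theorem2 (R : realType) (Y : system R)
    (smaleY : smale_space Y) (irrY : irreducible Y)
    (tdsY : totally_disconnected_stable_sets Y)
    (G : groupoid) (topG : topological_groupoid G) (etaleG : etale G)
    (moritaG : morita_equivalent G (unstable_groupoid Y))
    (S : system R) (smaleS : smale_space S) (irrS : irreducible S)
    (sftS : shift_of_finite_type S)
    (f : factor_map S Y) (sbijf : s_bijective f) (p : nat) :
  isomorphic (stable_homology f p) (groupoid_homology G p).
Proof.
have sY := smale_space_axioms smaleY; have sS := smale_space_axioms smaleS.
have zS := sft_zero_dimensional sftS.
have [Z [rho [lact [tau [ract]]]]] := moritaG.
move=> [[hZ lZ] [l1 l2 l3] [r1 r2 r3] [c1 c2 c3] [q1 q2]].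
have bb : bibundle rho lact tau ract by split.
exact: (bibundle_homology sS sY sbijf zS topG etaleG bb).
Qed.
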